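(* Let $n\ge1$ be an integer and let $p,a,b,q$ be real numbers such that $$p>1,\quad a<\frac{n-p}{p},\quad a\le b<a+1,\quad q=\frac{np}{n-p(1+a-b)},$$ and set $\mu:=\dfrac{n-p(1+a)}{p-1}$. Let $f:\mathbb{R}^n\times\mathbb{R}\to\mathbb{R}$ be a Carathéodory function for which there is a constant $\Lambda>0$ such that $|f(x,s)|\le\Lambda|x|^{-bq}|s|^{q-1}$ for all $s\in\mathbb{R}$ and a.e. $x\in\mathbb{R}^n$. Let $R_0>0$ and let $u$ be a weak solution of the equation $$-\operatorname{div}\left(|x|^{-ap}|\nabla u|^{p-2}\nabla u\right)=f(x,u)\quad\text{in }\mathbb{R}^n\setminus B(0,R_0).$$ Assume that there exists a constant $\alpha>0$ such that $$\left||x|^{\mu}u(x)-\alpha\right|+\left||x|^{\mu+1}\nabla u(x)+\alpha\mu|x|^{-1}x\right|\to0\quad\text{as }|x|\to\infty.$$ Let $r_0:=1/R_0$ and let $u_\ast:B(0,r_0)\setminus\{0\}\to\mathbb{R}$ be the function defined by $$u_\ast(y):=|y|^{-\mu}u\left(|y|^{-2}y\right)\quad\text{for all }y\in B(0,r_0)\setminus\{0\}.$$ Let $$\gamma:=\mu+2-n,\qquad\gamma':=\frac{\mu q}{p}-n.$$ Then there exist $r\in(0,r_0)$, Carathéodory functions $A:B(0,r)\times\mathbb{R}\times\mathbb{R}^n\to\mathbb{R}^n$ and $B:B(0,r)\times\mathbb{R}\times\mathbb{R}^n\to\mathbb{R}$, and a constant $C>0$ such that $$|A(y,z,\xi)|\le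 C|y|^{\gamma}|\xi|,\qquad A(y,z,\xi)\cdot\xi\ge C^{-1}|y|^{\gamma}|\xi|^2,\qquad |B(y,z,\xi)|\le C\left(|y|^{\gamma}|\xi|^2+|y|^{\gamma'}\right)$$ for a.e. $y\in B(0,r)$ and all $(z,\xi)\in\mathbb{R}\times\mathbb{R}^n$, and such that $u_\ast$ is a weak solution of the equation $$-\operatorname{div}\left(A(y,u_\ast,\nabla u_\ast)\right)=B(y,u_\ast,\nabla u_\ast)\quad\text{in }B(0,r),$$ that is, $u_\ast\in H^{1,2}(B(0,r),|y|^{\gamma})$ and $$\int_{B(0,r)}\left(A(y,u_\ast,\nabla u_\ast)\cdot\nabla\varphi-B(y,u_\ast,\nabla u_\ast)\varphi\right)dy=0\quad\text{for all }\varphi\in C^\infty_0(B(0,r)).$$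
   Context: $B(0,r)$ (two arguments) denotes the ball of center $0$ and radius $r$ in $\mathbb{R}^n$; $B(y,z,\xi)$ (three arguments) denotes the right-hand side function of the transformed equation. A Carathéodory function is one that is measurable in the space variable for all values of the remaining variables and continuous in the remaining variables for a.e. value of the space variable. For $r>0$ and $\gamma>-n$, $H^{1,2}(B(0,r),|y|^{\gamma})$ is the completion of $C^\infty(B(0,r))$ (functions with finite norm) with respect to the norm $$\|u\|_{H^{1,2}(B(0,r),|y|^{\gamma})}=\left(\int_{B(0,r)}|y|^{\gamma}|u|^2\,dy+\int_{B(0,r)}|y|^{\gamma}|\nabla u|^2\,dy\right)^{1/2}.$$ $C^\infty_0(B(0,r))$ denotes the smooth functions with compact support in $B(0,r)$. A weak solution $u$ of the equation in the exterior domain $\mathbb{R}^n\setminus B(0,R_0)$ is a function with locally $p$-integrable weak gradient such that $\int|x|^{-ap}|\nabla u|^{p-2}\langle\nabla u,\nabla\varphi\rangle\,dx=\int f(x,u)\varphi\,dx$ for all smooth $\varphi$ with compact support in the open exterior domain. Pointwise assertions on $u$ and $\nabla u$ as $|x|\to\infty$ are understood for the $C^1$ representative of $u$ for $|x|$ large. The function $u_\ast$ is defined on the punctured ball, hence almost everywhere on $B(0,r)$.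
   Formalization: The formal statement additionally assumes n − p(1+a−b) > 0, which is automatic when p < n; otherwise q can be undefined or negative, |s|^{q−1} has no value at s = 0, and the claim can fail. *)

(* Defs.v *)
From HB Require Import structures.
From mathcomp Require Import all_boot all_order all_algebra.
From mathcomp Require Import all_classical all_reals all_analysis.

Set Implicit Arguments.
Unset Strict Implicit.
Unset Printing Implicit Defensive.

Import Order.TTheory GRing.Theory Num.Theory.
Import numFieldNormedType.Exports.

Local Open Scope classical_set_scope.
Local Open Scope ring_scope.

Lemma product_sigma_finite d1 d2 (T1 : measurableType d1)
    (T2 : measurableType d2) (R : realType)
    (m1 : {sigma_finite_measure set T1 -> \bar R})
    (m2 : {sigma_finite_measure set T2 -> \bar R}) :
  sigma_finite setT (m1 \x m2)%E.
Proof.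
have /sigma_finiteP[F [TF ndF Foo]] := sigma_finiteT m1.
have /sigma_finiteP[G [TG ndG Goo]] := sigma_finiteT m2.
exists (fun n => F n `*` G n).
  rewrite -setXTT TF TG predeqE => -[x y]; split.
    move=> [/= [i _ Fix] [k _ Gky]]; exists (maxn i k) => //; split.
    - by move: x Fix; exact/subsetPset/ndF/leq_maxl.
    - by move: y Gky; exact/subsetPset/ndG/leq_maxr.
  by move=> [i _ []/= ? ?]; split; exists i.
move=> k; have [? ?] := Foo k; have [? ?] := Goo k.
split; first exact: measurableX.
by rewrite product_measure1E// lte_mul_pinfty// ge0_fin_numE.
Qed.

Section lebesgue_tuple.
Context {R : realType}.
Local Notation T := (measurableTypeR R).

Definition tuple_cons n (x : T * n.-tuple T) : n.+1.-tuple T :=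
  [the n.+1.-tuple T of x.1 :: x.2].

Lemma measurable_tuple_cons n : measurable_fun setT (@tuple_cons n).
Proof. exact: measurable_cons. Qed.

Section step.
Variables (n : nat) (m : {sigma_finite_measure set (n.-tuple T) -> \bar R}).

Definition lebesgue_tuple_step : set (n.+1.-tuple T) -> \bar R :=
  pushforward (@lebesgue_measure R \x m)%E (@tuple_cons n).

Let step0 : lebesgue_tuple_step set0 = 0%E.
Proof. by rewrite /lebesgue_tuple_step /pushforward preimage_set0 measure0. Qed.

Let step_ge0 A : (0 <= lebesgue_tuple_step A)%E.
Proof. by rewrite /lebesgue_tuple_step /pushforward; exact: measure_ge0. Qed.

Let step_sigma_additive : semi_sigma_additive lebesgue_tuple_step.
Proof.
move=> F mF tF mUF; rewrite /lebesgue_tuple_step /pushforward preimage_bigcup.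
apply: measure_semi_sigma_additive.
- by move=> k; rewrite -[X in measurable X]setTI; exact: measurable_tuple_cons.
- apply/trivIsetP => /= i j _ _ ij; rewrite -preimage_setI.
  by move/trivIsetP : tF => /(_ _ _ _ _ ij) ->//; rewrite preimage_set0.
- rewrite -preimage_bigcup -[X in measurable X]setTI.
  exact: measurable_tuple_cons.
Qed.

HB.instance Definition _ := isMeasure.Build _ _ _ lebesgue_tuple_step
  step0 step_ge0 step_sigma_additive.

Let step_sigma_finite : sigma_finite setT lebesgue_tuple_step.
Proof.
have [F UF mF] := product_sigma_finite (@lebesgue_measure R) m.
pose g (t : n.+1.-tuple T) : T * n.-tuple T :=
  (thead t, [tuple of behead t]).
have gK : cancel (@tuple_cons n) g.
  case=> x t; rewrite /g /tuple_cons /=; congr pair.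
  by apply: val_inj => /=.
have mg : measurable_fun setT g.
  apply: measurable_fun_pair; last exact: measurable_behead.
  exact: measurable_tnth.
exists (fun k => g @^-1` F k).
  by rewrite -preimage_bigcup -UF preimage_setT.
move=> k; have [mFk Fkoo] := mF k; split.
  by rewrite -[X in measurable X]setTI; exact: mg.
rewrite /lebesgue_tuple_step /pushforward -comp_preimage.
rewrite (_ : g \o _ = id) ?preimage_id//.
by apply/funext => x /=; rewrite gK.
Qed.

HB.instance Definition _ :=
  Measure_isSigmaFinite.Build _ _ _ lebesgue_tuple_step step_sigma_finite.

End step.

Fixpoint lebesgue_tuple n : {sigma_finite_measure set (n.-tuple T) -> \bar R} :=
  match n with
  | 0 => [the {sigma_finite_measure set (0.-tuple T) -> \bar R} of
          dirac [tuple]]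
  | k.+1 => [the {sigma_finite_measure set (k.+1.-tuple T) -> \bar R} of
             lebesgue_tuple_step (lebesgue_tuple k)]
  end.

End lebesgue_tuple.

Section lebesgue_Rn.
Context {R : realType} {n : nat}.

Local Open Scope ereal_scope.

(* Lebesgue outer measure on R^n: the outer measure induced by the n-fold
   product of the one-dimensional Lebesgue (Borel) measure. *)
Definition lebesgue_outer (A : set 'rV[R]_n) : \bar R :=
  ((@lebesgue_tuple R n)^*)%mu
    ((fun t : n.-tuple R => \row_i tnth t i) @^-1` A).

Let outer0 : lebesgue_outer set0 = 0.
Proof. by rewrite /lebesgue_outer preimage_set0 outer_measure0. Qed.

Let outer_ge0 A : 0 <= lebesgue_outer A.
Proof. exact: outer_measure_ge0. Qed.

Let le_outer : {homo lebesgue_outer : A B / A `<=` B >-> A <= B}.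
Proof. by move=> A B AB; apply: le_outer_measure => t /AB. Qed.

Let outer_sigma_subadditive : sigma_subadditive lebesgue_outer.
Proof.
move=> F; rewrite /lebesgue_outer preimage_bigcup.
exact: outer_measure_sigma_subadditive.
Qed.

HB.instance Definition _ := isOuterMeasure.Build R 'rV[R]_n lebesgue_outer
  outer0 outer_ge0 le_outer outer_sigma_subadditive.

End lebesgue_Rn.

(* R^n with the complete sigma-algebra of Lebesgue measurable sets. *)
Notation Leb R n := (caratheodory_type (@lebesgue_outer R n)).

Section leb.
Context {R : realType} {n : nat}.

Definition leb : set (Leb R n) -> \bar R := lebesgue_outer.

HB.instance Definition _ := isMeasure.Build _ _ _ leb
  (@caratheodory_measure0 _ _ (@lebesgue_outer R n))
  (@caratheodory_measure_ge0 _ _ (@lebesgue_outer R n))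
  (@caratheodory_measure_sigma_additive _ _ (@lebesgue_outer R n)).

End leb.

Section euclidean.
Context {R : realType} {n : nat}.
Implicit Types x y : 'rV[R]_n.

(* The library norm `|x| on 'rV[R]_n is the sup norm. *)
Definition dotr x y : R := \sum_(i < n) x 0 i * y 0 i.

Definition enorm x : R := Num.sqrt (dotr x x).

Definition eball (r : R) : set 'rV[R]_n := [set x | enorm x < r].

Definition exterior (r : R) : set 'rV[R]_n := [set x | r < enorm x].

Definition enorm_infty : set_system 'rV[R]_n :=
  [set A | exists M : R, exterior M `<=` A].

End euclidean.

Section smooth.
Context {R : realType} {n : nat}.
Implicit Types (U : set 'rV[R]_n) (f : 'rV[R]_n -> R).

Definition partial (i : 'I_n) f : 'rV[R]_n -> R :=
  fun x => 'D_(delta_mx 0 i) f x.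

Definition grad f (x : 'rV[R]_n) : 'rV[R]_n := \row_i partial i f x.

(* U is meant to be open in the next three definitions. *)
Definition C1_on U f := forall x, U x ->
  forall i, derivable f x (delta_mx 0 i) /\ {for x, continuous (partial i f)}.

Definition smooth_on U f := forall (s : seq 'I_n) x, U x ->
  {for x, continuous (foldr partial f s)} /\
  forall i, derivable (foldr partial f s) x (delta_mx 0 i).

Definition test_function U f :=
  [/\ smooth_on setT f, compact (closure [set x | f x != 0]) &
      closure [set x | f x != 0] `<=` U].

End smooth.

Section weak.
Context {R : realType} {n : nat}.
Implicit Types (U : set 'rV[R]_n) (u : 'rV[R]_n -> R).

Definition loc_integrable U u := forall K : set 'rV[R]_n,
  compact K -> K `<=` U -> leb.-integrable (K : set (Leb R n)) (EFin \o u).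

Definition weak_gradient U u (Du : 'rV[R]_n -> 'rV[R]_n) :=
  [/\ loc_integrable U u,
      forall i, loc_integrable U (fun x => Du x 0 i) &
      forall phi, test_function U phi -> forall i,
        \int[leb]_(x in (U : set (Leb R n))) (u x * partial i phi x) =
        - \int[leb]_(x in (U : set (Leb R n))) (Du x 0 i * phi x)].

Definition caratheodory (P : topologicalType) U (F : 'rV[R]_n -> P -> R) :=
  (forall w, measurable_fun (U : set (Leb R n)) (F ^~ w)) /\
  {ae (@leb R n), forall x, U x -> continuous (F x)}.

(* Weak solutions of
     - div (|x|^(- a p) |grad u|^(p - 2) grad u) = f(x, u) in |x| > R0. *)
Definition weak_solution_exterior (p a : R) (f : 'rV[R]_n -> R -> R) (R0 : R) u :=
  let U := exterior R0 : set (Leb R n) in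
  exists Du : 'rV[R]_n -> 'rV[R]_n,
  [/\ weak_gradient U u Du,
      forall K : set 'rV[R]_n, compact K -> K `<=` U ->
        (\int[leb]_(x in (K : set (Leb R n))) (enorm (Du x) `^ p)%:E < +oo)%E &
      forall phi, test_function U phi ->
        let lhs x := enorm x `^ (- (a * p)) * enorm (Du x) `^ (p - 2) *
                     dotr (Du x) (grad phi x) in
        let rhs x := f x (u x) * phi x in
        [/\ leb.-integrable U (EFin \o lhs), leb.-integrable U (EFin \o rhs) &
            \int[leb]_(x in U) lhs x = \int[leb]_(x in U) rhs x]].

Definition C1_representative_near_infinity u v := exists M : R,
  C1_on (exterior M) v /\
  {ae (@leb R n), forall x, exterior M x -> u x = v x}.

Definition H12_norm (r gamma : R) u (Du : 'rV[R]_n -> 'rV[R]_n) : \bar R :=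
  let D := eball r : set (Leb R n) in
  (sqrte (\int[leb]_(y in D) (enorm y `^ gamma * u y ^+ 2)%:E +
          \int[leb]_(y in D) (enorm y `^ gamma * enorm (Du y) ^+ 2)%:E))%E.

(* The completion is realized as the set of pairs (u, Du) that are limits of
   (phi_k, grad phi_k) in the weighted L^2 spaces.  Du is determined by u
   almost everywhere: it is the weak gradient of u in the punctured ball,
   where the weight is locally bounded above and below. *)
Definition H12 (r gamma : R) u (Du : 'rV[R]_n -> 'rV[R]_n) :=
  let D := eball r : set (Leb R n) in
  [/\ measurable_fun D u, forall i, measurable_fun D (fun y => Du y 0 i) &
      exists phi : nat -> 'rV[R]_n -> R,
        (forall k, smooth_on (eball r) (phi k) /\
                   (H12_norm r gamma (phi k) (grad (phi k)) < +oo)%E) /\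
        H12_norm r gamma (fun y => phi k y - u y)
                         (fun y => grad (phi k) y - Du y) @[k --> \oo]
          --> 0%E].

(* Weak solutions of - div A(y, u, grad u) = B(y, u, grad u) in B(0, r). *)
Definition weak_solution_ball (r gamma : R)
    (A : 'rV[R]_n -> R * 'rV[R]_n -> 'rV[R]_n)
    (B : 'rV[R]_n -> R * 'rV[R]_n -> R) u :=
  let D := eball r : set (Leb R n) in
  exists Du : 'rV[R]_n -> 'rV[R]_n, H12 r gamma u Du /\
  forall phi, test_function (eball r) phi ->
    let g y := dotr (A y (u y, Du y)) (grad phi y) -
               B y (u y, Du y) * phi y in
    leb.-integrable D (EFin \o g) /\ \int[leb]_(y in D) g y = 0.

End weak.

(* Main.v *)
Require Import Defs.
From HB Require Import structures.
From mathcomp Require Import all_boot all_order all_algebra.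
From mathcomp Require Import all_classical all_reals all_analysis.
From mathcomp Require Import measurable_realfun interval_inference.
From mathcomp Require Import ring lra.

Set Implicit Arguments.
Unset Strict Implicit.
Unset Printing Implicit Defensive.

Import Order.TTheory GRing.Theory Num.Theory.
Import numFieldNormedType.Exports.

Local Open Scope classical_set_scope.
Local Open Scope ring_scope.


(** Write w(x) = |x|^mu u(x), so that u_* is w read through the inversion x = y/|y|^2. The
    asymptotics say that w tends to alpha and |x| |grad w| to 0. Split grad u = X + Y, where X = -mu
    u x/|x|^2 is what remains when w is frozen and Y = |x|^(-mu) grad w. Far out |Y| <= d |X|
    ([exterior_asymptotics]), so the flux |xi|^(p-2) xi can be expanded around the nonzero vector X:
    its increment is bounded by, and coercive like, |X|^(p-2) Y, and its component along X is linear
    in Y up to a quadratic error ([pflux_expansion]).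

    The value of mu makes the flux of X, weighted by |x|^(-ap), equal to -mu^(p-1) w^(p-1) |x|^(-n)
    x ([radial_flux]), and the field |x|^(-n) x is divergence free away from 0. Testing the equation
    with |x|^(-mu) phi and adding mu^(p-1) times the integral of |x|^(-n) x . grad (w^(p-1)
    |x|^(-mu) phi), which is 0, removes the leading terms ([exterior_identity]). There remain a flux
    of the size of grad w, a source quadratic in grad w, and the term coming from f.

    The inversion has Jacobian |y|^(-2n) and a conformal derivative, so the identity becomes -div a
    = b1 + b2 in a punctured ball, with |a| <= C |y|^gamma |grad u_*|, a . grad u_* >= c |y|^gamma
    |grad u_*|^2, |b1| <= C |y|^gamma |grad u_*|^2 and |b2| <= C |y|^gamma' ([pulla_norm],
    [pulla_dot], [pullb1_norm], [pullb2_norm], [pull_identity]). These bounds concern the single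
    vector grad u_*(y).

    The origin is removable: |y| |grad u_*| is bounded and gamma - 2 = mu - n > -n, so |y|^(gamma-2)
    is integrable and dominates the errors of cutoffs eta_k with |grad eta_k| <= 16/|y|. This gives
    both the identity for test functions that do not vanish near 0 ([ball_test_identity]) and the
    membership in the weighted Sobolev space ([ball_H12]).

    Two supporting results connect this with the definitions. The weak gradient of u is a.e. the
    gradient of the C1 representative, by the fundamental lemma ([weak_gradient_C1]), and C1 test
    functions are allowed by mollification ([weak_eq_C1]). The change of variables under the
    inversion is checked on conical shells, where scaling gives all volumes, and extended by
    uniqueness of measures ([leb_inversion]). *)

(** * The Euclidean inner product and norm on row vectors *)

Section euclidean_facts.
Context {R : realType} {n : nat}.
Implicit Types x y z : 'rV[R]_n.

Lemma dotrC x y : dotr x y = dotr y x.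
Proof. by apply: eq_bigr => i _; rewrite mulrC. Qed.

Lemma dotrDl x y z : dotr (x + y) z = dotr x z + dotr y z.
Proof. by rewrite -big_split; apply: eq_bigr => i _; rewrite mxE mulrDl. Qed.

Lemma dotrZl (a : R) x y : dotr (a *: x) y = a * dotr x y.
Proof. by rewrite /dotr mulr_sumr; apply: eq_bigr => i _; rewrite mxE mulrA. Qed.

Lemma dotrDr x y z : dotr x (y + z) = dotr x y + dotr x z.
Proof. by rewrite dotrC dotrDl !(dotrC x). Qed.

Lemma dotrZr (a : R) x y : dotr x (a *: y) = a * dotr x y.
Proof. by rewrite dotrC dotrZl dotrC. Qed.

Lemma dotrNl x y : dotr (- x) y = - dotr x y.
Proof. by rewrite -scaleN1r dotrZl mulN1r. Qed.

Lemma dotrNr x y : dotr x (- y) = - dotr x y.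
Proof. by rewrite dotrC dotrNl dotrC. Qed.

Lemma dotr0l x : dotr 0 x = 0.
Proof. by rewrite -(scale0r (0 : 'rV[R]_n)) dotrZl mul0r. Qed.

Lemma dotr0r x : dotr x 0 = 0. Proof. by rewrite dotrC dotr0l. Qed.

Lemma dotr_ge0 x : 0 <= dotr x x.
Proof. by apply: sumr_ge0 => i _; rewrite -expr2 sqr_ge0. Qed.

Lemma enorm_ge0 x : 0 <= enorm x. Proof. exact: sqrtr_ge0. Qed.
Hint Resolve enorm_ge0 : core.

Lemma sqr_enorm x : enorm x ^+ 2 = dotr x x.
Proof. by rewrite sqr_sqrtr// dotr_ge0. Qed.

Lemma coord_sqr_le x i : x 0 i ^+ 2 <= enorm x ^+ 2.
Proof.
rewrite sqr_enorm /dotr (bigD1 i)//= -expr2 lerDl.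
by apply: sumr_ge0 => j _; rewrite -expr2 sqr_ge0.
Qed.

Lemma coord_le_enorm x i : `|x 0 i| <= enorm x.
Proof.
by rewrite -(ler_pXn2r (ltn0Sn 1)) ?nnegrE// real_normK ?num_real// coord_sqr_le.
Qed.

Lemma enorm_eq0 x : (enorm x == 0) = (x == 0).
Proof.
apply/idP/eqP => [/eqP e0|->]; last by rewrite /enorm dotr0l sqrtr0.
apply/rowP => i; rewrite mxE; apply/eqP; rewrite -normr_le0 -e0.
exact: coord_le_enorm.
Qed.

Lemma enorm0 : enorm (0 : 'rV[R]_n) = 0.
Proof. by apply/eqP; rewrite enorm_eq0. Qed.

Lemma enorm_gt0 x : (0 < enorm x) = (x != 0).
Proof. by rewrite lt_def enorm_eq0 enorm_ge0 andbT. Qed.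

Lemma enormZ (a : R) x : enorm (a *: x) = `|a| * enorm x.
Proof.
by rewrite /enorm dotrZl dotrZr mulrA -expr2 sqrtrM ?sqr_ge0// sqrtr_sqr.
Qed.

Lemma enormN x : enorm (- x) = enorm x.
Proof. by rewrite -scaleN1r enormZ normrN1 mul1r. Qed.

Lemma cauchy_schwarz_dotr x y : `|dotr x y| <= enorm x * enorm y.
Proof.
rewrite -(ler_pXn2r (ltn0Sn 1)) ?nnegrE ?mulr_ge0// real_normK ?num_real//.
rewrite exprMn !sqr_enorm.
have [->|y0] := eqVneq y 0; first by rewrite !dotr0r expr0n mulr0.
have yy0 : 0 < dotr y y by rewrite -sqr_enorm exprn_gt0// enorm_gt0.
have := dotr_ge0 (dotr y y *: x - dotr x y *: y).
rewrite dotrDl !dotrDr !dotrNr !dotrNl !dotrZl !dotrZr (dotrC y x) => h.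
rewrite -subr_ge0 -(pmulr_rge0 _ yy0); apply: le_trans h _.
by rewrite le_eqVlt; apply/orP; left; apply/eqP; ring.
Qed.

Lemma dotr_le_enorm x y : dotr x y <= enorm x * enorm y.
Proof. exact: le_trans (ler_norm _) (cauchy_schwarz_dotr x y). Qed.

Lemma ler_enormD x y : enorm (x + y) <= enorm x + enorm y.
Proof.
rewrite -(ler_pXn2r (ltn0Sn 1)) ?nnegrE ?addr_ge0//.
rewrite sqrrD sqr_enorm dotrDl !dotrDr (dotrC y x) -!sqr_enorm.
by have := dotr_le_enorm x y; lra.
Qed.

Lemma ler_enormB x y : enorm (x - y) <= enorm x + enorm y.
Proof. by rewrite -(enormN y) ler_enormD. Qed.

Lemma ler_dist_enorm x y : `|enorm x - enorm y| <= enorm (x - y).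
Proof.
have h (a b : 'rV[R]_n) : enorm a - enorm b <= enorm (a - b).
  by have := ler_enormD (a - b) b; rewrite subrK lerBlDr.
by rewrite ler_norml h andbT lerNl opprB -(enormN (x - y)) opprB h.
Qed.

Lemma enorm_le_bound x (M : R) : 0 <= M ->
  (forall i, `|x 0 i| <= M) -> enorm x <= n%:R * M.
Proof.
move=> M0 xM; have nM : 0 <= n%:R * M by rewrite mulr_ge0.
rewrite -(ler_pXn2r (ltn0Sn 1)) ?nnegrE// sqr_enorm.
apply: (@le_trans _ _ (\sum_(i < n) M ^+ 2)).
  apply: ler_sum => i _; rewrite -expr2 -real_normK ?num_real//.
  by rewrite ler_pXn2r ?nnegrE.
rewrite sumr_const card_ord -[_ *+ n]mulr_natl exprMn ler_wpM2r ?sqr_ge0//.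
by rewrite -natrX ler_nat; case: (n) => // m; rewrite leq_pmull.
Qed.

Lemma sup_norm_le_enorm x : `|x| <= enorm x.
Proof.
rewrite /Num.Def.normr /= mx_normrE; apply: bigmax_le => // -[i j] _ /=.
by rewrite (ord1 i) coord_le_enorm.
Qed.

Lemma coord_le_sup_norm x i : `|x 0 i| <= `|x|.
Proof.
rewrite [leRHS]/Num.Def.normr /= mx_normrE.
by apply/bigmax_geP; right; exists (0, i).
Qed.

Lemma enorm_le_sup_norm x : enorm x <= n%:R * `|x|.
Proof. by apply: enorm_le_bound => // i; exact: coord_le_sup_norm. Qed.

Lemma continuous_enorm : continuous (@enorm R n).
Proof.
move=> x; apply/(@cvgrPdist_lt _ _ _ (nbhs x)) => e e0.
have d0 : 0 < e / n.+1%:R by rewrite divr_gt0.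
apply/nbhs_ballP; exists (e / n.+1%:R) => // y.
rewrite -ball_normE /= => xy.
apply: le_lt_trans (ler_dist_enorm _ _) _.
apply: le_lt_trans (enorm_le_sup_norm _) _.
apply: (@le_lt_trans _ _ (n.+1%:R * `|x - y|)).
  by rewrite ler_wpM2r// ler_nat.
by rewrite mulrC -ltr_pdivlMr.
Qed.

Lemma open_eball (r : R) : open (eball r : set 'rV[R]_n).
Proof.
rewrite (_ : eball r = (@enorm R n) @^-1` [set x | x < r])//.
by apply: open_comp => [x _|]; [exact: continuous_enorm|exact: open_lt].
Qed.

Lemma open_exterior (r : R) : open (exterior r : set 'rV[R]_n).
Proof.
rewrite (_ : exterior r = (@enorm R n) @^-1` [set x | r < x])//.
by apply: open_comp => [x _|]; [exact: continuous_enorm|exact: open_gt].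
Qed.

Lemma compact_annulus (s t : R) :
  compact [set x : 'rV[R]_n | s <= enorm x <= t].
Proof.
apply: bounded_closed_compact.
  exists t; split; first exact: num_real.
  move=> M tM x /= /andP[_ xt]; apply: le_trans (sup_norm_le_enorm x) _.
  by rewrite (le_trans xt)// ltW.
rewrite (_ : mkset _ = (@enorm R n) @^-1` [set x | s <= x] `&`
                       (@enorm R n) @^-1` [set x | x <= t]); last first.
  by apply/seteqP; split => x /=; [move/andP|move=> ?; apply/andP].
by apply: closedI; apply: closed_comp => [x _|];
  try exact: continuous_enorm; [exact: closed_ge|exact: closed_le].
Qed.

End euclidean_facts.
#[export] Hint Resolve enorm_ge0 : core.

(** * Lebesgue measure under dilations and translations *)

Section tuple_affine.
Context {R : realType}.
Local Notation T := (measurableTypeR R).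

Definition tuple_affine n (s : R) (c : n.-tuple T) (t : n.-tuple T) : n.-tuple T :=
  [tuple s * tnth t i + tnth c i | i < n].

Lemma measurable_affine1 (s c : R) :
  measurable_fun setT (fun x : T => s * x + c : T).
Proof. by apply: measurable_funD => //; exact: measurable_funM. Qed.

Lemma measurable_tuple_affine n s c : measurable_fun setT (@tuple_affine n s c).
Proof.
apply/measurable_fun_tnthP => i.
rewrite (_ : _ \o _ = (fun x : T => s * x + tnth c i : T) \o (@tnth n T ^~ i)).
  by apply: measurableT_comp (measurable_affine1 _ _) (measurable_tnth _).
by apply/funext => t /=; rewrite tnth_mktuple.
Qed.

(** The image of Lebesgue measure under the map, multiplied by s, gives every half-open interval its
    length, so it is Lebesgue measure by uniqueness. *)
Lemma lebesgue_affine1 (s c : R) (A : set T) : 0 < s -> measurable A ->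
  lebesgue_measure ((fun x : T => s * x + c : T) @^-1` A) =
  (s^-1%:E * lebesgue_measure A)%E.
Proof.
move=> s0 mA.
pose g := fun x : T => s * x + c : T.
have mg : measurable_fun setT g by exact: measurable_affine1.
pose pg0 := [the measure _ _ of pushforward (@lebesgue_measure R) g].
pose pg := pg0 mg.
pose m : {measure set T -> \bar R} :=
  [the measure _ _ of mscale (NngNum (ltW s0)) pg].
suff -> : lebesgue_measure A = m A.
  by rewrite /m /= /mscale /pushforward /= muleA -EFinM mulVf ?mul1e// gt_eqF.
apply: lebesgue_measure_unique => // _ [[a b] /= _ <-].
rewrite /m /= /mscale /= /pushforward.
rewrite (_ : g @^-1` _ = `](a - c) / s, (b - c) / s]%classic); last first.
  apply/seteqP; split => x /=; rewrite !in_itv/= /g ltr_pdivrMr// ler_pdivlMr//;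
    by move=> /andP[? ?]; apply/andP; split; lra.
rewrite !lebesgue_measure_itv /= !lte_fin ltr_pM2r ?invr_gt0// ltrD2r.
case: ifPn => ab; last by rewrite mule0.
rewrite -!EFinB -EFinM; congr EFin.
by field; rewrite gt_eqF.
Qed.

(** Induction on n: through [tuple_cons] the map becomes a product of affine maps, and the rescaled
    image measure agrees with the product measure on rectangles, which determines it. *)
Lemma lebesgue_tuple_affine n (s : R) (c : n.-tuple T) (A : set (n.-tuple T)) :
  0 < s -> measurable A ->
  lebesgue_tuple n (tuple_affine s c @^-1` A) =
  ((s ^- n)%:E * lebesgue_tuple n A)%E.
Proof.
move=> s0; elim: n c A => [|n IH] c A mA.
  rewrite expr0 invr1 mul1e; suff -> : tuple_affine s c @^-1` A = A by [].
  have id0 t : tuple_affine s c t = t by apply: eq_from_tnth => -[].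
  by apply/seteqP; split => t /=; rewrite id0.
rewrite /= /lebesgue_tuple_step /pushforward.
set B := @tuple_cons R n @^-1` A.
have mcons : measurable_fun setT (@tuple_cons R n) by exact: measurable_tuple_cons.
have mB : measurable B by rewrite -[B]setTI; exact: (mcons measurableT _ mA).
pose c' : n.-tuple T := [tuple of behead c].
pose h (x : T * n.-tuple T) : T * n.-tuple T :=
  (s * x.1 + thead c, tuple_affine s c' x.2).
have mh : measurable_fun setT h.
  apply/measurable_fun_pair.
    exact: (measurableT_comp (measurable_affine1 _ _) measurable_fst).
  exact: (measurableT_comp (measurable_tuple_affine _ _) measurable_snd).
have hE x t : tuple_affine s c (tuple_cons (x, t)) = tuple_cons (h (x, t)).
  apply: eq_from_tnth => i; rewrite /tuple_cons /h/= (tuple_eta c) tnth_mktuple.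
  by case: (unliftP ord0 i) => [j ->|->]; rewrite ?tnthS ?tnth0 ?tnth_mktuple.
rewrite (_ : _ @^-1` (_ @^-1` A) = h @^-1` B); last first.
  by apply/seteqP; split => -[x t] /=; rewrite /B /= hE.
have sn0 : 0 <= s ^+ n.+1 by rewrite exprn_ge0// ltW.
pose ph0 := [the measure _ _ of
  pushforward (@lebesgue_measure R \x lebesgue_tuple n)%E h].
pose ph := ph0 mh.
pose m' : {measure set (T * n.-tuple T) -> \bar R} :=
  [the measure _ _ of mscale (NngNum sn0) ph].
suff -> : ((@lebesgue_measure R \x lebesgue_tuple n) B = m' B)%E.
  rewrite /m' /= /mscale /pushforward /= muleA -EFinM mulVf ?mul1e//.
  by rewrite expf_neq0// gt_eqF.
apply: product_measure_unique => // A1 A2 mA1 mA2.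
rewrite /m' /= /mscale /= /pushforward.
rewrite (_ : h @^-1` _ = ((fun x : T => s * x + thead c : T) @^-1` A1) `*`
                       (tuple_affine s c' @^-1` A2)); last by [].
rewrite product_measure1E/=; last 2 first.
- by rewrite -[X in measurable X]setTI; exact: measurable_affine1.
- by rewrite -[X in measurable X]setTI; exact: measurable_tuple_affine.
rewrite lebesgue_affine1// IH//.
rewrite muleACA [LHS]muleA -[RHS]mul1e; congr (_ * _)%E.
rewrite -!EFinM exprS -invfM mulfV//.
by rewrite mulf_neq0 ?expf_neq0// gt_eqF.
Qed.

End tuple_affine.

Section leb_affine.
Context {R : realType} {n : nat}.
Local Notation T := (measurableTypeR R).
Local Notation V := 'rV[R]_n.
Local Notation rho := (fun t : n.-tuple R => \row_i tnth t i : 'rV[R]_n).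

Definition affine (s : R) (c x : V) : V := s *: x + c.

Lemma lebesgue_outerE (A : set V) :
  lebesgue_outer A = ((@lebesgue_tuple R n)^*)%mu (rho @^-1` A).
Proof. by []. Qed.

(** A measurable cover of A pulls back to a cover of the preimage whose total mass is multiplied by
    s^(-n). *)
Lemma mu_ext_tuple_affine_le (s : R) (c : n.-tuple T) (A : set (n.-tuple T)) :
  0 < s ->
  (((@lebesgue_tuple R n)^*)%mu (tuple_affine s c @^-1` A) <=
   (s ^- n)%:E * ((@lebesgue_tuple R n)^*)%mu A)%E.
Proof.
move=> s0; have sn0 : 0 < s ^+ n by rewrite exprn_gt0.
rewrite lee_pdivlMl// [leRHS]/mu_ext; apply: le_ereal_inf_tmp => _ [F [mF AF] <-].
rewrite -lee_pdivlMl// -nneseriesZl//.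
apply: ereal_inf_lbound; exists (fun k => tuple_affine s c @^-1` F k).
  split=> [k|]; last by rewrite -preimage_bigcup => t /AF.
  by rewrite -[X in measurable X]setTI; exact: measurable_tuple_affine.
by apply: eq_eseriesr => k _; rewrite lebesgue_tuple_affine.
Qed.

Lemma lebesgue_outer_affine_le (s : R) c (A : set V) : 0 < s ->
  (lebesgue_outer (affine s c @^-1` A) <= (s ^- n)%:E * lebesgue_outer A)%E.
Proof.
move=> s0; rewrite !lebesgue_outerE.
pose c' : n.-tuple R := [tuple c 0 i | i < n].
apply: le_trans (mu_ext_tuple_affine_le c' _ s0).
apply: le_outer_measure => t /=; congr (A _); apply/rowP => i.
by rewrite !mxE !tnth_mktuple.
Qed.

Lemma affineK (s : R) c : s != 0 ->
  cancel (affine s c) (affine s^-1 (- (s^-1 *: c))).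
Proof.
by move=> s0 x; rewrite /affine scalerDr scalerA mulVf// scale1r addrK.
Qed.

(** The missing inequality is the known one for the inverse map, which has ratio s^-1. *)
Lemma lebesgue_outer_affine (s : R) c (A : set V) : 0 < s ->
  lebesgue_outer (affine s c @^-1` A) = ((s ^- n)%:E * lebesgue_outer A)%E.
Proof.
move=> s0; apply/eqP; rewrite eq_le lebesgue_outer_affine_le//=.
have sn0 : 0 < s ^+ n by rewrite exprn_gt0.
have := @lebesgue_outer_affine_le s^-1 (- (s^-1 *: c))
  (affine s c @^-1` A).
rewrite invr_gt0 => /(_ s0).
rewrite -comp_preimage (_ : affine s c \o _ = id); last first.
  apply/funext => x /=; rewrite /affine scalerDr scalerA mulfV ?gt_eqF//.
  by rewrite scale1r scalerN scalerA mulfV ?gt_eqF// scale1r subrK.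
by rewrite preimage_id exprVn invrK -lee_pdivrMl// muleC.
Qed.

(** The measurable sets of [Leb] are those of Caratheodory's criterion, which only involves the
    outer measure; the map multiplies all outer measures by the same constant, so the criterion is
    preserved. *)
Lemma measurable_affine (s : R) c (A : set (Leb R n)) : 0 < s ->
  measurable A -> measurable (affine s c @^-1` A : set (Leb R n)).
Proof.
move=> s0 mA.
have mA' : caratheodory_measurable lebesgue_outer A := mA.
suff : caratheodory_measurable lebesgue_outer (affine s c @^-1` A) by [].
move=> X.
have s'0 : 0 < s^-1 by rewrite invr_gt0.
have E B : lebesgue_outer B = ((s ^- n)%:E *
   lebesgue_outer (affine s^-1 (- (s^-1 *: c)) @^-1` B))%E.
  rewrite -(@lebesgue_outer_affine s c)//.
  rewrite -comp_preimage (_ : _ \o _ = id) ?preimage_id//.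
  by apply/funext => x /=; rewrite affineK// gt_eqF.
set g := affine s^-1 (- (s^-1 *: c)) in E *.
have gA : g @^-1` (affine s c @^-1` A) = A.
  rewrite -comp_preimage (_ : _ \o _ = id) ?preimage_id//.
  apply/funext => x /=; rewrite /g /affine scalerDr scalerA mulfV ?gt_eqF//.
  by rewrite scale1r scalerN scalerA mulfV ?gt_eqF// scale1r subrK.
rewrite (E X) (E (X `&` _)) (E (X `&` ~` _)) 2!(preimage_setI g).
rewrite -(preimage_setC g) gA.
have o0 (B : set V) : (0 <= lebesgue_outer B)%E.
  exact: (outer_measure_ge0 (@lebesgue_outer R n)).
by rewrite (mA' (g @^-1` X)) ge0_muleDr.
Qed.

Lemma measurable_fun_affine (s : R) c : 0 < s ->
  measurable_fun [set: Leb R n] (affine s c : Leb R n -> Leb R n).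
Proof. by move=> s0 _ A mA; rewrite setTI; exact: measurable_affine. Qed.

Lemma leb_affine (s : R) c (A : set (Leb R n)) : 0 < s ->
  leb (affine s c @^-1` A) = ((s ^- n)%:E * leb A)%E.
Proof. exact: lebesgue_outer_affine. Qed.

End leb_affine.

(** * Borel sets and their measurability *)

Section borel.
Context {R : realType} {n : nat}.
Local Notation T := (measurableTypeR R).
Local Notation V := 'rV[R]_n.
Local Notation rho := (fun t : n.-tuple R => \row_i tnth t i : 'rV[R]_n).

Definition borel : set (set V) := <<s open >>.

Lemma measurable_tuple_box (q : V) (e : R) :
  measurable ([set t | forall i, `|q 0 i - tnth t i| < e] : set (n.-tuple T)).
Proof.
rewrite (_ : mkset _ = \bigcap_(i in [set: 'I_n])
    (@tnth n T ^~ i @^-1` (ball (q 0 i) e))); last first.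
  by apply/seteqP; split => t /= h; move=> i; have := h i; [|exact].
apply: fin_bigcap_measurable => // i _.
rewrite -[X in measurable X]setTI.
by apply: measurable_tnth => //; exact: measurable_ball.
Qed.

(** An open set is a countable union of open cubes with rational centers and radii 1/(k+1). *)
Lemma open_tuple_measurable (A : set V) : open A ->
  measurable (rho @^-1` A : set (n.-tuple T)).
Proof.
move=> oA.
pose bx (q : V) (e : R) := [set x : V | forall i, `|q 0 i - x 0 i| < e].
pose F (qk : 'rV[rat]_n * nat) := bx (map_mx ratr qk.1) qk.2.+1%:R^-1.
rewrite (_ : A = \bigcup_(qk in [set qk | F qk `<=` A]) F qk); last first.
  apply/seteqP; split => x; last by case=> qk /= + ?; exact.
  move=> Ax; have : nbhs x A by exact: open_nbhs_nbhs.
  move=> /nbhs_ballP[e /= e0 eA].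
  (* The center q lies within 1/(k+1) of x, so the cube around q lies within 2/(k+1) < e of x. *)
  have [k ke] : exists k : nat, k.+1%:R^-1 < e / 2.
    have [k _ /(_ _ (leqnn k))] := near_infty_natSinv_lt (PosNum (divr_gt0 e0 (ltr0Sn R 1))).
    by exists k.
  have k0 : (0 : R) < k.+1%:R^-1 by rewrite invr_gt0.
  have qP i : exists q : rat, `|ratr q - x 0 i| < k.+1%:R^-1.
    have [|q] := @rat_in_itvoo R (x 0 i - k.+1%:R^-1) (x 0 i + k.+1%:R^-1).
      by rewrite ltrBlDr -addrA ltrDl addr_gt0.
    rewrite in_itv/= => qx; exists q.
    by rewrite ltr_distl.
  pose q : 'rV[rat]_n := \row_i projT1 (cid (qP i)).
  exists (q, k) => /=; last first.
    by move=> i; rewrite !mxE; case: cid.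
  move=> y /= qy; apply: eA; split => // i j; rewrite !ord1.
  have := qy j; rewrite !mxE; case: cid => r /= xr yr.
  rewrite /ball /= -(subrKA (ratr r)) (le_lt_trans (ler_normD _ _))//.
  by rewrite (distrC (x 0 j)) (splitr e) ltrD// (lt_trans _ ke).
rewrite preimage_bigcup.
rewrite bigcup_mkcond; apply: countable_bigcupT_measurable => // qk.
case: ifPn => // _.
rewrite (_ : _ @^-1` _ = [set t | forall i, `|map_mx ratr qk.1 0 i - tnth t i| < qk.2.+1%:R^-1]).
  exact: measurable_tuple_box.
by apply/seteqP; split => t /= h i; have := h i; rewrite !mxE.
Qed.

Lemma borel_tuple_measurable (A : set V) : borel A ->
  measurable (rho @^-1` A : set (n.-tuple T)).
Proof.
move: A; apply: smallest_sub.
  split => //=.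
  - by rewrite preimage_set0.
  - by move=> A mA; rewrite setTD -preimage_setC; exact: measurableC.
  - by move=> F mF; rewrite preimage_bigcup; exact: bigcupT_measurable.
exact: open_tuple_measurable.
Qed.

Lemma tuple_borel (B : set (n.-tuple T)) : measurable B ->
  borel [set x : V | B [tuple x 0 i | i < n]].
Proof.
move=> mB.
pose f (x : g_sigma_algebraType (@open V)) : n.-tuple T :=
  [tuple (x : V) 0 i | i < n].
suff mf : measurable_fun setT f.
  by have := mf measurableT _ mB; rewrite setTI.
apply/measurable_fun_tnthP => i.
rewrite (_ : _ \o _ = (fun x : V => x 0 i)); last first.
  by apply/funext => x /=; rewrite tnth_mktuple.
apply: (measurability _ (RGenOpens.measurableE R)) => _ [_ [a [b ->] <-]].
rewrite setTI; apply: sub_sigma_algebra.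
apply: open_comp => [x _|]; first exact: coord_continuous.
exact: interval_open.
Qed.

Lemma borel_measurable (A : set (Leb R n)) : borel A -> measurable A.
Proof.
move=> /borel_tuple_measurable mA.
suff : caratheodory_measurable lebesgue_outer A by [].
move=> X; rewrite !lebesgue_outerE !preimage_setI -preimage_setC.
exact: (@caratheodory_measurable_mu_ext _ _ _ (lebesgue_tuple n) _ mA).
Qed.

Lemma leb_borel (A : set (Leb R n)) : borel A ->
  leb A = lebesgue_tuple n (rho @^-1` A).
Proof. by move=> /borel_tuple_measurable mA; exact: measurable_mu_extE. Qed.

End borel.

(** * Borel hulls, null sets, and measures of balls and points *)

Section leb_facts.
Context {R : realType} {n : nat}.
Local Notation T := (measurableTypeR R).
Local Notation V := 'rV[R]_n.
Local Notation L := (Leb R n).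
Local Notation rho := (fun t : n.-tuple R => \row_i tnth t i : 'rV[R]_n).
Local Notation tup := (fun x : V => [tuple x 0 i | i < n] : n.-tuple T).

Lemma leb_ge0 (A : set V) : (0 <= leb (A : set L))%E.
Proof. exact: (outer_measure_ge0 (@lebesgue_outer R n)). Qed.
Hint Resolve leb_ge0 : core.

Lemma le_leb (A B : set V) : A `<=` B -> (leb (A : set L) <= leb (B : set L))%E.
Proof. exact: le_outer_measure. Qed.

Lemma rhoK : cancel rho tup.
Proof. by move=> t; apply: eq_from_tnth => i; rewrite tnth_mktuple mxE. Qed.

Lemma tupK : cancel tup rho.
Proof. by move=> x; apply/rowP => i; rewrite mxE tnth_mktuple. Qed.

Lemma borel_sigma_algebra : sigma_algebra setT (@borel R n).
Proof. exact: smallest_sigma_algebra. Qed.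

Lemma borel_bigcup (F : (set V)^nat) : (forall k, borel (F k)) ->
  borel (\bigcup_k F k).
Proof. by case: borel_sigma_algebra => _ _; exact. Qed.

Lemma borelC (A : set V) : borel A -> borel (~` A).
Proof. by case: borel_sigma_algebra => _ h _ /h; rewrite setTD. Qed.

Lemma borel_bigcap (F : (set V)^nat) : (forall k, borel (F k)) ->
  borel (\bigcap_k F k).
Proof.
move=> bF; rewrite -[X in borel X]setCK; apply: borelC; rewrite setC_bigcap.
by apply: borel_bigcup => k; exact: borelC.
Qed.

Lemma borelI (A B : set V) : borel A -> borel B -> borel (A `&` B).
Proof.
move=> bA bB; rewrite (_ : A `&` B = \bigcap_k (if k is 0%N then A else B)).
  by apply: borel_bigcap => -[].
apply/seteqP; split => x /=; first by move=> [? ?] [].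
by move=> h; split; [exact: (h 0%N)|exact: (h 1%N)].
Qed.

Lemma open_borel (A : set V) : open A -> borel A.
Proof. exact: sub_sigma_algebra. Qed.

Lemma closed_borel (A : set V) : closed A -> borel A.
Proof.
move=> cA; rewrite -(setCK A); apply: borelC; apply: open_borel.
exact: closed_openC.
Qed.

(** The hull is the intersection over k of countable Borel covers of A whose total mass exceeds the
    outer measure of A by at most 1/(k+1). *)
Lemma leb_hull (A : set V) : (leb (A : set L) < +oo)%E ->
  exists B : set V, [/\ borel B, A `<=` B & leb (B : set L) = leb (A : set L)].
Proof.
move=> Afin.
have Afn : (leb (A : set L) \is a fin_num)%E by rewrite ge0_fin_numE.
have cov (k : nat) : exists F : (set (n.-tuple T))^nat,
    [/\ forall j, measurable (F j), rho @^-1` A `<=` \bigcup_j F j &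
    (\sum_(j <oo) lebesgue_tuple n (F j) <= leb (A : set L) + k.+1%:R^-1%:E)%E].
  have k0 : (0 : R) < k.+1%:R^-1 by rewrite invr_gt0.
  have [_ [F [mF AF] <-] hF] := lb_ereal_inf_adherent k0 Afn.
  by exists F; split => //; exact: ltW.
pose F k := projT1 (cid (cov k)).
have FP k : [/\ forall j, measurable (F k j), rho @^-1` A `<=` \bigcup_j F k j &
    (\sum_(j <oo) lebesgue_tuple n (F k j) <= leb (A : set L) + k.+1%:R^-1%:E)%E].
  by rewrite /F; case: cid.
pose G k := \bigcup_j (tup @^-1` F k j).
have bG k : borel (G k).
  apply: borel_bigcup => j; apply: tuple_borel.
  by have [] := FP k.
have bB : borel (\bigcap_k G k) by exact: borel_bigcap.
have AB : A `<=` \bigcap_k G k.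
  move=> x Ax k _; have [_ + _] := FP k.
  by move=> /(_ (tup x)) /=; rewrite tupK => /(_ Ax)[j _ Fj]; exists j.
exists (\bigcap_k G k); split => //.
apply/eqP; rewrite eq_le; apply/andP; split; last exact: le_outer_measure.
apply/lee_addgt0Pr => e e0.
have [k ke] : exists k : nat, k.+1%:R^-1 < e.
  have [k _ /(_ _ (leqnn k))] := near_infty_natSinv_lt (PosNum e0).
  by exists k.
apply: (@le_trans _ _ (leb (A : set L) + k.+1%:R^-1%:E)%E); last first.
  by rewrite leeD2l// lee_fin ltW.
have [mF _ /(le_trans _)] := FP k; apply.
apply: (@le_trans _ _ (leb (G k : set L))).
  by apply: le_outer_measure; exact: bigcap_inf.
apply: (le_trans (outer_measure_sigma_subadditive (@lebesgue_outer R n) _)).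
apply: lee_nneseries => [*|j _]; first exact: leb_ge0.
suff <- : leb (tup @^-1` F k j : set L) = lebesgue_tuple n (F k j) by [].
rewrite leb_borel; last exact: tuple_borel.
by congr (lebesgue_tuple n _); apply/seteqP; split => t /=; rewrite rhoK.
Qed.

Lemma null_hull (N : set V) : leb (N : set L) = 0%E ->
  exists B : set V, [/\ borel B, N `<=` B & leb (B : set L) = 0%E].
Proof.
move=> N0; have [|B [bB NB B0]] := @leb_hull N; first by rewrite N0 ltry.
by exists B; split => //; rewrite B0.
Qed.

Lemma leb_complete : measure_is_complete (@leb R n).
Proof. exact: (@measure_is_complete_caratheodory _ _ (@lebesgue_outer R n)). Qed.

Lemma null_measurable (N : set L) : leb N = 0%E -> measurable N.
Proof.
move=> N0; have [B [bB NB B0]] := null_hull N0.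
by apply: leb_complete; exists B; split => //; exact: borel_measurable.
Qed.

Lemma subset_null (N M : set L) : N `<=` M -> leb M = 0%E -> leb N = 0%E.
Proof.
move=> NM M0; apply/eqP; rewrite eq_le; apply/andP; split.
  by rewrite -M0; exact: le_outer_measure.
exact: leb_ge0.
Qed.

(** By completeness, an almost everywhere statement is the vanishing of an outer measure, with no
    measurability to check; exceptional sets are handled in this form from here on. *)
Lemma aeP (P : V -> Prop) : {ae (@leb R n), forall x, P x} <->
  leb ([set x | ~ P x] : set L) = 0%E.
Proof.
split=> [[N [_ N0 PN]]|N0]; first exact: subset_null PN N0.
by exists [set x | ~ P x]; split => //; exact: null_measurable.
Qed.

Lemma open_measurable (A : set L) : open (A : set V) -> measurable A.
Proof. by move=> oA; apply: borel_measurable; exact: open_borel. Qed.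

Lemma closed_measurable (A : set L) : closed (A : set V) -> measurable A.
Proof. by move=> cA; apply: borel_measurable; exact: closed_borel. Qed.

Lemma compact_measurable (A : set L) : compact (A : set V) -> measurable A.
Proof.
move=> cA; apply: closed_measurable; apply: compact_closed cA.
exact: (@norm_hausdorff R V).
Qed.

Lemma open_continuous_measurable (U : set L) (g : V -> R) :
  open (U : set V) -> (forall x, U x -> {for x, continuous g}) ->
  measurable_fun U (g : L -> R).
Proof.
move=> oU cg; apply: (measurability _ (RGenOpens.measurableE R)).
move=> _ [_ [a [b ->] <-]]; apply: open_measurable.
rewrite openE => x [Ux gx]; apply: filterI.
  exact: open_nbhs_nbhs.
have := cg x Ux; apply.
by apply: open_nbhs_nbhs; split => //; exact: interval_open.
Qed.

Lemma continuous_measurable (U : set L) (g : V -> R) : continuous g ->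
  measurable_fun U (g : L -> R).
Proof.
move=> cg; apply: measurable_funTS.
by apply: open_continuous_measurable => [|x _]; [exact: (@openT V)|exact: cg].
Qed.

Lemma ae_eq_measurable_fun (D : set L) (g h : L -> R) :
  (forall x, D x -> True) ->
  leb [set x | D x /\ g x <> h x] = 0%E -> measurable_fun D g ->
  measurable_fun D h.
Proof.
move=> _ N0 mg mD B mB; set N := mkset _ in N0.
have mN' (M : set L) : M `<=` N -> measurable M.
  by move=> MN; apply/null_measurable/(subset_null MN).
rewrite (_ : D `&` h @^-1` B =
  ((D `&` g @^-1` B) `\` (N `&` g @^-1` B)) `|` (N `&` h @^-1` B)).
  by apply: measurableU; [apply: measurableD; [exact: mg|]|];
    apply: mN'; exact: subIsetl.
apply/seteqP; split => x /=.
  move=> [Dx Bx]; have [e|e] := pselect (g x = h x); last by right.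
  left; split; first by rewrite e.
  by case=> -[].
case=> [[[Dx Bx] nN]|[[Dx _] Bx]]; last by [].
split => //; have [<-//|e] := pselect (g x = h x).
by exfalso; apply: nN.
Qed.

Lemma measurable_tuple_cube m (r : R) :
  measurable ([set t | forall i, `|tnth t i| < r] : set (m.-tuple T)).
Proof.
rewrite (_ : mkset _ = [set t | forall i, `|(0 : 'rV[R]_m) 0 i - tnth t i| < r]).
  exact: measurable_tuple_box.
by apply/seteqP; split => t /= h i; have := h i; rewrite !mxE sub0r normrN.
Qed.

Lemma lebesgue_tuple_cube_lty m (r : R) :
  (lebesgue_tuple m [set t : m.-tuple R | forall i, (`|tnth t i| < r)%R] < +oo)%E.
Proof.
elim: m => [|m IH].
  by rewrite /= diracE; case: (_ \in _); rewrite ltry.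
rewrite /= /lebesgue_tuple_step /pushforward.
rewrite (_ : _ @^-1` _ = ball (0%R : R) r `*`
    [set t : m.-tuple R | forall i, (`|tnth t i| < r)%R]).
  rewrite product_measure1E; [|exact: measurable_ball|exact: measurable_tuple_cube].
  have b : (lebesgue_measure (ball (0%R : R) r) < +oo)%E.
    have [r0|r0] := leP 0%R r; first by rewrite lebesgue_measure_ball// ltry.
    rewrite (_ : ball _ _ = set0) ?measure0 ?ltry//.
    by apply/seteqP; split => x //=; rewrite /ball /= => /lt_trans/(_ r0);
      rewrite normr_lt0.
  by rewrite lte_mul_pinfty// ge0_fin_numE.
apply/seteqP; split => -[x t] /=.
  move=> h; split => [|i].
    by have := h ord0; rewrite /tuple_cons /= tnth0 /ball /= sub0r normrN.
  by have := h (lift ord0 i); rewrite tnthS.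
move=> [xr tr] i; case: (unliftP ord0 i) => [j ->|->]; rewrite ?tnthS ?tnth0//.
by move: xr; rewrite /ball /= sub0r normrN.
Qed.

Lemma eball_lty (r : R) : (leb (eball r : set L) < +oo)%E.
Proof.
apply: le_lt_trans (lebesgue_tuple_cube_lty n r).
rewrite leb_borel; last by apply: open_borel; exact: open_eball.
apply: le_measure.
- rewrite inE; apply: borel_tuple_measurable.
  by apply: open_borel; exact: open_eball.
- by rewrite inE; exact: measurable_tuple_cube.
- move=> t /= tr i; apply: le_lt_trans tr.
  by have := coord_le_enorm (rho t) i; rewrite mxE.
Qed.

Lemma bounded_lty (A : set L) (r : R) : A `<=` [set x | enorm x <= r] -> (leb A < +oo)%E.
Proof.
move=> Ar; apply: le_lt_trans (eball_lty (r + 1)); apply: le_outer_measure.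
by move=> x /Ar /= xr; rewrite /eball /=; lra.
Qed.

(** The dilation by 2 fixes the singleton but divides its finite measure by 2^n > 1. *)
Lemma leb0 : (0 < n)%N -> leb ([set 0] : set L) = 0%E.
Proof.
move=> n0; have fin0 : (leb ([set (0%R : V)] : set L) < +oo)%E.
  by apply: (@bounded_lty _ 0) => x ->; rewrite /= enorm0.
have s2 : (0 : R) < 2 by [].
have := @leb_affine R n 2 0 [set (0 : V)] s2.
rewrite (_ : _ @^-1` _ = [set (0 : V)]); last first.
  apply/seteqP; split => x /=; rewrite /affine addr0.
    by move/eqP; rewrite scaler_eq0 pnatr_eq0/= => /eqP.
  by move=> ->; rewrite scaler0.
move/eqP; rewrite -[X in _ == (X * _)%E]/(_%:E).
case: (leb _) fin0 (leb_ge0 ([set (0 : V)])) => [r _ r0|//|//].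
rewrite -EFinM eqe => /eqP rE.
have r0' : r * (1 - 2 ^- n) = 0 by rewrite mulrBr mulr1 [r * _]mulrC -rE subrr.
move/eqP : r0'; rewrite mulf_eq0 => /orP[/eqP->//|].
rewrite subr_eq0 eq_sym invr_eq1 => /eqP h.
have : 1 < (2 : R) ^+ n by rewrite exprn_egt1 ?ltr1n// -lt0n.
by rewrite h ltxx.
Qed.

End leb_facts.
#[export] Hint Resolve leb_ge0 : core.

(** * Integrals under dilations and translations *)

Section integral_affine.
Context {R : realType} {n : nat}.
Local Notation V := 'rV[R]_n.
Local Notation L := (Leb R n).
Local Open Scope ereal_scope.

Lemma ge0_integral_affine (s : R) (c : V) (F : L -> \bar R) : (0 < s)%R ->
  measurable_fun setT F -> (forall x, 0 <= F x) ->
  \int[leb]_x F (affine s c x) = (s ^- n)%:E * \int[leb]_x F x.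
Proof.
move=> s0 mF F0.
have sn0 : (0 <= s ^- n)%R by rewrite invr_ge0 exprn_ge0// ltW.
rewrite -(ge0_integral_mscale leb measurableT (NngNum sn0))//.
have mf := measurable_fun_affine c s0.
have := @ge0_integral_pushforward _ _ L L R _ mf leb setT F measurableT mF
  (fun y _ => F0 y).
rewrite preimage_setT => <-.
apply: eq_measure_integral => A mA _; rewrite /= /mscale/=.
by rewrite /pushforward leb_affine.
Qed.

Lemma measurable_fun_comp_affine (s : R) (c : V) (F : L -> \bar R) :
  (0 < s)%R -> measurable_fun setT F ->
  measurable_fun setT (fun x : L => F (affine s c x)).
Proof.
move=> s0 mF; apply: (measurableT_comp mF).
exact: measurable_fun_affine.
Qed.

Lemma integrable_affine (s : R) (c : V) (F : L -> \bar R) : (0 < s)%R ->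
  leb.-integrable setT F -> leb.-integrable setT (fun x : L => F (affine s c x)).
Proof.
move=> s0 /integrableP[mF Foo]; apply/integrableP; split.
  exact: measurable_fun_comp_affine.
have mN : measurable_fun setT (abse \o F) by exact: measurableT_comp.
rewrite (@ge0_integral_affine s c (abse \o F))//; last by move=> x /=.
by rewrite lte_mul_pinfty// lee_fin invr_ge0 exprn_ge0// ltW.
Qed.

Lemma integral_affine (s : R) (c : V) (F : L -> \bar R) : (0 < s)%R ->
  leb.-integrable setT F ->
  \int[leb]_x F (affine s c x) = (s ^- n)%:E * \int[leb]_x F x.
Proof.
move=> s0 iF; have mF := measurable_int _ iF.
rewrite integralE [in RHS]integralE.
have mp := measurable_funepos mF; have mn := measurable_funeneg mF.
rewrite muleBr//; last first.
  apply: fin_num_adde_defl; rewrite fin_numN.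
  exact: (integrable_neg_fin_num measurableT iF).
rewrite -(ge0_integral_affine c s0 mp) -?(ge0_integral_affine c s0 mn).
- by congr (_ - _); apply: eq_integral => x _; rewrite ?funeposE ?funenegE.
- by move=> x; exact: funeneg_ge0.
- by move=> x; exact: funepos_ge0.
Qed.

End integral_affine.

Section Rintegral_affine.
Context {R : realType} {n : nat}.
Local Notation V := 'rV[R]_n.
Local Notation L := (Leb R n).

Lemma Rintegral_affine (s : R) (c : V) (F : L -> R) : 0 < s ->
  leb.-integrable setT (EFin \o F) ->
  \int[leb]_x F (affine s c x) = s ^- n * \int[leb]_x F x.
Proof.
move=> s0 iF; rewrite /Rintegral.
have := integral_affine c s0 iF; rewrite /comp => ->.
by rewrite fineM//; exact: integrable_fin_num iF.
Qed.

End Rintegral_affine.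

(** * Measures given by a density *)

Section density.
Context d (T : measurableType d) {R : realType} (mu : {measure set T -> \bar R}).
Variable w : T -> R.
Hypothesis mw : measurable_fun setT w.
Hypothesis w0 : forall x, 0 <= w x.
Local Open Scope ereal_scope.

Definition density (A : set T) : \bar R := \int[mu]_(x in A) (w x)%:E.

Let density0 : density set0 = 0.
Proof. by rewrite /density integral_set0. Qed.

Let density_ge0 A : 0 <= density A.
Proof. by apply: integral_ge0 => x _; rewrite lee_fin. Qed.

Let density_sigma_additive : semi_sigma_additive density.
Proof.
apply: semi_sigma_additive_nng_induced => [|x]; last by rewrite lee_fin.
exact/measurable_EFinP.
Qed.

HB.instance Definition _ := isMeasure.Build _ _ _ density
  density0 density_ge0 density_sigma_additive.

Import HBNNSimple.

(** For indicators this is the definition of [density]; increasing simple functions and monotone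
    convergence on both sides give the rest. *)
Lemma ge0_integral_density (f : T -> \bar R) : measurable_fun setT f ->
  (forall x, 0 <= f x) ->
  \int[density]_x f x = \int[mu]_x (f x * (w x)%:E).
Proof.
move=> mf f0.
pose h := nnsfun_approx measurableT mf.
have mEw : measurable_fun setT (EFin \o w) by exact/measurable_EFinP.
have -> : \int[density]_x f x =
    lim (\int[density]_x (EFin \o h n) x @[n --> \oo]).
  have fE x : f x = lim ((EFin \o h n) x @[n --> \oo]).
    by apply/esym/cvg_lim => //; exact: cvg_nnsfun_approx.
  under eq_integral do rewrite fE.
  apply: monotone_convergence => //.
  - by move=> n; apply/measurable_EFinP.
  - by move=> n x _ //=; rewrite lee_fin.
  - by move=> x _ a b ab; rewrite lee_fin; exact/lefP/nd_nnsfun_approx.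
have -> : \int[mu]_x (f x * (w x)%:E) =
    lim (\int[mu]_x ((EFin \o h n) x * (w x)%:E) @[n --> \oo]).
  have fg x : f x * (w x)%:E = lim ((EFin \o h n) x * (w x)%:E @[n --> \oo]).
    apply/esym/cvg_lim => //; apply: cvgeZr => //; exact: cvg_nnsfun_approx.
  under eq_integral do rewrite fg.
  apply: monotone_convergence => [//| | |].
  - by move=> n; apply/emeasurable_funM => //; exact/measurable_EFinP.
  - by move=> n x Ex /=; rewrite mule_ge0 ?lee_fin.
  - move=> x Ex a b ab/=; rewrite lee_wpmul2r ?lee_fin//.
    exact/lefP/nd_nnsfun_approx.
congr (limn _); apply/funext => n.
transitivity (\int[density]_x
   (\sum_(y \in range (h n)) (y * \1_(h n @^-1` [set y]) x)%:E)).
  by apply: eq_integral => t tE; rewrite /= fimfunE -fsumEFin.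
have indich m r : measurable_fun setT (fun x => (r * \1_(h m @^-1` [set r]) x)%:E).
  by apply: (measurable_comp measurableT) => //; exact: measurable_funM.
rewrite ge0_integral_fsum//; last by move=> m y Ey; exact: nnfun_muleindic_ge0.
transitivity (\int[mu]_x (\sum_(y \in range (h n))
    (y * \1_(h n @^-1` [set y]) x)%:E * (w x)%:E)); last first.
  apply: eq_integral => x xE.
  rewrite -ge0_mule_fsuml => [|y]; last exact: nnfun_muleindic_ge0.
  by rewrite fsumEFin // -(fimfunE _ x).
rewrite ge0_integral_fsum//; last 2 first.
  - by move=> y; exact: emeasurable_funM.
  - by move=> m y Ey; apply: mule_ge0; [exact: nnfun_muleindic_ge0|rewrite lee_fin].
apply: eq_fsbigr => r rhn.
under eq_integral do rewrite EFinM.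
rewrite integralZl_indic_nnsfun => //.
under [RHS]eq_integral do rewrite EFinM -muleA.
rewrite ge0_integralZl//.
- under [in RHS]eq_integral do rewrite muleC.
  rewrite [in RHS](eq_integral ((EFin \o w) \_ (h n @^-1` [set r]))); last first.
    by move=> x xE; rewrite epatch_indic.
  by rewrite -integral_mkcond integral_indic// setIT.
- by apply: emeasurable_funM => //; exact/measurable_EFinP.
- by move=> t Et; rewrite mule_ge0 ?lee_fin.
- by move: rhn; rewrite inE => -[t _ <-]; rewrite lee_fin.
Qed.

End density.

(** * The inversion in the unit sphere and the projection to directions *)

Section inversion.
Context {R : realType} {n : nat}.
Local Notation V := 'rV[R]_n.
Implicit Types x y : V.

(** Since 0^-1 = 0, the origin is sent to itself and the inversion is an involution of the whole
    space. *)
Definition inversion y : V := enorm y ^- 2 *: y.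
Definition direction y : V := (enorm y)^-1 *: y.

Lemma inversion0 : inversion 0 = 0. Proof. by rewrite /inversion scaler0. Qed.

Lemma enorm_inversion y : enorm (inversion y) = (enorm y)^-1.
Proof.
have [->|y0] := eqVneq y 0; first by rewrite inversion0 enorm0 invr0.
rewrite /inversion enormZ ger0_norm ?invr_ge0 ?sqr_ge0//.
by field; rewrite enorm_eq0.
Qed.

Lemma inversionK : involutive inversion.
Proof.
move=> y; have [->|y0] := eqVneq y 0; first by rewrite !inversion0.
rewrite {1}/inversion enorm_inversion /inversion scalerA.
rewrite (_ : _ * _ = 1) ?scale1r//; field.
by rewrite enorm_eq0.
Qed.

Lemma inversion_eq0 y : (inversion y == 0) = (y == 0).
Proof. by rewrite -enorm_eq0 enorm_inversion invr_eq0 enorm_eq0. Qed.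

Lemma direction_inversion y : direction (inversion y) = direction y.
Proof.
have [->|y0] := eqVneq y 0; first by rewrite inversion0.
rewrite /direction enorm_inversion /inversion scalerA; congr (_ *: _).
by field; rewrite enorm_eq0.
Qed.

Lemma directionZ (s : R) y : 0 < s -> direction (s *: y) = direction y.
Proof.
move=> s0; have [->|y0] := eqVneq y 0; first by rewrite scaler0.
rewrite /direction enormZ gtr0_norm// scalerA; congr (_ *: _).
by field; rewrite enorm_eq0 y0 gt_eqF.
Qed.

Lemma enorm_direction y : y != 0 -> enorm (direction y) = 1.
Proof.
move=> y0; rewrite /direction enormZ ger0_norm ?invr_ge0 ?enorm_ge0//.
by rewrite mulVf// enorm_eq0.
Qed.

Lemma scale_direction y : enorm y *: direction y = y.
Proof.
have [->|y0] := eqVneq y 0; first by rewrite enorm0 scale0r.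
by rewrite scalerA mulfV ?scale1r// enorm_eq0.
Qed.

Lemma continuous_enorm_inv y : y != 0 ->
  {for y, continuous (fun z : V => (enorm z)^-1)}.
Proof.
move=> y0; apply: continuousV; first by rewrite enorm_eq0.
exact: continuous_enorm.
Qed.

Lemma continuous_direction y : y != 0 -> {for y, continuous direction}.
Proof.
move=> y0; apply: continuousZ; first exact: continuous_enorm_inv.
exact: cvg_id.
Qed.

Lemma continuous_inversion y : y != 0 -> {for y, continuous inversion}.
Proof.
move=> y0; rewrite (_ : inversion = fun z => (enorm z)^-1 *: direction z).
  by apply: continuousZ; [exact: continuous_enorm_inv|exact: continuous_direction].
by apply/funext => z; rewrite /direction scalerA -expr2 exprVn.
Qed.

Lemma open_punctured : open [set x : V | x != 0].
Proof.
rewrite (_ : mkset _ = exterior 0); first exact: open_exterior.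
by apply/seteqP; split => x /=; rewrite /exterior /= enorm_gt0.
Qed.

(** The preimage of an open set is open in the punctured space, up to the single point 0, which is
    itself a Borel set. *)
Lemma borel_preimage (g : V -> V) : (forall y, y != 0 -> {for y, continuous g}) ->
  forall A, borel A -> borel (g @^-1` A).
Proof.
move=> cg; apply: smallest_sub.
  split => //=.
  - by rewrite preimage_set0; apply: open_borel; exact: open0.
  - by move=> A bA; rewrite setTD -preimage_setC; exact: borelC.
  - by move=> F bF; rewrite preimage_bigcup; exact: borel_bigcup.
move=> O oO /=.
rewrite (_ : g @^-1` O = ([set x | x != 0] `&` g @^-1` O) `|`
    ([set x : V | ~~ (x != 0)] `&` g @^-1` O)); last first.
  rewrite -setIUl (_ : _ `|` _ = setT) ?setTI//.
  by apply/seteqP; split => x //= _; case: eqP; [right|left].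
rewrite -bigcup2E; apply: borel_bigcup => -[|[|k]] /=.
- apply: open_borel; rewrite openE => x [x0 gx]; apply: filterI.
    by apply: open_nbhs_nbhs; split => //; exact: open_punctured.
  by apply: cg => //; exact: open_nbhs_nbhs.
- have [g0|g0] := pselect (O (g 0)).
    rewrite (_ : _ `&` _ = [set 0]).
      apply: closed_borel; exact: (accessible_closed_set1 (hausdorff_accessible (@norm_hausdorff R V))).
    by apply/seteqP; split => x /=; [move=> [/negPn/eqP]|move=> ->; rewrite eqxx].
  rewrite (_ : _ `&` _ = set0); first by apply: open_borel; exact: open0.
  by apply/seteqP; split => x //= [/negPn/eqP ->].
- by apply: open_borel; exact: open0.
Qed.

End inversion.

(** Continuity of l^n at l = 1; this removes the factors that come from comparing volumes on
    slightly enlarged or thin shells. *)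
Lemma le_of_le_expr (R : realType) (n : nat) (a b c : R) :
  (forall l, 1 < l -> a <= l ^+ n * b + c) -> a <= b + c.
Proof.
move=> h; rewrite leNgt; apply/negP => ba.
have : \forall l \near (1 : R), l ^+ n * b + c < a.
  have cf : {for 1, continuous (fun l : R => l ^+ n * b + c)}.
    apply: continuousD; last exact: cvg_cst.
    by apply: continuousM; [exact: exprn_continuous|exact: cvg_cst].
  move: cf => /cvgr_lt; apply; by rewrite /= expr1n mul1r.
move=> /nbhs_ballP[e /= e0 eh].
have := eh (1 + e / 2); rewrite /ball /= opprD addNKr normrN gtr0_norm ?divr_gt0//.
rewrite ltr_pdivrMr// ltr_pMr// ltr1n => /(_ isT).
by rewrite ltNge h// ltrDl divr_gt0.
Qed.

(** * Volumes of conical shells *)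

Section cones.
Context {R : realType} {n : nat}.
Hypothesis n0 : (0 < n)%N.
Local Notation V := 'rV[R]_n.
Local Notation L := (Leb R n).
Implicit Types (U : set V) (s t : R).

(** A shell contains one of its two boundary spheres: the outer one for [cone], the inner one for
    [cocone]. The inversion exchanges the two kinds. *)
Definition cone U s t : set V := [set x | s < enorm x <= t /\ U (direction x)].
Definition cocone U s t : set V := [set x | s <= enorm x < t /\ U (direction x)].

Lemma lebU (A B : set V) : measurable (A : set L) -> measurable (B : set L) ->
  A `&` B = set0 ->
  leb (A `|` B : set L) = (leb (A : set L) + leb (B : set L))%E.
Proof. by move=> mA mB AB; rewrite measureU. Qed.

Lemma borel_enorm (I : set R) : measurable (I : set (measurableTypeR R)) -> 
  borel ((@enorm R n) @^-1` I).
Proof.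
move=> mI; pose f := @enorm R n : g_sigma_algebraType (@open V) -> R.
suff mf : measurable_fun setT f.
  by have := mf measurableT _ mI; rewrite setTI.
apply: (measurability _ (RGenOpens.measurableE R)) => _ [_ [a [b ->] <-]].
rewrite setTI; apply: sub_sigma_algebra.
apply: open_comp => [x _|]; first exact: continuous_enorm.
exact: interval_open.
Qed.

Lemma borel_cone U s t : borel U -> borel (cone U s t).
Proof.
move=> bU; rewrite (_ : cone U s t =
    (@enorm R n) @^-1` `]s, t]%classic `&` direction @^-1` U).
  apply: borelI; first exact: borel_enorm.
  exact: borel_preimage continuous_direction _ bU.
by apply/seteqP; split => x /=; rewrite in_itv.
Qed.

Lemma borel_cocone U s t : borel U -> borel (cocone U s t).
Proof.
move=> bU; rewrite (_ : cocone U s t =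
    (@enorm R n) @^-1` `[s, t[%classic `&` direction @^-1` U).
  apply: borelI; first exact: borel_enorm.
  exact: borel_preimage continuous_direction _ bU.
by apply/seteqP; split => x /=; rewrite in_itv.
Qed.

Lemma measurable_cone U s t : borel U -> measurable (cone U s t : set L).
Proof. by move=> bU; apply: borel_measurable; exact: borel_cone. Qed.

Lemma measurable_cocone U s t : borel U -> measurable (cocone U s t : set L).
Proof. by move=> bU; apply: borel_measurable; exact: borel_cocone. Qed.

Lemma cone_lty U s t : (leb (cone U s t : set L) < +oo)%E.
Proof. by apply: (@bounded_lty _ _ _ t) => x [/andP[]]. Qed.

Lemma cocone_lty U s t : (leb (cocone U s t : set L) < +oo)%E.
Proof. by apply: (@bounded_lty _ _ _ t) => x [/andP[_ /ltW]]. Qed.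

(** The volume of the unit cone over U, that is 1/n times the area of the part of the unit sphere in
    U. *)
Definition solid_angle U : R := fine (leb (cone U 0 1 : set L)).

Lemma solid_angle_ge0 U : 0 <= solid_angle U.
Proof. by rewrite fine_ge0. Qed.

Lemma leb_cone0 U t : 0 < t ->
  leb (cone U 0 t : set L) = (t ^+ n * solid_angle U)%:E.
Proof.
move=> t0; have t'0 : 0 < t^-1 by rewrite invr_gt0.
rewrite (_ : cone U 0 t = affine t^-1 0 @^-1` cone U 0 1); last first.
  apply/seteqP; split => x /=; rewrite /cone /affine /= addr0 directionZ//;
  rewrite enormZ gtr0_norm// pmulr_rgt0// ler_pdivrMl// mulr1//.
rewrite leb_affine// exprVn invrK EFinM /solid_angle fineK//.
by rewrite ge0_fin_numE// cone_lty.
Qed.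

Lemma leb_cone U s t : borel U -> 0 < s -> s <= t ->
  leb (cone U s t : set L) = ((t ^+ n - s ^+ n) * solid_angle U)%:E.
Proof.
move=> bU s0 st; have t0 := lt_le_trans s0 st.
have := leb_cone0 U t0.
rewrite (_ : cone U 0 t = cone U 0 s `|` cone U s t); last first.
  apply/seteqP; split => x; rewrite /cone /=.
    move=> [/andP[x0 xt] Ux]; have [xs|sx] := leP (enorm x) s.
      by left; rewrite x0.
    by right; rewrite xt.
  case=> -[/andP[sx xt] Ux]; split => //; first by rewrite sx (le_trans xt).
  by rewrite (lt_trans s0).
rewrite lebU//; [|exact: measurable_cone|exact: measurable_cone|]; last first.
  apply/seteqP; split => x //= [[/andP[_ xs] _] [/andP[sx _] _]].
  by move: (lt_le_trans sx xs); rewrite ltxx.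
rewrite leb_cone0// => /eqP.
have := cone_lty U s t; have := leb_ge0 (cone U s t).
case: (leb _) => [r _ _|//|//].
by rewrite -EFinD eqe => /eqP h; congr EFin; lra.
Qed.

(** Instead of proving spheres negligible, the shell is squeezed for l > 1 between
    [cone U s (t / l)] and [cone U (s / l) t], and l tends to 1. *)
Lemma leb_cocone U s t : borel U -> 0 < s -> s <= t ->
  leb (cocone U s t : set L) = ((t ^+ n - s ^+ n) * solid_angle U)%:E.
Proof.
move=> bU s0 st; have t0 := lt_le_trans s0 st.
have := cocone_lty U s t; have := leb_ge0 (cocone U s t).
case E : (leb _) => [r||//] // _ _; congr EFin.
have sa := solid_angle_ge0 U.
have [sn0 tn0] : 0 < s ^+ n /\ 0 < t ^+ n by rewrite !exprn_gt0.
apply/eqP; rewrite eq_le; apply/andP; split.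
  suff : s ^+ n * solid_angle U <= (t ^+ n * solid_angle U - r) + 0 by lra.
  apply: (@le_of_le_expr _ n) => l l1; have l0 := lt_trans ltr01 l1.
  have h : r <= (t ^+ n - (s / l) ^+ n) * solid_angle U.
    rewrite -lee_fin -E -leb_cone ?divr_gt0//.
      apply: le_leb => x [/andP[sx xt] Ux]; split => //.
      by rewrite (ltW xt) andbT (lt_le_trans _ sx)// ltr_pdivrMr// ltr_pMr.
    by rewrite (le_trans _ st)// ler_pdivrMr// ler_peMr// ltW.
  have ln0 : 0 < l ^+ n by rewrite exprn_gt0.
  move: h; rewrite -(ler_pM2l ln0) mulrA mulrBr.
  rewrite (_ : l ^+ n * (s / l) ^+ n = s ^+ n); last first.
    by rewrite -exprMn mulrC divfK// gt_eqF.
  rewrite mulrBl; lra.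
suff : t ^+ n * solid_angle U <= r + s ^+ n * solid_angle U + 0 by lra.
apply: (@le_of_le_expr _ n) => l l1; have l0 := lt_trans ltr01 l1.
have ln0 : 0 < l ^+ n by rewrite exprn_gt0.
have r0 : 0 <= r by rewrite -lee_fin -E.
rewrite addr0; have [sl|ls] := leP s (t / l).
  have h : ((t / l) ^+ n - s ^+ n) * solid_angle U <= r.
    rewrite -lee_fin -E -leb_cone//.
    apply: le_leb => x [/andP[sx xt] Ux]; split => //.
    by rewrite (ltW sx)/= (le_lt_trans xt)// ltr_pdivrMr// ltr_pMr.
  move: h; rewrite -(ler_pM2l ln0) mulrA mulrBr.
  rewrite (_ : l ^+ n * (t / l) ^+ n = t ^+ n); last first.
    by rewrite -exprMn mulrC divfK// gt_eqF.
  rewrite mulrBl; lra.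
move: ls; rewrite ltr_pdivrMr// => ls.
have tls : t ^+ n <= l ^+ n * s ^+ n.
  by rewrite -exprMn ler_pXn2r ?nnegrE ?mulr_ge0 ?ltW// mulrC.
by rewrite mulrDr mulrA (le_trans (ler_wpM2r sa tls))// lerDr mulr_ge0 ?(ltW ln0).
Qed.

End cones.

Lemma measurable_funV_ge0 d (T : measurableType d) (R : realType) (D : set T)
    (f : T -> R) : (forall x, 0 <= f x) -> measurable_fun D f ->
  measurable_fun D (fun x => (f x)^-1).
Proof.
move=> f0 mf; rewrite (_ : (fun x => _) = (@powR R ^~ (- 1)) \o f).
  by apply: measurableT_comp mf; exact: measurable_powR.
by apply/funext => x /=; rewrite powR_inv1.
Qed.

(** * The Jacobian of the inversion on conical shells *)

Section inversion_measure.
Context {R : realType} {n : nat}.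
Hypothesis n0 : (0 < n)%N.
Local Notation V := 'rV[R]_n.
Local Notation L := (Leb R n).
Implicit Types (U : set V) (s t : R).

(** The absolute value of the Jacobian determinant of the inversion. *)
Definition inversion_jac (y : L) : R := (enorm (y : V) ^+ (2 * n))^-1.

Lemma inversion_jac_ge0 y : 0 <= inversion_jac y.
Proof. by rewrite invr_ge0 exprn_ge0// enorm_ge0. Qed.

Lemma measurable_enorm (D : set L) : measurable_fun D (@enorm R n : L -> R).
Proof. by apply: continuous_measurable; exact: continuous_enorm. Qed.

Lemma measurable_inversion_jac : measurable_fun [set: L] inversion_jac.
Proof.
apply: measurable_funV_ge0 => [x|]; first by rewrite exprn_ge0// enorm_ge0.
by apply: measurable_funX; exact: measurable_enorm.
Qed.

Let nu := density (@leb R n) inversion_jac.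

Lemma inversion_cone U s t : 0 < s -> 0 < t ->
  inversion @^-1` (cone U s t) = cocone U t^-1 s^-1.
Proof.
move=> s0 t0.
apply/seteqP; split => y /=; rewrite /cone /cocone /= direction_inversion;
  rewrite enorm_inversion => -[/andP[h1 h2] Uy]; split => //.
  have y0 : 0 < enorm y by rewrite -invr_gt0 (lt_trans s0).
  apply/andP; split.
    by rewrite -[leRHS]invrK lef_pV2// posrE invr_gt0.
  by rewrite -[ltLHS]invrK ltf_pV2// posrE invr_gt0.
have y0 : 0 < enorm y by rewrite (lt_le_trans _ h1)// invr_gt0.
apply/andP; split.
  by rewrite -[ltLHS]invrK ltf_pV2// posrE invr_gt0.
by rewrite -[leRHS]invrK lef_pV2// posrE invr_gt0.
Qed.

Lemma density_cocone U s t : borel U -> 0 < s -> s <= t ->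
  ((t ^- (2 * n))%:E * leb (cocone U s t : set L) <= nu (cocone U s t) /\
   nu (cocone U s t) <= (s ^- (2 * n))%:E * leb (cocone U s t : set L))%E.
Proof.
move=> bU s0 st; have t0 := lt_le_trans s0 st.
have mC := measurable_cocone s t bU.
have n2 : (0 < 2 * n)%N by rewrite muln_gt0.
have mw : measurable_fun (cocone U s t : set L) (EFin \o inversion_jac).
  by apply/measurable_EFinP; exact: measurable_funTS measurable_inversion_jac.
rewrite -!integral_cst//; split.
  apply: ge0_le_integral => //=.
  - by move=> x _; rewrite lee_fin invr_ge0 exprn_ge0// ltW.
  - move=> x [/andP[sx xt] _]; have x0 := lt_le_trans s0 sx.
    by rewrite lee_fin lef_pV2 ?posrE ?exprn_gt0// (ler_pXn2r n2) ?nnegrE ?(ltW x0) ?(ltW s0) ?(ltW t0)// ltW.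
apply: ge0_le_integral => //=.
- by move=> x _; rewrite lee_fin inversion_jac_ge0.
- move=> x [/andP[sx xt] _]; have x0 := lt_le_trans s0 sx.
  by rewrite lee_fin lef_pV2 ?posrE ?exprn_gt0// (ler_pXn2r n2) ?nnegrE ?(ltW x0) ?(ltW s0).
Qed.

(** On the inverted shell 1/t <= |y| < 1/s the density lies between s^(2n) and t^(2n), while the
    volume there is (s^(-n) - t^(-n)) times the solid angle; the product is the volume of the
    original shell up to the factor (t/s)^n. *)
Lemma density_inversion_cone_bounds U s t : borel U -> 0 < s -> s <= t ->
  (nu (inversion @^-1` cone U s t) <= ((t / s) ^+ n)%:E * leb (cone U s t : set L) /\
   leb (cone U s t : set L) <= ((t / s) ^+ n)%:E * nu (inversion @^-1` cone U s t))%E.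
Proof.
move=> bU s0 st; have t0 := lt_le_trans s0 st.
rewrite inversion_cone//.
have t'0 : 0 < t^-1 by rewrite invr_gt0.
have st' : t^-1 <= s^-1 by rewrite lef_pV2.
have [h1 h2] := density_cocone bU t'0 st'.
have sa := solid_angle_ge0 U.
rewrite leb_cocone// in h1 h2; rewrite leb_cone//.
have ts : 0 < s ^+ n /\ 0 < t ^+ n by rewrite !exprn_gt0.
case: ts => sn tn.
have E1 : t^-1 ^- (2 * n) * ((s^-1 ^+ n - t^-1 ^+ n) * solid_angle U) =
    (t / s) ^+ n * ((t ^+ n - s ^+ n) * solid_angle U).
  rewrite !exprVn mulnC exprM invrK expr_div_n.
  by field; rewrite !gt_eqF.
have E2 : s^-1 ^- (2 * n) * ((s^-1 ^+ n - t^-1 ^+ n) * solid_angle U) =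
    (s / t) ^+ n * ((t ^+ n - s ^+ n) * solid_angle U).
  rewrite !exprVn mulnC exprM invrK expr_div_n.
  by field; rewrite !gt_eqF.
rewrite -EFinM E1 in h2; rewrite -EFinM E2 in h1; split; first by rewrite -EFinM.
rewrite -lee_pdivrMl ?exprn_gt0 ?divr_gt0//.
rewrite -EFinM; apply: le_trans h1; rewrite lee_fin.
by rewrite -exprVn invf_div.
Qed.

Lemma nu_ge0 (A : set V) : (0 <= nu A)%E.
Proof. by apply: integral_ge0 => x _; rewrite lee_fin inversion_jac_ge0. Qed.

Lemma nu_setU (A B : set V) : measurable (A : set L) -> measurable (B : set L) ->
  A `&` B = set0 -> (nu (A `|` B) = nu A + nu B)%E.
Proof.
move=> mA mB AB; rewrite /nu /density.
rewrite (@ge0_integral_setU _ L R leb A B)//.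
- by apply/measurable_EFinP; exact: measurable_funTS measurable_inversion_jac.
- by move=> x _; rewrite lee_fin inversion_jac_ge0.
- by rewrite disj_set2E; apply/eqP.
Qed.

(** Cutting the shell into k+1 shells of ratio at most l and adding up replaces the error factor
    (t/s)^n by l^n. *)
Lemma density_inversion_cone_iter U (k : nat) (l s t : R) : borel U -> 0 < s ->
  1 <= l -> s <= t <= s * l ^+ k.+1 ->
  (nu (inversion @^-1` cone U s t) <= (l ^+ n)%:E * leb (cone U s t : set L) /\
   leb (cone U s t : set L) <= (l ^+ n)%:E * nu (inversion @^-1` cone U s t))%E.
Proof.
move=> bU s0 l1; have l0 := lt_le_trans ltr01 l1.
have base a b : 0 < a -> a <= b <= a * l ->
  (nu (inversion @^-1` cone U a b) <= (l ^+ n)%:E * leb (cone U a b : set L) /\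
   leb (cone U a b : set L) <= (l ^+ n)%:E * nu (inversion @^-1` cone U a b))%E.
  move=> a0 /andP[ab bl]; have [h1 h2] := density_inversion_cone_bounds bU a0 ab.
  have bal : (b / a) ^+ n <= l ^+ n.
    rewrite ler_pXn2r ?nnegrE ?divr_ge0 ?(ltW l0) ?(ltW a0)//.
      by rewrite ler_pdivrMr// mulrC.
    by rewrite (le_trans (ltW a0)).
  split; [apply: (le_trans h1)|apply: (le_trans h2)]; apply: lee_wpmul2r;
    by rewrite ?lee_fin// ?nu_ge0.
elim: k t => [|k IH] t; first by rewrite expr1; exact: base.
move=> /andP[st tl].
have [tk|/ltW kt] := leP t (s * l ^+ k.+1); first by apply: IH; rewrite st.
set m := s * l ^+ k.+1 in kt *.
have lk : 1 <= l ^+ k.+1 by rewrite exprn_ege1.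
have sm : s <= m by rewrite ler_peMr// ltW.
have m0 := lt_le_trans s0 sm.
have t0 := lt_le_trans s0 st.
have [|h1 h2] := IH m; first by rewrite sm lexx.
have [|h3 h4] := base m t m0; first by rewrite kt/= /m -mulrA -exprSr.
have D : cone U s t = cone U s m `|` cone U m t.
  apply/seteqP; split => x; rewrite /cone /=.
    move=> [/andP[sx xt] Ux]; have [xs|mx] := leP (enorm x) m.
      by left; rewrite sx.
    by right; rewrite xt.
  case=> -[/andP[sx xt] Ux]; split => //; first by rewrite sx (le_trans xt).
  by rewrite (le_lt_trans sm).
have D0 : cone U s m `&` cone U m t = set0.
  apply/seteqP; split => x //= [[/andP[_ xs] _] [/andP[sx _] _]].
  by move: (lt_le_trans sx xs); rewrite ltxx.
rewrite D preimage_setU nu_setU ?lebU//; first last.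
- by rewrite -preimage_setI D0 preimage_set0.
- by rewrite (inversion_cone U m0 t0); exact: measurable_cocone.
- by rewrite (inversion_cone U s0 m0); exact: measurable_cocone.
- exact: measurable_cone.
- exact: measurable_cone.
by split; rewrite ge0_muleDr ?nu_ge0 ?leb_ge0//; exact: leeD.
Qed.

(** Shells of ratio l > 1 cover any range of radii, so the two sides agree up to l^n for every l >
    1; let l tend to 1. *)
Lemma density_inversion_cone U s t : borel U -> 0 < s ->
  nu (inversion @^-1` cone U s t) = leb (cone U s t : set L).
Proof.
move=> bU s0; have [ts|st] := ltP t s.
  rewrite (_ : cone _ _ _ = set0); first by rewrite preimage_set0 /nu /density integral_set0 measure0.
  apply/seteqP; split => x //= [/andP[sx xt] _].
  by move: (lt_trans (lt_le_trans sx xt) ts); rewrite ltxx.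
have [k1 k2] := density_inversion_cone_bounds bU s0 st.
have fl : (leb (cone U s t : set L) < +oo)%E by exact: cone_lty.
have key l : 1 < l ->
  (nu (inversion @^-1` cone U s t) <= (l ^+ n)%:E * leb (cone U s t : set L) /\
   leb (cone U s t : set L) <= (l ^+ n)%:E * nu (inversion @^-1` cone U s t))%E.
  move=> l1.
  have [k kP] : exists k : nat, t <= s * l ^+ k.+1.
    have l0 := lt_trans ltr01 l1.
    have /(cvgr_lt (0 : R))/(_ (s / t)) : (l^-1 ^+ k) @[k --> \oo] --> (0 : R).
      by apply: cvg_expr; rewrite gtr0_norm ?invr_gt0// invf_lt1.
    have t0 := lt_le_trans s0 st.
    rewrite divr_gt0// => /(_ isT)[k _ /(_ k.+1 (leqnSn k))] /=.
    rewrite exprVn ltr_pdivlMr// -[_ * t]mulrC ltr_pdivrMr ?exprn_gt0//.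
    by move=> /ltW ?; exists k.
  by apply: (@density_inversion_cone_iter U k) => //; [exact: ltW|rewrite st].
have nuoo : (nu (inversion @^-1` cone U s t) < +oo)%E.
  by apply: le_lt_trans k1 _; rewrite lte_mul_pinfty// lee_fin exprn_ge0// divr_ge0// ?(ltW s0)// (le_trans (ltW s0)).
move: nuoo fl key; have := leb_ge0 (cone U s t); have : (0 <= nu (inversion @^-1` cone U s t))%E by exact: nu_ge0.
case: (nu _) => [x| |]; case: (leb _) => [y| |] // x0 y0 _ _ key.
congr EFin; apply/eqP; rewrite eq_le; apply/andP; split.
  rewrite -[y]addr0; apply: (@le_of_le_expr _ n) => l /key[h _].
  by rewrite addr0; move: h; rewrite -EFinM lee_fin.
rewrite -[x]addr0; apply: (@le_of_le_expr _ n) => l /key[_ h].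
by rewrite addr0; move: h; rewrite -EFinM lee_fin.
Qed.
End inversion_measure.

Lemma exists_natSinv_lt (R : realType) (e : R) : 0 < e ->
  exists k : nat, k.+1%:R^-1 < e.
Proof.
move=> e0; have [k _ /(_ _ (leqnn k))] := near_infty_natSinv_lt (PosNum e0).
by exists k.
Qed.

Lemma exists_rat_lt (R : realType) (x y : R) : x < y ->
  exists q : rat, x < ratr q < y.
Proof. by move=> /rat_in_itvoo[q]; rewrite in_itv; exists q. Qed.

(** * Change of variables under the inversion on Borel sets *)

Section inversion_change_of_variables.
Context {R : realType} {n : nat}.
Hypothesis n0 : (0 < n)%N.
Local Notation V := 'rV[R]_n.
Local Notation L := (Leb R n).
Local Notation B := (g_sigma_algebraType (@open V)).
Implicit Types (U : set V) (s t : R).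

(** A class stable under intersection, generating the Borel sets, on whose members the two measures
    are already known to agree. The origin is included because no shell with s > 0 contains it. *)
Let G : set (set V) := [set A | A = [set 0] \/
  exists U s t, [/\ borel U, 0 < s & A = cone U s t]].

Let GI : setI_closed G.
Proof.
have h0 (A : set V) : G (A `&` [set 0]) \/ A `&` [set 0] = set0.
  have [A0|A0] := pselect (A 0).
    by left; left; apply/seteqP; split => x /=; [case|move=> ->].
  by right; apply/seteqP; split => x //= [Ax x0]; apply: A0; rewrite -x0.
have G0 : G set0.
  right; exists set0, 1, 0; split => //; first by apply: open_borel; exact: open0.
  by apply/seteqP; split => x //= [].
move=> A1 A2 [->|[U1 [s1 [t1 [bU1 s10 ->]]]]] [->|[U2 [s2 [t2 [bU2 s20 ->]]]]].
- by have [//|->] := h0 [set 0].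
- by rewrite setIC; have [//|->] := h0 (cone U2 s2 t2).
- by have [//|->] := h0 (cone U1 s1 t1).
right; exists (U1 `&` U2), (Num.max s1 s2), (Num.min t1 t2); split.
- exact: borelI.
- by rewrite lt_max s10.
- apply/seteqP; split => x; rewrite /cone /= gt_max le_min.
    by move=> [[/andP[-> ->] ?] [/andP[-> ->] ?]].
  by move=> [/andP[/andP[-> ->] /andP[-> ->]] []].
Qed.

Let G_borel : G `<=` @borel R n.
Proof.
move=> A [->|[U [s [t [bU s0 ->]]]]]; last exact: borel_cone.
apply: closed_borel.
exact: (accessible_closed_set1 (hausdorff_accessible (@norm_hausdorff R V))).
Qed.

Let bx (q : V) (e : R) := [set x : V | forall i, `|q 0 i - x 0 i| < e].

Let borel_bx q e : borel (bx q e).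
Proof.
have := @tuple_borel R n _ (measurable_tuple_box q e).
congr borel; apply/seteqP; split => x /= h i; have := h i; by rewrite tnth_mktuple.
Qed.

Let F (i : ('rV[rat]_n * nat) * (rat * rat)) : set V :=
  cone (bx (map_mx ratr i.1.1) i.1.2.+1%:R^-1) (ratr i.2.1) (ratr i.2.2).

(** The polar analogue of covering by rational cubes: away from 0, an open set is a countable union
    of shells with rational radii over cubes of directions with rational centers. *)
Let open_cover (O : set V) : open O ->
  O = (O `&` [set 0]) `|` \bigcup_(i in [set i | (0 < (ratr i.2.1 : R)) /\ F i `<=` O]) F i.
Proof.
move=> oO; apply/seteqP; split => x; last first.
  by case=> [[//]|[i [_ iO]] /iO].
move=> Ox; have [x00|x0] := eqVneq x 0; first by left; split.
right.
have rho0 : 0 < enorm x by rewrite enorm_gt0.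
have : nbhs x O by exact: open_nbhs_nbhs.
move=> /nbhs_ballP[e /= e0 eO].
(* An angular error below 2/(k+1) displaces a point at distance |x| by less than e/2; the radii
   below are chosen to contribute at most another e/2. *)
have [k ke] : exists k : nat, k.+1%:R^-1 < e / (4 * enorm x).
  by apply: exists_natSinv_lt; rewrite divr_gt0// mulr_gt0.
have k0 : (0 : R) < k.+1%:R^-1 by rewrite invr_gt0.
have qP i : exists q : rat, `|ratr q - direction x 0 i| < k.+1%:R^-1.
  have [|q qx] := @exists_rat_lt R (direction x 0 i - k.+1%:R^-1) (direction x 0 i + k.+1%:R^-1).
    by rewrite ltrBlDr -addrA ltrDl addr_gt0.
  by exists q; rewrite ltr_distl.
pose q : 'rV[rat]_n := \row_i projT1 (cid (qP i)).
have [|a /andP[a1 a2]] := @exists_rat_lt R (Num.max 0 (enorm x - e / 2)) (enorm x).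
  by rewrite gt_max rho0/= gtrDl oppr_lt0 divr_gt0.
have [|b /andP[b1 b2]] := @exists_rat_lt R (enorm x) (enorm x + e / 2).
  by rewrite ltrDl divr_gt0.
move: a1; rewrite gt_max => /andP[a0 a1].
exists ((q, k), (a, b)); last first.
  rewrite /F /cone /=; split; first by rewrite a2 ltW.
  by move=> i; rewrite !mxE; case: cid.
split => //= y; rewrite /F /cone /= => -[/andP[ay yb] yq].
apply: eO; split => // i j; rewrite !ord1 /ball /=.
have := yq j; rewrite !mxE; case: cid => r /= xr yr.
have y0 : y != 0 by rewrite -enorm_gt0 (lt_trans a0).
have cE (z : V) : z 0 j = enorm z * direction z 0 j.
  by rewrite -[in LHS](scale_direction z) mxE.
rewrite (cE x) (cE y).
have ty : `|direction y 0 j| <= 1 by rewrite -(enorm_direction y0) coord_le_enorm.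
set th := direction y 0 j in ty yr *; set om := direction x 0 j in xr *.
have -> : enorm x * om - enorm y * th =
  enorm x * ((om - ratr r) + (ratr r - th)) + (enorm x - enorm y) * th by ring.
apply: le_lt_trans (ler_normD _ _) _.
have h1 : `|enorm x * (om - ratr r + (ratr r - th))| < e / 2.
  rewrite normrM gtr0_norm//.
  apply: (@le_lt_trans _ _ (enorm x * (`|om - ratr r| + `|ratr r - th|))).
    by rewrite ler_pM2l// ler_normD.
  have h : `|om - ratr r| + `|ratr r - th| < e / (4 * enorm x) + e / (4 * enorm x).
    by rewrite ltrD// (lt_trans _ ke)// distrC.
  rewrite mulrC -ltr_pdivlMr//; apply: lt_le_trans h _.
  rewrite le_eqVlt; apply/orP; left; apply/eqP; field; by rewrite gt_eqF.
have h2 : `|(enorm x - enorm y) * th| < e / 2.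
  rewrite normrM; apply: (@le_lt_trans _ _ (`|enorm x - enorm y| * 1)).
    by rewrite ler_wpM2l.
  by rewrite mulr1 ltr_norml; apply/andP; split; lra.
lra.
Qed.

Let sigmaG : @measurable _ B = <<s G >>.
Proof.
apply/seteqP; split.
  apply: smallest_sub; first exact: smallest_sigma_algebra.
  move=> O oO /=; rewrite (open_cover oO).
  pose GT := g_sigma_algebraType G.
  apply: (@measurableU _ GT).
    have [Oz|Oz] := pselect (O 0).
      rewrite (_ : _ `&` _ = [set 0]); last first.
        by apply/seteqP; split => x /=; [case|move=> ->].
      by apply: sub_sigma_algebra; left.
    rewrite (_ : _ `&` _ = set0); first exact: (@measurable0 _ GT).
    by apply/seteqP; split => x //= [Ax x0]; apply: Oz; rewrite -x0.
  rewrite bigcup_mkcond; apply: (@countable_bigcupT_measurable _ GT) => // i.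
  case: ifPn => [|_]; last exact: (@measurable0 _ GT).
  rewrite inE => -[i0 _]; apply: sub_sigma_algebra; right.
  by exists (bx (map_mx ratr i.1.1) i.1.2.+1%:R^-1), (ratr i.2.1), (ratr i.2.2).
apply: smallest_sub; first exact: smallest_sigma_algebra.
exact: G_borel.
Qed.

Let nu := density (@leb R n) (@inversion_jac R n).

Let mid : measurable_fun [set: L] (idfun : L -> B).
Proof.
move=> _ A mA; rewrite setTI preimage_id; exact: borel_measurable.
Qed.

Let minv : measurable_fun [set: L] (inversion : L -> B).
Proof.
move=> _ A mA; rewrite setTI; apply: borel_measurable.
exact: borel_preimage continuous_inversion _ mA.
Qed.

Let num : {measure set L -> \bar R}.
Proof.
pose m := [the measure _ _ of density (@leb R n) (@inversion_jac R n)].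
exact: (m (@measurable_inversion_jac R n) (@inversion_jac_ge0 R n)).
Defined.

Let numE A : num A = nu A. Proof. by []. Qed.

Let m1 : {measure set B -> \bar R}.
Proof.
pose m := [the measure _ _ of pushforward (@leb R n) (idfun : L -> B)].
exact: (m mid).
Defined.

Let m2 : {measure set B -> \bar R}.
Proof.
pose m := [the measure _ _ of pushforward num (inversion : L -> B)].
exact: (m minv).
Defined.

(** Lebesgue measure and the image under the inversion of the measure with density [inversion_jac]
    coincide on the class [G], hence on all Borel sets. *)
Lemma leb_inversion_borel (A : set V) : borel A ->
  leb (A : set L) = nu (inversion @^-1` A).
Proof.
move=> bA; suff : m1 A = m2 A by [].
(* Countably many members of [G] of finite measure that exhaust the space, as uniqueness of measures
   requires. *)
pose g k : set V := if k is k'.+1 then cone setT k.+1%:R^-1 k.+1%:R else [set 0].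
have bT : borel [set: V] by apply: open_borel; exact: openT.
apply: (@measure_unique _ R B G g sigmaG GI _ _ m1 m2) => //.
- by case=> [|k]; [left|right; exists setT, k.+2%:R^-1, k.+2%:R; split].
- apply/seteqP; split => x // _.
  have [->|x0] := eqVneq x 0; first by exists 0%N.
  have xp : 0 < enorm x by rewrite enorm_gt0.
  have [k kx] := exists_natSinv_lt xp.
  have [N xN] : exists N : nat, enorm x < N%:R.
    by exists (Num.bound (enorm x)); exact: archi_boundP (enorm_ge0 x).
  exists (maxn k N).+1 => //; split => //; apply/andP; split.
    rewrite (le_lt_trans _ kx)// lef_pV2 ?posrE// ler_nat ltnS.
    by rewrite (leq_trans (leq_maxl k N)).
  rewrite (le_trans (ltW xN))// ler_nat (leq_trans (leq_maxr k N))//.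
  by rewrite (leq_trans (leqnSn _)).
- move=> C [->|[U [s [t [bU s0 ->]]]]].
    transitivity (leb ([set 0] : set L)); first by [].
    transitivity (nu [set 0]); last first.
      rewrite /m2 /= /pushforward numE; congr (nu _).
      by apply/seteqP; split => x /=; [move=> ->; exact: inversion0
        |move/eqP; rewrite inversion_eq0 => /eqP].
    rewrite leb0// /nu /density integral0_eq// => x ->.
    by rewrite /inversion_jac enorm0 expr0n muln_eq0 (gtn_eqF n0) invr0.
  transitivity (leb (cone U s t : set L)); first by [].
  by rewrite -density_inversion_cone.
- case=> [|k].
    suff : (leb ([set 0%R] : set L) < +oo)%E by []. by rewrite leb0 ?ltry.
  exact: cone_lty.
Qed.
End inversion_change_of_variables.

(** * Change of variables under the inversion on Lebesgue measurable sets and for integrals *)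

Section measurable_hull.
Context {R : realType} {n : nat}.
Local Notation V := 'rV[R]_n.
Local Notation L := (Leb R n).

(** On the bounded pieces of A the hull of equal measure exceeds the piece by a null set, since the
    measures are finite; the union of these hulls serves for A. *)
Lemma measurable_hull (A : set L) : measurable A ->
  exists B : set V, [/\ borel B, A `<=` B & leb (B `\` A : set L) = 0%E].
Proof.
move=> mA.
have mk k : measurable (A `&` eball k%:R : set L).
  by apply: measurableI => //; apply: open_measurable; exact: open_eball.
have fink k : (leb (A `&` eball k%:R : set L) < +oo)%E.
  apply: (@bounded_lty _ _ _ k%:R) => x [_]; exact: ltW.
pose B k := projT1 (cid (leb_hull (fink k))).
have BP k : [/\ borel (B k), A `&` eball k%:R `<=` B k &
    leb (B k : set L) = leb (A `&` eball k%:R : set L)].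
  by rewrite /B; case: cid.
exists (\bigcup_k B k); split.
- by apply: borel_bigcup => k; have [] := BP k.
- move=> x Ax; exists (Num.bound (enorm (x : V))) => //.
  by have [_ + _] := BP (Num.bound (enorm (x : V))); apply; split => //=; exact: archi_boundP (enorm_ge0 x).
- apply: (@subset_null _ _ _ (\bigcup_k (B k `\` (A `&` eball k%:R)))).
    move=> x [[k _ Bx] nAx]; exists k => //; split => //.
    by case.
  have Bk0 k : leb (B k `\` (A `&` eball k%:R) : set L) = 0%E.
    have [bB AB BA] := BP k.
    have mB := borel_measurable bB.
    have Boo : (leb (B k : set L) < +oo)%E by rewrite BA.
    have := measureD mB (mk k) Boo; rewrite (setIidr AB).
    set l := (X in X = _ -> _); set r := (X in _ = X -> _) => E.
    transitivity r; first exact: E.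
    rewrite /r -[X in (X - _)%E]/(leb (B k : set L)) BA.
    by apply: subee; rewrite ge0_fin_numE.
  apply/eqP; rewrite eq_le leb_ge0 andbT.
  apply: (le_trans (outer_measure_sigma_subadditive (@lebesgue_outer R n) _)).
  by rewrite eseries0// => k _ _; exact: Bk0.
Qed.
End measurable_hull.

Lemma ge0_integral_substitution d (T : measurableType d) (R : realType)
    (mu : {measure set T -> \bar R}) (phi : T -> T) (w : T -> R)
    (F : T -> \bar R) : measurable_fun setT phi -> measurable_fun setT w ->
  (forall x, 0 <= w x) ->
  (forall A, measurable A -> mu A = density mu w (phi @^-1` A)) ->
  measurable_fun setT F -> (forall x, 0 <= F x)%E ->
  (\int[mu]_x F x = \int[mu]_y (F (phi y) * (w y)%:E))%E.
Proof.
move=> mphi mw w0 muE mF F0.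
have mFp : measurable_fun setT (F \o phi) by exact: measurableT_comp.
have F0p x : (0 <= (F \o phi) x)%E by exact: F0.
apply: etrans (ge0_integral_density mu mw w0 mFp F0p).
have := @ge0_integral_pushforward _ _ _ _ R _ mphi
  (density mu w) setT F measurableT mF (fun y _ => F0 y).
move=> /(_ mw w0); rewrite preimage_setT => <-.
by apply: eq_measure_integral => A mA _; exact: muE.
Qed.

Section inversion_integral.
Context {R : realType} {n : nat}.
Hypothesis n0 : (0 < n)%N.
Local Notation V := 'rV[R]_n.
Local Notation L := (Leb R n).
Local Notation w := (@inversion_jac R n).
Let nu := density (@leb R n) w.

Let nu_null (A : set V) : leb (A : set L) = 0%E -> nu A = 0%E.
Proof.
move=> A0; rewrite /nu /density null_set_integral//; first exact: null_measurable.
apply/measurable_EFinP; exact: measurable_funTS (@measurable_inversion_jac R n).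
Qed.

(** For a Borel null hull B, the measure of the inverse of B is the integral of the Jacobian over
    the inverse of the inverse, that is over B itself. *)
Lemma inversion_null (A : set V) : leb (A : set L) = 0%E ->
  leb (inversion @^-1` A : set L) = 0%E.
Proof.
move=> /null_hull[B [bB AB B0]].
apply: (@subset_null _ _ _ (inversion @^-1` B)); first by move=> x; exact: AB.
rewrite leb_inversion_borel//; last exact: borel_preimage continuous_inversion _ bB.
rewrite -comp_preimage (_ : _ \o _ = idfun) ?preimage_id; first exact: nu_null.
by apply/funext => x /=; rewrite inversionK.
Qed.

(** A Lebesgue measurable set is a Borel set minus a null set, and the inversion respects both
    kinds; continuity alone would only handle Borel sets. *)
Lemma measurable_inversion : measurable_fun [set: L] (inversion : L -> L).
Proof.
move=> _ A mA; rewrite setTI.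
have [B [bB AB BA]] := measurable_hull mA.
rewrite (_ : inversion @^-1` A =
    inversion @^-1` B `\` inversion @^-1` (B `\` A)); last first.
  apply/seteqP; split => x /=; first by move=> Ax; split; [exact: AB|case].
  by move=> [Bx h]; apply: contrapT => nAx; apply: h.
apply: measurableD; last by apply: null_measurable; exact: inversion_null.
by apply: borel_measurable; exact: borel_preimage continuous_inversion _ bB.
Qed.

Lemma leb_inversion (A : set L) : measurable A ->
  leb A = nu (inversion @^-1` A).
Proof.
move=> mA; have [B [bB AB BA]] := measurable_hull mA.
have E : (B : set L) = A `|` (B `\` A) by rewrite setDUK.
have mN : measurable (B `\` A : set L) by exact: null_measurable.
have minvm (C : set V) : measurable (C : set L) -> measurable (inversion @^-1` C : set L).
  by move=> mC; rewrite -[X in measurable X]setTI; exact: measurable_inversion.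
have d0 : A `&` (B `\` A) = set0 by rewrite setDIK.
transitivity (leb (B : set L)).
  by rewrite E lebU// BA adde0.
rewrite leb_inversion_borel// E preimage_setU nu_setU//.
- by rewrite -/nu (nu_null (inversion_null BA)) adde0.
- exact: minvm.
- exact: minvm.
- by rewrite -preimage_setI d0 preimage_set0.
Qed.

Lemma ge0_integral_inversion (F : L -> \bar R) : measurable_fun setT F ->
  (forall x, 0 <= F x)%E ->
  (\int[leb]_x F x = \int[leb]_y (F (inversion y) * (w y)%:E))%E.
Proof.
move=> mF F0; apply: (@ge0_integral_substitution _ L) => //.
- exact: measurable_inversion.
- exact: measurable_inversion_jac.
- by move=> x; exact: inversion_jac_ge0.
- by move=> A; exact: leb_inversion.
Qed.

Lemma integrable_inversion (F : L -> R) : leb.-integrable setT (EFin \o F) ->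
  leb.-integrable setT (fun y : L => (F (inversion y) * w y)%:E).
Proof.
move=> /integrableP[mF Foo]; apply/integrableP; split.
  apply/measurable_EFinP; apply: measurable_funM.
    apply: (@measurableT_comp _ _ _ _ _ _ F _ (inversion : L -> L)).
      exact/measurable_EFinP.
    exact: measurable_inversion.
  exact: measurable_inversion_jac.
apply: le_lt_trans Foo.
have mN : measurable_fun setT (abse \o (EFin \o F)) by exact: measurableT_comp.
rewrite (ge0_integral_inversion mN); last by move=> x /=.
rewrite le_eqVlt; apply/orP; left; apply/eqP; apply: eq_integral => x _ /=.
by rewrite normrM (ger0_norm (inversion_jac_ge0 _)) EFinM.
Qed.

Lemma Rintegral_inversion (F : L -> R) : leb.-integrable setT (EFin \o F) ->
  \int[leb]_x F x = \int[leb]_y (F (inversion y) * w y).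
Proof.
move=> iF; have iG := integrable_inversion iF.
have mF := measurable_int _ iF.
rewrite /Rintegral integralE [in RHS]integralE; congr fine.
have mp := measurable_funepos mF; have mn := measurable_funeneg mF.
rewrite (ge0_integral_inversion mp); last by move=> x; exact: funepos_ge0.
rewrite (ge0_integral_inversion mn); last by move=> x; exact: funeneg_ge0.
congr (_ - _)%E; apply: eq_integral => x _; rewrite ?funeposE ?funenegE /=.
  rewrite -!EFin_max -EFinM maxr_pMl ?mul0r//; exact: inversion_jac_ge0.
rewrite -!EFin_max -EFinM maxr_pMl ?inversion_jac_ge0// mul0r.
by rewrite mulNr.
Qed.

End inversion_integral.

(** * Frechet gradients and the rules of calculus *)

Section frechet.
Context {R : realType} {n : nat}.
Local Notation V := 'rV[R]_n.
Implicit Types (f : V -> R) (x y g : V) (F : V -> V).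

Lemma nbhs_enormP x (P : set V) :
  nbhs x P <-> exists2 d : R, 0 < d & forall y, enorm (y - x) < d -> P y.
Proof.
split=> [/nbhs_ballP[d /= d0 dP]|[d d0 dP]].
  exists d => // y yx; apply: dP; rewrite -ball_normE /=.
  by rewrite distrC (le_lt_trans (sup_norm_le_enorm _)).
apply/nbhs_ballP; exists (d / n.+1%:R); first by rewrite /= divr_gt0.
move=> y; rewrite -ball_normE /= => xy; apply: dP.
apply: le_lt_trans (enorm_le_sup_norm _) _; rewrite distrC.
apply: (@le_lt_trans _ _ (n.+1%:R * `|x - y|)).
  by rewrite ler_wpM2r// ler_nat.
by rewrite mulrC -ltr_pdivlMr.
Qed.

(** Differentiability of f at x with gradient g, as an estimate in the Euclidean norm; in this form
    the product and chain rules are sums of error bounds. *)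
Definition frechet f x g := forall e : R, 0 < e ->
  \forall y \near x, `|f y - f x - dotr g (y - x)| <= e * enorm (y - x).

Lemma near_enorm_lt x (d : R) : 0 < d -> \forall y \near x, enorm (y - x) < d.
Proof. by move=> d0; apply/nbhs_enormP; exists d. Qed.

Lemma near_forall_fin (I : finType) x (P : I -> V -> Prop) :
  (forall i, \forall y \near x, P i y) -> \forall y \near x, forall i, P i y.
Proof. exact: (@filter_forall _ _ P (nbhs x) _). Qed.

Lemma frechet_lipschitz f x g : frechet f x g ->
  \forall y \near x, `|f y - f x| <= (enorm g + 1) * enorm (y - x).
Proof.
move=> /(_ _ ltr01); apply: filterS => y; rewrite mul1r => fy.
rewrite -(subrK (dotr g (y - x)) (f y - f x)) (le_trans (ler_normD _ _))//.
rewrite mulrDl mul1r addrC lerD//; exact: cauchy_schwarz_dotr.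
Qed.

Lemma frechet_continuous f x g : frechet f x g -> {for x, continuous f}.
Proof.
move=> /frechet_lipschitz fx; apply/(@cvgrPdist_le _ _ _ (nbhs x)) => e e0.
have g1 : 0 < enorm g + 1 by rewrite ltr_wpDl ?enorm_ge0.
have d0 : 0 < e / (enorm g + 1) by rewrite divr_gt0.
near=> y; rewrite distrC.
have h1 : `|f y - f x| <= (enorm g + 1) * enorm (y - x) by near: y.
have h2 : enorm (y - x) < e / (enorm g + 1) by near: y; exact: near_enorm_lt.
by apply: (le_trans h1); rewrite mulrC -ler_pdivlMr// ltW.
Unshelve. all: by end_near. Qed.

Lemma frechet_cst (c : R) x : frechet (fun=> c) x 0.
Proof.
move=> e e0; apply/nbhs_enormP; exists 1 => // y _; rewrite subrr dotr0l subr0 normr0.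
by rewrite mulr_ge0 ?enorm_ge0 ?ltW.
Qed.

Lemma dotr_delta i x : dotr (delta_mx 0 i) x = x 0 i.
Proof.
rewrite /dotr (bigD1 i)//= big1 ?addr0 => [|j ji]; rewrite mxE eqxx/=.
  by rewrite eqxx mul1r.
by rewrite (negbTE ji) mul0r.
Qed.

Lemma enorm_delta i : enorm (delta_mx 0 i : V) = 1.
Proof. by rewrite /enorm dotr_delta mxE !eqxx sqrtr1. Qed.

Lemma frechet_coord i x : frechet (fun y => y 0 i) x (delta_mx 0 i).
Proof.
move=> e e0; apply/nbhs_enormP; exists 1 => // y _; rewrite dotr_delta !mxE subrr normr0.
by rewrite mulr_ge0 ?enorm_ge0 ?ltW.
Qed.

Lemma frechetD f1 f2 x g1 g2 : frechet f1 x g1 -> frechet f2 x g2 ->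
  frechet (fun y => f1 y + f2 y) x (g1 + g2).
Proof.
move=> h1 h2 e e0; have e20 : 0 < e / 2 by rewrite divr_gt0.
near=> y.
have a1 : `|f1 y - f1 x - dotr g1 (y - x)| <= e / 2 * enorm (y - x).
  by near: y; exact: h1.
have a2 : `|f2 y - f2 x - dotr g2 (y - x)| <= e / 2 * enorm (y - x).
  by near: y; exact: h2.
rewrite dotrDl (_ : _ - _ = (f1 y - f1 x - dotr g1 (y - x)) +
  (f2 y - f2 x - dotr g2 (y - x))); last by ring.
by rewrite (le_trans (ler_normD _ _))// [e in e * _]splitr mulrDl lerD.
Unshelve. all: by end_near. Qed.

Lemma frechetZ f x g (c : R) : frechet f x g -> frechet (fun y => c * f y) x (c *: g).
Proof.
move=> h e e0; have c1 : 0 < `|c| + 1 by rewrite ltr_wpDl.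
have e20 : 0 < e / (`|c| + 1) by rewrite divr_gt0.
near=> y.
have a1 : `|f y - f x - dotr g (y - x)| <= e / (`|c| + 1) * enorm (y - x).
  by near: y; exact: h.
rewrite dotrZl -!mulrBr normrM.
apply: (@le_trans _ _ ((`|c| + 1) * (e / (`|c| + 1) * enorm (y - x)))).
  by apply: ler_pM => //; rewrite lerDl.
by rewrite mulrA mulrCA mulfV ?mulr1// gt_eqF.
Unshelve. all: by end_near. Qed.

Lemma frechetM f1 f2 x g1 g2 : frechet f1 x g1 -> frechet f2 x g2 ->
  frechet (fun y => f1 y * f2 y) x (f2 x *: g1 + f1 x *: g2).
Proof.
move=> h1 h2 e e0.
(* K adds the coefficients of the three error terms below, and d K <= e. *)
pose K := `|f2 x| + 1 + enorm g1 + `|f1 x|.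
have K0 : 0 < K by rewrite /K; have := normr_ge0 (f2 x);
  have := normr_ge0 (f1 x); have := enorm_ge0 g1; lra.
pose d := Num.min 1 (e / K).
have d0 : 0 < d by rewrite lt_min ltr01/= divr_gt0.
have c2 := frechet_continuous h2.
near=> y.
have a1 : `|f1 y - f1 x - dotr g1 (y - x)| <= d * enorm (y - x).
  by near: y; exact: h1.
have a2 : `|f2 y - f2 x - dotr g2 (y - x)| <= d * enorm (y - x).
  by near: y; exact: h2.
have a3 : `|f2 y - f2 x| <= d.
  by rewrite distrC; near: y; move/(@cvgrPdist_le _ _ _ (nbhs x)): c2; apply.
have d1 : d <= 1 by rewrite ge_min lexx.
have f2y : `|f2 y| <= `|f2 x| + 1.
  rewrite -(subrK (f2 x) (f2 y)) (le_trans (ler_normD _ _))// addrC lerD2l.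
  exact: le_trans d1.
have E0 := enorm_ge0 (y - x).
rewrite dotrDl !dotrZl (_ : _ - _ = (f1 y - f1 x - dotr g1 (y - x)) * f2 y +
  dotr g1 (y - x) * (f2 y - f2 x) + f1 x * (f2 y - f2 x - dotr g2 (y - x)));
  last by ring.
apply: (@le_trans _ _ (d * enorm (y - x) * (`|f2 x| + 1) +
   enorm g1 * enorm (y - x) * d + `|f1 x| * (d * enorm (y - x)))).
  rewrite (le_trans (ler_normD _ _))// lerD//.
    rewrite (le_trans (ler_normD _ _))// lerD//.
      by rewrite normrM ler_pM.
    by rewrite normrM ler_pM// cauchy_schwarz_dotr.
  by rewrite normrM ler_wpM2l.
rewrite (_ : _ + _ + _ = d * K * enorm (y - x)); last by rewrite /K; ring.
rewrite ler_wpM2r// -ler_pdivlMr//.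
by rewrite /d ge_min lexx orbT.
Unshelve. all: by end_near. Qed.

Lemma is_derive1_approx (phi : R -> R) (t d : R) : is_derive t 1 phi d ->
  forall e : R, 0 < e ->
  \forall s \near t, `|phi s - phi t - d * (s - t)| <= e * `|s - t|.
Proof.
move=> [dp dE] e e0; have := derivable_nbhs dp.
rewrite dE => /eqaddoP /(_ e e0) h.
rewrite (near_shift 0 t) subr0; apply: filterS h => {}h /=.
rewrite /= -![(_ + _ : _ -> _) _]/(_ + _) -![(- _ : _ -> _) _]/(- _) /=.
by rewrite addrK [h *: 1]mulr1 opprD addrA [h *: d]mulrC.
Qed.

Lemma frechet_comp1 (phi : R -> R) f x g (d : R) : is_derive (f x) 1 phi d ->
  frechet f x g -> frechet (phi \o f) x (d *: g).
Proof.
move=> dphi h e e0.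
pose K := enorm g + 1 + `|d|.
have K0 : 0 < K by rewrite /K; have := normr_ge0 d; have := enorm_ge0 g; lra.
have d0 : 0 < e / K by rewrite divr_gt0.
have cf := frechet_continuous h.
have lf := frechet_lipschitz h.
near=> y.
have a1 : `|f y - f x - dotr g (y - x)| <= e / K * enorm (y - x).
  by near: y; exact: h.
have a2 : `|phi (f y) - phi (f x) - d * (f y - f x)| <= e / K * `|f y - f x|.
  near: y; exact: (cf _ (is_derive1_approx dphi d0)).
have a3 : `|f y - f x| <= (enorm g + 1) * enorm (y - x) by near: y.
rewrite /= dotrZl (_ : _ - _ = (phi (f y) - phi (f x) - d * (f y - f x)) +
  d * (f y - f x - dotr g (y - x))); last by ring.
rewrite (le_trans (ler_normD _ _))// normrM.
apply: (@le_trans _ _ (e / K * ((enorm g + 1) * enorm (y - x)) +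
   `|d| * (e / K * enorm (y - x)))).
  rewrite lerD//; last by rewrite ler_wpM2l.
  by rewrite (le_trans a2)// ler_wpM2l// ltW.
rewrite (_ : _ + _ = e / K * K * enorm (y - x)); last by rewrite /K; ring.
by rewrite divfK// gt_eqF.
Unshelve. all: by end_near. Qed.

Lemma dotr_sum (I : Type) (r : seq I) (P : pred I) (G : I -> V) x :
  dotr (\sum_(i <- r | P i) G i) x = \sum_(i <- r | P i) dotr (G i) x.
Proof.
apply: (big_morph (fun z => dotr z x)) => [a b|]; first exact: dotrDl.
exact: dotr0l.
Qed.

(** The vectors J i are the rows of the Jacobian matrix of F, so the gradient of the composite is
    the transposed Jacobian applied to g. *)
Lemma frechet_compV f F x g (J : 'I_n -> V) :
  (forall i, frechet (fun y => F y 0 i) x (J i)) -> frechet f (F x) g ->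
  frechet (f \o F) x (\sum_i g 0 i *: J i).
Proof.
move=> hF hf e e0.
pose L := \sum_i (enorm (J i) + 1).
have L0 : 0 <= L by apply: sumr_ge0 => i _; rewrite addr_ge0 ?enorm_ge0.
pose S := \sum_i `|g 0 i|.
have S0 : 0 <= S by apply: sumr_ge0.
pose K := n%:R * L + S + 1.
have K0 : 0 < K by rewrite /K ltr_wpDl// addr_ge0 ?mulr_ge0.
have d0 : 0 < e / K by rewrite divr_gt0.
have cF : {for x, continuous F}.
  apply/(@cvgrPdist_le _ _ _ (nbhs x)) => r r0.
  have : \forall y \near x, forall i, `|F x 0 i - F y 0 i| <= r.
    apply: near_forall_fin => i.
    by have /(@cvgrPdist_le _ _ _ (nbhs x)) := frechet_continuous (hF i); apply.
  apply: filterS => y hy; rewrite /Num.Def.normr /= mx_normrE.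
  by apply: bigmax_le => [|[i j] _ /=]; [exact: ltW|rewrite !mxE (ord1 i)].
near=> y.
have a1 : `|f (F y) - f (F x) - dotr g (F y - F x)| <= e / K * enorm (F y - F x).
  by near: y; exact: (cF _ (hf _ d0)).
have a2 i : `|F y 0 i - F x 0 i - dotr (J i) (y - x)| <= e / K * enorm (y - x).
  by move: i; near: y; apply: near_forall_fin => i; exact: hF.
have a3 i : `|F y 0 i - F x 0 i| <= (enorm (J i) + 1) * enorm (y - x).
  by move: i; near: y; apply: near_forall_fin => i; exact: frechet_lipschitz.
have E0 := enorm_ge0 (y - x).
have a4 : enorm (F y - F x) <= n%:R * (L * enorm (y - x)).
  apply: enorm_le_bound => [|i]; first by rewrite mulr_ge0.
  rewrite !mxE (le_trans (a3 i))// ler_wpM2r// /L (bigD1 i)//= lerDl.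
  by apply: sumr_ge0 => j _; rewrite addr_ge0 ?enorm_ge0.
rewrite /= dotr_sum (_ : _ - _ = (f (F y) - f (F x) - dotr g (F y - F x)) +
  \sum_i g 0 i * (F y 0 i - F x 0 i - dotr (J i) (y - x))); last first.
  under [in RHS]eq_bigr do rewrite mulrBr.
  rewrite big_split/= sumrN addrA; congr (_ - _).
    have -> : \sum_i g 0 i * (F y 0 i - F x 0 i) = dotr g (F y - F x).
      by apply: eq_bigr => i _; rewrite !mxE.
    by rewrite subrK.
  by apply: eq_bigr => i _; rewrite dotrZl.
rewrite (le_trans (ler_normD _ _))//.
apply: (@le_trans _ _ (e / K * (n%:R * (L * enorm (y - x))) +
   S * (e / K * enorm (y - x)))).
  rewrite lerD//; first by rewrite (le_trans a1)// ler_wpM2l// ltW.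
  rewrite (le_trans (ler_norm_sum _ _ _))// /S mulr_suml ler_sum// => i _.
  by rewrite normrM ler_wpM2l.
apply: (@le_trans _ _ (e / K * K * enorm (y - x))); last by rewrite divfK// gt_eqF.
rewrite (_ : _ + _ = e / K * (n%:R * L + S) * enorm (y - x)); last by ring.
by rewrite ler_wpM2r// ler_wpM2l ?(ltW d0)// /K lerDl.
Unshelve. all: by end_near. Qed.

Lemma frechet_is_derive f x g i : frechet f x g ->
  is_derive x (delta_mx 0 i) f (g 0 i).
Proof.
move=> h.
have hc : (fun t : R => t^-1 *: ((f \o shift x) (t *: delta_mx 0 i) - f x)) @ 0^'
    --> (g 0 i).
  apply/cvgrPdist_le => e e0.
  have := h e e0 => /nbhs_enormP[d d0 hd].
  near=> t.
  have t0 : t != 0 by near: t; exact: nbhs_dnbhs_neq.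
  have td : `|t| < d.
    near: t; apply: dnbhs0_lt => //.
  have := hd (t *: delta_mx 0 i + x).
  rewrite addrK enormZ enorm_delta mulr1 => /(_ td).
  rewrite dotrZr dotrC dotr_delta => h1.
  rewrite distrC /= (_ : _ - _ = t^-1 * (f (t *: delta_mx 0 i + x) - f x - t * g 0 i)).
    by rewrite normrM normfV mulrC ler_pdivrMr ?normr_gt0.
  by rewrite [in RHS]mulrBr mulrA mulVf// mul1r.
split; first by apply/cvg_ex; exists (g 0 i).
by apply: cvg_lim.
Unshelve. all: by end_near. Qed.

End frechet.

(** * Continuously differentiable functions *)

Section C1.
Context {R : realType} {n : nat}.
Local Notation V := 'rV[R]_n.
Implicit Types (f g : V -> R) (x y : V) (U : set V).

Lemma is_derive_line f (a v : V) (t : R) : derivable f (a + t *: v) v ->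
  is_derive t 1 (fun s : R => f (a + s *: v)) ('D_v f (a + t *: v)).
Proof.
move=> df.
have E : (fun h : R => h^-1 *: (((fun s : R => f (a + s *: v)) \o shift t) (h *: 1)
            - f (a + t *: v))) =
    (fun h : R => h^-1 *: ((f \o shift (a + t *: v)) (h *: v) - f (a + t *: v))).
  apply/funext => h /=; congr (_ *: (f _ - _)).
  by rewrite [h *: 1]mulr1 scalerDl addrCA.
split; first by rewrite /derivable E.
by rewrite /derive E.
Qed.

Lemma mvt_line f (a v : V) (h : R) :
  (forall t : R, `|t| <= `|h| -> derivable f (a + t *: v) v) ->
  exists2 t : R, `|t| <= `|h| & f (a + h *: v) - f a = h * 'D_v f (a + t *: v).
Proof.
move=> df.
pose F (s : R) := f (a + s *: v).
pose dF (s : R) := 'D_v f (a + s *: v).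
have F0 : F 0 = f a by rewrite /F scale0r addr0.
have dFh (t : R) : `|t| <= `|h| -> is_derive t 1 F (dF t).
  by move=> th; apply: is_derive_line; exact: df.
have cF (b c : R) : (forall t : R, b <= t <= c -> `|t| <= `|h|) -> {within `[b, c], continuous F}.
  move=> hbc; apply: derivable_within_continuous => t.
  by rewrite in_itv/= => /hbc /dFh [].
have [h0|h0] := leP 0 h.
  have H (t : R) : 0 <= t <= h -> `|t| <= `|h|.
    by move=> /andP[t0 th]; rewrite !ger0_norm.
  have [t||t tI E] := @MVT_segment R F dF 0 h h0.
  - by rewrite in_itv/= => /andP[/ltW t0 /ltW th]; apply/dFh/H; rewrite t0.
  - exact: cF.
  - exists t; first by apply: H; move: tI; rewrite in_itv.
    by rewrite -F0 -/(F h) E subr0 mulrC.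
have H (t : R) : h <= t <= 0 -> `|t| <= `|h|.
  by move=> /andP[th t0]; rewrite !ler0_norm// ?lerN2// ltW.
have [t||t tI E] := @MVT_segment R F dF h 0 (ltW h0).
- by rewrite in_itv/= => /andP[/ltW t0 /ltW th]; apply/dFh/H; rewrite t0.
- exact: cF.
- exists t; first by apply: H; move: tI; rewrite in_itv.
  rewrite -F0 -/(F h); have : F h - F 0 = - (F 0 - F h) by rewrite opprB.
  by move=> ->; rewrite E sub0r mulrN opprK mulrC.
Qed.

(** Move from x to y one coordinate at a time; the mean value theorem on each edge produces a
    partial derivative at a point near x, and continuity of the partials controls the error. *)
Lemma C1_frechet U f x : open U -> C1_on U f -> U x -> frechet f x (grad f x).
Proof.
move=> oU fU Ux e e0.
have d0 : 0 < e / n.+1%:R by rewrite divr_gt0.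
have : \forall y \near x, U y /\ forall i, `|partial i f y - partial i f x| <= e / n.+1%:R.
  apply: filterI; first exact: open_nbhs_nbhs.
  apply: near_forall_fin => i.
  have [_ /(@cvgrPdist_le _ _ _ (nbhs x)) /(_ _ d0)] := fU x Ux i.
  by apply: filterS => y; rewrite distrC.
move=> /nbhs_enormP[d dp hd]; apply/nbhs_enormP; exists d => // y yx.
(* The vertices of the path: the first k coordinates are already those of y. *)
pose z (k : nat) : V := \row_i (if (i < k)%N then y 0 i else x 0 i).
have z0 : z 0%N = x by apply/rowP => i; rewrite mxE.
have zn : z n = y by apply/rowP => i; rewrite mxE ltn_ord.
have zS (k : 'I_n) : z k.+1 = z k + (y 0 k - x 0 k) *: delta_mx 0 k.
  apply/rowP => i; rewrite !mxE eqxx /= ltnS leq_eqVlt.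
  have [->|ik] := eqVneq i k; first by rewrite eqxx ltnn mulr1 addrC subrK.
  by rewrite mulr0 addr0 (negbTE (_ : (i != k :> nat))).
have zd (k : 'I_n) (t : R) : `|t| <= `|y 0 k - x 0 k| ->
    enorm (z k + t *: delta_mx 0 k - x) < d.
  move=> ht; apply: le_lt_trans yx.
  rewrite -(ler_pXn2r (ltn0Sn 1)) ?nnegrE ?enorm_ge0// !sqr_enorm.
  apply: ler_sum => i _; rewrite -!expr2 !mxE eqxx /=.
  have [->|ik] := eqVneq i k.
    rewrite ltnn mulr1 addrAC subrr add0r -real_normK ?num_real//.
    rewrite -[leRHS]real_normK ?num_real// ler_pXn2r ?nnegrE//.
  rewrite mulr0 addr0; case: ifP => // _; by rewrite subrr expr0n sqr_ge0.
have tele : f y - f x = \sum_(k < n) (f (z k.+1) - f (z k)).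
  rewrite -zn -[in LHS]z0.
  by rewrite -(telescope_sumr (fun k => f (z k))) ?big_mkord.
have step (k : 'I_n) : `|f (z k.+1) - f (z k) - (y 0 k - x 0 k) * partial k f x| <=
    e / n.+1%:R * enorm (y - x).
  have [t|t ht] := @mvt_line f (z k) (delta_mx 0 k) (y 0 k - x 0 k).
    by move=> ht; have [] := fU _ (hd _ (zd k t ht)).1 k.
  rewrite -zS => ->; rewrite -mulrBr normrM mulrC ler_pM//.
    by have [_] := hd _ (zd k t ht); apply.
  by have := coord_le_enorm (y - x) k; rewrite !mxE.
rewrite (_ : f y - f x - _ = \sum_(k < n)
   (f (z k.+1) - f (z k) - (y 0 k - x 0 k) * partial k f x)); last first.
  rewrite big_split/= -tele sumrN; congr (_ - _).
  by apply: eq_bigr => i _; rewrite !mxE mulrC.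
apply: (le_trans (ler_norm_sum _ _ _)).
apply: (@le_trans _ _ (\sum_(k < n) (e / n.+1%:R * enorm (y - x)))).
  by apply: ler_sum => k _.
rewrite sumr_const card_ord (_ : _ *+ n = e / n.+1%:R * n%:R * enorm (y - x)); last first.
  by rewrite -mulr_natr mulrAC.
rewrite ler_wpM2r ?enorm_ge0//.
by rewrite mulrAC ler_pdivrMr// ler_wpM2l ?(ltW e0)// ler_nat.
Qed.

(** Together with [C1_frechet] this transfers each Frechet rule to [C1_on] along with the formula
    for the gradient. *)
Lemma frechet_C1 U f (G : V -> V) : open U ->
  (forall x, U x -> frechet f x (G x)) ->
  (forall x, U x -> forall i, {for x, continuous (fun y => G y 0 i)}) ->
  C1_on U f /\ (forall x, U x -> grad f x = G x).
Proof.
move=> oU fG cG.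
have pE x i : U x -> partial i f x = G x 0 i.
  by move=> Ux; have [_ <-] := frechet_is_derive i (fG x Ux).
split=> [x Ux i|x Ux]; last by apply/rowP => i; rewrite mxE pE.
split; first by have [] := frechet_is_derive i (fG x Ux).
apply/(@cvgrPdist_le _ _ _ (nbhs x)) => e e0; rewrite pE//.
have /(@cvgrPdist_le _ _ _ (nbhs x)) /(_ e e0) := cG x Ux i.
have : \forall y \near x, U y by exact: open_nbhs_nbhs.
apply: filterS2 => y Uy; by rewrite pE.
Qed.

Lemma C1_continuous U f x : open U -> C1_on U f -> U x -> {for x, continuous f}.
Proof. by move=> oU fU Ux; apply: frechet_continuous (C1_frechet oU fU Ux). Qed.

Lemma C1_continuous_grad U f x i : C1_on U f -> U x ->
  {for x, continuous (fun y => grad f y 0 i)}.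
Proof.
move=> fU Ux; have [_] := fU x Ux i.
by rewrite (_ : (fun y => _) = partial i f)//; apply/funext => y; rewrite mxE.
Qed.

Lemma eq_C1_on U f g : open U -> (forall x, U x -> f x = g x) -> C1_on U f ->
  C1_on U g /\ (forall x, U x -> grad g x = grad f x).
Proof.
move=> oU fg fU; apply: frechet_C1 => // [x Ux|x Ux i]; last exact: C1_continuous_grad fU Ux.
move=> e e0; have := C1_frechet oU fU Ux e0.
have : \forall y \near x, U y by exact: open_nbhs_nbhs.
by apply: filterS2 => y Uy; rewrite !fg.
Qed.

Lemma C1_onS U W f : U `<=` W -> C1_on W f -> C1_on U f.
Proof. by move=> UW fW x /UW; exact: fW. Qed.

Lemma C1_onD U f g : open U -> C1_on U f -> C1_on U g ->
  C1_on U (fun x => f x + g x) /\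
  (forall x, U x -> grad (fun x => f x + g x) x = grad f x + grad g x).
Proof.
move=> oU fU gU; apply: frechet_C1 => // [x Ux|x Ux i].
  by apply: frechetD; exact: C1_frechet oU _ Ux.
rewrite (_ : (fun y => _) = (fun y => grad f y 0 i + grad g y 0 i)); last first.
  by apply/funext => y; rewrite mxE.
by apply: continuousD; [exact: C1_continuous_grad fU Ux|exact: C1_continuous_grad gU Ux].
Qed.

Lemma C1_onM U f g : open U -> C1_on U f -> C1_on U g ->
  C1_on U (fun x => f x * g x) /\
  (forall x, U x -> grad (fun x => f x * g x) x = g x *: grad f x + f x *: grad g x).
Proof.
move=> oU fU gU; apply: frechet_C1 => // [x Ux|x Ux i].
  by apply: frechetM; exact: C1_frechet oU _ Ux.
rewrite (_ : (fun y => _) = (fun y => g y * grad f y 0 i + f y * grad g y 0 i)); last first.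
  by apply/funext => y; rewrite !mxE.
apply: continuousD; apply: continuousM.
- exact: C1_continuous oU gU Ux.
- exact: C1_continuous_grad fU Ux.
- exact: C1_continuous oU fU Ux.
- exact: C1_continuous_grad gU Ux.
Qed.

Lemma C1_on_cst U (c : R) : open U -> C1_on U (fun=> c : R) /\
  (forall x, U x -> grad (fun=> c : R) x = 0).
Proof.
move=> oU; apply: (@frechet_C1 _ _ (fun=> 0)) => // [x _|x _ i]; first exact: frechet_cst.
exact: (@cst_continuous V R ((0 : V) 0 i) x).
Qed.

Lemma C1_on_coord U i : open U -> C1_on U (fun x => x 0 i) /\
  (forall x, U x -> grad (fun x => x 0 i) x = delta_mx 0 i).
Proof.
move=> oU; apply: (@frechet_C1 _ _ (fun=> delta_mx 0 i)) => // [x _|x _ j].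
  exact: frechet_coord.
exact: (@cst_continuous V R ((delta_mx 0 i : V) 0 j) x).
Qed.

Lemma C1_on_comp1 U f (phi dphi : R -> R) (I : set R) : open U -> C1_on U f ->
  (forall x, U x -> I (f x)) ->
  (forall t, I t -> is_derive t 1 phi (dphi t)) ->
  (forall t, I t -> {for t, continuous dphi}) ->
  C1_on U (fun x => phi (f x)) /\
  (forall x, U x -> grad (fun x => phi (f x)) x = dphi (f x) *: grad f x).
Proof.
move=> oU fU fI dI cI; apply: frechet_C1 => // [x Ux|x Ux i].
  apply: frechet_comp1; first exact/dI/fI.
  exact: C1_frechet oU fU Ux.
rewrite (_ : (fun y => _) = (fun y => dphi (f y) * grad f y 0 i)); last first.
  by apply/funext => y; rewrite !mxE.
apply: continuousM; last exact: C1_continuous_grad fU Ux.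
apply: (@continuous_comp _ _ _ f dphi); first exact: C1_continuous oU fU Ux.
exact/cI/fI.
Qed.

End C1.

(** * Uniformity on compact sets and integrals of partial derivatives *)

Section compact_facts.
Context {R : realType} {n : nat}.
Local Notation V := 'rV[R]_n.
Local Notation L := (Leb R n).
Implicit Types (f g : V -> R) (x y : V) (U K : set V).

(** Only x is confined to K; y may leave it, which is what difference quotients near the boundary of
    K require. *)
Lemma compact_unif_continuous K g : compact K ->
  (forall x, K x -> {for x, continuous g}) -> forall e : R, 0 < e ->
  exists2 d : R, 0 < d & forall x y, K x -> enorm (y - x) < d -> `|g y - g x| <= e.
Proof.
move=> /compact_near_coveringP cK cg e e0.
have e20 : 0 < e / 2 by rewrite divr_gt0.
have : \forall d \near (0 : R)^'+, K `<=` [set x | forall y, enorm (y - x) < d -> `|g y - g x| <= e].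
  apply: cK => x Kx.
  have /(@cvgrPdist_le _ _ _ (nbhs x)) /(_ _ e20) /nbhs_enormP[d d0 hd] := cg x Kx.
  have d20 : 0 < d / 2 by rewrite divr_gt0.
  exists ([set y | enorm (y - x) < d / 2], [set t : R | t < d / 2]) => /=.
    by split; [exact: near_enorm_lt|exact: nbhs_right_lt].
  move=> [z t] /= [zx td] y yz.
  have h1 : `|g x - g z| <= e / 2 by apply: hd; apply: (lt_trans zx); lra.
  have h2 : `|g x - g y| <= e / 2.
    apply: hd; rewrite -(subrKA z) (le_lt_trans (ler_enormD _ _))//.
    by have := lt_trans yz td; lra.
  rewrite (_ : g y - g z = (g x - g z) - (g x - g y)); last by ring.
  by rewrite (le_trans (ler_normB _ _))// (splitr e) lerD.
move=> h; near (0 : R)^'+ => d.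
exists d => // x y Kx; have : K `<=` [set x | forall y, enorm (y - x) < d -> `|g y - g x| <= e] by near: d.
by move=> /(_ x Kx); exact.
Unshelve. all: by end_near. Qed.

Lemma compact_bound K g : compact K -> (forall x, K x -> {for x, continuous g}) ->
  exists2 M : R, 0 <= M & forall x, K x -> `|g x| <= M.
Proof.
move=> /compact_near_coveringP cK cg.
have : \forall M \near +oo%R, K `<=` [set x | `|g x| <= M].
  apply: cK => x Kx.
  have /(@cvgrPdist_le _ _ _ (nbhs x)) /(_ _ ltr01) h := cg x Kx.
  exists ([set y | `|g x - g y| <= 1], [set t : R | `|g x| + 1 <= t]) => /=.
    by split => //; exact: nbhs_pinfty_ge.
  move=> [z t] /= [zx]; apply: le_trans.
  rewrite -[g z](subrK (g x)) (le_trans (ler_normD _ _))// addrC lerD2l.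
  by rewrite distrC.
move=> h; near (pinfty_nbhs R) => M; exists M => [|x Kx].
  by near: M; exact: nbhs_pinfty_ge.
have : K `<=` [set x | `|g x| <= M] by near: M.
by move/(_ x Kx).
Unshelve. all: by end_near. Qed.

Lemma compact_eball_le (r : R) : compact [set x : V | enorm x <= r].
Proof.
rewrite (_ : mkset _ = [set x | 0 <= enorm x <= r]); first exact: compact_annulus.
by apply/seteqP; split => x /=; rewrite enorm_ge0.
Qed.

Lemma integrable_bounded_support (g : L -> R) (M r : R) :
  measurable_fun setT g -> (forall x, `|g x| <= M) ->
  (forall x : V, r < enorm x -> g x = 0) ->
  leb.-integrable setT (EFin \o g).
Proof.
move=> mg gM g0; pose B := [set x : V | enorm x <= r].
have mB : measurable (B : set L).
  by apply: compact_measurable; exact: compact_eball_le.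
have Boo : (leb (B : set L) < +oo)%E by exact: (@bounded_lty _ _ _ r).
have : leb.-integrable (B : set L) (EFin \o g).
  apply: measurable_bounded_integrable => //; first exact: measurable_funTS mg.
  by exists M; split; [exact: num_real|move=> N MN x _ /=; rewrite (le_trans (gM x))// ltW].
move/(integrable_mkcond _ mB).
rewrite (_ : (_ \_ _) = EFin \o g)//; apply/funext => x; rewrite patchE /=.
case: ifPn => // /negP; rewrite inE /B /= => /negP; rewrite -ltNge => rx.
by rewrite g0.
Qed.

Lemma integrable_continuous_support g (r : R) : continuous g ->
  (forall x : V, r < enorm x -> g x = 0) -> leb.-integrable [set: L] (EFin \o g).
Proof.
move=> cg g0; have [M M0 gM] := compact_bound (compact_eball_le (r:=r)) (fun x _ => cg x).
apply: (@integrable_bounded_support g M r) => //; first exact: continuous_measurable.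
move=> x; have [xr|rx] := leP (enorm (x : V)) r; first exact: gM.
by rewrite g0// normr0.
Qed.

Definition C1c (r : R) f := C1_on setT f /\ forall x, r < enorm x -> f x = 0.

Lemma C1c_continuous r f : C1c r f -> continuous f.
Proof. by move=> [fC _] x; apply: C1_continuous fC _ => //; exact: openT. Qed.

Lemma C1c_continuous_partial r f i : C1c r f -> continuous (partial i f).
Proof. by move=> [fC _] x; have [] := fC x I i. Qed.

Lemma grad_eq0 U f x : open U -> (forall y, U y -> f y = 0) -> U x -> grad f x = 0.
Proof.
move=> oU f0 Ux.
have [c1 c2] := C1_on_cst (0 : R) oU.
have [_ h] := eq_C1_on oU (fun y Uy => esym (f0 y Uy)) c1.
by rewrite h// c2.
Qed.

Lemma C1c_grad_eq0 r f x : C1c r f -> r < enorm x -> grad f x = 0.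
Proof.
move=> [_ f0] rx; exact: (@grad_eq0 (exterior r) f x (@open_exterior R n r) f0 rx).
Qed.

Lemma C1c_partial_eq0 r f i x : C1c r f -> r < enorm x -> partial i f x = 0.
Proof. by move=> fC rx; have := C1c_grad_eq0 fC rx => /rowP/(_ i); rewrite !mxE. Qed.

Lemma C1c_difference_quotient r f i : C1c r f -> forall e : R, 0 < e ->
  exists2 d : R, 0 < d & forall x (h : R), h != 0 -> `|h| < d ->
  `|h^-1 * (f (x + h *: delta_mx 0 i) - f x) - partial i f x| <= e.
Proof.
move=> fC e e0; have cp := C1c_continuous_partial (i:=i) fC.
have [d d0 hd] := @compact_unif_continuous _ (partial i f)
  (compact_eball_le (r:=r + 1)) (fun x _ => cp x) e e0.
exists (Num.min d 1) => [|x h h0]; first by rewrite lt_min d0 ltr01.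
rewrite lt_min => /andP[hd1 h1].
have [t th ->] := @mvt_line _ _ f x (delta_mx 0 i) h (fun t _ => (fC.1 _ I i).1).
rewrite mulrA mulVf// mul1r.
have tE : enorm (x + t *: delta_mx 0 i - x) = `|t|.
  by rewrite addrAC subrr add0r enormZ enorm_delta mulr1.
have [xr|rx] := leP (enorm x) (r + 1).
  by apply: hd => //; rewrite tE (le_lt_trans th).
rewrite -[X in X - _]/(partial i f _) !(C1c_partial_eq0 i fC) ?subrr ?normr0 ?ltW//.
  by apply: lt_trans rx; rewrite ltrDl.
have := ler_dist_enorm (x + t *: delta_mx 0 i) x; rewrite tE => /ler_normlP[a _].
by have := le_lt_trans th h1; lra.
Qed.

(** Difference quotients have integral 0 by translation invariance, and they converge uniformly to
    the partial derivative while their supports stay in a fixed ball. No iterated integration is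
    involved. *)
Lemma integral_partial_eq0 r f i : C1c r f -> \int[leb]_(x in [set: L]) partial i f x = 0.
Proof.
move=> fC; apply/eqP; rewrite -normr_le0; apply/ler_addgt0Pr => e e0; rewrite add0r.
pose B := [set x : V | enorm x <= r + 1].
have mB : measurable (B : set L).
  by apply: compact_measurable; exact: compact_eball_le.
have Boo : (leb (B : set L) < +oo)%E by exact: (@bounded_lty _ _ _ (r + 1)).
pose b := fine (leb (B : set L)).
have b0 : 0 <= b by rewrite fine_ge0.
have b10 : 0 < b + 1 by rewrite ltr_wpDl.
have [d d0 hd] := C1c_difference_quotient i fC (divr_gt0 e0 b10).
(* Besides h < d for the uniform bound, h < 1 keeps the translate of f supported in the ball of
   radius r + 1. *)
pose h := Num.min (d / 2) (2^-1).
have h0 : 0 < h by rewrite lt_min divr_gt0//= invr_gt0.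
have hd' : h < d by rewrite gt_min; apply/orP; left; lra.
have h1 : h < 1 by rewrite gt_min; apply/orP; right; lra.
pose q x := h^-1 * (f (x + h *: delta_mx 0 i) - f x).
have cf := C1c_continuous fC.
have if0 := integrable_continuous_support cf fC.2.
have s1 : (0 : R) < 1 by [].
have if1 : leb.-integrable [set: L] (EFin \o (fun x : L => f ((x : V) + h *: delta_mx 0 i))).
  have := integrable_affine (h *: delta_mx 0 i) s1 if0.
  by rewrite /comp /affine; under eq_fun do rewrite scale1r.
have ip : leb.-integrable [set: L] (EFin \o (partial i f : L -> R)).
  apply: (@integrable_continuous_support _ r); first exact: C1c_continuous_partial fC.
  by move=> x; exact: C1c_partial_eq0.
have iB : leb.-integrable [set: L] (EFin \o (fun x : L => f ((x : V) + h *: delta_mx 0 i) - f x)).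
  by have := integrableB measurableT if1 if0; apply: eq_integrable.
have iq : leb.-integrable [set: L] (EFin \o (q : L -> R)).
  by have := integrableZl measurableT h^-1 iB; apply: eq_integrable.
have q0 : \int[leb]_(x in [set: L]) q x = 0.
  rewrite /q RintegralZl// RintegralB//.
  have := Rintegral_affine (h *: delta_mx 0 i) s1 if0.
  rewrite /affine; under [X in X = _ -> _]eq_Rintegral do rewrite scale1r.
  by move=> ->; rewrite expr1n invr1 mul1r subrr mulr0.
have -> : \int[leb]_(x in [set: L]) partial i f x =
          \int[leb]_(x in [set: L]) (partial i f x - q x).
  by rewrite RintegralB// q0 subr0.
have ipq : leb.-integrable [set: L] (EFin \o (fun x : L => partial i f x - q x)).
  by have := integrableB measurableT ip iq; apply: eq_integrable.
apply: (le_trans (le_normr_Rintegral measurableT ipq)).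
have E x : `|partial i f x - q x| <= e / (b + 1) * \1_B x.
  have [xB|rx] := leP (enorm x) (r + 1).
    rewrite indicE mem_set// mulr1 distrC; apply: hd; first by rewrite gt_eqF.
    by rewrite gtr0_norm.
  rewrite indicE memNset//; last by apply/negP; rewrite -ltNge.
  rewrite mulr0 (C1c_partial_eq0 i fC); last by apply: lt_trans rx; rewrite ltrDl.
  rewrite /q !fC.2 ?subrr ?mulr0 ?subrr ?normr0//; first by apply: lt_trans rx; rewrite ltrDl.
  have := ler_dist_enorm (x + h *: delta_mx 0 i) x.
  rewrite addrAC subrr add0r enormZ enorm_delta mulr1 (gtr0_norm h0) => /ler_normlP[a _].
  by lra.
have i0 : leb.-integrable [set: L] (EFin \o (\1_B : L -> R)).
  apply: (@integrable_bounded_support _ 1 (r + 1)).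
  - exact: measurable_indic.
  - by move=> x; rewrite indicE; case: (_ \in _); rewrite /= ?normr1 ?normr0.
  - by move=> x rx; rewrite indicE memNset//; apply/negP; rewrite -ltNge.
have i1 : leb.-integrable [set: L] (EFin \o (fun x : L => e / (b + 1) * \1_B x)).
  by have := integrableZl measurableT (e / (b + 1)) i0; apply: eq_integrable.
apply: (@le_trans _ _ (\int[leb]_(x in [set: L]) (e / (b + 1) * \1_B x))).
  by apply: le_Rintegral => //; exact: integrable_norm.
rewrite RintegralZl//.
rewrite /Rintegral integral_indic// setIT -/b mulrAC ler_pdivrMr//.
by rewrite ler_wpM2l ?(ltW e0)// lerDl.
Qed.

End compact_facts.

Lemma powR_continuous_pos (R : realType) (a t : R) : 0 < t ->
  {for t, continuous (@powR R ^~ a)}.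
Proof.
move=> t0; have [d _] := @is_derive1_powR R a t t0.
by apply: differentiable_continuous; apply/derivable1_diffP.
Qed.

Lemma continuous_sumr (R : realType) (T : topologicalType) (I : Type)
    (r : seq I) (F : I -> T -> R) (y : T) :
  (forall i, {for y, continuous (F i)}) ->
  {for y, continuous (fun z => \sum_(i <- r) F i z)}.
Proof.
move=> cF; elim: r => [|i r IH].
  rewrite (_ : (fun z => _) = cst 0); first exact: cst_continuous.
  by apply/funext => z; rewrite big_nil.
rewrite (_ : (fun z => _) = (fun z => F i z + \sum_(j <- r) F j z)).
  exact: continuousD (cF i) IH.
by apply/funext => z; rewrite big_cons.
Qed.

(** * Powers of the norm and the derivative of the inversion *)

Section punctured.
Context {R : realType} {n : nat}.
Local Notation V := 'rV[R]_n.
Implicit Types (f g : V -> R) (x y : V) (U : set V).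

Definition punctured : set V := [set x | x != 0].

Lemma frechet_sqr_enorm x : frechet (fun y => dotr y y) x (2 *: x).
Proof.
move=> e e0; apply/nbhs_enormP; exists e => // y yx.
rewrite (_ : _ - _ = enorm (y - x) ^+ 2).
  by rewrite ger0_norm ?sqr_ge0// expr2 ler_wpM2r ?enorm_ge0// ltW.
rewrite sqr_enorm dotrZl !dotrDr !dotrDl !dotrNr !dotrNl (dotrC y x); ring.
Qed.

Lemma enorm_powRE x (s : R) : enorm x `^ s = dotr x x `^ (s / 2).
Proof. by rewrite /enorm -powR12_sqrt ?dotr_ge0// -powRrM mulrC. Qed.

Lemma C1_on_enorm_powR (s : R) : C1_on punctured (fun x => enorm x `^ s) /\
  (forall x, punctured x -> grad (fun x => enorm x `^ s) x = (s * enorm x `^ (s - 2)) *: x).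
Proof.
have d0 x : x != 0 -> 0 < dotr x x by move=> x0; rewrite -sqr_enorm exprn_gt0// enorm_gt0.
have [c1 c2] : C1_on punctured (fun x => dotr x x) /\
    (forall x, punctured x -> grad (fun x => dotr x x) x = 2 *: x).
  apply: (@frechet_C1 _ _ _ _ (fun x => 2 *: x)) => [|x _|x _ i].
  - exact: open_punctured.
  - exact: frechet_sqr_enorm.
  - rewrite (_ : (fun y => _) = (fun y : V => 2 * y 0 i)); last by apply/funext => y; rewrite mxE.
    by apply: continuousM; [exact: cst_continuous|exact: coord_continuous].
have fI x : punctured x -> [set t : R | 0 < t] (dotr x x) by move=> /d0.
have dI (t : R) : [set t : R | 0 < t] t ->
    is_derive t 1 (@powR R ^~ (s / 2)) (s / 2 * t `^ (s / 2 - 1)).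
  by move=> t0; exact: is_derive1_powR.
have cI (t : R) : [set t : R | 0 < t] t ->
    {for t, continuous (fun t => s / 2 * t `^ (s / 2 - 1))}.
  by move=> t0; apply: continuousM; [exact: cst_continuous|exact: powR_continuous_pos].
have [b1 b2] := C1_on_comp1 (@open_punctured R n) c1 fI dI cI.
have E : (fun x => enorm x `^ s) = (fun x : V => dotr x x `^ (s / 2)).
  by apply/funext => x; rewrite enorm_powRE.
split; first by rewrite E.
move=> x x0; rewrite E b2// c2// scalerA; congr (_ *: _).
rewrite enorm_powRE (_ : (s - 2) / 2 = s / 2 - 1); last by field.
by field.
Qed.

(* The transpose of the Jacobian of the inversion; it is symmetric. *)
Definition reflection y (a : V) : V :=
  enorm y ^- 2 *: (a - (2 * dotr y a * enorm y ^- 2) *: y).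

Lemma reflectionK_dotr y a b : dotr (reflection y a) b = dotr a (reflection y b).
Proof.
rewrite /reflection !dotrZl !dotrZr !dotrDl !dotrDr !dotrNl !dotrNr !dotrZl !dotrZr.
by rewrite (dotrC a y); congr (_ * _); ring.
Qed.

(** Up to the factor |y|^(-2), [reflection y] is the orthogonal reflection in the hyperplane normal
    to y, an involution: the inversion is conformal. *)
Lemma reflection_reflection y a : y != 0 ->
  reflection y (reflection y a) = enorm y ^- 4 *: a.
Proof.
move=> y0; have e0 : enorm y != 0 by rewrite enorm_eq0.
apply/rowP => i; rewrite /reflection !mxE !(dotrZr, dotrDr, dotrNr) -sqr_enorm.
by field.
Qed.

Lemma enorm_reflection y a : y != 0 -> enorm (reflection y a) = enorm y ^- 2 * enorm a.
Proof.
move=> y0; have e0 : enorm y != 0 by rewrite enorm_eq0.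
apply/eqP; rewrite -(@eqrXn2 _ 2)// ?enorm_ge0//; last first.
  by rewrite mulr_ge0 ?enorm_ge0// invr_ge0 sqr_ge0.
rewrite (sqr_enorm (reflection y a)) reflectionK_dotr reflection_reflection// dotrZr -sqr_enorm.
by rewrite exprMn exprVn -exprM.
Qed.

Lemma reflection_inversion y a : y != 0 ->
  reflection (inversion y) a = enorm y ^+ 4 *: reflection y a.
Proof.
move=> y0; have e0 : enorm y != 0 by rewrite enorm_eq0.
rewrite /reflection enorm_inversion /inversion dotrZl scalerA.
apply/rowP => i; rewrite !mxE; field.
exact: e0.
Qed.

Lemma dotr_rowE (g : V) (J : 'I_n -> V) i : (\sum_j g 0 j *: J j) 0 i = \sum_j g 0 j * J j 0 i.
Proof. by rewrite summxE; apply: eq_bigr => j _; rewrite mxE. Qed.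

Lemma frechet_inversion_coord y i : y != 0 ->
  frechet (fun z => inversion z 0 i) y (reflection y (delta_mx 0 i)).
Proof.
move=> y0; have e0 : enorm y != 0 by rewrite enorm_eq0.
have [c1 c2] := C1_on_enorm_powR (- 2).
have h := C1_frechet (@open_punctured R n) c1 (y0 : punctured y).
rewrite c2// in h.
have := frechetM h (frechet_coord i y).
rewrite (_ : (fun z => _ * _) = (fun z : V => inversion z 0 i)); last first.
  by apply/funext => z; rewrite /inversion mxE powR_invn ?enorm_ge0.
congr (frechet _ _ _); apply/rowP => j.
rewrite /reflection !mxE dotrC dotr_delta powR_invn ?enorm_ge0//.
rewrite (_ : - 2 - 2 = - 4%:R); last by rewrite -opprD -natrD.
rewrite powR_invn ?enorm_ge0//; field.
exact: e0.
Qed.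

Lemma frechet_comp_inversion f y (g : V) : inversion y != 0 ->
  frechet f (inversion y) g -> frechet (f \o inversion) y (reflection y g).
Proof.
rewrite inversion_eq0 => y0 hf.
have h := frechet_compV (fun i => frechet_inversion_coord i y0) hf.
move: h; congr (frechet _ _ _); apply/rowP => k.
rewrite dotr_rowE /reflection !mxE.
rewrite (eq_bigr (fun j => enorm y ^- 2 * (g 0 j * (k == j)%:R) -
   2 * enorm y ^- 4 * y 0 k * (y 0 j * g 0 j))); last first.
  move=> j _; rewrite !mxE eqxx /= dotrC dotr_delta; field.
  by rewrite enorm_eq0.
rewrite big_split/= sumrN -!mulr_sumr -/(dotr y g).
rewrite (bigD1 k)//= eqxx mulr1 big1 ?addr0; last first.
  by move=> j jk; rewrite eq_sym (negbTE jk) mulr0.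
by field; rewrite enorm_eq0.
Qed.

Lemma C1_on_comp_inversion U f : open U -> U `<=` punctured -> C1_on U f ->
  C1_on (inversion @^-1` U) (f \o inversion) /\
  (forall y, U (inversion y) ->
     grad (f \o inversion) y = reflection y (grad f (inversion y))).
Proof.
move=> oU U0 fU.
have nz y : U (inversion y) -> y != 0 by move/U0; rewrite /punctured /= inversion_eq0.
have oI : open (inversion @^-1` U : set V).
  rewrite openE => y Uy; apply: continuous_inversion; first exact: nz.
  exact: open_nbhs_nbhs.
apply: frechet_C1 => // [y Uy|y Uy i].
  apply: frechet_comp_inversion; first exact: U0.
  exact: C1_frechet oU fU Uy.
have y0 := nz _ Uy.
have ci j : {for y, continuous (fun z => grad f (inversion z) 0 j)}.
  apply: (@continuous_comp _ _ _ inversion (fun z => grad f z 0 j)).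
    exact: continuous_inversion.
  exact: C1_continuous_grad fU Uy.
have cen : {for y, continuous (fun z : V => enorm z ^- 2)}.
  rewrite (_ : (fun z => _) = (fun z : V => (enorm z)^-1 * (enorm z)^-1)).
    by apply: continuousM; exact: continuous_enorm_inv.
  by apply/funext => z; rewrite -expr2 exprVn.
rewrite (_ : (fun z => _) = (fun z : V => enorm z ^- 2 * (grad f (inversion z) 0 i -
  (2 * (\sum_j z 0 j * grad f (inversion z) 0 j) * enorm z ^- 2) * z 0 i))); last first.
  by apply/funext => z; rewrite /reflection !mxE.
apply: continuousM => //; apply: continuousB => //; apply: continuousM; last exact: coord_continuous.
apply: continuousM => //; apply: continuousM; first exact: cst_continuous.
apply: continuous_sumr => j.
by apply: continuousM => //; exact: coord_continuous.
Qed.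

End punctured.

(** * Smooth bump functions *)

Section flat_function.
Context {R : realType}.

Lemma is_derive1_of_approx (phi : R -> R) (t d : R) :
  (forall e : R, 0 < e ->
     \forall s \near t, `|phi s - phi t - d * (s - t)| <= e * `|s - t|) ->
  is_derive t 1 phi d.
Proof.
move=> h.
have hc : (fun s : R => s^-1 *: ((phi \o shift t) (s *: 1) - phi t)) @ 0^' --> d.
  apply/cvgrPdist_le => e e0.
  have /nbhs_ballP[r /= r0 hr] := h e e0.
  near=> s.
  have s0 : s != 0 by near: s; exact: nbhs_dnbhs_neq.
  have sr : `|s| < r by near: s; exact: dnbhs0_lt.
  have := hr (s + t); rewrite -ball_normE /= opprD addrCA subrr addr0 normrN.
  move=> /(_ sr); rewrite addrK => h1.
  rewrite distrC [s *: 1]mulr1 (_ : _ - _ = s^-1 * (phi (s + t) - phi t - d * s)).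
    by rewrite normrM normfV mulrC ler_pdivrMr ?normr_gt0.
  by rewrite [in RHS]mulrBr [d * s]mulrC [in RHS]mulrA mulVf// mul1r.
split; first by apply/cvg_ex; exists d.
by apply: cvg_lim.
Unshelve. all: by end_near. Qed.

Definition flat (k : nat) (t : R) : R :=
  if 0 < t then t ^- k * expR (- t^-1) else 0.

Lemma flat_ge0 k t : 0 <= flat k t.
Proof.
by rewrite /flat; case: ifPn => // t0; rewrite mulr_ge0 ?expR_ge0// invr_ge0 exprn_ge0// ltW.
Qed.

(** The exponential series gives exp(1/t) >= t^(-k-2)/(k+2)!. The quadratic bound makes [flat k]
    differentiable at 0 with derivative 0. *)
Lemma flat_le k t : 0 <= t -> flat k t <= (k.+2)`!%:R * t ^+ 2.
Proof.
rewrite /flat le_eqVlt => /predU1P[<-|t0]; first by rewrite ltxx mulr_ge0// sqr_ge0.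
rewrite t0 expRN.
have h := @expR_ge1Dxn R (t^-1) k.+1; rewrite invr_ge0 ltW// in h.
have f0 : (0 : R) < (k.+2)`!%:R by rewrite ltr0n fact_gt0.
have h1 : t^-1 ^+ k.+2 <= (k.+2)`!%:R * expR t^-1.
  by rewrite -ler_pdivrMl// mulrC (le_trans _ (h isT))// lerDr.
have tk : 0 < t ^+ k.+2 by rewrite exprn_gt0.
have tk' : 0 < t ^+ k by rewrite exprn_gt0.
have e0 : 0 < expR t^-1 by rewrite expR_gt0.
move: h1; rewrite exprVn -(ler_pM2l tk) mulfV ?gt_eqF// => h1.
rewrite -(ler_pM2l (mulr_gt0 tk' e0)).
rewrite (_ : t ^+ k * _ * (_ / _) = 1); last first.
  by rewrite mulrACA mulfV ?gt_eqF// mulfV ?gt_eqF// mulr1.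
apply: (le_trans h1); rewrite le_eqVlt; apply/orP; left; apply/eqP.
by rewrite !exprS; ring.
Qed.

Lemma is_derive_flat k (t : R) :
  is_derive t 1 (flat k) (- k%:R * flat k.+1 t + flat k.+2 t).
Proof.
have [t0|t0|<-] := ltgtP 0 t.
- pose phi := ((@powR R ^~ (- k%:R)) : R -> R) * (expR \o (- (@powR R ^~ (- 1) : R -> R))).
  apply: (@near_eq_is_derive _ _ _ phi).
    have : \forall s \near t, 0 < s by apply: open_nbhs_nbhs; split => //; exact: open_gt.
    apply: filterS => s s0; rewrite /flat s0 /phi.
    rewrite -![(_ * _ : _ -> _) _]/(_ * _) /= -![(- _ : _ -> _) _]/(- _).
    by rewrite powR_invn ?ltW// powR_inv1// ltW.
  have d1 := @is_derive1_powR R (- k%:R) t t0.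
  have d2 := is_deriveN (@is_derive1_powR R (- 1) t t0).
  have d3 := @is_derive1_comp R expR _ t _ _ (is_derive_expR _) d2.
  have d4 := is_deriveM d1 d3.
  apply: is_derive_eq d4 _; rewrite /flat t0 /=.
  rewrite -![(- _ : _ -> _) _]/(- _) powR_inv1 ?ltW//.
  have E1 : (- 1 - 1 : R) = - 2%:R by rewrite -opprD.
  have E2 : (- k%:R - 1 : R) = - k.+1%:R by rewrite -opprD natr1.
  rewrite E1 E2 !powR_invn ?ltW// -![_ *: _]/(_ * _) !exprS; field.
  by rewrite expf_neq0 ?gt_eqF.
- apply: (@near_eq_is_derive _ _ _ (cst 0 : R -> R)).
    have : \forall s \near t, s < 0 by apply: open_nbhs_nbhs; split => //; exact: open_lt.
    by apply: filterS => s s0; rewrite /flat ltNge ltW.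
  by rewrite /flat ltNge (ltW t0)/= mulr0 addr0; exact: is_derive_cst.
have f0 m : flat m 0 = 0 by rewrite /flat ltxx.
rewrite !f0 mulr0 addr0; apply: is_derive1_of_approx => e e0.
have F0 : (0 : R) < (k.+2)`!%:R by rewrite ltr0n fact_gt0.
have d0 : 0 < e / (k.+2)`!%:R by rewrite divr_gt0.
apply/nbhs_ballP; exists (e / (k.+2)`!%:R) => // s.
rewrite /ball /= sub0r normrN => hs; rewrite f0 mul0r !subr0.
have [s0|s0] := leP 0 s; last first.
  by rewrite /flat ltNge (ltW s0)/= normr0 mulr_ge0// ltW.
rewrite (ger0_norm (flat_ge0 _ _)) (le_trans (flat_le _ s0))// ger0_norm//.
rewrite expr2 mulrA ler_wpM2r// mulrC -ler_pdivlMr// ltW//.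
by rewrite -(ger0_norm s0).
Qed.

End flat_function.

Section smooth_class.
Context {R : realType} {n : nat}.
Local Notation V := 'rV[R]_n.
Implicit Types (f g : V -> R) (x y : V).

(* A family of functions closed under partial derivatives that contains bump
   functions: the derivative of [flat k] is a combination of [flat k.+1] and
   [flat k.+2]. *)
Inductive bump_algebra (e : R) : (V -> R) -> Prop :=
| bump_cst c : bump_algebra e (fun=> c)
| bump_coord i : bump_algebra e (fun x => x 0 i)
| bump_flat k : bump_algebra e (fun x => flat k (e ^+ 2 - dotr x x))
| bump_add f g : bump_algebra e f -> bump_algebra e g -> bump_algebra e (fun x => f x + g x)
| bump_mul f g : bump_algebra e f -> bump_algebra e g -> bump_algebra e (fun x => f x * g x).

Lemma bump_frechet e f : bump_algebra e f ->
  exists G : 'I_n -> V -> R, (forall i, bump_algebra e (G i)) /\ forall x, frechet f x (\row_i G i x).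
Proof.
elim=> [c|i|k|{}f g _ [F [Fb Ff]] _ [G [Gb Gg]]|{}f g fb [F [Fb Ff]] gb [G [Gb Gg]]].
- exists (fun _ _ => 0); split => [i|x]; first exact: bump_cst.
  by rewrite (_ : \row_i _ = 0); [exact: frechet_cst|apply/rowP => i; rewrite !mxE].
- exists (fun j _ => (delta_mx 0 i : V) 0 j); split => [j|x]; first exact: bump_cst.
  rewrite (_ : \row_j _ = delta_mx 0 i); first exact: frechet_coord.
  by apply/rowP => j; rewrite !mxE.
- pose d (x : V) := - k%:R * flat k.+1 (e ^+ 2 - dotr x x) + flat k.+2 (e ^+ 2 - dotr x x).
  exists (fun j x => d x * (- 2 * x 0 j)); split => [j|x].
    apply: bump_mul; last by apply: bump_mul; [exact: bump_cst|exact: bump_coord].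
    apply: bump_add; last exact: bump_flat.
    by apply: bump_mul; [exact: bump_cst|exact: bump_flat].
  have h1 := frechetD (frechet_cst (e ^+ 2) x) (frechetZ (- 1) (frechet_sqr_enorm x)).
  have E : e ^+ 2 + - 1 * dotr x x = e ^+ 2 - dotr x x by rewrite mulN1r.
  have dphi := is_derive_flat k (e ^+ 2 + - 1 * dotr x x).
  have := frechet_comp1 dphi h1.
  rewrite (_ : flat k \o _ = (fun y => flat k (e ^+ 2 - dotr y y))); last first.
    by apply/funext => y /=; rewrite mulN1r.
  congr (frechet _ _ _); apply/rowP => j; rewrite !mxE E /d; ring.
- exists (fun i x => F i x + G i x); split => [i|x]; first exact: bump_add.
  rewrite (_ : \row_i _ = \row_i F i x + \row_i G i x); first exact: frechetD.
  by apply/rowP => i; rewrite !mxE.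
- exists (fun i x => g x * F i x + f x * G i x); split => [i|x].
    by apply: bump_add; apply: bump_mul.
  rewrite (_ : \row_i _ = g x *: (\row_i F i x) + f x *: \row_i G i x).
    exact: frechetM.
  by apply/rowP => i; rewrite !mxE.
Qed.

Lemma bump_partial e f i : bump_algebra e f -> bump_algebra e (partial i f).
Proof.
move=> /bump_frechet[G [Gb Gf]]; rewrite (_ : partial i f = G i)//.
apply/funext => x; have [_] := frechet_is_derive i (Gf x).
by rewrite /partial mxE.
Qed.

Lemma bump_smooth e f : bump_algebra e f -> smooth_on setT f.
Proof.
move=> fb s x _; have : bump_algebra e (foldr partial f s).
  by elim: s => //= i s; exact: bump_partial.
move=> /bump_frechet[G [_ Gf]]; split; first exact: frechet_continuous (Gf x).
by move=> i; have [] := frechet_is_derive i (Gf x).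
Qed.

Lemma smooth_on_partial U f i : smooth_on U f -> smooth_on U (partial i f).
Proof.
move=> fs s x Ux; have := fs (rcons s i) x Ux.
by rewrite foldr_rcons.
Qed.

Lemma smooth_on_C1 U f : smooth_on U f -> C1_on U f.
Proof.
move=> fs x Ux i; split; first exact: (fs [::] x Ux).2.
exact: (fs [:: i] x Ux).1.
Qed.

End smooth_class.

(** * Convolution with a kernel of compact support *)

Section bounded_factor.
Context d (T : measurableType d) (R : realType) (mu : {measure set T -> \bar R}).
Variables (D : set T) (mD : measurable D).
Implicit Types G u : T -> R.

Lemma integrable_bounded_mul G u (c : R) : mu.-integrable D (EFin \o G) ->
  measurable_fun D u -> (forall x, D x -> `|u x| <= c) ->
  mu.-integrable D (EFin \o (fun x => G x * u x)).
Proof.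
move=> iG mu_ uc; have mG := measurable_int _ iG.
have mG' : measurable_fun D G by exact/measurable_EFinP.
have iN : mu.-integrable D (EFin \o (fun x => `|c| * `|G x|)).
  have := integrableZl mD `|c| (integrable_norm iG).
  by apply: eq_integrable.
apply: le_integrable iN => //.
  by apply/measurable_EFinP; exact: measurable_funM.
move=> x Dx /=; rewrite lee_fin normrM (ger0_norm (_ : 0 <= `|c| * `|G x|)).
  by rewrite mulrC ler_wpM2r// (le_trans (uc _ Dx))// ler_norm.
by rewrite mulr_ge0.
Qed.

Lemma Rintegral_bounded_mul G u (c : R) : 0 <= c -> mu.-integrable D (EFin \o G) ->
  measurable_fun D u -> (forall x, D x -> `|u x| <= c) ->
  `| \int[mu]_(x in D) (G x * u x) | <= c * \int[mu]_(x in D) `|G x|.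
Proof.
move=> c0 iG mu_ uc; have iGu := integrable_bounded_mul iG mu_ uc.
apply: (le_trans (le_normr_Rintegral mD iGu)).
have iN := integrable_norm iG.
rewrite -RintegralZl//; apply: le_Rintegral => //.
- exact: integrable_norm.
- by have := integrableZl mD c iN; apply: eq_integrable.
- by move=> x Dx; rewrite normrM mulrC ler_wpM2r// uc.
Qed.

End bounded_factor.

Section convolution.
Context {R : realType} {n : nat}.
Local Notation V := 'rV[R]_n.
Local Notation L := (Leb R n).
Implicit Types (f g k : V -> R) (x y : V).

Definition Cc (r : R) f := continuous f /\ forall x, r < enorm x -> f x = 0.

Lemma C1c_Cc r f : C1c r f -> Cc r f.
Proof. by move=> fC; split; [exact: C1c_continuous fC|exact: fC.2]. Qed.

Lemma C1c_partial_Cc r f i : C1c r f -> Cc r (partial i f).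
Proof.
by move=> fC; split=> [|x]; [exact: C1c_continuous_partial fC|exact: C1c_partial_eq0].
Qed.

Lemma Cc_bound r f : Cc r f -> exists2 M : R, 0 <= M & forall x, `|f x| <= M.
Proof.
move=> [cf f0]; have [M M0 fM] := compact_bound (compact_eball_le (r:=r)) (fun x _ => cf x).
exists M => // x; have [xr|rx] := leP (enorm x) r; first exact: fM.
by rewrite f0// normr0.
Qed.

Lemma Cc_integrable r f : Cc r f -> leb.-integrable [set: L] (EFin \o (f : L -> R)).
Proof. by move=> [cf f0]; exact: integrable_continuous_support cf f0. Qed.

Lemma Cc_unif_continuous r f : Cc r f -> forall e : R, 0 < e ->
  exists2 d : R, 0 < d & forall x y, enorm (y - x) < d -> `|f y - f x| <= e.
Proof.
move=> [cf f0] e e0.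
have [d d0 hd] := @compact_unif_continuous _ _ _ f
  (compact_eball_le (r:=r + 1)) (fun x _ => cf x) e e0.
exists (Num.min d 1) => [|x y]; first by rewrite lt_min d0 ltr01.
rewrite lt_min => /andP[yd y1].
have [xr|rx] := leP (enorm x) (r + 1); first exact: hd.
rewrite !f0 ?subrr ?normr0 ?ltW//; first by apply: lt_trans rx; rewrite ltrDl.
have := ler_dist_enorm y x => /ler_normlP[a _].
by have := le_lt_trans a y1; lra.
Qed.

(** The sign of s covers both uses: for s = -1 the kernel k is smooth and carries all the
    derivatives; for s = 1 the kernel is G and the derivatives fall on the function k. *)
Definition conv (s : R) (G : L -> R) k x : R := \int[leb]_(y in [set: L]) (G y * k ((y : V) + s *: x)).

Variables (s : R) (G : L -> R).
Hypothesis iG : leb.-integrable [set: L] (EFin \o G).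

Let B : R := \int[leb]_(y in [set: L]) `|G y|.

Let B_ge0 : 0 <= B.
Proof. exact: Rintegral_ge0. Qed.

Lemma continuous_shift_arg k x : continuous k -> continuous (fun y => k (y + x)).
Proof.
move=> ck y; apply: (@continuous_comp _ _ _ (fun z : V => z + x) k); last exact: ck.
apply: (@continuousD _ _ _ (fun z : V => z) (fun=> x)); first exact: cvg_id.
exact: cst_continuous.
Qed.

Lemma integrable_conv r k x : Cc r k ->
  leb.-integrable [set: L] (EFin \o (fun y : L => G y * k ((y : V) + s *: x))).
Proof.
move=> kC; have [M M0 kM] := Cc_bound kC.
apply: (@integrable_bounded_mul _ _ _ _ _ measurableT _ _ M) => //.
by apply: continuous_measurable; exact: continuous_shift_arg kC.1.
Qed.

Lemma conv_continuous r k : Cc r k -> continuous (conv s G k).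
Proof.
move=> kC x; apply/(@cvgrPdist_le _ _ _ (nbhs x)) => e e0.
have b10 : 0 < B + 1 by rewrite ltr_wpDl.
have e'0 : 0 < e / (B + 1) by rewrite divr_gt0.
have [d d0 hd] := Cc_unif_continuous kC e'0.
have s10 : 0 < `|s| + 1 by rewrite ltr_wpDl.
near=> z.
have zx : enorm (z - x) < d / (`|s| + 1).
  by near: z; apply: near_enorm_lt; rewrite divr_gt0.
rewrite distrC /conv -RintegralB//; [|exact: integrable_conv kC|exact: integrable_conv kC].
under eq_Rintegral do rewrite -mulrBr.
apply: (@le_trans _ _ (e / (B + 1) * B)).
  apply: Rintegral_bounded_mul => //; first exact: ltW.
    apply: measurable_funB; apply: continuous_measurable; exact: continuous_shift_arg kC.1.
  move=> y _; apply: hd.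
  rewrite opprD addrACA subrr add0r -scalerBr enormZ.
  apply: (@le_lt_trans _ _ ((`|s| + 1) * enorm (z - x))).
    by rewrite ler_wpM2r ?enorm_ge0// lerDl.
  by rewrite mulrC -ltr_pdivlMr.
by rewrite mulrAC ler_pdivrMr// ler_wpM2l ?(ltW e0)// lerDl.
Unshelve. all: by end_near. Qed.

(** The difference quotients of k converge uniformly to its partial derivative and G is integrable,
    so differentiation passes under the integral. *)
Lemma conv_is_derive r k i x : s != 0 -> C1c r k ->
  is_derive x (delta_mx 0 i) (conv s G k) (s * conv s G (partial i k) x).
Proof.
move=> s0 kC; have kCc := C1c_Cc kC; have pC := C1c_partial_Cc i kC.
have hc : (fun t : R => t^-1 *: ((conv s G k \o shift x) (t *: delta_mx 0 i) - conv s G k x)) @ 0^'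
    --> (s * conv s G (partial i k) x).
  apply/cvgrPdist_le => e e0.
  have b10 : 0 < B + 1 by rewrite ltr_wpDl.
  have s'0 : 0 < `|s| by rewrite normr_gt0.
  have e'0 : 0 < e / (`|s| * (B + 1)) by rewrite divr_gt0// mulr_gt0.
  have [d d0 hd] := C1c_difference_quotient i kC e'0.
  near=> t.
  have t0 : t != 0 by near: t; exact: nbhs_dnbhs_neq.
  have td : `|t| < d / `|s| by near: t; apply: dnbhs0_lt; rewrite divr_gt0.
  have st0 : s * t != 0 by rewrite mulf_neq0.
  have std : `|s * t| < d by rewrite normrM mulrC -ltr_pdivlMr.
  rewrite distrC /=.
  pose u y := (s * t)^-1 * (k (y + s *: x + (s * t) *: delta_mx 0 i) - k (y + s *: x)) -
     partial i k (y + s *: x).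
  have cu : continuous u.
    move=> y; apply: (@continuousB _ _ _ (fun y => (s * t)^-1 *
      (k (y + s *: x + (s * t) *: delta_mx 0 i) - k (y + s *: x)))
      (fun y => partial i k (y + s *: x))); last first.
      by apply: continuous_shift_arg; exact: pC.1.
    apply: continuousM; first exact: cst_continuous.
    apply: (@continuousB _ _ _ (fun y => k (y + s *: x + (s * t) *: delta_mx 0 i))
       (fun y => k (y + s *: x))); last by apply: continuous_shift_arg; exact: kCc.1.
    rewrite (_ : (fun x0 => _) = (fun y => k (y + (s *: x + (s * t) *: delta_mx 0 i)))).
      by apply: continuous_shift_arg; exact: kCc.1.
    by apply/funext => z; rewrite addrA.
  rewrite (_ : _ - _ = s * \int[leb]_(y in [set: L]) (G y * u y)); last first.
    have i1 := integrable_conv (t *: delta_mx 0 i + x) kCc.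
    have i2 := integrable_conv x kCc.
    have i3 := integrable_conv x pC.
    have i12 : leb.-integrable [set: L] (EFin \o (fun y : L =>
        G y * k ((y : V) + s *: (t *: delta_mx 0 i + x)) - G y * k ((y : V) + s *: x))).
      by have := integrableB measurableT i1 i2; apply: eq_integrable.
    have i4 : leb.-integrable [set: L] (EFin \o (fun y : L => (s * t)^-1 *
        (G y * k ((y : V) + s *: (t *: delta_mx 0 i + x)) - G y * k ((y : V) + s *: x)))).
      by have := integrableZl measurableT (s * t)^-1 i12; apply: eq_integrable.
    transitivity (s * (\int[leb]_(y in [set: L]) ((s * t)^-1 *
        (G y * k ((y : V) + s *: (t *: delta_mx 0 i + x)) - G y * k ((y : V) + s *: x))) -
        conv s G (partial i k) x)).
      rewrite RintegralZl// RintegralB// mulrBr; congr (_ - _).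
      by rewrite mulrA invfM mulrA mulfV// mul1r.
    congr (_ * _); rewrite /conv -RintegralB//; apply: eq_Rintegral => y _.
    rewrite /u (_ : s *: (t *: delta_mx 0 i + x) = s *: x + (s * t) *: delta_mx 0 i).
      by rewrite addrA; ring.
    by rewrite scalerDr scalerA addrC.
  rewrite normrM.
  apply: (@le_trans _ _ (`|s| * (e / (`|s| * (B + 1)) * B))).
    rewrite ler_wpM2l// Rintegral_bounded_mul//.
    - exact: ltW.
    - exact: continuous_measurable.
    - by move=> y _; exact: hd.
  rewrite mulrA (_ : `|s| * (e / (`|s| * (B + 1))) = e / (B + 1)); last first.
    by field; rewrite !gt_eqF.
  by rewrite mulrAC ler_pdivrMr// ler_wpM2l ?(ltW e0)// lerDl.
split; first by apply/cvg_ex; exists (s * conv s G (partial i k) x).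
by apply: cvg_lim.
Unshelve. all: by end_near. Qed.

Lemma conv_partial r k i : s != 0 -> C1c r k ->
  partial i (conv s G k) = (fun x => s * conv s G (partial i k) x).
Proof. by move=> s0 kC; apply/funext => x; have [] := conv_is_derive i x s0 kC. Qed.

Lemma smooth_C1c r k : smooth_on setT k -> (forall x, r < enorm x -> k x = 0) -> C1c r k.
Proof. by move=> ks k0; split => //; exact: smooth_on_C1. Qed.

Lemma partial_scale f i (c : R) : C1_on setT f ->
  partial i (fun x => c * f x) = (fun x => c * partial i f x).
Proof.
move=> fC; apply/funext => x.
have := frechetZ c (C1_frechet (@openT V) fC (I : [set: V] x)).
by move=> /(frechet_is_derive i)[_]; rewrite !mxE.
Qed.

Lemma conv_foldr_partial r k l : s != 0 -> smooth_on setT k ->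
  (forall x, r < enorm x -> k x = 0) ->
  [/\ smooth_on setT (foldr partial k l),
      (forall x, r < enorm x -> foldr partial k l x = 0) &
   foldr partial (conv s G k) l = (fun x => s ^+ size l * conv s G (foldr partial k l) x)].
Proof.
move=> s0 ks k0; elim: l => [|i l [IH1 IH2 IH3]] /=.
  by split => //; apply/funext => x; rewrite mul1r.
have lC := smooth_C1c IH1 IH2.
split; first exact: smooth_on_partial.
  by move=> x; exact: C1c_partial_eq0.
rewrite IH3 partial_scale; last first.
  move=> x _ j; split; first by have [] := conv_is_derive j x s0 lC.
  rewrite (conv_partial j s0 lC).
  apply: continuousM; first exact: cst_continuous.
  exact: conv_continuous (C1c_partial_Cc j lC) _.
apply/funext => x; rewrite (conv_partial i s0 lC) exprSr.
by rewrite mulrA.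
Qed.

Lemma conv_smooth r k : s != 0 -> smooth_on setT k ->
  (forall x, r < enorm x -> k x = 0) -> smooth_on setT (conv s G k).
Proof.
move=> s0 ks k0 l x _; have [h1 h2 ->] := conv_foldr_partial l s0 ks k0.
have lC := smooth_C1c h1 h2; split.
  apply: continuousM; first exact: cst_continuous.
  exact: conv_continuous (C1c_Cc lC) _.
move=> i; have d := conv_is_derive i x s0 lC.
by have [] := is_deriveZ (s ^+ size l) d.
Qed.

End convolution.

(** * Mollifiers and smooth approximation *)

Section mollification.
Context {R : realType} {n : nat}.
Local Notation V := 'rV[R]_n.
Local Notation L := (Leb R n).
Local Notation T := (measurableTypeR R).
Implicit Types (f g k : V -> R) (x y : V).

Lemma lebesgue_tuple_cube_gt0 m (r : R) : 0 < r ->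
  (0 < lebesgue_tuple m [set t : m.-tuple R | forall i, (`|tnth t i| < r)%R])%E.
Proof.
move=> r0; elim: m => [|m IH].
  rewrite /= diracE mem_set; first by rewrite lte01.
  by case.
rewrite /= /lebesgue_tuple_step /pushforward.
rewrite (_ : _ @^-1` _ = ball (0%R : R) r `*`
    [set t : m.-tuple R | forall i, (`|tnth t i| < r)%R]).
  rewrite product_measure1E; [|exact: measurable_ball|exact: measurable_tuple_cube].
  have b : (0 < lebesgue_measure (ball (0%R : R) r))%E.
    by rewrite lebesgue_measure_ball ?ltW// lte_fin mulrn_wgt0.
  exact: mule_gt0.
apply/seteqP; split => -[x t] /=.
  move=> h; split => [|i].
    by have := h ord0; rewrite /tuple_cons /= tnth0 /ball /= sub0r normrN.
  by have := h (lift ord0 i); rewrite tnthS.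
move=> [xr tr] i; case: (unliftP ord0 i) => [j ->|->]; rewrite ?tnthS ?tnth0//.
by move: xr; rewrite /ball /= sub0r normrN.
Qed.

Lemma leb_eball_gt0 (r : R) : 0 < r -> (0 < leb (eball r : set L))%E.
Proof.
move=> r0; have r'0 : 0 < r / n.+1%:R by rewrite divr_gt0.
apply: lt_le_trans (lebesgue_tuple_cube_gt0 n r'0) _.
rewrite leb_borel; last by apply: open_borel; exact: open_eball.
apply: le_measure.
- by rewrite inE; exact: measurable_tuple_cube.
- rewrite inE; apply: borel_tuple_measurable.
  by apply: open_borel; exact: open_eball.
- move=> t /= tr; rewrite /eball /=.
  apply: (@le_lt_trans _ _ (n%:R * (r / n.+1%:R))).
    by apply: enorm_le_bound => [|i]; [exact: ltW|rewrite mxE ltW].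
  by rewrite mulrCA gtr_pMr// ltr_pdivrMr// mul1r ltr_nat.
Qed.

Definition bump (d : R) (x : V) : R := flat 0 (d ^+ 2 - dotr x x).

Lemma bump_ge0 d x : 0 <= bump d x. Proof. exact: flat_ge0. Qed.

Lemma bump_eq0 d x : 0 <= d -> d <= enorm x -> bump d x = 0.
Proof.
move=> d0 dx; rewrite /bump /flat ltNge subr_le0 -sqr_enorm.
by rewrite ler_pXn2r ?nnegrE ?enorm_ge0// dx.
Qed.

Lemma bump_Cc d : 0 <= d -> Cc d (bump d).
Proof.
move=> d0; split=> [x|x dx]; last by rewrite bump_eq0// ltW.
have [G [_ h]] := bump_frechet (@bump_flat R n d 0).
have {}h := h x.
exact: frechet_continuous h.
Qed.

Lemma integral_bump_gt0 d : 0 < d -> 0 < \int[leb]_(x in [set: L]) bump d x.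
Proof.
move=> d0; have iB := Cc_integrable (bump_Cc (ltW d0)).
have d20 : 0 < d / 2 by rewrite divr_gt0.
pose D := eball (d / 2) : set L.
have mD : measurable D by apply: open_measurable; exact: open_eball.
pose t := d ^+ 2 - (d / 2) ^+ 2.
have t0 : 0 < t by rewrite /t (_ : _ - _ = d ^+ 2 * (3 / 4)); [rewrite mulr_gt0// exprn_gt0|field].
pose c := expR (- t^-1).
have cD x : D x -> c <= bump d x.
  move=> /= xD; have h : t <= d ^+ 2 - dotr x x.
    rewrite lerB// -sqr_enorm ler_pXn2r ?nnegrE ?enorm_ge0 ?(ltW d20)//.
    exact: ltW.
  have h0 := lt_le_trans t0 h.
  by rewrite /bump /flat h0 expr0 invr1 mul1r ler_expR lerN2 lef_pV2.
have fin : (leb D \is a fin_num)%E by rewrite ge0_fin_numE ?leb_ge0// eball_lty.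
apply: (@lt_le_trans _ _ (c * fine (leb D))).
  by rewrite mulr_gt0 ?expR_gt0// fine_gt0// leb_eball_gt0//= eball_lty.
rewrite -lee_fin /Rintegral fineK; last exact: integrable_fin_num.
rewrite EFinM fineK// -integral_cst//.
apply: (@le_trans _ _ (\int[leb]_(x in D) (bump d x)%:E)%E).
  apply: ge0_le_integral => //=.
  - by move=> x _; rewrite lee_fin expR_ge0.
  - by apply/measurable_EFinP; apply: continuous_measurable; exact: (bump_Cc (ltW d0)).1.
apply: ge0_subset_integral => //=.
- by apply/measurable_EFinP; apply: continuous_measurable; exact: (bump_Cc (ltW d0)).1.
- by move=> x _; rewrite lee_fin bump_ge0.
Qed.

Definition mollifier (d : R) (x : V) : R :=
  (\int[leb]_(x in [set: L]) bump d x)^-1 * bump d x.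

Lemma mollifier_ge0 d x : 0 < d -> 0 <= mollifier d x.
Proof. by move=> d0; rewrite mulr_ge0 ?bump_ge0// invr_ge0 ltW// integral_bump_gt0. Qed.

Lemma mollifier_eq0 d x : 0 < d -> d <= enorm x -> mollifier d x = 0.
Proof. by move=> d0 dx; rewrite /mollifier bump_eq0 ?mulr0// ltW. Qed.

Lemma mollifier_smooth d : smooth_on setT (mollifier d).
Proof.
by apply: (@bump_smooth _ _ d); apply: bump_mul; [exact: bump_cst|exact: bump_flat].
Qed.

Lemma mollifier_Cc d : 0 < d -> Cc d (mollifier d).
Proof.
move=> d0; split=> [x|x dx]; last by rewrite mollifier_eq0// ltW.
by apply: C1_continuous (smooth_on_C1 (mollifier_smooth d)) _ => //; exact: openT.
Qed.

Lemma mollifier_integrable d : 0 < d -> leb.-integrable [set: L] (EFin \o (mollifier d : L -> R)).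
Proof. by move=> d0; exact: Cc_integrable (mollifier_Cc d0). Qed.

Lemma integral_mollifier d : 0 < d -> \int[leb]_(x in [set: L]) mollifier d x = 1.
Proof.
move=> d0; rewrite /mollifier RintegralZl//; last exact: Cc_integrable (bump_Cc (ltW d0)).
by rewrite mulVf// gt_eqF// integral_bump_gt0.
Qed.

Lemma conv_mollifier_near r g (e : R) : Cc r g -> 0 < e ->
  \forall d \near (0 : R)^'+, forall x, `|conv 1 (mollifier d) g x - g x| <= e.
Proof.
move=> gC e0; have [d0 d00 hd] := Cc_unif_continuous gC e0.
near=> d => x; have dp : 0 < d by near: d; exact: nbhs_right_gt.
have dd : d < d0 by near: d; exact: nbhs_right_lt.
have iM := mollifier_integrable dp.
(* Cutting the oscillation of g to the ball that carries the mollifier does not change the integral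
   and makes the factor at most e everywhere. *)
pose u (y : L) := if enorm (y : V) < d then g ((y : V) + x) - g x else 0.
have -> : conv 1 (mollifier d) g x - g x = \int[leb]_(y in [set: L]) (mollifier d y * u y).
  rewrite -[X in _ - X]mul1r -[X in _ - X * _](integral_mollifier dp) -RintegralZr//.
  rewrite /conv -RintegralB//; last 2 first.
  - exact: integrable_conv gC.
  - by have := integrableZr measurableT (g x) iM; apply: eq_integrable.
  apply: eq_Rintegral => y _; rewrite /u scale1r -mulrBr; case: ltP => // dy.
  by rewrite mollifier_eq0// !mul0r.
have mu_ : measurable_fun setT u.
  apply: measurable_fun_ifT.
  - apply: measurable_fun_ltr; last exact: measurable_cst.
    by apply: continuous_measurable; exact: continuous_enorm.
  - apply: measurable_funB; last exact: measurable_cst.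
    by apply: continuous_measurable; apply: continuous_shift_arg; exact: gC.1.
  - exact: measurable_cst.
have ub (y : L) : [set: L] y -> `|u y| <= e.
  move=> _; rewrite /u; case: ltP => [yd|_]; last by rewrite normr0 ltW.
  by apply: hd; rewrite addrK (lt_trans yd).
apply: (le_trans (Rintegral_bounded_mul measurableT (ltW e0) iM mu_ ub)).
under eq_Rintegral do rewrite ger0_norm ?mollifier_ge0//.
by rewrite integral_mollifier// mulr1.
Unshelve. all: by end_near. Qed.

(** Translation by x. The left side is smooth since the mollifier is; the right side is close to g,
    and so are its derivatives when g is C1. *)
Lemma conv_swap r g d x : 0 < d -> Cc r g ->
  conv (- 1) g (mollifier d) x = conv 1 (mollifier d) g x.
Proof.
move=> d0 gC; have s1 : (0 : R) < 1 by [].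
have iF := integrable_conv (- 1) (Cc_integrable gC) x (mollifier_Cc d0).
have := Rintegral_affine x s1 iF; rewrite expr1n invr1 mul1r.
rewrite -[X in _ = X -> _]/(conv (- 1) g (mollifier d) x) => <-.
apply: eq_Rintegral => y _; rewrite /affine scale1r scaleN1r addrK scale1r.
by rewrite mulrC.
Qed.

Definition supp_in (a b : R) f := forall x, f x != 0 -> a <= enorm x <= b.

Lemma supp_in_Cc a b f : continuous f -> supp_in a b f -> Cc b f.
Proof.
move=> cf fs; split => // x bx; apply/eqP/negPn/negP => /fs /andP[_].
by rewrite leNgt bx.
Qed.

(** One approximant serves for the values and, when g is C1, for all first derivatives at once; the
    support grows by at most del on each side. *)
Lemma mollify a b g (e del : R) : continuous g -> supp_in a b g -> 0 < e -> 0 < del ->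
  exists phi : V -> R, [/\ smooth_on setT phi, supp_in (a - del) (b + del) phi,
    (forall x, `|phi x - g x| <= e) &
    (C1_on setT g -> forall i x, `|partial i phi x - partial i g x| <= e)].
Proof.
move=> cg gs e0 del0; have gC := supp_in_Cc cg gs.
have h1 := conv_mollifier_near gC e0.
have h2 : \forall d \near (0 : R)^'+, C1_on setT g -> forall i x,
    `|conv 1 (mollifier d) (partial i g) x - partial i g x| <= e.
  have [gC1|ngC1] := pselect (C1_on setT g); last by apply: nearW => d /ngC1.
  have gCC : C1c b g by split => //; exact: gC.2.
  have hh : \forall d \near (0 : R)^'+, forall i x,
      `|conv 1 (mollifier d) (partial i g) x - partial i g x| <= e.
    apply: filter_forall => i; exact: conv_mollifier_near (C1c_partial_Cc i gCC) e0.
  by apply: filterS hh => d hd _ i x; exact: hd.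
near (0 : R)^'+ => d.
have dp : 0 < d by near: d; exact: nbhs_right_gt.
have dd : d < del by near: d; exact: nbhs_right_lt.
have E : conv (- 1) g (mollifier d) = conv 1 (mollifier d) g.
  by apply/funext => x; exact: conv_swap gC.
exists (conv (- 1) g (mollifier d)); split.
- apply: (@conv_smooth _ _ _ _ (Cc_integrable gC) d).
  + by rewrite oppr_eq0 oner_eq0.
  + exact: mollifier_smooth.
  + by move=> x dx; rewrite mollifier_eq0// ltW.
- move=> x; apply: contraR => nx; apply/eqP; rewrite E /conv.
  transitivity (\int[leb]_(y in [set: L]) (0 : R)); last first.
    by rewrite Rintegral_cst// mul0r.
  apply: eq_Rintegral => y _; rewrite scale1r; have [yd|dy] := ltP (enorm (y : V)) d; last first.
    by rewrite mollifier_eq0// mul0r.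
  have -> : g ((y : V) + x) = 0; last by rewrite mulr0.
  apply/eqP/negPn/negP => /gs /andP[h3 h4]; move/negP: nx; apply.
  have := ler_enormD (y : V) x; have := ler_enormB ((y : V) + x) (y : V).
  rewrite addrAC subrr add0r => h5 h6; apply/andP; split; lra.
- by move=> x; rewrite E; move: x; near: d.
- move=> gC1 i x; have gCC : C1c b g by split => //; exact: gC.2.
  rewrite E (conv_partial (mollifier_integrable dp) i (oner_neq0 R) gCC) mul1r.
  have : C1_on setT g -> forall i x,
    `|conv 1 (mollifier d) (partial i g) x - partial i g x| <= e by near: d.
  exact.
Unshelve. all: by end_near. Qed.

Lemma supp_in_closure a b f : supp_in a b f ->
  closure [set x | f x != 0] `<=` [set x | a <= enorm x <= b].
Proof.
move=> fs; have cl : closed [set x : V | a <= enorm x <= b].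
  by apply: compact_closed; [exact: norm_hausdorff|exact: compact_annulus].
rewrite [X in _ `<=` X]((closure_id _).1 cl).
by apply: closure_subset => x /= /fs.
Qed.

Lemma smooth_test_function a b f (U : set V) : smooth_on setT f -> supp_in a b f ->
  [set x | a <= enorm x <= b] `<=` U -> test_function U f.
Proof.
move=> fs fab abU; split => //; last exact: subset_trans (supp_in_closure fab) abU.
apply: subclosed_compact (@compact_annulus _ _ a b) (supp_in_closure fab).
exact: closed_closure.
Qed.

End mollification.

(** * Supports and the fundamental lemma of the calculus of variations *)

Section support.
Context d (T : measurableType d) (R : realType) (mu : {measure set T -> \bar R}).
Implicit Types (D E : set T) (F : T -> R).

Lemma patch_eq_support D E F : (forall x, F x != 0 -> D x <-> E x) -> F \_ D = F \_ E.
Proof.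
move=> h; apply/funext => x; rewrite /patch.
have [->|/h DE] := eqVneq (F x) 0; first by case: ifP => _; case: ifP.
by rewrite (_ : (x \in D) = (x \in E))//; apply/idP/idP; rewrite !inE DE.
Qed.

Lemma Rintegral_eq_support D E F : (forall x, F x != 0 -> D x <-> E x) ->
  \int[mu]_(x in D) F x = \int[mu]_(x in E) F x.
Proof. by move=> h; rewrite Rintegral_mkcond (patch_eq_support h) -Rintegral_mkcond. Qed.

Lemma integrable_eq_support D E F : measurable D -> measurable E ->
  (forall x, F x != 0 -> D x <-> E x) ->
  mu.-integrable D (EFin \o F) -> mu.-integrable E (EFin \o F).
Proof.
move=> mD mE h /(integrable_mkcond _ mD) i; apply/(integrable_mkcond _ mE).
by move: i; rewrite !restrict_EFin (patch_eq_support h).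
Qed.

End support.

Section fundamental_lemma.
Context {R : realType} {n : nat}.
Local Notation V := 'rV[R]_n.
Local Notation L := (Leb R n).
Implicit Types (f g : V -> R) (x y : V).

Definition annulus (s t : R) : set V := [set x | s <= enorm x <= t].

Lemma annulus_measurable s t : measurable (annulus s t : set L).
Proof. by apply: compact_measurable; exact: compact_annulus. Qed.
Hint Resolve annulus_measurable : core.

Section bump_distance.
Variables (O : set V).

(** The distance to the complement of O, truncated at 1 so that the infimum is over a nonempty set
    even when O is the whole space. *)
Definition out_dist x : R :=
  inf [set t | t = 1 \/ exists2 y, ~ O y & t = enorm (x - y)].

Let D := out_dist.

Lemma out_dist_lb x : has_lbound [set t | t = 1 \/ exists2 y, ~ O y & t = enorm (x - y)].
Proof. by exists 0 => t [->//|[y _ ->]]; exact: enorm_ge0. Qed.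

Lemma out_dist_ge0 x : 0 <= D x.
Proof.
apply: lb_le_inf; first by exists 1; left.
by move=> t [->//|[y _ ->]]; exact: enorm_ge0.
Qed.

Lemma out_dist_eq0 x : ~ O x -> D x = 0.
Proof.
move=> Ox; apply/eqP; rewrite eq_le out_dist_ge0 andbT.
by apply: (ge_inf (out_dist_lb x)); right; exists x => //; rewrite subrr enorm0.
Qed.

Lemma out_dist_gt0 x : open O -> O x -> 0 < D x.
Proof.
move=> oO Ox; have /nbhs_enormP[e e0 he] : nbhs x O by exact: open_nbhs_nbhs.
apply: (@lt_le_trans _ _ (Num.min e 1)); first by rewrite lt_min e0 ltr01.
apply: lb_le_inf; first by exists 1; left.
move=> t [->|[y Oy ->]]; first by rewrite ge_min lexx orbT.
rewrite ge_min leNgt; apply/orP; left; apply/negP => xy; apply: Oy.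
by apply: he; rewrite -enormN opprB.
Qed.

Lemma out_dist_continuous : continuous D.
Proof.
have lip x z : D x <= D z + enorm (x - z).
  rewrite -lerBlDr; apply: lb_le_inf; first by exists 1; left.
  move=> t [->|[y Oy ->]]; rewrite lerBlDr.
    apply: (@le_trans _ _ 1); last by rewrite lerDl enorm_ge0.
    by apply: (ge_inf (out_dist_lb x)); left.
  apply: (@le_trans _ _ (enorm (x - y))).
    by apply: (ge_inf (out_dist_lb x)); right; exists y.
  by rewrite (_ : x - y = (z - y) + (x - z)); [exact: ler_enormD|rewrite (addrC (z - y)) addrA subrK].
move=> x; apply/(@cvgrPdist_le _ _ _ (nbhs x)) => e e0.
near=> z; have xz : enorm (z - x) < e by near: z; exact: near_enorm_lt.
have xz' : enorm (x - z) < e by rewrite -enormN opprB.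
have := lip x z; have := lip z x.
move: xz xz'; set s1 := enorm (z - x); set s2 := enorm (x - z) => xz xz' l1 l2.
by apply/ler_normlP; split; lra.
Unshelve. all: by end_near. Qed.

End bump_distance.

Variables (rho : R) (h : L -> R).
Hypothesis hloc : loc_integrable (exterior rho) h.
Hypothesis h0 : forall phi, test_function (exterior rho) phi ->
  \int[leb]_(x in (exterior rho : set L)) (h x * phi x) = 0.

Lemma exterior_measurable (s : R) : measurable (exterior s : set L).
Proof. by apply: open_measurable; exact: open_exterior. Qed.

Lemma loc_integrable_annulus s t : rho < s -> leb.-integrable (annulus s t : set L) (EFin \o h).
Proof.
move=> rs; apply: hloc; first exact: compact_annulus.
by move=> x /andP[sx _]; exact: lt_le_trans sx.
Qed.

Let rint_annulus s t g : rho < s -> supp_in s t g ->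
  \int[leb]_(x in (exterior rho : set L)) (h x * g x) =
  \int[leb]_(x in (annulus s t : set L)) (h x * g x).
Proof.
move=> rs gs; apply: Rintegral_eq_support => x hg.
have /gs xs : g x != 0 by apply: contra_neq hg => ->; rewrite mulr0.
split=> // _; rewrite /exterior /=; case/andP: xs => xs _; exact: lt_le_trans rs xs.
Qed.

(** A continuous function supported in an annulus is a uniform limit of test functions supported in
    a slightly larger annulus, on which h is integrable. *)
Lemma weak_zero_continuous a b g : rho < a -> continuous g -> supp_in a b g ->
  \int[leb]_(x in (exterior rho : set L)) (h x * g x) = 0.
Proof.
move=> ra cg gs; apply/eqP/negPn/negP; rewrite -normr_gt0.
set I := `| _ | => I0; pose del := (a - rho) / 2.
have del0 : 0 < del by rewrite divr_gt0// subr_gt0.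
have rs : rho < a - del by rewrite /del; lra.
pose K := annulus (a - del) (b + del) : set L.
have mK : measurable K by exact: annulus_measurable.
have iK : leb.-integrable K (EFin \o h) by exact: loc_integrable_annulus.
pose B := \int[leb]_(x in K) `|h x|.
have B0 : 0 <= B by apply: Rintegral_ge0.
have B1 : 0 < B + 1 by rewrite ltr_wpDl.
(* With this e the bound I <= e B contradicts I > 0. *)
have [e eE] : exists e, e = I / (B + 1) by exists (I / (B + 1)).
have e0 : 0 < e by rewrite eE divr_gt0.
have [phi [ps pab pe _]] := mollify cg gs e0 del0.
have gs' : supp_in (a - del) (b + del) g.
  move=> x /gs /andP[h1 h2]; apply/andP; split; [apply: le_trans h1|apply: le_trans h2 _]; lra.
have cphi : continuous phi.
  by move=> x; exact: (C1_continuous (@openT V) (smooth_on_C1 ps) Logic.I).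
have tphi : test_function (exterior rho) phi.
  apply: (smooth_test_function ps pab) => x /= /andP[ax _]; exact: lt_le_trans ax.
suff : I <= e * B.
  by rewrite eE mulrAC ler_pdivlMr// ler_pM2l//; move: B0; lra.
have [M M0 gM] := Cc_bound (supp_in_Cc cg gs).
have [N N0 pN] := Cc_bound (supp_in_Cc cphi pab).
have i1 : leb.-integrable K (EFin \o (fun x => h x * g x)).
  by apply: (@integrable_bounded_mul _ _ _ _ _ mK _ _ M) => //; exact: continuous_measurable.
have i2 : leb.-integrable K (EFin \o (fun x => h x * phi x)).
  by apply: (@integrable_bounded_mul _ _ _ _ _ mK _ _ N) => //; exact: continuous_measurable.
rewrite /I -[X in `|X|]subr0 -[X in _ - X](h0 tphi) (rint_annulus rs gs') (rint_annulus rs pab).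
rewrite -RintegralB//; under eq_Rintegral do rewrite -mulrBr.
apply: (Rintegral_bounded_mul mK (ltW e0) iK).
  by apply: measurable_funB; exact: continuous_measurable.
by move=> x _; rewrite distrC.
Qed.

(** The functions min(1, j dist(x, complement of O)) increase to the indicator of O and are
    admissible continuous functions; dominated convergence concludes. *)
Lemma weak_zero_open a b (O : set V) : rho < a -> open O -> O `<=` annulus a b ->
  \int[leb]_(x in (O : set L)) h x = 0.
Proof.
move=> ra oO Oab; pose K := annulus a b : set L.
have mK : measurable K by exact: annulus_measurable.
have iK : leb.-integrable K (EFin \o h) by exact: loc_integrable_annulus.
have mO : measurable (O : set L) by exact: open_measurable.
pose g j x : R := Num.min 1 (j%:R * out_dist O x).
have cg j : continuous (g j).
  move=> x; apply: (@continuous_min _ _ (fun=> 1) (fun x => j%:R * out_dist O x)).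
    exact: cst_continuous.
  by apply: continuousM; [exact: cst_continuous|exact: out_dist_continuous].
have g01 j x : 0 <= g j x <= 1.
  by rewrite /g le_min ler01 mulr_ge0 ?out_dist_ge0//= ge_min lexx.
have gs j : supp_in a b (g j).
  move=> x; apply: contra_neqT => xab; rewrite /g out_dist_eq0 ?mulr0 ?min_r//.
  by move=> /Oab; rewrite /annulus /= (negbTE xab).
have Z j : \int[leb]_(x in K) (h x * g j x) = 0.
  by rewrite -(rint_annulus ra (gs j)); exact: weak_zero_continuous (cg j) (gs j).
have ->: \int[leb]_(x in (O : set L)) h x = \int[leb]_(x in K) (h \_ (O : set L)) x.
  rewrite Rintegral_mkcond [RHS]Rintegral_mkcond; apply: eq_Rintegral => x _.
  rewrite /patch; case: (boolP (x \in K)) => // /negP xK; case: ifPn => // /set_mem /Oab.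
  by move=> /mem_set.
have mh := measurable_int _ iK.
have mh' : measurable_fun K h by exact/measurable_EFinP.
pose F j : L -> \bar R := EFin \o (fun x => h x * g j x).
have mF j : measurable_fun K (F j).
  by apply/measurable_EFinP; apply: measurable_funM => //; exact: continuous_measurable.
have cvg_g x : K x -> F j x @[j --> \oo] --> (EFin \o (h \_ (O : set L))) x.
  move=> _; rewrite /F /= /patch; case: ifPn => [/set_mem Ox|nOx].
    apply: cvg_near_cst; have D0 := out_dist_gt0 oO Ox.
    near=> j; rewrite /g min_l ?mulr1// -ler_pdivrMr//.
    by near: j; exact: nbhs_infty_ger.
  apply: cvg_near_cst; near=> j.
  by rewrite /g out_dist_eq0 ?mulr0 ?min_r ?mulr0// => /mem_set; apply/negP.
have := @dominated_cvg _ _ _ leb K mK F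
  (EFin \o (h \_ (O : set L))) (EFin \o (fun x => `|h x|)) mF cvg_g.
move=> lim; have zero j : (\int[leb]_(x in K) F j x = 0)%E.
  have i : leb.-integrable K (EFin \o (fun x => h x * g j x)).
    apply: (@integrable_bounded_mul _ _ _ _ _ mK _ _ 1) => //; first exact: continuous_measurable.
    by move=> x _; have /andP[? ?] := g01 j x; rewrite ger0_norm.
  by rewrite -(fineK (integrable_fin_num mK i)); congr EFin; exact: Z.
rewrite /Rintegral.
suff -> : (\int[leb]_(x in K) (h \_ (O : set L) x)%:E)%E = 0%E by [].
have {}lim : (\int[leb]_(x in K) F j x)%E @[j --> \oo] -->
   (\int[leb]_(x in K) (EFin \o (h \_ (O : set L))) x)%E.
  apply: lim => //; first exact: (integrable_norm iK).
  move=> j x _ /=; rewrite lee_fin normrM.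
  by have /andP[? ?] := g01 j x; rewrite (ger0_norm (_ : 0 <= g j x))// ler_piMr.
move: lim; under eq_fun do rewrite zero.
by move=> /(cvg_unique (@ereal_hausdorff R) (cvg_cst 0%E)) <-.
Unshelve. all: by end_near. Qed.


End fundamental_lemma.

Section fundamental_lemma2.
Context {R : realType} {n : nat}.
Local Notation V := 'rV[R]_n.
Local Notation L := (Leb R n).
Implicit Types (f g : V -> R) (x y : V).

(** The positive and negative parts of k are densities of two finite measures that agree on open
    sets, a class stable under intersection; they agree on Borel sets, then on measurable sets by
    hulls, so k integrates to 0 over every measurable set. *)
Lemma ae_eq0_integral_open (k : L -> R) : leb.-integrable [set: L] (EFin \o k) ->
  (forall O : set V, open O -> \int[leb]_(x in (O : set L)) k x = 0) ->
  leb ([set x | k x <> 0] : set L) = 0%E.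
Proof.
move=> ik k0; have mk : measurable_fun [set: L] k by apply/measurable_EFinP; exact: measurable_int ik.
pose wp (x : L) : R := Num.max (k x) 0; pose wn (x : L) : R := Num.max (-1 * k x) 0.
have mwp : measurable_fun [set: L] wp by apply: (measurable_maxr mk); exact: measurable_cst.
have mwn : measurable_fun [set: L] wn.
  apply: measurable_maxr; last exact: measurable_cst.
  by apply: measurable_funM => //; exact: measurable_cst.
have wp0 x : 0 <= wp x by rewrite le_max lexx orbT.
have wn0 x : 0 <= wn x by rewrite le_max lexx orbT.
have wpn x : k x = wp x - wn x.
  rewrite /wp /wn mulN1r; case: (leP 0 (k x)) => kx; first by rewrite max_r ?subr0// oppr_le0.
  by rewrite max_l ?sub0r ?opprK// oppr_ge0 ltW.
have iwp : leb.-integrable [set: L] (EFin \o wp).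
  apply: (le_integrable measurableT _ _ ik); first exact/measurable_EFinP.
  by move=> x _ /=; rewrite lee_fin ger0_norm// ge_max ler_norm normr_ge0.
have iwn : leb.-integrable [set: L] (EFin \o wn).
  apply: (le_integrable measurableT _ _ ik); first exact/measurable_EFinP.
  by move=> x _ /=; rewrite lee_fin ger0_norm// ge_max normr_ge0 andbT mulN1r -normrN ler_norm.
pose m01 := [the measure _ _ of density (@leb R n) wp]; pose m1 := m01 mwp wp0.
pose m02 := [the measure _ _ of density (@leb R n) wn]; pose m2 := m02 mwn wn0.
have iE (w : L -> R) (E : set L) : leb.-integrable [set: L] (EFin \o w) -> measurable E ->
    leb.-integrable E (EFin \o w) by move=> iw mE; exact: integrableS iw.
have RE (E : set L) : measurable E -> \int[leb]_(x in E) k x = fine (m1 E) - fine (m2 E).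
  move=> mE; rewrite /m1 /m2 /= /density -RintegralB//; [|exact: iE|exact: iE].
  by apply: eq_Rintegral => x _; exact: wpn.
have fin1 (E : set L) : measurable E -> m1 E \is a fin_num.
  by move=> mE; apply: integrable_fin_num => //; exact: iE.
have fin2 (E : set L) : measurable E -> m2 E \is a fin_num.
  by move=> mE; apply: integrable_fin_num => //; exact: iE.
have mO (O : set V) : open O -> measurable (O : set L) by exact: open_measurable.
have m12 : forall E : set V, borel E -> m1 E = m2 E.
  apply: (@g_sigma_algebra_measure_unique _ _ L open _ (fun=> setT)) => //.
  - by move=> _; exact: openT.
  - by rewrite bigcup_const//; exists 0%N.
  - exact: openI.
  - move=> O oO; rewrite -(fineK (fin1 _ (mO _ oO))) -(fineK (fin2 _ (mO _ oO))).
    by congr EFin; apply/eqP; rewrite -subr_eq0 -RE ?k0//; exact: mO.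
  - by move=> _; rewrite -ge0_fin_numE ?measure_ge0// fin1.
have nullm (w : L -> R) (N : set L) : measurable_fun setT w -> leb N = 0%E -> density leb w N = 0%E.
  move=> mw N0; apply: (null_set_integral (null_measurable N0) _ N0).
  by apply/measurable_EFinP; exact: measurable_funTS.
have m12' (E : set L) : measurable E -> m1 E = m2 E.
  move=> mE; have [B [bB EB B0]] := measurable_hull mE.
  have BE : (B : set L) = E `|` (B `\` E) by rewrite setDUK.
  have mN : measurable (B `\` E : set L) by exact: null_measurable.
  have e1 : m1 (B `\` E) = 0%E by exact: nullm.
  have e2 : m2 (B `\` E) = 0%E by exact: nullm.
  have EN : E `&` (B `\` E) = set0 by apply/seteqP; split => x //= -[Ex []].
  have := m12 _ bB; rewrite BE !measureU// => h.
  by rewrite -[m1 E]adde0 -[X in (_ + X)%E = _]e1 -[m2 E]adde0 -[X in _ = (_ + X)%E]e2.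
have h := @integral_ae_eq _ _ _ leb _ measurableT (cst 0%E) (EFin \o k) ik (measurable_cst _) _.
have : {ae (@leb R n), forall x, k x = 0}.
  suff : ae_eq leb setT (EFin \o k) (cst 0%E).
    by apply: filterS => x /(_ Logic.I) [].
  apply: h => F _ mF; rewrite integral0.
  have i := iE k F ik mF.
  rewrite -(fineK (integrable_fin_num mF i)); congr EFin.
  by transitivity (fine (m1 F) - fine (m2 F)); [exact: RE|rewrite m12'// subrr].
by move=> /aeP.
Qed.

End fundamental_lemma2.

Section weak_zero.
Context {R : realType} {n : nat}.
Local Notation V := 'rV[R]_n.
Local Notation L := (Leb R n).
Implicit Types (f g : V -> R) (x y : V).

Variables (rho : R) (h : L -> R).
Hypothesis hloc : loc_integrable (exterior rho) h.
Hypothesis h0 : forall phi, test_function (exterior rho) phi ->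
  \int[leb]_(x in (exterior rho : set L)) (h x * phi x) = 0.

(** The exterior is a countable union of open annuli with closure inside it, on each of which the
    restriction of h is integrable. *)
Lemma weak_zero : leb ([set x | rho < enorm x /\ h x <> 0] : set L) = 0%E.
Proof.
pose s k : R := rho + k.+1%:R^-1.
have s_gt k : rho < s k by rewrite /s ltrDl invr_gt0.
pose A k := (exterior (s k) `&` eball k%:R : set V).
have oA k : open (A k) by apply: openI; [exact: open_exterior|exact: open_eball].
have mA k : measurable (A k : set L) by exact: open_measurable.
have AK k : A k `<=` annulus (s k) k%:R.
  by move=> x [h1 h2]; rewrite /annulus /= (ltW h1) (ltW h2).
have Z k : leb ([set x | (h \_ (A k : set L)) x <> 0] : set L) = 0%E.
  apply: ae_eq0_integral_open.
    rewrite -restrict_EFin; apply/(integrable_mkcond _ (mA k)).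
    exact: (integrableS (annulus_measurable _ _) (mA k) (@AK k) (loc_integrable_annulus hloc _ (s_gt k))).
  move=> O oO; transitivity (\int[leb]_(x in (O `&` A k : set L)) h x).
    rewrite (Rintegral_mkcond _ (O : set L)) (Rintegral_mkcond _ (O `&` A k : set L)).
    apply: eq_Rintegral => x _.
    rewrite /patch (_ : (x \in (O `&` A k : set L)) = (x \in O) && (x \in (A k : set L))).
      by case: (x \in O).
    by rewrite -in_setI.
  by apply: (weak_zero_open hloc h0 (s_gt k) (openI oO (oA k))); apply: subset_trans (AK k); exact: subIsetr.
apply: (@subset_null _ _ _ (\bigcup_k [set x : V | (h \_ (A k : set L)) x <> 0])); last first.
  apply/eqP; rewrite eq_le leb_ge0 andbT.
  apply: (le_trans (outer_measure_sigma_subadditive (@lebesgue_outer R n) _)).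
  by rewrite eseries0// => k _ _; exact: Z.
move=> x [rx hx].
have [N hN] : exists k : nat, k.+1%:R^-1 < enorm x - rho.
  by apply: exists_natSinv_lt; rewrite subr_gt0.
exists (maxn N (Num.trunc (enorm x)).+1) => //=; rewrite /patch mem_set//; split.
  rewrite /exterior /= /s -ltrBrDl; apply: le_lt_trans hN.
  by rewrite lef_pV2 ?posrE// ler_nat ltnS leq_maxl.
rewrite /eball /=; apply: (@lt_le_trans _ _ (Num.trunc (enorm x)).+1%:R).
  exact: truncnS_gt.
by rewrite ler_nat leq_maxr.
Qed.

End weak_zero.

(** * Weak gradients and test functions in exterior domains *)

Section local_weak_forms.
Context {R : realType} {n : nat}.
Local Notation V := 'rV[R]_n.
Local Notation L := (Leb R n).
Implicit Types (f g phi : V -> R) (x y : V) (U K : set V).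

Lemma closed_annulus s t : closed (@annulus R n s t).
Proof. by apply: compact_closed; [exact: norm_hausdorff|exact: compact_annulus]. Qed.

Lemma annulus_exterior rho s t : rho < s -> @annulus R n s t `<=` exterior rho.
Proof. by move=> rs x /andP[sx _]; exact: lt_le_trans sx. Qed.

(** The product vanishes on the open complement of K, which together with U covers the space, so the
    behavior of f outside U does not matter. *)
Lemma C1_on_extend U f phi K : open U -> C1_on U f -> C1_on setT phi ->
  closed K -> K `<=` U -> (forall x, ~ K x -> phi x = 0) ->
  C1_on setT (fun x => f x * phi x) /\
  (forall x, U x ->
     grad (fun x => f x * phi x) x = phi x *: grad f x + f x *: grad phi x).
Proof.
move=> oU fU phiC cK KU phi0.
have [h1 h2] := C1_onM oU fU (C1_onS (@subsetT _ U) phiC).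
split=> // x _; have [Ux|nUx] := pselect (U x); first exact: h1.
have oC : open (~` K) by exact: closed_openC.
have [c _] := C1_on_cst (0 : R) oC.
have e y : (~` K) y -> 0 = f y * phi y by move=> Ky; rewrite phi0// mulr0.
by have [h _] := eq_C1_on oC e c; apply: h => /KU.
Qed.

Lemma supp_in_notin a b phi x : supp_in a b phi -> ~ annulus a b x -> phi x = 0.
Proof. by move=> ps xab; apply/eqP/negPn/negP => /ps. Qed.

Lemma supp_in_grad a b phi x : supp_in a b phi -> ~ annulus a b x -> grad phi x = 0.
Proof.
move=> ps xab; apply: (@grad_eq0 _ _ (~` annulus a b)) => //.
  by apply: closed_openC; exact: closed_annulus.
by move=> y; exact: supp_in_notin.
Qed.

Lemma supp_in_partial a b phi i : supp_in a b phi -> supp_in a b (partial i phi).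
Proof.
move=> ps x; apply: contra_neqT => /negP xab.
by have := supp_in_grad ps xab => /rowP/(_ i); rewrite !mxE.
Qed.

Lemma C1_on_extend_supp U f phi a b : open U -> C1_on U f -> C1_on setT phi ->
  supp_in a b phi -> annulus a b `<=` U ->
  [/\ C1_on setT (fun x => f x * phi x), supp_in a b (fun x => f x * phi x) &
  (forall x, U x ->
     grad (fun x => f x * phi x) x = phi x *: grad f x + f x *: grad phi x)].
Proof.
move=> oU fU phiC ps abU.
have [h1 h2] := C1_on_extend oU fU phiC (@closed_annulus a b) abU (fun x => supp_in_notin ps).
split=> // x fx; apply: ps; apply: contra_neq fx => ->; exact: mulr0.
Qed.

Lemma supp_in_C1c a b phi : C1_on setT phi -> supp_in a b phi -> C1c b phi.
Proof.
by move=> h ps; split=> // x bx; apply: (supp_in_notin ps) => /andP[_]; rewrite leNgt bx.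
Qed.

Lemma C1_setT_continuous phi : C1_on setT phi -> continuous phi.
Proof. by move=> h x; exact: (C1_continuous (@openT V) h Logic.I). Qed.

Lemma C1_setT_continuous_partial phi i : C1_on setT phi -> continuous (partial i phi).
Proof. by move=> h x; have [] := h x Logic.I i. Qed.

Lemma compact_enorm_le K : compact K -> exists M : R, forall x, K x -> enorm x <= M.
Proof.
move=> cK; have [M _ h] := compact_bound cK (fun x _ => @continuous_enorm R n x).
by exists M => x Kx; apply: le_trans (ler_norm _) (h x Kx).
Qed.

(** The continuous function 1/(|x| - rho) is bounded on the compact support, which keeps the support
    at a positive distance from the inner sphere. *)
Lemma test_function_supp_in rho phi : test_function (exterior rho) phi ->
  exists a b, rho < a /\ supp_in a b phi.
Proof.
move=> [_ cK KU]; set K := closure _ in cK KU.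
have [b hb] := compact_enorm_le cK.
have [N N0 hN] : exists2 N : R, 0 <= N & forall x, K x -> `|(enorm x - rho)^-1| <= N.
  apply: compact_bound => // x /KU rx.
  apply: (@continuousV _ _ (fun x => enorm x - rho)); first by rewrite gt_eqF// subr_gt0.
  by apply: (@continuousB _ _ _ (fun x => enorm x) (fun=> rho));
    [exact: continuous_enorm|exact: cst_continuous].
exists (rho + (N + 1)^-1), b; split; first by rewrite ltrDl invr_gt0 ltr_wpDl.
move=> x fx; have Kx : K x by exact: subset_closure.
rewrite (hb x Kx) andbT -lerBrDl.
have x0 : 0 < enorm x - rho by rewrite subr_gt0; exact: KU.
have := hN x Kx; rewrite ger0_norm ?invr_ge0 ?(ltW x0)// => h.
have N1 : 0 < N + 1 by rewrite ltr_wpDl.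
rewrite -[leRHS]invrK lef_pV2 ?posrE ?invr_gt0//.
by apply: le_trans h _; rewrite lerDl.
Qed.

Lemma test_functionS U U' phi : U `<=` U' -> test_function U phi -> test_function U' phi.
Proof. by move=> UU' [h1 h2 h3]; split => //; exact: subset_trans UU'. Qed.

Lemma continuous_loc_integrable U g : open U ->
  (forall x, U x -> {for x, continuous g}) -> loc_integrable U g.
Proof.
move=> oU cg K cK KU; have mK : measurable (K : set L) by exact: compact_measurable.
have [M hM] := compact_enorm_le cK.
have [N N0 hN] := compact_bound cK (fun x Kx => cg x (KU x Kx)).
apply: measurable_bounded_integrable => //.
- exact: (@bounded_lty _ _ K M).
- apply: (@measurable_funS _ _ _ _ (U : set L)) => //; first exact: open_measurable.
  exact: open_continuous_measurable.
- exists N; split; first exact: num_real.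
  by move=> z Nz x Kx; apply: le_trans (hN x Kx) (ltW Nz).
Qed.

Lemma loc_integrableS U U' g : U `<=` U' -> loc_integrable U' g -> loc_integrable U g.
Proof. by move=> UU' h K cK KU; apply: h => //; exact: subset_trans UU'. Qed.

Lemma loc_integrableB U f g : loc_integrable U f -> loc_integrable U g ->
  loc_integrable U (fun x => f x - g x).
Proof.
move=> hf hg K cK KU; have mK : measurable (K : set L) by exact: compact_measurable.
have := integrableB mK (hf K cK KU) (hg K cK KU); exact: eq_integrable.
Qed.

Lemma Rintegral_null_eq (D : set L) (f g : L -> R) : measurable D ->
  measurable_fun D f -> leb [set x | D x /\ f x <> g x] = 0%E ->
  \int[leb]_(x in D) f x = \int[leb]_(x in D) g x.
Proof.
move=> mD mf fg; have mg : measurable_fun D g by apply: ae_eq_measurable_fun fg mf.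
congr fine; apply: ae_eq_integral; [exact: mD|exact/measurable_EFinP|exact/measurable_EFinP|].
apply/aeP; apply: subset_null fg => x /=.
by move=> h; apply: contrapT => h2; apply: h => Dx; congr EFin; apply: contrapT => fgx; apply: h2.
Qed.

(** Against a test function, both the weak gradient of u and the gradient of v integrate by parts to
    the same quantity because u = v almost everywhere; the fundamental lemma identifies them. *)
Lemma weak_gradient_C1 (r0 M : R) (u v : V -> R) (Du : V -> V) : r0 <= M ->
  weak_gradient (exterior r0) u Du -> C1_on (exterior M) v ->
  leb ([set x | M < enorm x /\ u x <> v x] : set L) = 0%E ->
  forall i, leb ([set x | M < enorm x /\ Du x 0 i <> grad v x 0 i] : set L) = 0%E.
Proof.
move=> rM [iu iDu hu] vC uv i.
have oM : open (exterior M : set V) by exact: open_exterior.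
have SM : exterior M `<=` (exterior r0 : set V) by move=> x; exact: le_lt_trans.
have iv : loc_integrable (exterior M) (fun x => grad v x 0 i).
  by apply: continuous_loc_integrable => // x Mx; exact: C1_continuous_grad vC Mx.
have iD : loc_integrable (exterior M) (fun x => Du x 0 i) by exact: loc_integrableS (iDu i).
have hz := @weak_zero R n M (fun x => Du x 0 i - grad v x 0 i) (loc_integrableB iD iv).
apply: (@subset_null _ _ _ _ _ (hz _)).
  by move=> x [Mx h]; split => // /eqP; rewrite subr_eq0 => /eqP.
move=> {hz} phi tphi; have [a [b [Ma ps]]] := test_function_supp_in tphi.
have phiC : C1_on setT phi by case: tphi => h _ _; exact: smooth_on_C1.
have aU := annulus_exterior (t:=b) Ma.
have [N N0 hN] := Cc_bound (supp_in_Cc (C1_setT_continuous phiC) ps).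
have [N' N'0 hN'] := Cc_bound (supp_in_Cc (C1_setT_continuous_partial (i:=i) phiC) (supp_in_partial (i:=i) ps)).
pose K := annulus a b : set L.
have mK : measurable K by exact: annulus_measurable.
have cK : compact (annulus a b : set V) by exact: compact_annulus.
have mphi : measurable_fun K phi by apply: continuous_measurable; exact: C1_setT_continuous.
have mdphi : measurable_fun K (partial i phi).
  by apply: continuous_measurable; exact: C1_setT_continuous_partial.
have i1 : leb.-integrable K (EFin \o (fun x => Du x 0 i * phi x)).
  by apply: (@integrable_bounded_mul _ _ _ _ _ mK _ _ N _ mphi) => //; exact: iD.
have i2 : leb.-integrable K (EFin \o (fun x => grad v x 0 i * phi x)).
  by apply: (@integrable_bounded_mul _ _ _ _ _ mK _ _ N _ mphi) => //; exact: iv.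
have i3 : leb.-integrable K (EFin \o (fun x => u x * partial i phi x)).
  apply: (@integrable_bounded_mul _ _ _ _ _ mK _ _ N' _ mdphi) => //.
  by apply: iu => //; exact: subset_trans SM.
have vloc : loc_integrable (exterior M) v.
  by apply: continuous_loc_integrable => // x Mx; exact: C1_continuous vC Mx.
have i4 : leb.-integrable K (EFin \o (fun x => v x * partial i phi x)).
  by apply: (@integrable_bounded_mul _ _ _ _ _ mK _ _ N' _ mdphi) => //; exact: vloc.
have [vphiC vphis gvphi] := C1_on_extend_supp oM vC phiC ps aU.
have H0 := integral_partial_eq0 i (supp_in_C1c vphiC vphis).
have in_supp F x : supp_in a b F -> F x != 0 -> K x by move=> h; exact: h.
have e1 : \int[leb]_(x in (exterior M : set L)) ((Du x 0 i - grad v x 0 i) * phi x) =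
    \int[leb]_(x in K) (Du x 0 i * phi x) - \int[leb]_(x in K) (grad v x 0 i * phi x).
  rewrite -RintegralB//; transitivity (\int[leb]_(x in K) ((Du x 0 i - grad v x 0 i) * phi x)).
    apply: Rintegral_eq_support => x; rewrite mulf_eq0 negb_or => /andP[_ /ps Kx].
    by split=> // _; exact: aU.
  by apply: eq_Rintegral => x _; rewrite mulrBl.
have e2 : \int[leb]_(x in K) (Du x 0 i * phi x) = - \int[leb]_(x in K) (u x * partial i phi x).
  apply/eqP; rewrite -eqr_oppLR; apply/eqP.
  transitivity (- \int[leb]_(x in (exterior r0 : set L)) (Du x 0 i * phi x)).
    congr (- _); apply: Rintegral_eq_support => x; rewrite mulf_eq0 negb_or => /andP[_ /ps Kx].
    by split=> // _; apply/SM/aU.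
  rewrite -(hu phi (test_functionS SM tphi) i); apply: Rintegral_eq_support => x.
  rewrite mulf_eq0 negb_or => /andP[_ /(supp_in_partial ps) Kx].
  by split=> // _; apply/SM/aU.
have e3 : \int[leb]_(x in K) (u x * partial i phi x) = \int[leb]_(x in K) (v x * partial i phi x).
  apply: (Rintegral_null_eq mK); first by apply/measurable_EFinP; exact: measurable_int i3.
  apply: subset_null uv => x [Kx h]; split; first exact: aU.
  by move=> uvx; apply: h; rewrite uvx.
have e4 : \int[leb]_(x in K) (v x * partial i phi x) + \int[leb]_(x in K) (grad v x 0 i * phi x) = 0.
  rewrite -RintegralD// -[RHS]H0; symmetry.
  transitivity (\int[leb]_(x in K) partial i (fun x => v x * phi x) x).
    apply: Rintegral_eq_support => x /(supp_in_partial vphis) Kx; split => //.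
  apply: eq_Rintegral => x /set_mem Kx; have /rowP/(_ i) := gvphi x (aU x Kx).
  by rewrite !mxE => ->; rewrite addrC (mulrC (phi x)).
by rewrite e1 e2 e3; move: e4; lra.
Qed.

(** A test function bounded below on an annulus, by which integrability of F phi turns into
    integrability of F there. *)
Lemma plateau_test_function (rho s t : R) : rho < s ->
  exists2 phi, test_function (exterior rho) phi &
    forall x : V, annulus s t x -> 1 / 2 <= phi x.
Proof.
(* A third of the gap for the slope of g, a third for the mollification, and a third to stay outside
   the sphere of radius rho. *)
move=> rs; pose d := (s - rho) / 3; have d0 : 0 < d by rewrite divr_gt0// subr_gt0.
pose m x := Num.max (Num.max (s - enorm x) (enorm x - t)) 0.
pose g x := Num.max 0 (1 - m x / d).
have cm : continuous m.
  move=> x; apply: (@continuous_max _ _ (fun x => Num.max (s - enorm x) (enorm x - t)) (fun=> 0));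
    last exact: cst_continuous.
  apply: (@continuous_max _ _ (fun x => s - enorm x) (fun x => enorm x - t)).
    by apply: (@continuousB _ _ _ (fun=> s) (fun x => enorm x));
      [exact: cst_continuous|exact: continuous_enorm].
  by apply: (@continuousB _ _ _ (fun x => enorm x) (fun=> t));
    [exact: continuous_enorm|exact: cst_continuous].
have cg : continuous g.
  move=> x; apply: (@continuous_max _ _ (fun=> 0) (fun x => 1 - m x / d)); first exact: cst_continuous.
  apply: (@continuousB _ _ _ (fun=> 1 : R) (fun x => m x / d)); first exact: cst_continuous.
  by apply: (@continuousM _ _ m (fun=> d^-1)); [exact: cm|exact: cst_continuous].
have gs : supp_in (s - d) (t + d) g.
  move=> x gx; have : m x < d.
    rewrite ltNge; apply: contra_neqN gx => dm; rewrite /g max_l// subr_le0.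
    by rewrite ler_pdivlMr// mul1r.
  rewrite /m !gt_max => /andP[/andP[h1 h2] _]; apply/andP; split; lra.
have e0 : (0 : R) < 1 / 2 by rewrite divr_gt0.
have [phi [p1 p2 p3 _]] := mollify cg gs e0 d0.
exists phi.
  apply: (smooth_test_function p1 p2); apply: (@annulus_exterior rho).
  by rewrite /d; lra.
move=> x /andP[sx xt]; have := p3 x.
have -> : g x = 1.
  have mx : m x = 0 by rewrite /m [LHS]max_r// ge_max !subr_le0 sx xt.
  by rewrite /g mx mul0r subr0 max_r.
by move=> /ler_normlP[]; lra.
Qed.

End local_weak_forms.

(** * Second-order expansion of the p-Laplace flux *)

Section plaplace_linearization.
Context {R : realType}.

Lemma real_mvt (F dF : R -> R) (a b : R) :
  (forall t : R, `|t - a| <= `|b - a| -> is_derive t 1 F (dF t)) ->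
  exists2 c : R, `|c - a| <= `|b - a| & F b - F a = dF c * (b - a).
Proof.
move=> dFt.
have cF (x y : R) : (forall t : R, x <= t <= y -> `|t - a| <= `|b - a|) -> {within `[x, y], continuous F}.
  move=> hbc; apply: derivable_within_continuous => t.
  by rewrite in_itv/= => /hbc /dFt [].
have [ab|ba] := leP a b.
  have H (t : R) : a <= t <= b -> `|t - a| <= `|b - a|.
    by move=> /andP[t0 th]; rewrite !ger0_norm ?subr_ge0 ?lerB.
  have [t||t tI E] := @MVT_segment R F dF a b ab.
  - by rewrite in_itv/= => /andP[/ltW t0 /ltW th]; apply/dFt/H; rewrite t0.
  - exact: cF.
  - by exists t => //; apply: H; move: tI; rewrite in_itv.
have H (t : R) : b <= t <= a -> `|t - a| <= `|b - a|.
  move=> /andP[th t0]; rewrite !ler0_norm ?subr_le0 ?(ltW ba)//.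
  by rewrite lerN2 lerB.
have [t||t tI E] := @MVT_segment R F dF b a (ltW ba).
- by rewrite in_itv/= => /andP[/ltW t0 /ltW th]; apply/dFt/H; rewrite t0.
- exact: cF.
- exists t; first by apply: H; move: tI; rewrite in_itv.
  by rewrite -opprB E -mulrN opprB.
Qed.

Lemma powR_le_ends (e m M t : R) : 0 < m -> m <= t -> t <= M ->
  t `^ e <= m `^ e + M `^ e.
Proof.
move=> m0 mt tM; have t0 := lt_le_trans m0 mt; have M0 := lt_le_trans t0 tM.
have [e0|e0] := leP 0 e.
  apply: (@le_trans _ _ (M `^ e)); last by rewrite lerDr powR_ge0.
  by apply: ge0_ler_powR => //; rewrite nnegrE ltW.
apply: (@le_trans _ _ (m `^ e)); last by rewrite lerDl powR_ge0.
rewrite -[e]opprK powRN [leRHS]powRN lef_pV2 ?posrE ?powR_gt0//.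
by apply: ge0_ler_powR => //; rewrite ?nnegrE ?oppr_ge0 ltW.
Qed.

Lemma powR_bounds (e m M : R) : 0 < m -> exists2 K : R, 0 < K &
  forall t, m <= t -> t <= M -> K^-1 <= t `^ e <= K.
Proof.
move=> m0; pose K := (m `^ e + M `^ e) + (m `^ (- e) + M `^ (- e)).
have h1 : 0 <= m `^ e + M `^ e by rewrite addr_ge0 ?powR_ge0.
have h2 : 0 < m `^ (- e) + M `^ (- e) by rewrite ltr_pwDl ?powR_gt0 ?powR_ge0.
have K0 : 0 < K by rewrite /K ltr_wpDl.
exists K => // t mt tM; have t0 := lt_le_trans m0 mt.
apply/andP; split; last by apply: le_trans (powR_le_ends e m0 mt tM) _; rewrite /K lerDl ltW.
rewrite -[leRHS]invrK lef_pV2 ?posrE ?invr_gt0 ?powR_gt0// -powRN.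
by apply: le_trans (powR_le_ends (- e) m0 mt tM) _; rewrite /K lerDr.
Qed.

(** The mean value theorem twice: for t^s - s t, and then for t^(s-1), on the interval around 1
    where powers are bounded. *)
Lemma powR_taylor (s : R) : exists2 C : R, 0 <= C & forall t, `|t - 1| <= 1 / 2 ->
  `|t `^ s - 1 - s * (t - 1)| <= C * `|t - 1| ^+ 2.
Proof.
have h0 : (0 : R) < 1 / 2 by rewrite divr_gt0.
have [K K0 hK] := powR_bounds (s - 1 - 1) (3 / 2) h0.
exists (`|s| * (`|s - 1| * K)) => [|t ht]; first by rewrite !mulr_ge0// ltW.
have pos (c : R) : `|c - 1| <= `|t - 1| -> 0 < c by move=> hc; have := le_trans hc ht => /ler_normlP[]; lra.
have [c hc E] : exists2 c, `|c - 1| <= `|t - 1| &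
    (t `^ s - s * t) - (1 `^ s - s * 1) = (s * c `^ (s - 1) - s) * (t - 1).
  apply: (@real_mvt (fun t => t `^ s - s * t) (fun c => s * c `^ (s - 1) - s)) => c /pos c0.
  have d1 : is_derive c 1 (@powR R ^~ s) (s * c `^ (s - 1)) by exact: is_derive1_powR.
  have d2 : is_derive c 1 (fun t : R => s * t) s.
    have := is_deriveZ s (is_derive_id c (1 : R)).
    by rewrite /GRing.scale /= mulr1.
  exact: is_deriveB.
have [d hd E'] : exists2 d, `|d - 1| <= `|c - 1| &
    c `^ (s - 1) - 1 `^ (s - 1) = ((s - 1) * d `^ (s - 1 - 1)) * (c - 1).
  apply: (@real_mvt (fun t => t `^ (s - 1))) => d hd.
  by apply: is_derive1_powR; apply: pos; exact: le_trans hd hc.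
rewrite !powR1 mulr1 in E E'.
have -> : t `^ s - 1 - s * (t - 1) = s * ((s - 1) * d `^ (s - 1 - 1)) * (c - 1) * (t - 1).
  transitivity ((t `^ s - s * t) - (1 - s)); first by ring.
  rewrite E (_ : c `^ (s - 1) = 1 + (s - 1) * d `^ (s - 1 - 1) * (c - 1)); first by ring.
  by rewrite -E' addrCA subrr addr0.
rewrite !normrM expr2 [leRHS]mulrA ler_wpM2r// ler_pM// ?mulr_ge0//.
rewrite ler_wpM2l// ler_wpM2l// ger0_norm ?powR_ge0//.
have := le_trans (le_trans hd hc) ht => /ler_normlP[d1 d2].
by have /andP[] : K^-1 <= d `^ (s - 1 - 1) <= K by apply: hK; lra.
Qed.

(** Here s stands for X . Y/|X|^2, t for |Y|/|X|, and T is the ratio of |X + Y|^(p-2) to |X|^(p-2).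
    The three claims are the size, the coercivity and the expansion along X of the flux increment,
    divided by the appropriate powers of |X|. *)
Lemma plaplace_scalar (p : R) : 1 < p -> exists d c C : R,
  [/\ 0 < d <= 1, 0 < c, 0 <= C & forall s t, 0 <= t -> t <= d -> `|s| <= t ->
   let T := (1 + 2 * s + t ^+ 2) `^ ((p - 2) / 2) in
   [/\ `|T - 1| <= C * t, c * t ^+ 2 <= (T - 1) * s + T * t ^+ 2 &
       `|T * (1 + s) - 1 - (p - 1) * s| <= C * t ^+ 2]].
Proof.
move=> p1; set e := (p - 2) / 2; have pe : p = 2 * e + 2 by rewrite /e; field.
have [C0 C00 hC] := powR_taylor e.
pose K := `|e| + 9 * C0; have K0 : 0 <= K by rewrite addr_ge0// mulr_ge0.
(* The coercivity constant: t^2 + (p-2) s^2 >= m t^2 because |s| <= t, with the worst case at s = 0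
   if p >= 2 and at |s| = t otherwise. *)
pose m := Num.min 1 (p - 1); have m0 : 0 < m by rewrite lt_min ltr01 subr_gt0.
pose Q := 2 * K + 2 * `|e| + 1.
have Q0 : 0 < Q by rewrite /Q ltr_wpDl// addr_ge0// mulr_ge0.
(* The bound 1/6 puts |X + Y|^2/|X|^2 within 1/2 of 1; the other one makes all cubic errors at most
   (m/2) t^2. *)
pose d := Num.min (1 / 6) (m / (2 * Q)).
have d0 : 0 < d by rewrite lt_min !divr_gt0// mulr_gt0.
have d6 : d <= 1 / 6 by rewrite ge_min lexx.
have dQ : Q * d <= m / 2.
  rewrite mulrC -ler_pdivlMr// (_ : m / 2 / Q = m / (2 * Q)); last by rewrite invfM mulrA.
  by rewrite ge_min lexx orbT.
exists d, (m / 2), (Q + K); split => //; first by rewrite d0/=; lra.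
- by rewrite divr_gt0.
- by rewrite addr_ge0// ltW.
move=> s t t0 td st T; have t1 : t <= 1 by lra.
have t2 : 0 <= t ^+ 2 by rewrite exprn_ge0.
have t2t : t ^+ 2 <= t by rewrite expr2 ler_piMr.
have en : 0 <= `|e| by exact: normr_ge0.
have st' := st; move: st' => /ler_normlP[s1 s2].
pose u := 1 + 2 * s + t ^+ 2.
have u1 : `|u - 1| <= 3 * t by apply/ler_normlP; rewrite /u; split; lra.
have u2 : `|u - 1| <= 1 / 2 by apply: le_trans u1 _; lra.
(* The second-order remainder of T, of size K t^2, since u - 1 = 2 s + t^2. *)
pose k := T - 1 - 2 * e * s.
have kK : `|k| <= K * t ^+ 2.
  rewrite (_ : k = e * t ^+ 2 + (T - 1 - e * (u - 1))); last by rewrite /k /u; ring.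
  apply: le_trans (ler_normD _ _) _; rewrite normrM (ger0_norm t2) mulrDl lerD2l.
  apply: le_trans (hC u u2) _; rewrite [9 * C0]mulrC -mulrA ler_wpM2l//.
  have : `|u - 1| ^+ 2 <= (3 * t) ^+ 2 by rewrite ler_pXn2r ?nnegrE// mulr_ge0.
  by rewrite exprMn (_ : 3 ^+ 2 = 9)//; ring.
have TE : T = 1 + 2 * e * s + k by rewrite /k; ring.
have kt : `|k| <= K * t by apply: le_trans kK _; rewrite ler_wpM2l.
have es : `|2 * e * s| <= 2 * `|e| * t by rewrite !normrM (ger0_norm (_ : 0 <= 2))// ler_wpM2l// mulr_ge0.
have ks : `|k * s| <= K * t ^+ 2 * t by rewrite normrM ler_pM.
have ks' : `|k * s| <= K * t ^+ 2 by apply: le_trans ks _; rewrite ler_piMr// mulr_ge0.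
have kt2 : `|k * t ^+ 2| <= K * t ^+ 2 * t.
  by rewrite normrM (ger0_norm t2) mulrAC ler_wpM2r.
have est2 : `|2 * e * s * t ^+ 2| <= 2 * `|e| * t ^+ 2 * t.
  by rewrite normrM (ger0_norm t2) [leRHS]mulrAC ler_wpM2r.
have ss : s ^+ 2 <= t ^+ 2 by rewrite -(real_normK (num_real s)) ler_pXn2r ?nnegrE.
have ess : `|2 * e * s ^+ 2| <= 2 * `|e| * t ^+ 2.
  by rewrite normrM (ger0_norm (sqr_ge0 s)) normrM (ger0_norm (_ : 0 <= 2))// ler_wpM2l// mulr_ge0.
split.
- rewrite TE (_ : _ - 1 = 2 * e * s + k); last by ring.
  apply: le_trans (ler_normD _ _) _; apply: le_trans (lerD es kt) _.
  rewrite -mulrDl ler_wpM2r// /Q; move: K0 en; lra.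
- rewrite TE (_ : _ * s + _ = (t ^+ 2 + 2 * e * s ^+ 2) + (k * s + 2 * e * s * t ^+ 2 + k * t ^+ 2)); last by ring.
  have main : m * t ^+ 2 <= t ^+ 2 + 2 * e * s ^+ 2.
    have [e0|e0] := leP 0 e.
      apply: (@le_trans _ _ (1 * t ^+ 2)); first by rewrite ler_wpM2r// /m ge_min lexx.
      by rewrite mul1r lerDl mulr_ge0 ?sqr_ge0// mulr_ge0.
    apply: (@le_trans _ _ ((p - 1) * t ^+ 2)); first by rewrite ler_wpM2r// /m ge_min lexx orbT.
    have : 0 <= - e * (t ^+ 2 - s ^+ 2) by rewrite mulr_ge0 ?subr_ge0// oppr_ge0 ltW.
    by rewrite pe; lra.
  have rest : Q * d * t ^+ 2 <= m / 2 * t ^+ 2 by rewrite ler_wpM2r.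
  have Qt : (2 * K + 2 * `|e|) * t ^+ 2 * t <= Q * d * t ^+ 2.
    rewrite -mulrA (mulrC _ t) mulrA ler_wpM2r// ler_pM//; last by rewrite /Q lerDl.
    by rewrite addr_ge0// mulr_ge0.
  move: ks est2 kt2 => /ler_normlP[a1 _] /ler_normlP[a2 _] /ler_normlP[a3 _]; lra.
- rewrite TE (_ : _ - _ = k + 2 * e * s ^+ 2 + k * s); last by rewrite pe; ring.
  apply: le_trans (ler_normD _ _) _; apply: le_trans (lerD (ler_normD _ _) ks') _.
  apply: le_trans (lerD (lerD kK ess) (lexx _)) _.
  by rewrite -!mulrDl ler_wpM2r// /Q; move: K0 en; lra.
Qed.

End plaplace_linearization.

Section plaplace.
Context {R : realType} {n : nat}.
Local Notation V := 'rV[R]_n.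
Implicit Types (X Y : V).

Definition pflux (p : R) X : V := enorm X `^ (p - 2) *: X.

(* Second-order expansion of the p-Laplace flux around a nonzero vector. *)
Lemma pflux_expansion (p : R) : 1 < p -> exists d c C : R,
  [/\ 0 < d <= 1, 0 < c, 0 <= C & forall X Y, X != 0 -> enorm Y <= d * enorm X ->
   [/\ enorm (pflux p (X + Y) - pflux p X) <= C * (enorm X `^ (p - 2) * enorm Y),
       c * (enorm X `^ (p - 2) * enorm Y ^+ 2) <= dotr (pflux p (X + Y) - pflux p X) Y &
       `|dotr (pflux p (X + Y) - pflux p X) X - (p - 1) * enorm X `^ (p - 2) * dotr X Y| <=
         C * (enorm X `^ (p - 2) * enorm Y ^+ 2)]].
Proof.
move=> p1; have [d [c [C [/andP[d0 d1] c0 C0 h]]]] := plaplace_scalar p1.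
exists d, c, (C + C + 1); split => //; [by rewrite d0|by rewrite !addr_ge0|].
move=> X Y X0 YX; have eX : 0 < enorm X by rewrite enorm_gt0.
pose t := enorm Y / enorm X; pose s := dotr X Y / enorm X ^+ 2.
have t0 : 0 <= t by rewrite /t divr_ge0 ?enorm_ge0.
have td : t <= d by rewrite ler_pdivrMr//.
have st : `|s| <= t.
  rewrite normrM normfV (ger0_norm (_ : 0 <= enorm X ^+ 2)) ?exprn_ge0 ?(ltW eX)//.
  rewrite ler_pdivrMr ?exprn_gt0// expr2 mulrA divfK ?gt_eqF// mulrC.
  exact: cauchy_schwarz_dotr.
have [] := h s t t0 td st; set T := _ `^ _ => h1 h2 h3.
have tY : enorm Y = t * enorm X by rewrite divfK// gt_eqF.
have sXY : dotr X Y = s * enorm X ^+ 2 by rewrite divfK// expf_eq0 gt_eqF.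
have dXX : dotr X X = enorm X ^+ 2 by rewrite sqr_enorm.
have X2 : 0 <= enorm X ^+ 2 by rewrite exprn_ge0// ltW.
have EY2 : enorm Y ^+ 2 = t ^+ 2 * enorm X ^+ 2 by rewrite {1}tY exprMn.
set N := enorm X `^ (p - 2); have N0 : 0 <= N by rewrite powR_ge0.
have u0 : 0 <= 1 + 2 * s + t ^+ 2.
  have : 0 <= (1 + s) ^+ 2 + (t ^+ 2 - s ^+ 2).
    rewrite addr_ge0 ?sqr_ge0// subr_ge0.
    by rewrite -(real_normK (num_real s)) ler_pXn2r ?nnegrE.
  by lra.
have NT : enorm (X + Y) `^ (p - 2) = N * T.
  rewrite enorm_powRE (_ : dotr (X + Y) (X + Y) = dotr X X * (1 + 2 * s + t ^+ 2)).
    by rewrite powRM ?dotr_ge0// /N enorm_powRE.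
  rewrite dotrDl !dotrDr (dotrC Y X) -(sqr_enorm Y) sXY tY dXX; ring.
have E : pflux p (X + Y) - pflux p X = N *: ((T - 1) *: X + T *: Y).
  rewrite /pflux NT -/N !scalerDr !scalerA mulrBr mulr1 scalerBl.
  by rewrite addrAC.
have T1 : `|T| <= C + 1.
  rewrite -[T](subrK 1); apply: le_trans (ler_normD _ _) _; rewrite normr1 lerD2r.
  by apply: le_trans h1 _; rewrite ler_piMr//; lra.
rewrite E; split.
- rewrite enormZ (ger0_norm N0) mulrCA ler_wpM2l//.
  apply: le_trans (ler_enormD _ _) _; rewrite !enormZ -(addrA C) mulrDl.
  apply: lerD; last by rewrite ler_wpM2r ?enorm_ge0.
  by rewrite [in leRHS]tY mulrA ler_wpM2r ?enorm_ge0.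
- rewrite [leRHS](_ : _ = N * (((T - 1) * s + T * t ^+ 2) * enorm X ^+ 2)); last first.
    by rewrite dotrZl dotrDl !dotrZl sXY -(sqr_enorm Y) EY2; ring.
  rewrite [leLHS](_ : _ = N * (c * t ^+ 2 * enorm X ^+ 2)); last by rewrite EY2; ring.
  by rewrite ler_wpM2l// ler_wpM2r.
- rewrite (_ : _ - _ = N * ((T * (1 + s) - 1 - (p - 1) * s) * enorm X ^+ 2)); last first.
    by rewrite dotrZl dotrDl !dotrZl (dotrC Y X) dXX sXY; ring.
  rewrite [leRHS](_ : _ = N * ((C + C + 1) * t ^+ 2 * enorm X ^+ 2)); last by rewrite EY2; ring.
  rewrite normrM (ger0_norm N0) ler_wpM2l// normrM (ger0_norm X2) ler_wpM2r//.
  by apply: le_trans h3 _; rewrite ler_wpM2r ?exprn_ge0//; lra.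
Qed.

End plaplace.

(** * Radial cutoff functions *)

Section cutoff.
Context {R : realType}.

Definition sqr_ramp (t : R) : R := Num.max 0 t ^+ 2.

Lemma sqr_ramp_is_derive (t : R) : is_derive t 1 sqr_ramp (2 * Num.max 0 t).
Proof.
apply: is_derive1_of_approx => e e0; near=> s.
have se : `|s - t| <= e.
  by rewrite distrC; near: s; apply: (@cvgr_dist_le _ _ _ _ _ (fun s : R => s)) => //; exact: cvg_id.
apply: (@le_trans _ _ (`|s - t| * `|s - t|)); last by rewrite ler_wpM2r.
rewrite -expr2 (real_normK (num_real _)) /sqr_ramp.
have [s0|s0] := leP 0 s; have [t0|t0] := leP 0 t.
- by rewrite ler_norml; apply/andP; split; have := sqr_ge0 (s - t); lra.
- have h : 0 <= s * - t by rewrite mulr_ge0// oppr_ge0 ltW.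
  by rewrite ler_norml; apply/andP; split; have := sqr_ge0 s; have := sqr_ge0 t; move: h; lra.
- have h : 0 <= t * - s by rewrite mulr_ge0// oppr_ge0 ltW.
  by rewrite ler_norml; apply/andP; split; have := sqr_ge0 s; have := sqr_ge0 t; move: h; lra.
- by rewrite expr0n/= mulr0 mul0r !subr0 normr0 sqr_ge0.
Unshelve. all: by end_near. Qed.

Lemma max0_continuous : continuous (fun t : R => Num.max 0 t).
Proof.
by move=> t; apply: (@continuous_max _ _ (fun=> 0 : R) (fun t => t));
  [exact: cst_continuous|exact: cvg_id].
Qed.

(** Two squared ramps composed so as to give 0 for t <= 1 and 1 for t >= 2. It is only C1, which is
    enough: smooth approximations come later by mollification. *)
Definition smooth_step (t : R) : R := 1 - sqr_ramp (1 - sqr_ramp (t - 1)).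

Definition dsmooth_step (t : R) : R :=
  4 * Num.max 0 (1 - sqr_ramp (t - 1)) * Num.max 0 (t - 1).

Lemma smooth_step_is_derive (t : R) : is_derive t 1 smooth_step (dsmooth_step t).
Proof.
have d1 : is_derive t 1 (fun t : R => t - 1) 1.
  have := is_deriveB (is_derive_id t (1 : R)) (is_derive_cst (1 : R) t (1 : R)).
  by rewrite subr0.
have d2 : is_derive t 1 (fun t => sqr_ramp (t - 1)) (2 * Num.max 0 (t - 1)).
  have := @is_derive1_comp _ sqr_ramp (fun t => t - 1) t _ _ (sqr_ramp_is_derive (t - 1)) d1.
  by rewrite mulr1.
have d3 : is_derive t 1 (fun t => 1 - sqr_ramp (t - 1)) (- (2 * Num.max 0 (t - 1))).
  have := is_deriveB (is_derive_cst (1 : R) t (1 : R)) d2.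
  by rewrite sub0r.
have d4 := @is_derive1_comp _ sqr_ramp (fun t => 1 - sqr_ramp (t - 1)) t _ _
  (sqr_ramp_is_derive (1 - sqr_ramp (t - 1))) d3.
have := is_deriveB (is_derive_cst (1 : R) t (1 : R)) d4.
rewrite /dsmooth_step (_ : 0 - _ = 4 * Num.max 0 (1 - sqr_ramp (t - 1)) * Num.max 0 (t - 1)) //.
by ring.
Qed.

Lemma sqr_ramp_continuous : continuous sqr_ramp.
Proof.
move=> t; rewrite /sqr_ramp; apply: (@continuous_comp _ _ _ (fun t : R => Num.max 0 t) (fun t => t ^+ 2)).
  exact: max0_continuous.
exact: exprn_continuous.
Qed.

Lemma dsmooth_step_continuous : continuous dsmooth_step.
Proof.
have c1 : continuous (fun t : R => t - 1).
  by move=> t; apply: cvgB; [exact: cvg_id|exact: cvg_cst].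
have c2 : continuous (fun t : R => 1 - sqr_ramp (t - 1)).
  move=> t; apply: cvgB; first exact: cvg_cst.
  exact: (@continuous_comp _ _ _ (fun t : R => t - 1) sqr_ramp t (c1 t) (@sqr_ramp_continuous _)).
have c3 : continuous (fun t : R => Num.max 0 (1 - sqr_ramp (t - 1))).
  move=> t; exact: (@continuous_comp _ _ _ (fun t : R => 1 - sqr_ramp (t - 1)) (fun t => Num.max 0 t) t (c2 t) (@max0_continuous _)).
have c4 : continuous (fun t : R => Num.max 0 (t - 1)).
  move=> t; exact: (@continuous_comp _ _ _ (fun t : R => t - 1) (fun t => Num.max 0 t) t (c1 t) (@max0_continuous _)).
by move=> t; apply: cvgM; [apply: cvgM; [exact: cvg_cst|exact: c3]|exact: c4].
Qed.

Lemma sqr_ramp0 (t : R) : t <= 0 -> sqr_ramp t = 0.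
Proof. by move=> t0; rewrite /sqr_ramp max_l// expr0n. Qed.

Lemma sqr_ramp_pos (t : R) : 0 <= t -> sqr_ramp t = t ^+ 2.
Proof. by move=> t0; rewrite /sqr_ramp max_r. Qed.

Lemma sqr_ramp_ge0 t : 0 <= sqr_ramp t. Proof. exact: sqr_ge0. Qed.

Lemma smooth_step0 (t : R) : t <= 1 -> smooth_step t = 0.
Proof.
by move=> t1; rewrite /smooth_step (sqr_ramp0 (_ : t - 1 <= 0)) ?subr_le0// subr0 sqr_ramp_pos// expr1n subrr.
Qed.

Lemma smooth_step1 (t : R) : 2 <= t -> smooth_step t = 1.
Proof.
move=> t2; have : 1 <= sqr_ramp (t - 1) by rewrite sqr_ramp_pos ?exprn_ege1//; lra.
by move=> h; rewrite /smooth_step sqr_ramp0 ?subr0// subr_le0.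
Qed.

Lemma smooth_step_bounds t : 0 <= smooth_step t <= 1.
Proof.
rewrite /smooth_step subr_ge0 gerBl sqr_ramp_ge0 andbT.
have [h|h] := leP 1 (sqr_ramp (t - 1)); first by rewrite sqr_ramp0// subr_le0.
by rewrite sqr_ramp_pos ?subr_ge0 ?(ltW h)// exprn_ile1// ?subr_ge0 ?(ltW h)// gerBl sqr_ramp_ge0.
Qed.

Lemma dsmooth_step_bounds t : 0 <= dsmooth_step t /\ dsmooth_step t * t <= 8.
Proof.
have h1 : 0 <= Num.max 0 (1 - sqr_ramp (t - 1)) <= 1.
  by rewrite le_max lexx/= ge_max ler01/= gerBl sqr_ramp_ge0.
have h2 : 0 <= Num.max 0 (t - 1) by rewrite le_max lexx.
have /andP[h11 h12] := h1.
split; first by rewrite /dsmooth_step !mulr_ge0.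
have [t2|t2] := leP t 2; last first.
  rewrite /dsmooth_step (max_l (y := 1 - _)) ?mulr0 ?mul0r//.
  rewrite subr_le0 sqr_ramp_pos ?exprn_ege1//; lra.
have [t1|t1] := leP t 1.
  have b0 : Num.max 0 (t - 1) = 0 by rewrite max_l// subr_le0.
  by rewrite /dsmooth_step b0 mulr0 mul0r.
have h3 : Num.max 0 (t - 1) = t - 1 by rewrite max_r//; lra.
rewrite /dsmooth_step h3; set a := Num.max 0 (1 - _) in h11 h12 *.
have : a * ((t - 1) * t) <= 1 * (1 * 2) by rewrite ler_pM// ?mulr_ge0 ?ler_pM//; lra.
by lra.
Qed.

Context {n : nat}.
Local Notation V := 'rV[R]_n.

Definition radial_step (c : R) (y : V) : R := smooth_step (c * dotr y y).

Lemma dotr_continuous (y : V) : {for y, continuous (fun y : V => dotr y y)}.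
Proof. exact: frechet_continuous (frechet_sqr_enorm y). Qed.

Lemma radial_step_C1 c : C1_on setT (radial_step c) /\
  (forall y, grad (radial_step c) y = (dsmooth_step (c * dotr y y) * (2 * c)) *: y).
Proof.
have cd (y : V) : {for y, continuous (fun y : V => dsmooth_step (c * dotr y y))}.
  apply: (@continuous_comp _ _ _ (fun y : V => c * dotr y y) dsmooth_step); last exact: dsmooth_step_continuous.
  by apply: (@continuousM _ _ (fun=> c) (fun y : V => dotr y y)); [exact: cst_continuous|exact: dotr_continuous].
have fr (y : V) : [set: V] y ->
    frechet (radial_step c) y ((dsmooth_step (c * dotr y y) * (2 * c)) *: y).
  move=> _; rewrite (mulrC 2) mulrA -scalerA -scalerA.
  by apply: frechet_comp1 (smooth_step_is_derive _) _; exact: frechetZ (frechet_sqr_enorm y).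
have ct (y : V) : [set: V] y -> forall i, {for y, continuous
    (fun y : V => ((dsmooth_step (c * dotr y y) * (2 * c)) *: y) 0 i)}.
  move=> _ i; rewrite (_ : (fun y => _) = (fun y : V => dsmooth_step (c * dotr y y) * (2 * c) * y 0 i)).
    apply: (@continuousM _ _ (fun y : V => dsmooth_step (c * dotr y y) * (2 * c)) (fun y : V => y 0 i)).
      by apply: (@continuousM _ _ (fun y : V => dsmooth_step (c * dotr y y)) (fun=> 2 * c)); [exact: cd|exact: cst_continuous].
    exact: coord_continuous.
  by apply/funext => z; rewrite mxE.
have [h1 h2] := frechet_C1 (@openT V) fr ct.
by split=> [|y]; [exact: h1|exact: h2].
Qed.

(** The bound is independent of c by scaling, so a cutoff at any radius costs at most 16/|y| in the
    gradient. *)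
Lemma radial_step_grad_le c (y : V) : 0 <= c ->
  enorm (grad (radial_step c) y) * enorm y <= 16.
Proof.
move=> c0; have [_ ->] := radial_step_C1 c.
have [h1 h2] := dsmooth_step_bounds (c * dotr y y).
set T := dsmooth_step _ in h1 h2 *.
have E : 2 * (T * (c * dotr y y)) <= 16 by move: h2; lra.
apply: le_trans E.
have k0 : 0 <= T * (2 * c) by apply: mulr_ge0 => //; exact: mulr_ge0.
by rewrite enormZ (ger0_norm k0) -(sqr_enorm y) le_eqVlt; apply/orP; left; apply/eqP; ring.
Qed.

Lemma radial_step0 c (y : V) : c * dotr y y <= 1 -> radial_step c y = 0.
Proof. exact: smooth_step0. Qed.

Lemma radial_step1 c (y : V) : 2 <= c * dotr y y -> radial_step c y = 1.
Proof. exact: smooth_step1. Qed.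

Lemma radial_step_grad0 c (y : V) : 2 <= c * dotr y y -> grad (radial_step c) y = 0.
Proof.
move=> h; have [_ ->] := radial_step_C1 c.
rewrite /dsmooth_step [X in 4 * X](_ : _ = 0) ?mulr0 ?mul0r ?scale0r//.
rewrite max_l// subr_le0 sqr_ramp_pos ?exprn_ege1//; lra.
Qed.

End cutoff.

(** * Integrable powers of the norm, and limits of weighted integrals *)

Section integrability.
Context {R : realType} {n : nat}.
Local Notation V := 'rV[R]_n.
Local Notation L := (Leb R n).

Lemma measurable_enorm_powR (b : R) (D : set L) : measurable_fun D (fun y : L => enorm (y : V) `^ b).
Proof.
apply: measurable_funTS.
by apply: (@measurableT_comp _ _ _ _ _ _ (@powR R ^~ b) _ (fun y : L => enorm (y : V)));
  [exact: measurable_powR|exact: measurable_enorm].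
Qed.

Lemma dominated_Rintegral (D : set L) (f_ : nat -> L -> R) (f g : L -> R) : measurable D ->
  (forall k, measurable_fun D (f_ k)) -> measurable_fun D f ->
  leb ([set x | D x /\ ~ (f_ k x @[k --> \oo] --> f x)] : set L) = 0%E ->
  leb.-integrable D (EFin \o g) ->
  leb ([set x | D x /\ ~ (forall k, `|f_ k x| <= g x)] : set L) = 0%E ->
  leb.-integrable D (EFin \o f) /\
  \int[leb]_(x in D) f_ k x @[k --> \oo] --> \int[leb]_(x in D) f x.
Proof.
move=> mD mf_ mf cvf ig fg.
pose F_ k : L -> \bar R := EFin \o f_ k.
have mF_ k : measurable_fun D (F_ k) by apply/measurable_EFinP.
have mF : measurable_fun D (EFin \o f) by apply/measurable_EFinP.
have h1 : {ae (@leb R n), forall x, D x -> F_ ^~ x @ \oo --> (EFin \o f) x}.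
  apply/aeP; apply: subset_null cvf => x /= h; apply: contrapT => h'; apply: h => Dx.
  by apply: cvg_EFin; [exact: nearW|apply: contrapT => h2; apply: h'].
have h2 : {ae (@leb R n), forall x, forall k, D x -> (`|F_ k x| <= (EFin \o g) x)%E}.
  apply/aeP; apply: subset_null fg => x /= h; apply: contrapT => h'; apply: h => k Dx.
  rewrite lee_fin; move: k; apply: contrapT => h2; apply: h'; split => // h3; exact: h2.
have [i1 _ c1] := dominated_convergence mD mF_ mF h1 ig h2.
split=> //; rewrite /Rintegral.
have iF : (\int[leb]_(x in D) (EFin \o f) x \is a fin_num)%E by exact: integrable_fin_num.
by apply: fine_cvg; rewrite fineK.
Qed.

Hypothesis n0 : (0 < n)%N.

(** Let A N be the shell r/2^N <= |y| < r. Doubling maps the part of A (N+1) below r/2 into A N, and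
    multiplies its weighted mass by 2^(b+n). So the masses satisfy m(A (N+1)) <= m(A 1) + theta m(A
    N) with theta = 2^(-b-n) and stay bounded. *)
Lemma integrable_enorm_powR (b r : R) : - n%:R < b -> 0 < r ->
  leb.-integrable (eball r : set L) (EFin \o (fun y : L => enorm (y : V) `^ b)).
Proof.
move=> nb r0.
pose A N := [set y : V | r / 2 ^+ N <= enorm y < r].
pose w (y : L) : R := enorm (y : V) `^ b.
have mw : measurable_fun [set: L] w by exact: measurable_enorm_powR.
have w0 y : 0 <= w y by exact: powR_ge0.
have mA N : measurable (A N : set L).
  rewrite (_ : A N = annulus (r / 2 ^+ N) r `&` eball r).
    by apply: measurableI; [exact: annulus_measurable|apply: open_measurable; exact: open_eball].
  apply/seteqP; split=> y; rewrite /A /annulus /eball /=.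
    by move=> /andP[h1 h2]; rewrite h1 (ltW h2).
  by move=> [/andP[-> _] ->].
pose m0 := [the measure _ _ of density (@leb R n) w]; pose m := m0 mw w0.
(* This is where b > -n enters. *)
have th : 2 `^ (- b) * 2 ^- n < 1 :> R.
  rewrite -powR_mulrn// -powRN -powRD; last by apply/implyP => _; rewrite pnatr_eq0.
  rewrite -[ltRHS](powRr0 (2 : R)) /powR !pnatr_eq0/= ltr_expR ltr_pM2r ?ln_gt0 ?ltr1n//; lra.
set theta := (X in X < 1) in th.
have theta0 : 0 <= theta by rewrite mulr_ge0 ?powR_ge0// invr_ge0 exprn_ge0.
have [c c0 mA1] : exists2 c : R, 0 <= c & (m (A 1%N) <= c%:E)%E.
  have fin : (leb (A 1%N : set L) \is a fin_num)%E.
    by rewrite ge0_fin_numE ?leb_ge0//; apply: (@bounded_lty _ _ _ r) => y /andP[_ /ltW].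
  pose K : R := (r / 2 ^+ 1) `^ b + r `^ b.
  have K0 : 0 <= K by rewrite addr_ge0 ?powR_ge0.
  exists (K * fine (leb (A 1%N : set L))); first by rewrite mulr_ge0 ?fine_ge0 ?leb_ge0.
  rewrite EFinM fineK// -(integral_cst leb (mA 1%N)).
  rewrite /m /= /density; apply: (ge0_le_integral _ (mA 1%N)).
  - by move=> y _; rewrite lee_fin.
  - by apply/measurable_EFinP; exact: measurable_enorm_powR.
  - exact: measurable_cst.
  - move=> y /andP[h1 h2]; rewrite lee_fin; apply: powR_le_ends h1 (ltW h2).
    by rewrite divr_gt0.
have step N : (m (A N.+1) <= m (A 1%N) + theta%:E * m (A N))%E.
  pose h N (y : L) : \bar R := ((w y)%:E * (\1_(A N) y)%:E)%E.
  have mE K : m (A K) = (\int[leb]_y h K y)%E.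
    by rewrite /m /= /density integral_mkcond; apply: eq_integral => y _; rewrite /h /patch indicE; case: ifP; rewrite ?mule1 ?mule0.
  have mh K : measurable_fun [set: L] (h K).
    apply: emeasurable_funM; apply/measurable_EFinP; first exact: mw.
    by apply: measurable_indic; exact: mA.
  have h0 K y : (0 <= h K y)%E by rewrite mule_ge0// lee_fin.
  have two0 : 0 < 2 :> R by [].
  have p0 : (0 <= (2 `^ (- b))%:E :> \bar R)%E by rewrite lee_fin powR_ge0.
  have mha : measurable_fun [set: L] (fun y : L => h N (affine 2 0%R y)).
    exact: (measurable_fun_comp_affine 0 two0 (mh N)).
  have ha0 y : (0 <= h N (affine 2 0%R y))%E by exact: h0.
  have mha' : measurable_fun [set: L] (fun y : L => (2 `^ (- b))%:E * h N (affine 2 0%R y))%E.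
    by apply: emeasurable_funM; [exact: measurable_cst|exact: mha].
  have ha0' y : (0 <= (2 `^ (- b))%:E * h N (affine 2 0%R y))%E by exact: mule_ge0.
  have E2 : (theta%:E * m (A N) = \int[leb]_y ((2 `^ (- b))%:E * h N (affine 2 0%R y)))%E.
    rewrite (ge0_integralZl leb measurableT mha (fun y _ => ha0 y) p0).
    by rewrite (ge0_integral_affine 0 two0 (mh N) (h0 N)) -mE muleA -EFinM.
  rewrite E2 !mE -(ge0_integralD leb measurableT (fun y _ => h0 1%N y) (mh 1%N) (fun y _ => ha0' y) mha').
  apply: (ge0_le_integral _ measurableT (fun y _ => h0 N.+1 y) (mh N.+1)).
    by apply: emeasurable_funD; [exact: mh|exact: mha'].
  move=> y _; rewrite {1}/h indicE; case: (boolP (y \in A N.+1)) => [|_]; last first.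
    by rewrite mule0; exact: adde_ge0.
  move=> /set_mem /andP[y1 y2]; rewrite mule1.
  have [yr|yr] := leP (r / 2 ^+ 1) (enorm (y : V)).
    have -> : h 1%N y = (w y)%:E.
      by rewrite /h indicE mem_set ?mule1// /A /= yr.
    by rewrite leeDl.
  apply: (@le_trans _ _ ((2 `^ (- b))%:E * h N (affine 2 0%R y)))%E; last first.
    by rewrite leeDr.
  rewrite /h indicE mem_set; last first.
    rewrite /A /affine /= addr0 enormZ (ger0_norm (_ : 0 <= 2))//; apply/andP; split.
      by rewrite (mulrC 2) -ler_pdivrMr// -mulrA -invfM -exprSr.
    by move: yr; rewrite expr1 ltr_pdivlMr// mulrC.
  rewrite mule1 -EFinM lee_fin /w /affine addr0 enormZ (ger0_norm (_ : 0 <= 2))//.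
  rewrite powRM ?enorm_ge0// mulrA -powRD; last by apply/implyP => _; rewrite pnatr_eq0.
  by rewrite addNr powRr0 mul1r.
(* The fixed point of K = c + theta K, hence a bound preserved by the recursion. *)
pose K := c / (1 - theta).
have t1 : 0 < 1 - theta by rewrite subr_gt0.
have K0 : 0 <= K by rewrite divr_ge0// ltW.
have mAK N : (m (A N) <= K%:E)%E.
  elim: N => [|N IH].
    rewrite (_ : A 0%N = set0) ?measure0 ?lee_fin//.
    apply/seteqP; split=> // y; rewrite /A /= expr0 divr1 => /andP[h1].
    by rewrite ltNge h1.
  apply: (le_trans (step N)).
  have -> : K%:E = (c%:E + theta%:E * K%:E)%E.
    by rewrite -EFinM -EFinD; congr EFin; rewrite /K; field; rewrite gt_eqF.
  by apply: leeD => //; apply: lee_pmul => //; rewrite ?measure_ge0 ?lee_fin.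
have mE : measurable (eball r : set L) by apply: open_measurable; exact: open_eball.
have ndA : nondecreasing_seq A.
  apply/nondecreasing_seqP => N; apply/subsetPset => y /andP[h1 h2]; apply/andP; split => //.
  apply: le_trans h1; rewrite ler_pM2l// lef_pV2 ?posrE ?exprn_gt0//.
  by rewrite ler_eXn2l// ltr1n.
have cvA := nondecreasing_cvg_mu mA (bigcup_measurable (fun k _ => mA k)) ndA (mu := m).
have mU : (m (\bigcup_N A N) <= K%:E)%E.
  rewrite -(cvg_lim _ cvA)//; apply: lime_le; first by apply/cvg_ex; eexists; exact: cvA.
  by apply: nearW.
apply/integrableP; split; first by apply/measurable_EFinP; exact: measurable_enorm_powR.
rewrite (_ : (\int[leb]_(y in _) _)%E = m (eball r)); last first.
  by apply: eq_integral => y _ /=; rewrite ger0_norm// powR_ge0.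
have sub : (eball r : set L) `<=` (\bigcup_N A N) `|` [set (0 : V)].
  move=> y yr; have [->|y0] := eqVneq (y : V) 0; [by right|left].
  have yp : 0 < enorm (y : V) by rewrite enorm_gt0.
  have [N hN] : exists N : nat, r / enorm (y : V) < N%:R.
    by exists (Num.trunc (r / enorm (y : V))).+1; exact: truncnS_gt.
  exists N => //; rewrite /A /=; apply/andP; split => //.
  rewrite ler_pdivrMr ?exprn_gt0// mulrC -ler_pdivrMr//.
  apply: (le_trans (ltW hN)); rewrite -natrX ler_nat.
  by apply: ltnW; exact: ltn_expl.
have m00 : m [set (0 : V)] = 0%E.
  have l0 := @leb0 R n n0.
  apply: (null_set_integral (null_measurable l0) _ l0).
  by apply/measurable_EFinP; exact: measurable_enorm_powR.
have mU' : measurable (\bigcup_N A N : set L) by apply: bigcup_measurable => k _; exact: mA.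
have m0' : measurable ([set 0] : set L) by apply: null_measurable; exact: leb0.
have le1 : (m (eball r) <= m ((\bigcup_N A N) `|` [set (0%R : V)]))%E.
  by apply: le_measure sub; rewrite inE; [exact: mE|exact: measurableU].
apply: (le_lt_trans le1); apply: (@le_lt_trans _ _ (m (\bigcup_N A N) + m [set (0%R : V)])%E).
  apply: measureU2; [exact: mU'|exact: m0'].
by rewrite m00 adde0; apply: (le_lt_trans mU); exact: ltry.
Qed.

End integrability.

Section measurability.
Context {R : realType} {n : nat}.
Local Notation V := 'rV[R]_n.
Local Notation L := (Leb R n).
Hypothesis n0 : (0 < n)%N.

Lemma eball_measurable (r : R) : measurable (eball r : set L).
Proof. by apply: open_measurable; exact: open_eball. Qed.

Lemma lebU0 (A B : set L) : leb A = 0%E -> leb B = 0%E -> leb (A `|` B) = 0%E.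
Proof.
move=> A0 B0; have h : (leb (A `|` B) <= leb A + leb B)%E.
  by apply: measureU2; exact: null_measurable.
by apply/eqP; rewrite eq_le leb_ge0 andbT; apply: le_trans h _; rewrite A0 B0 adde0.
Qed.

Lemma measurable_fun_punctured (r : R) (f : V -> R) :
  (forall y, y != 0 -> enorm y < r -> {for y, continuous f}) ->
  measurable_fun (eball r : set L) (f : L -> R).
Proof.
move=> cf; pose U := punctured `&` eball r : set V.
have oU : open U by apply: openI; [exact: open_punctured|exact: open_eball].
have mU : measurable (U : set L) by exact: open_measurable.
have m0 : measurable ([set 0] : set L) by apply: null_measurable; exact: leb0.
apply: (@measurable_funS _ _ _ _ ((U : set L) `|` [set 0])).
- exact: measurableU.
- move=> y yr; have [->|y0] := eqVneq (y : V) 0; [by right|by left].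
- apply/measurable_funU => //; split; last exact: measurable_fun_set1.
  by apply: open_continuous_measurable => // y [y0 yr]; exact: cf.
Qed.

Lemma measurable_dotr (D : set L) (F G : L -> V) :
  (forall i, measurable_fun D (fun y => F y 0 i)) ->
  (forall i, measurable_fun D (fun y => G y 0 i)) ->
  measurable_fun D (fun y => dotr (F y) (G y)).
Proof.
by move=> mF mG; apply: measurable_sum => i; apply: measurable_funM; [exact: mF|exact: mG].
Qed.

(** Dominated convergence in the form used for Sobolev norms: pointwise decay like 1/(k+1) forces
    the limit 0, and the integrals come as real numbers so that the root of their sum is computed in
    [R]. *)
Lemma weighted_vanishing (D : set L) (f_ : nat -> L -> R) (G : L -> R) : measurable D ->
  (forall k, measurable_fun D (f_ k)) -> (forall k y, D y -> 0 <= f_ k y) ->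
  leb.-integrable D (EFin \o G) ->
  leb ([set y | D y /\ ~ ((forall k, f_ k y <= G y) /\
      exists2 K : R, 0 <= K & \forall k \near \oo, f_ k y <= K * k.+1%:R^-1)] : set L) = 0%E ->
  exists2 i_ : nat -> R, (forall k, (\int[leb]_(y in D) (f_ k y)%:E)%E = (i_ k)%:E) &
    i_ k @[k --> \oo] --> (0 : R).
Proof.
move=> mD mf f0 iG bad.
exists (fun k => \int[leb]_(y in D) f_ k y) => [k|].
  rewrite /Rintegral fineK//.
  have ifk : leb.-integrable D (EFin \o f_ k).
    pose g (y : L) := if `|f_ k y| <= G y then f_ k y else 0.
    have mG : measurable_fun D G by apply/measurable_EFinP; exact: measurable_int iG.
    have fg : leb ([set y | D y /\ f_ k y <> g y] : set L) = 0%E.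
      apply: subset_null bad => y [Dy h]; split=> // -[h1 _]; apply: h.
      by rewrite /g ger0_norm ?f0// h1.
    have mg : measurable_fun D g by apply: ae_eq_measurable_fun fg (mf k).
    have ig : leb.-integrable D (EFin \o g).
      apply: (le_integrable mD _ _ iG); first exact/measurable_EFinP.
      move=> y Dy /=; rewrite lee_fin /g; case: ifP => [h|_]; last by rewrite normr0.
      by apply: le_trans h _; exact: ler_norm.
    apply/integrableP; split; first by apply/measurable_EFinP; exact: mf.
    have /integrableP[_] := ig; congr (_ < _)%E.
    apply: ae_eq_integral; [exact: mD| | |].
    - have m1 : measurable_fun D (EFin \o g) by apply/measurable_EFinP.
      exact: measurableT_comp.
    - have m1 : measurable_fun D (EFin \o f_ k) by apply/measurable_EFinP; exact: mf.
      exact: measurableT_comp.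
    apply/aeP; apply: subset_null fg => y /= h; apply: contrapT => h2; apply: h => Dy.
    by congr (`| _%:E |)%E; apply: contrapT => h3; apply: h2; split => // h4; apply: h3; rewrite h4.
  exact: integrable_fin_num.
have A1 : leb ([set y | D y /\ ~ (f_ k y @[k --> \oo] --> (0 : R))] : set L) = 0%E.
  apply: subset_null bad => y [Dy h]; split=> // -[_ [K K0 hK]]; apply: h.
  apply: (@squeeze_cvgr _ _ _ _ (fun=> 0) (fun k => K * k.+1%:R^-1)).
  - near=> k; rewrite f0//=; near: k; exact: hK.
  - exact: cvg_cst.
  - rewrite -[X in _ --> X](mulr0 K); apply: cvgM; first exact: cvg_cst.
    exact: cvg_harmonic.
have A2 : leb ([set y | D y /\ ~ (forall k, `|f_ k y| <= G y)] : set L) = 0%E.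
  apply: subset_null bad => y [Dy h]; split=> // -[h1 _]; apply: h => k.
  by rewrite ger0_norm ?f0.
have mc : measurable_fun D (fun _ : L => 0 : R) by exact: measurable_cst.
have [_] := dominated_Rintegral mD mf mc A1 iG A2.
rewrite (_ : \int[leb]_(x in D) (0 : R) = 0)//.
by rewrite /Rintegral integral0.
Unshelve. all: by end_near. Qed.

End measurability.

(** * Removing the singularity at the origin *)

Section ball_weak_form.
Context {R : realType} {n : nat}.
Local Notation V := 'rV[R]_n.
Local Notation L := (Leb R n).
Variables (r gam gam' C : R) (w : V -> R) (a : V -> V) (b1 b2 : V -> R).
Hypothesis n0 : (0 < n)%N.
Hypotheses (r0 : 0 < r) (gam_gt : 2 - n%:R < gam) (gam'_gt : - n%:R < gam') (C0 : 0 <= C).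
Let W := (punctured `&` eball (2 * r) : set V).
Hypothesis wC : C1_on W w.
Hypothesis w_le : forall y, W y -> `|w y| <= C.
Hypothesis gw_le : forall y, W y -> enorm (grad w y) * enorm y <= C.
Let D := eball r : set L.
Let P (y : V) := enorm y `^ gam.
Let Q (y : V) := enorm y `^ (gam - 2).

Let mD : measurable D. Proof. exact: eball_measurable. Qed.

Lemma ball_iP : leb.-integrable D (EFin \o (P : L -> R)).
Proof.
apply: integrable_enorm_powR => //; apply: lt_trans gam_gt.
by rewrite -[ltLHS]add0r ltrD2r.
Qed.

(** The key integrability. Since |grad w| |y| <= C, it bounds |y|^gamma |grad w|^2 and the product
    of the flux with the gradient of a cutoff. *)
Lemma ball_iQ : leb.-integrable D (EFin \o (Q : L -> R)).
Proof. by apply: integrable_enorm_powR => //; rewrite ltrBrDr addrC. Qed.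

Lemma ball_PQ y : y != 0 -> P y = Q y * enorm y ^+ 2.
Proof.
move=> y0; rewrite /P /Q -powR_mulrn ?enorm_ge0// -powRD ?subrK//.
by apply/implyP => _; rewrite enorm_eq0.
Qed.

Lemma ball_Q0 y : 0 <= Q y. Proof. exact: powR_ge0. Qed.

Lemma ball_W y : y != 0 -> enorm y < r -> W y.
Proof. by move=> y0 yr; split => //; rewrite /eball /= (lt_trans yr)// ltr_pMl// ltr1n. Qed.

Let oW : open W.
Proof. by apply: openI; [exact: open_punctured|exact: open_eball]. Qed.

(** Vanishes for |y| <= 1/(k+1) and equals 1 for |y| >= sqrt 2/(k+1). *)
Let eta k : V -> R := radial_step (k.+1%:R ^+ 2).

Lemma eta_C1 k : C1_on setT (eta k). Proof. by have [] := radial_step_C1 (n:=n) (k.+1%:R ^+ 2 : R). Qed.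

Lemma eta_supp k y : eta k y != 0 -> k.+1%:R^-1 <= enorm y.
Proof.
apply: contraNT; rewrite -ltNge => h; apply/eqP; apply: radial_step0.
rewrite -sqr_enorm -exprMn exprn_ile1 ?mulr_ge0 ?enorm_ge0//.
by rewrite mulrC -ler_pdivlMr// mul1r ltW.
Qed.

Lemma eta_near y : y != 0 -> \forall k \near \oo, eta k y = 1 /\ grad (eta k) y = 0.
Proof.
move=> y0; have e0 : 0 < dotr y y by rewrite -sqr_enorm exprn_gt0// enorm_gt0.
near=> k; have h : 2 <= k.+1%:R ^+ 2 * dotr y y.
  rewrite -ler_pdivrMr//; apply: (@le_trans _ _ k.+1%:R); last first.
    by rewrite expr2 ler_peMr// ler1n.
  apply: (@le_trans _ _ k%:R); last by rewrite ler_nat.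
  by near: k; exact: nbhs_infty_ger.
by split; [exact: radial_step1|exact: radial_step_grad0].
Unshelve. all: by end_near. Qed.

Lemma eta_bounds k y : 0 <= eta k y <= 1. Proof. exact: smooth_step_bounds. Qed.

Lemma eta_grad k y : enorm (grad (eta k) y) * enorm y <= 16.
Proof. by apply: radial_step_grad_le; rewrite sqr_ge0. Qed.

Lemma continuous_grad_coord (phi : V -> R) i : C1_on setT phi -> continuous (fun y => grad phi y 0 i).
Proof. by move=> h y; exact: C1_continuous_grad h Logic.I. Qed.

Lemma test_ball_supp phi : test_function (eball r) phi ->
  [/\ C1_on setT phi, exists2 t, t < r & (forall y : V, phi y != 0 -> enorm y <= t) &
    exists2 N : R, 0 <= N & forall y : V, `|phi y| <= N /\ enorm (grad phi y) <= N].
Proof.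
move=> [ps cK KU]; set K := closure _ in cK KU.
have phiC : C1_on setT phi by exact: smooth_on_C1.
have [N N0 hN] : exists2 N : R, 0 <= N & forall x, K x -> `|(r - enorm x)^-1| <= N.
  apply: compact_bound => // x /KU xr.
  apply: (@continuousV _ _ (fun x => r - enorm x)); first by rewrite gt_eqF// subr_gt0.
  by apply: (@continuousB _ _ _ (fun=> r) (fun x => enorm x));
    [exact: cst_continuous|exact: continuous_enorm].
have N1 : 0 < N + 1 by rewrite ltr_wpDl.
have kt y : K y -> enorm y <= r - (N + 1)^-1.
  move=> Ky; have x0 : 0 < r - enorm y by rewrite subr_gt0; exact: KU.
  have := hN y Ky; rewrite ger0_norm ?invr_ge0 ?(ltW x0)// => h.
  rewrite lerBrDr -lerBrDl -[leRHS]invrK lef_pV2 ?posrE ?invr_gt0//.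
  by apply: le_trans h _; rewrite lerDl.
have pt y : phi y != 0 -> enorm y <= r - (N + 1)^-1.
  by move=> py; apply: kt; exact: subset_closure.
have ps0 : supp_in 0 (r - (N + 1)^-1) phi by move=> y /pt ->; rewrite enorm_ge0.
split=> //; first by exists (r - (N + 1)^-1) => //; rewrite gtrBl invr_gt0.
have [M M0 hM] := Cc_bound (supp_in_Cc (C1_setT_continuous phiC) ps0).
have [M' M'0 hM'] : exists2 M : R, 0 <= M & forall i y, `|partial i phi y| <= M.
  have h i : exists M : R, 0 <= M /\ forall y, `|partial i phi y| <= M.
    have [M1 M10 h] := Cc_bound (supp_in_Cc (C1_setT_continuous_partial (i:=i) phiC) (supp_in_partial (i:=i) ps0)).
    by exists M1.
  have [F hF] := choice h.
  exists (\sum_i F i) => [|i y]; first by apply: sumr_ge0 => i _; have [] := hF i.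
  have [Fi0 hi] := hF i; apply: le_trans (hi y) _; rewrite (bigD1 i)//= lerDl.
  by apply: sumr_ge0 => j _; have [] := hF j.
exists (M + n%:R * M') => [|y]; first by rewrite addr_ge0// mulr_ge0.
split; first by apply: le_trans (hM y) _; rewrite lerDl mulr_ge0.
apply: (@le_trans _ _ (n%:R * M')); last by rewrite lerDr.
by apply: enorm_le_bound => // i; rewrite mxE.
Qed.

Lemma eta_mul phi k : C1_on setT phi -> C1_on setT (fun y => eta k y * phi y) /\
  (forall y, grad (fun y => eta k y * phi y) y = phi y *: grad (eta k) y + eta k y *: grad phi y).
Proof.
move=> phiC; have [h1 h2] := C1_onM (@openT V) (@eta_C1 k) phiC.
by split=> // y; exact: h2.
Qed.

Section test.
Hypothesis ma : forall i, measurable_fun D (fun y => a y 0 i).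
Hypotheses (mb1 : measurable_fun D b1) (mb2 : measurable_fun D b2).
Hypothesis a_le : forall y, y != 0 -> enorm y < r ->
  enorm (a y) <= C * P y * enorm (grad w y).
Hypothesis b1_le : forall y, y != 0 -> enorm y < r ->
  `|b1 y| <= C * P y * enorm (grad w y) ^+ 2.
Hypothesis b2_le : leb ([set y | D y /\ ~ (`|b2 y| <= C * enorm y `^ gam')] : set L) = 0%E.
Hypothesis eq0 : forall phi s t, 0 < s -> t < r -> C1_on setT phi -> supp_in s t phi ->
  \int[leb]_(y in [set: L]) (dotr (a y) (grad phi y) - (b1 y + b2 y) * phi y) = 0.

Let F phi (y : L) : R := dotr (a y) (grad phi y) - (b1 y + b2 y) * phi y.

Lemma measurable_F phi : C1_on setT phi -> measurable_fun D (F phi).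
Proof.
move=> phiC; apply: measurable_funB.
  apply: measurable_dotr => [|i]; first exact: ma.
  by apply: continuous_measurable; exact: continuous_grad_coord.
apply: measurable_funM; first exact: (measurable_funD mb1 mb2).
by apply: continuous_measurable; exact: C1_setT_continuous.
Qed.

Lemma ball_a_le y : y != 0 -> enorm y < r -> enorm (a y) <= C * C * (Q y * enorm y).
Proof.
move=> y0 yr; apply: le_trans (a_le y0 yr) _; rewrite ball_PQ// -!mulrA ler_wpM2l//.
rewrite [leLHS](_ : _ = Q y * enorm y * (enorm (grad w y) * enorm y)); last by ring.
rewrite [leRHS](_ : _ = Q y * enorm y * C); last by ring.
by rewrite ler_wpM2l ?mulr_ge0 ?ball_Q0 ?enorm_ge0//; apply: gw_le; exact: ball_W.
Qed.

Lemma ball_b1_le y : y != 0 -> enorm y < r -> `|b1 y| <= C * C ^+ 2 * Q y.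
Proof.
move=> y0 yr; apply: le_trans (b1_le y0 yr) _; rewrite ball_PQ// -!mulrA ler_wpM2l//.
rewrite [leLHS](_ : _ = Q y * (enorm (grad w y) * enorm y) ^+ 2); last by ring.
rewrite [leRHS](_ : _ = Q y * C ^+ 2); last by ring.
rewrite ler_wpM2l ?ball_Q0// ler_pXn2r ?nnegrE ?mulr_ge0 ?enorm_ge0//.
by apply: gw_le; exact: ball_W.
Qed.

(** The bound does not depend on k: the factor |y| in |a| <= C^2 |y|^(gamma-2) |y| absorbs the
    factor 1/|y| in the gradient of the cutoff. *)
Lemma F_eta_le phi k y N : y != 0 -> enorm y < r -> 0 <= N -> C1_on setT phi ->
  `|phi y| <= N -> enorm (grad phi y) <= N -> `|b2 y| <= C * enorm y `^ gam' ->
  `|F (fun y => eta k y * phi y) y| <=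
    N * (C * C * r + 16 * (C * C) + C * C ^+ 2) * Q y + N * C * enorm y `^ gam'.
Proof.
move=> y0 yr N0 phiC p1 p2 hb2; have [_ g] := eta_mul k phiC.
have /andP[e0 e1] := eta_bounds k y.
have ha := ball_a_le y0 yr; have hb1 := ball_b1_le y0 yr; have he := eta_grad k y.
have Q0 := ball_Q0 y; have en0 := enorm_ge0 y.
have CC : 0 <= C * C by rewrite mulr_ge0.
rewrite /F g; apply: le_trans (ler_normB _ _) _.
have t1 : `|dotr (a y) (phi y *: grad (eta k) y + eta k y *: grad phi y)| <=
    N * (16 * (C * C) * Q y) + N * (C * C * r * Q y).
  apply: le_trans (cauchy_schwarz_dotr _ _) _.
  apply: (@le_trans _ _ (enorm (a y) * (N * enorm (grad (eta k) y) + N))).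
    rewrite ler_wpM2l ?enorm_ge0//; apply: le_trans (ler_enormD _ _) _.
    rewrite !enormZ lerD// ?ler_wpM2r ?enorm_ge0//.
    by rewrite ger0_norm// (le_trans _ p2)// ler_piMl ?enorm_ge0.
  rewrite mulrDr; apply: lerD.
    rewrite mulrCA ler_wpM2l//.
    apply: (@le_trans _ _ (C * C * (Q y * enorm y) * enorm (grad (eta k) y))).
      by rewrite ler_wpM2r ?enorm_ge0.
    rewrite [leLHS](_ : _ = C * C * Q y * (enorm (grad (eta k) y) * enorm y)); last by ring.
    rewrite [leRHS](_ : _ = C * C * Q y * 16); last by ring.
    by rewrite ler_wpM2l// mulr_ge0.
  rewrite mulrC ler_wpM2l//; apply: le_trans ha _.
  rewrite [leRHS](_ : _ = C * C * (Q y * r)); last by ring.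
  by rewrite ler_wpM2l// ler_wpM2l// ltW.
have t2 : `|(b1 y + b2 y) * (eta k y * phi y)| <= (C * C ^+ 2 * Q y + C * enorm y `^ gam') * N.
  rewrite normrM ler_pM//; first by apply: le_trans (ler_normD _ _) _; rewrite lerD.
  by rewrite normrM (ger0_norm e0) (le_trans _ p1)// ler_piMl.
apply: le_trans (lerD t1 t2) _; rewrite le_eqVlt; apply/orP; left; apply/eqP; ring.
Qed.

(** The function eta_k phi is supported away from 0, where the equation is known; [F_eta_le] and the
    integrability of its two weights allow k to tend to infinity. *)
Lemma ball_test_identity phi : test_function (eball r) phi ->
  leb.-integrable D (EFin \o F phi) /\ \int[leb]_(y in D) F phi y = 0.
Proof.
move=> /test_ball_supp[phiC [t tr pt] [N N0 hN]].
pose f_ k := F (fun y => eta k y * phi y).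
have Z k : \int[leb]_(y in D) f_ k y = 0.
  have [c _] := eta_mul k phiC.
  have s : supp_in (k.+1%:R^-1) t (fun y => eta k y * phi y).
    by move=> y; rewrite mulf_eq0 negb_or => /andP[/eta_supp -> /pt ->].
  rewrite -(eq0 _ tr c s) ?invr_gt0//; apply: Rintegral_eq_support => y fy; split=> // _.
  apply: contrapT => /negP; rewrite -leNgt => ry; move: fy; rewrite /f_ /F.
  have ny : ~ annulus (k.+1%:R^-1) t (y : V) by move=> /andP[_]; rewrite leNgt (lt_le_trans tr ry).
  by rewrite (supp_in_grad s ny) (supp_in_notin s ny) dotr0r mulr0 subr0 eqxx.
pose G (y : L) := N * (C * C * r + 16 * (C * C) + C * C ^+ 2) * Q y + N * C * enorm (y : V) `^ gam'.
have iG : leb.-integrable D (EFin \o G).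
  have i1 := integrableZl mD (N * (C * C * r + 16 * (C * C) + C * C ^+ 2)) ball_iQ.
  have i2 := integrableZl mD (N * C) (integrable_enorm_powR n0 gam'_gt r0).
  by have := integrableD mD i1 i2; apply: eq_integrable.
have z0 : leb ([set 0] : set L) = 0%E by exact: leb0.
have bad : leb (([set 0] : set L) `|` [set y | D y /\ ~ (`|b2 y| <= C * enorm y `^ gam')]) = 0%E.
  exact: lebU0.
have mf_ k : measurable_fun D (f_ k) by apply: measurable_F; have [] := eta_mul k phiC.
have [] := @dominated_Rintegral R n D f_ (F phi) G mD mf_ (measurable_F phiC) _ iG _.
- apply: subset_null z0 => y [Dy h]; apply: contrapT => /eqP y0; apply: h.
  (* At a fixed y other than 0 the cutoff is eventually 1 with zero gradient, so the sequence is
     eventually constant. *)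
  apply: cvg_near_cst; near=> k.
  have [e1 e2] : eta k y = 1 /\ grad (eta k) y = 0 by near: k; exact: eta_near.
  by have [_ g] := eta_mul k phiC; rewrite /f_ /F g e1 e2 scaler0 add0r scale1r mul1r.
- apply: subset_null bad => y [Dy h]; have [->|y0] := eqVneq (y : V) 0; first by left.
  right; split=> // hb; apply: h => k.
  by have [p1 p2] := hN y; exact: F_eta_le.
- move=> i1; have -> : (fun k => \int[leb]_(y in D) f_ k y) = fun=> 0 by apply/funext => k; exact: Z.
  by move=> /(cvg_unique (@Rhausdorff R) (cvg_cst 0)) <-.
Unshelve. all: by end_near. Qed.

End test.

(** Equal to 1 on the ball of radius r and to 0 beyond 3r/2, so that zeta w extends by 0 outside the
    ball of radius 2r where w is given. *)
Let zeta (y : V) : R := 1 + -1 * radial_step (r ^- 2) y.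

Lemma zeta_C1 : C1_on setT zeta.
Proof.
have [s1 _] := radial_step_C1 (n:=n) (r ^- 2).
have [c1 _] := C1_on_cst (1 : R) (@openT V).
have [c2 _] := C1_on_cst (-1 : R) (@openT V).
have [m1 _] := C1_onM (@openT V) c2 s1.
by have [] := C1_onD (@openT V) c1 m1.
Qed.

Lemma zeta1 y : enorm y < r -> zeta y = 1.
Proof.
move=> yr; rewrite /zeta radial_step0 ?mulr0 ?addr0// -sqr_enorm mulrC ler_pdivrMr ?exprn_gt0//.
by rewrite mul1r ler_pXn2r ?nnegrE ?enorm_ge0 ?ltW.
Qed.

Lemma zeta_supp y : zeta y != 0 -> enorm y <= 3 / 2 * r.
Proof.
apply: contraNT; rewrite -ltNge => h; rewrite /zeta radial_step1 ?mulr1 ?addrN//.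
rewrite -sqr_enorm mulrC ler_pdivlMr ?exprn_gt0//.
have : (3 / 2 * r) ^+ 2 <= enorm y ^+ 2 by rewrite ler_pXn2r ?nnegrE ?enorm_ge0 ?(ltW h)// mulr_ge0// ltW.
have : 0 <= r ^+ 2 by rewrite sqr_ge0.
rewrite exprMn; lra.
Qed.

Let psi k (y : V) : R := w y * (eta k y * zeta y).

Lemma psiP k : [/\ C1_on setT (psi k), supp_in (k.+1%:R^-1) (3 / 2 * r) (psi k) &
  forall y, y != 0 -> enorm y < r -> psi k y = eta k y * w y /\
    grad (psi k) y = eta k y *: grad w y + w y *: grad (eta k) y].
Proof.
have [cC _] := eta_mul k zeta_C1.
have cs : supp_in (k.+1%:R^-1) (3 / 2 * r) (fun y => eta k y * zeta y).
  by move=> y; rewrite mulf_eq0 negb_or => /andP[/eta_supp -> /zeta_supp ->].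
have sW : annulus (k.+1%:R^-1) (3 / 2 * r) `<=` W.
  move=> y /andP[h1 h2]; split.
    by rewrite /punctured /= -enorm_gt0 (lt_le_trans _ h1)// invr_gt0.
  by rewrite /eball /= (le_lt_trans h2)// ltr_pM2r//; lra.
have [p1 p2 p3] := C1_on_extend_supp oW wC cC cs sW.
split=> // y y0 yr; split; first by rewrite /psi (zeta1 yr) mulr1 mulrC.
rewrite p3; last exact: ball_W.
rewrite (zeta1 yr) mulr1; congr (_ + _ *: _).
have e z : eball r z -> eta k z = eta k z * zeta z by move=> zr; rewrite (zeta1 zr) mulr1.
by have [_ ->] := eq_C1_on (@open_eball R n r) e (C1_onS (@subsetT _ _) (@eta_C1 k)).
Qed.

(** The functions psi_k are only C1, whereas the completion asks for smooth ones; mollification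
    brings them within 1/(k+1) in values and in each partial derivative. *)
Lemma approximants : exists phi_ : nat -> V -> R, forall k,
  [/\ smooth_on setT (phi_ k), exists b, C1c b (phi_ k),
   (forall y, `|phi_ k y - psi k y| <= k.+1%:R^-1) &
   (forall y, enorm (grad (phi_ k) y - grad (psi k) y) <= n%:R * k.+1%:R^-1)].
Proof.
suff h k : exists phi : V -> R, [/\ smooth_on setT phi, exists b, C1c b phi,
   (forall y, `|phi y - psi k y| <= k.+1%:R^-1) &
   (forall y, enorm (grad phi y - grad (psi k) y) <= n%:R * k.+1%:R^-1)].
  by have [F hF] := choice h; exists F.
have [p1 p2 _] := psiP k.
have e0 : (0 : R) < k.+1%:R^-1 by rewrite invr_gt0.
have [phi [q1 q2 q3 q4]] := mollify (C1_setT_continuous p1) p2 e0 (@ltr01 R).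
exists phi; split => //.
  by exists (3 / 2 * r + 1); apply: supp_in_C1c q2; exact: smooth_on_C1.
move=> y; apply: enorm_le_bound => [|i]; first exact: ltW.
by rewrite !mxE; exact: q4.
Qed.

(** Bounds uniform in k, the source of the dominating functions in [ball_H12]: the gradient error is
    at most |grad w| + C |grad eta_k|, hence (C + 16 C)/|y|. *)
Lemma psi_close k y : y != 0 -> enorm y < r -> `|psi k y - w y| <= C /\
  enorm (grad (psi k) y - grad w y) * enorm y <= 17 * C.
Proof.
move=> y0 yr; have [_ _ h] := psiP k; have [-> ->] := h y y0 yr.
have /andP[e0 e1] := eta_bounds k y; have Wy := ball_W y0 yr.
have e1' : `|eta k y - 1| <= 1 by rewrite ler0_norm ?subr_le0// opprB gerBl.
split.
  rewrite -{2}[w y]mul1r -mulrBl normrM (le_trans _ (w_le Wy))// ler_piMl//.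
rewrite addrAC -{2}[grad w y]scale1r -scalerBl.
apply: (@le_trans _ _ ((enorm (grad w y) + C * enorm (grad (eta k) y)) * enorm y)).
  rewrite ler_wpM2r ?enorm_ge0//; apply: le_trans (ler_enormD _ _) _; rewrite !enormZ.
  by apply: lerD; [rewrite ler_piMl ?enorm_ge0|rewrite ler_wpM2r ?enorm_ge0//; exact: w_le].
rewrite mulrDl -mulrA; have h1 := gw_le Wy.
have h2 : C * (enorm (grad (eta k) y) * enorm y) <= C * 16 by rewrite ler_wpM2l// eta_grad.
by move: h1 h2; lra.
Qed.

Lemma psi_near y : y != 0 -> enorm y < r ->
  \forall k \near \oo, psi k y = w y /\ grad (psi k) y = grad w y.
Proof.
move=> y0 yr; near=> k; have [_ _ h] := psiP k; have [-> ->] := h y y0 yr.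
have [-> ->] : eta k y = 1 /\ grad (eta k) y = 0 by near: k; exact: eta_near.
by rewrite mul1r scale1r scaler0 addr0.
Unshelve. all: by end_near. Qed.

Lemma measurable_w : measurable_fun D (w : L -> R).
Proof.
apply: measurable_fun_punctured => // y y0 yr.
by apply: C1_continuous wC _ => //; exact: ball_W.
Qed.

Lemma measurable_grad_w i : measurable_fun D (fun y : L => grad w y 0 i).
Proof.
apply: (@measurable_fun_punctured _ _ n0 r (fun y => grad w y 0 i)) => y y0 yr.
by apply: C1_continuous_grad wC _; exact: ball_W.
Qed.

Lemma H12_norm_fin (phi : V -> R) b : C1c b phi -> (H12_norm r gam phi (grad phi) < +oo)%E.
Proof.
move=> phiC; have pC : C1_on setT phi by case: phiC.
have [N N0 hN] := Cc_bound (C1c_Cc phiC).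
have h i : exists M : R, 0 <= M /\ forall y, `|partial i phi y| <= M.
  by have [M1 M10 h] := Cc_bound (C1c_partial_Cc i phiC); exists M1.
have [M hM] := choice h.
have i1 : leb.-integrable D (EFin \o (fun y : L => P y * phi y ^+ 2)).
  apply: (@integrable_bounded_mul _ _ _ _ _ mD _ _ (N ^+ 2) ball_iP).
    apply: measurable_funX; apply: continuous_measurable; exact: C1_setT_continuous.
  by move=> y _; rewrite normrX ler_pXn2r ?nnegrE.
have i2 : leb.-integrable D (EFin \o (fun y : L => P y * enorm (grad phi y) ^+ 2)).
  apply: (@integrable_bounded_mul _ _ _ _ _ mD _ _ (\sum_i (M i) ^+ 2) ball_iP).
    rewrite (_ : (fun y => _) = (fun y => dotr (grad phi y) (grad phi y))); last first.
      by apply/funext => y; rewrite sqr_enorm.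
    apply: measurable_dotr => i; apply: continuous_measurable; exact: continuous_grad_coord.
  move=> y _; rewrite ger0_norm ?exprn_ge0 ?enorm_ge0// sqr_enorm; apply: ler_sum => i _.
  rewrite mxE -expr2 -(real_normK (num_real (partial i phi y))) ler_pXn2r ?nnegrE//; by have [] := hM i.
rewrite /H12_norm.
have f1 := integrable_fin_num mD i1; have f2 := integrable_fin_num mD i2.
by rewrite -(fineK f1) -(fineK f2) ltry.
Qed.

(** The mollified truncations of w converge in the weighted norm by dominated convergence: values
    with a multiple of |y|^gamma, gradients with a multiple of |y|^(gamma-2). *)
Lemma ball_H12 (u : V -> R) : leb ([set y | D y /\ u y <> w y] : set L) = 0%E ->
  H12 r gam u (grad w).
Proof.
move=> uw; have wu : leb ([set y | D y /\ w y <> u y] : set L) = 0%E.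
  by apply: subset_null uw => y [Dy h]; split => // h'; apply: h.
have mu_ : measurable_fun D (u : L -> R) by apply: ae_eq_measurable_fun wu measurable_w.
split; [exact: mu_|exact: measurable_grad_w|].
have [phi_ hphi] := approximants; exists phi_; split.
  move=> k; have [p1 [b p2] _ _] := hphi k; split; last exact: H12_norm_fin p2.
  by move=> s x _; exact: p1.
have phiC k : C1_on setT (phi_ k) by have [p1 _ _ _] := hphi k; exact: smooth_on_C1.
have mP : measurable_fun D (P : L -> R) by exact: measurable_enorm_powR.
have z0 : leb ([set 0] : set L) = 0%E by exact: leb0.
have bad : leb (([set 0] : set L) `|` [set y | D y /\ u y <> w y]) = 0%E.
  exact: lebU0.
have k1 k : k.+1%:R^-1 <= 1 :> R by rewrite invf_le1// ler1n.
have k0 k : 0 <= k.+1%:R^-1 :> R by rewrite invr_ge0.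
have P0 y : 0 <= P y by exact: powR_ge0.
pose f1 k (y : L) := P y * (phi_ k y - u y) ^+ 2.
pose f2 k (y : L) := P y * enorm (grad (phi_ k) y - grad w y) ^+ 2.
have mf1 k : measurable_fun D (f1 k).
  apply: measurable_funM; first exact: mP.
  apply: measurable_funX; apply: measurable_funB; last exact: mu_.
  by apply: continuous_measurable; exact: C1_setT_continuous.
have mf2 k : measurable_fun D (f2 k).
  apply: measurable_funM; first exact: mP.
  rewrite (_ : (fun y => _) = (fun y : L => dotr (grad (phi_ k) y - grad w y) (grad (phi_ k) y - grad w y))); last first.
    by apply/funext => y; rewrite sqr_enorm.
  have m i : measurable_fun D (fun y : L => (grad (phi_ k) y - grad w y) 0 i).
    rewrite (_ : (fun y => _) = (fun y : L => grad (phi_ k) y 0 i - grad w y 0 i)); last first.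
      by apply/funext => y; rewrite !mxE.
    apply: measurable_funB; last exact: measurable_grad_w.
    by apply: continuous_measurable; exact: continuous_grad_coord.
  exact: (measurable_dotr m m).
have iG1 := integrableZl mD ((1 + C) ^+ 2) ball_iP.
have iG2 := integrableZl mD ((n%:R * r + 17 * C) ^+ 2) ball_iQ.
(* The constants come from |phi_k - w| <= 1 + C and from |y| |grad phi_k - grad w| <= n r + 17 C on
   the ball. *)
pose G1 (y : L) : R := (1 + C) ^+ 2 * P y.
pose G2 (y : L) : R := (n%:R * r + 17 * C) ^+ 2 * Q y.
have {}iG1 : leb.-integrable D (EFin \o G1) by move: iG1; apply: eq_integrable.
have {}iG2 : leb.-integrable D (EFin \o G2) by move: iG2; apply: eq_integrable.
have f10 k y : D y -> 0 <= f1 k y by move=> _; rewrite mulr_ge0// sqr_ge0.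
have f20 k y : D y -> 0 <= f2 k y by move=> _; rewrite mulr_ge0// sqr_ge0.
have sq_le (x c : R) k : 0 <= x -> 0 <= c -> x <= c * k.+1%:R^-1 -> x ^+ 2 <= c ^+ 2 * k.+1%:R^-1.
  move=> x0 c0 xc; apply: (@le_trans _ _ ((c * k.+1%:R^-1) ^+ 2)).
    by rewrite ler_pXn2r ?nnegrE// mulr_ge0.
  by rewrite exprMn ler_wpM2l ?sqr_ge0// expr2 ler_piMr.
have [i1 E1 c1] : exists2 i_ : nat -> R, (forall k, (\int[leb]_(y in D) (f1 k y)%:E)%E = (i_ k)%:E) &
    i_ k @[k --> \oo] --> (0 : R).
  apply: (weighted_vanishing mD mf1 f10 iG1); apply: subset_null bad => y [Dy h].
  have [->|y0] := eqVneq (y : V) 0; first by left.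
  right; split=> // uwy; apply: h; rewrite /f1 uwy; split.
    move=> k; rewrite /G1 mulrC ler_wpM2r// -(real_normK (num_real _)) ler_pXn2r ?nnegrE ?addr_ge0//.
    have [_ _ h1 _] := hphi k; have [h2 _] := psi_close k y0 Dy.
    rewrite -(subrK (psi k y) (phi_ k y)) -addrA; apply: le_trans (ler_normD _ _) _.
    by apply: lerD => //; apply: le_trans (h1 y) _.
  exists (P y) => //; near=> k; rewrite ler_wpM2l//.
  have [pw _] : psi k y = w y /\ grad (psi k) y = grad w y by near: k; exact: psi_near.
  have [_ _ h1 _] := hphi k; rewrite -(real_normK (num_real _)).
  have h2 : `|phi_ k y - w y| <= 1 * k.+1%:R^-1 by rewrite mul1r -pw.
  by have := sq_le _ 1 k (normr_ge0 _) ler01 h2; rewrite expr1n mul1r.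
have [i2 E2 c2] : exists2 i_ : nat -> R, (forall k, (\int[leb]_(y in D) (f2 k y)%:E)%E = (i_ k)%:E) &
    i_ k @[k --> \oo] --> (0 : R).
  apply: (weighted_vanishing mD mf2 f20 iG2); apply: subset_null z0 => y [Dy h].
  apply: contrapT => /eqP y0; apply: h; split.
    move=> k; rewrite /f2 /G2 ball_PQ// -mulrA mulrC ler_wpM2r ?ball_Q0// -exprMn.
    rewrite ler_pXn2r ?nnegrE ?addr_ge0 ?mulr_ge0 ?enorm_ge0 ?(ltW r0)//.
    have [_ _ _ h1] := hphi k; have [_ h2] := psi_close k y0 Dy; rewrite mulrC.
    apply: (@le_trans _ _ ((enorm (grad (phi_ k) y - grad (psi k) y) + enorm (grad (psi k) y - grad w y)) * enorm y)).
      rewrite ler_wpM2r ?enorm_ge0// (le_trans _ (ler_enormD _ _))//.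
      by rewrite addrA subrK.
    rewrite mulrDl lerD//; apply: ler_pM; rewrite ?enorm_ge0//; last exact: ltW.
    by apply: le_trans (h1 y) _; rewrite ler_piMr.
  exists (P y * n%:R ^+ 2); first by rewrite mulr_ge0// sqr_ge0.
  near=> k; rewrite /f2 -mulrA ler_wpM2l//.
  have [_ pw] : psi k y = w y /\ grad (psi k) y = grad w y by near: k; exact: psi_near.
  by have [_ _ _ h1] := hphi k; apply: sq_le; rewrite ?enorm_ge0// -pw.
rewrite /H12_norm.
have -> : (fun k => sqrte (\int[leb]_(y in eball r) (enorm y `^ gam * (phi_ k y - u y) ^+ 2)%:E +
    \int[leb]_(y in eball r) (enorm y `^ gam * enorm (grad (phi_ k) y - grad w y) ^+ 2)%:E)%E) =
    (fun k => (Num.sqrt (i1 k + i2 k))%:E).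
  by apply/funext => k; rewrite -[RHS]/(sqrte ((i1 k)%:E + (i2 k)%:E)%E) -E1 -E2.
have hsum : (fun k => i1 k + i2 k) @ \oo --> (0 : R).
  by rewrite -[X in _ --> X](addr0 0); exact: cvgD.
have hs : (@Num.sqrt R \o (fun k => i1 k + i2 k)) @ \oo --> (0 : R).
  apply: cvg_comp hsum _; have := @sqrt_continuous R 0.
  by rewrite /continuous_at sqrtr0.
by apply: cvg_EFin; [exact: nearW|exact: hs].
Unshelve. all: by end_near. Qed.

End ball_weak_form.

(** * Coefficients with prescribed values along the gradient of the solution *)

Section coefficients.
Context {R : realType} {n : nat}.
Local Notation V := 'rV[R]_n.
Local Notation L := (Leb R n).
Variables (r gam gam' c C : R) (a xi0 : V -> V) (b1 b2 : V -> R).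
Hypotheses (c0 : 0 < c) (C0 : 0 <= C).
Let D := eball r : set L.
Let P (y : V) := enorm y `^ gam.
Hypothesis ma : forall i, measurable_fun D (fun y => a y 0 i).
Hypothesis mxi : forall i, measurable_fun D (fun y => xi0 y 0 i).
Hypotheses (mb1 : measurable_fun D b1) (mb2 : measurable_fun D b2).
Hypothesis a_le : forall y, y != 0 -> enorm y < r ->
  enorm (a y) <= C * P y * enorm (xi0 y).
Hypothesis a_ge : forall y, y != 0 -> enorm y < r ->
  c * P y * enorm (xi0 y) ^+ 2 <= dotr (a y) (xi0 y).
Hypothesis b1_le : forall y, y != 0 -> enorm y < r ->
  `|b1 y| <= C * P y * enorm (xi0 y) ^+ 2.
Hypothesis b2_le : leb ([set y | D y /\ ~ (`|b2 y| <= C * enorm y `^ gam')] : set L) = 0%E.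

Let s (y : V) : R := (dotr (xi0 y) (xi0 y))^-1.

(* Where xi0 = 0 the convention 0^-1 = 0 turns all quotients into 0. *)
Definition coefk (y : V) : R :=
  P y + (dotr (a y) (xi0 y) - P y * dotr (xi0 y) (xi0 y)) * s y.

(** A linear map in xi: [coefk y] times the identity plus the skew map built from a and xi0. With k
    = a . xi0/|xi0|^2, it sends xi0 to a, and its quadratic form is k |xi|^2. *)
Definition coefA (y : V) (zx : R * V) : V :=
  coefk y *: zx.2 + (dotr (xi0 y) zx.2 * s y) *: a y - (dotr (a y) zx.2 * s y) *: xi0 y.

Definition coefB (y : V) (zx : R * V) : R := b1 y * s y * dotr zx.2 zx.2 + b2 y.

Lemma snd_coord_continuous i : continuous (fun zx : R * V => zx.2 0 i).
Proof.
move=> zx; apply: (@continuous_comp _ _ _ (fun zx : R * V => zx.2) (fun x : V => x 0 i)).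
  exact: cvg_snd.
exact: coord_continuous.
Qed.

Lemma snd_dotr_continuous (x : V) : continuous (fun zx : R * V => dotr x zx.2).
Proof.
move=> zx; apply: continuous_sumr => i.
apply: continuousM; [exact: cst_continuous|exact: snd_coord_continuous].
Qed.

Let mD : measurable D. Proof. exact: eball_measurable. Qed.

Let mP : measurable_fun D (P : L -> R). Proof. exact: measurable_enorm_powR. Qed.

Let ms : measurable_fun D (s : L -> R).
Proof.
apply: measurable_funV_ge0 => [y|]; first exact: dotr_ge0.
exact: (measurable_dotr mxi mxi).
Qed.

Let mcst (x : V) i : measurable_fun D (fun _ : L => x 0 i).
Proof. exact: measurable_cst. Qed.

Lemma measurable_coefk : measurable_fun D (coefk : L -> R).
Proof.
apply: (measurable_funD mP); apply: measurable_funM; last exact: ms.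
apply: measurable_funB; first exact: (measurable_dotr ma mxi).
by apply: (measurable_funM mP); exact: (measurable_dotr mxi mxi).
Qed.

Lemma caratheodory_coefA i : caratheodory (eball r) (fun y w => coefA y w 0 i).
Proof.
have E y (zx : R * V) : coefA y zx 0 i = coefk y * zx.2 0 i + (dotr (xi0 y) zx.2 * s y) * a y 0 i
    - (dotr (a y) zx.2 * s y) * xi0 y 0 i by rewrite /coefA !mxE.
split=> [zx|].
  rewrite (_ : (fun y => _) = (fun y : L => coefk y * zx.2 0 i + (dotr (xi0 y) zx.2 * s y) * a y 0 i
    - (dotr (a y) zx.2 * s y) * xi0 y 0 i)); last by apply/funext => y; rewrite E.
  apply: measurable_funB; first apply: measurable_funD.
  - by apply: (measurable_funM measurable_coefk); exact: measurable_cst.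
  - apply: measurable_funM; last exact: ma.
    by apply: measurable_funM; [exact: (measurable_dotr mxi (mcst zx.2))|exact: ms].
  - apply: measurable_funM; last exact: mxi.
    by apply: measurable_funM; [exact: (measurable_dotr ma (mcst zx.2))|exact: ms].
apply/aeP; rewrite (_ : [set y | _] = set0) ?measure0//.
apply/seteqP; split=> // y /= h; apply: h => _.
rewrite (_ : (fun w => coefA y w 0 i) = (fun zx : R * V => coefk y * zx.2 0 i +
  (dotr (xi0 y) zx.2 * s y) * a y 0 i - (dotr (a y) zx.2 * s y) * xi0 y 0 i)); last first.
  by apply/funext => zx; rewrite E.
move=> zx; apply: cvgB; first apply: cvgD.
- by apply: cvgM; [exact: cvg_cst|exact: snd_coord_continuous].
- by apply: cvgM; [apply: cvgM; [exact: snd_dotr_continuous|exact: cvg_cst]|exact: cvg_cst].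
- by apply: cvgM; [apply: cvgM; [exact: snd_dotr_continuous|exact: cvg_cst]|exact: cvg_cst].
Qed.

Lemma caratheodory_coefB : caratheodory (eball r) coefB.
Proof.
split=> [zx|].
  apply: measurable_funD; last exact: mb2.
  by apply: measurable_funM; [exact: (measurable_funM mb1 ms)|exact: measurable_cst].
apply/aeP; rewrite (_ : [set y | _] = set0) ?measure0//.
apply/seteqP; split=> // y /= h; apply: h => _ zx.
apply: cvgD; last exact: cvg_cst.
apply: cvgM; first exact: cvg_cst.
apply: (@continuous_sumr R _ _ _ (fun i (zx : R * V) => zx.2 0 i * zx.2 0 i)) => i.
by apply: cvgM; exact: snd_coord_continuous.
Qed.

(** Where xi0 = 0 the bounds on a and b1 force both to vanish, consistently with the default value 0
    of the quotients. *)
Lemma coef_xi0 y z : y != 0 -> enorm y < r ->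
  coefA y (z, xi0 y) = a y /\ coefB y (z, xi0 y) = b1 y + b2 y.
Proof.
move=> y0 yr; rewrite /coefA /coefB /coefk /=.
have [x0|x0] := eqVneq (xi0 y) 0.
  have := a_le y0 yr; have := b1_le y0 yr; rewrite x0 enorm0 expr0n/= !mulr0 normr_le0 => /eqP -> h.
  have /eqP : enorm (a y) == 0 by rewrite eq_le h enorm_ge0.
  move=> /eqP; rewrite enorm_eq0 => /eqP ->.
  by rewrite !scaler0 addr0 subr0 !mul0r.
have d0 : dotr (xi0 y) (xi0 y) != 0 by rewrite -sqr_enorm expf_eq0/= enorm_eq0.
split; last by rewrite /s mulfVK.
rewrite /s mulfV// scale1r mulrBl mulfK// addrCA subrr addr0.
by rewrite addrAC subrr add0r.
Qed.

(** The skew part does not contribute to A . xi, so ellipticity is the lower bound for [coefk]. In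
    C', the identity part accounts for C + 1, the two skew terms for C each, and c^-1 secures the
    lower bound. *)
Lemma coef_bounds y z xi : y != 0 -> enorm y < r -> `|b2 y| <= C * enorm y `^ gam' ->
  let C' := 3 * C + 1 + c^-1 in
  [/\ enorm (coefA y (z, xi)) <= C' * P y * enorm xi,
      C'^-1 * P y * enorm xi ^+ 2 <= dotr (coefA y (z, xi)) xi &
      `|coefB y (z, xi)| <= C' * (P y * enorm xi ^+ 2 + enorm y `^ gam')].
Proof.
move=> y0 yr hb2 C'; have P0 : 0 <= P y by exact: powR_ge0.
have ci0 : 0 < c^-1 by rewrite invr_gt0.
have [ec eE] : exists e, e = c^-1 by exists c^-1.
have ec0 : 0 < ec by rewrite eE.
have C'0 : 0 < C' by rewrite /C' -eE; move: ec0 C0; lra.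
have s0 : 0 <= s y by rewrite /s invr_ge0 dotr_ge0.
have x0 := enorm_ge0 xi.
have h1 : enorm (a y) * enorm (xi0 y) * s y <= C * P y.
  have [z0|z0] := eqVneq (xi0 y) 0; first by rewrite z0 enorm0 mulr0 mul0r mulr_ge0.
  have e0 : 0 < enorm (xi0 y) by rewrite enorm_gt0.
  rewrite /s -sqr_enorm ler_pdivrMr ?exprn_gt0// expr2 mulrA ler_pM2r//.
  exact: a_le.
have kE : c * P y <= coefk y \/ coefk y = P y.
  have [z0|z0] := eqVneq (xi0 y) 0; [right|left].
    by rewrite /coefk z0 !dotr0r mulr0 subr0 mul0r addr0.
  have d0 : dotr (xi0 y) (xi0 y) != 0 by rewrite -sqr_enorm expf_eq0/= enorm_eq0.
  rewrite /coefk /s mulrBl mulfK// addrCA subrr addr0 ler_pdivlMr.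
    by have := a_ge y0 yr; rewrite sqr_enorm.
  by rewrite lt_neqAle eq_sym d0 dotr_ge0.
have k_ge : C'^-1 * P y <= coefk y.
  have hc : C'^-1 <= c.
    by rewrite -[leRHS]invrK lef_pV2 ?posrE ?invr_gt0// /C' -eE; move: ec0 C0; lra.
  have h11 : C'^-1 <= 1 by rewrite invf_le1// /C' -eE; move: ec0 C0; lra.
  case: kE => [h|->]; last by rewrite ler_piMl.
  by apply: le_trans h; rewrite ler_wpM2r.
have k_le : `|coefk y| <= (C + 1) * P y.
  have [z0|z0] := eqVneq (xi0 y) 0.
    by rewrite /coefk z0 !dotr0r mulr0 subr0 mul0r addr0 ger0_norm// ler_peMl// lerDr.
  have d0 : dotr (xi0 y) (xi0 y) != 0 by rewrite -sqr_enorm expf_eq0/= enorm_eq0.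
  have -> : coefk y = dotr (a y) (xi0 y) * s y by rewrite /coefk /s; field.
  rewrite normrM (ger0_norm s0).
  apply: (@le_trans _ _ (C * P y)); last by rewrite ler_wpM2r// lerDl.
  by apply: le_trans h1; rewrite ler_wpM2r// cauchy_schwarz_dotr.
have h2 : `|dotr (xi0 y) xi * s y| * enorm (a y) <= C * P y * enorm xi.
  rewrite normrM (ger0_norm s0).
  apply: (@le_trans _ _ (enorm (xi0 y) * enorm xi * s y * enorm (a y))).
    by rewrite ler_wpM2r ?enorm_ge0// ler_wpM2r// cauchy_schwarz_dotr.
  rewrite [leLHS](_ : _ = enorm (a y) * enorm (xi0 y) * s y * enorm xi); last by ring.
  by rewrite ler_wpM2r.
have h3 : `|dotr (a y) xi * s y| * enorm (xi0 y) <= C * P y * enorm xi.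
  rewrite normrM (ger0_norm s0).
  apply: (@le_trans _ _ (enorm (a y) * enorm xi * s y * enorm (xi0 y))).
    by rewrite ler_wpM2r ?enorm_ge0// ler_wpM2r// cauchy_schwarz_dotr.
  rewrite [leLHS](_ : _ = enorm (a y) * enorm (xi0 y) * s y * enorm xi); last by ring.
  by rewrite ler_wpM2r.
split.
- rewrite /coefA /=; apply: le_trans (ler_enormB _ _) _.
  apply: (@le_trans _ _ ((C + 1) * P y * enorm xi + C * P y * enorm xi + C * P y * enorm xi)).
    apply: lerD; last by rewrite enormZ.
    apply: le_trans (ler_enormD _ _) _; rewrite !enormZ; apply: lerD => //.
    by rewrite ler_wpM2r.
  rewrite -!mulrDl ler_wpM2r// ler_wpM2r// /C' -eE; move: ec0 C0; lra.
- rewrite /coefA /= dotrDl dotrNl dotrDl !dotrZl (_ : _ - _ = coefk y * enorm xi ^+ 2); last first.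
    by rewrite sqr_enorm; ring.
  by rewrite ler_wpM2r// exprn_ge0.
- rewrite /coefB /= -sqr_enorm; apply: le_trans (ler_normD _ _) _; rewrite mulrDr.
  have CC : C <= C' by rewrite /C' -eE; move: ec0 C0; lra.
  apply: lerD; last by apply: le_trans hb2 _; rewrite ler_wpM2r// powR_ge0.
  rewrite normrM (ger0_norm (_ : 0 <= enorm xi ^+ 2)) ?exprn_ge0// mulrA ler_wpM2r ?exprn_ge0//.
  apply: (@le_trans _ _ (C * P y)); last by rewrite ler_wpM2r.
  have [z0|z0] := eqVneq (xi0 y) 0.
    by rewrite /s z0 dotr0r invr0 mulr0 normr0 mulr_ge0.
  have d0 : 0 < dotr (xi0 y) (xi0 y) by rewrite -sqr_enorm exprn_gt0// enorm_gt0.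
  rewrite normrM (ger0_norm s0) /s ler_pdivrMr// -sqr_enorm; exact: b1_le.
Qed.

End coefficients.

(** * The equation in the exterior domain *)

Section powR_exponents.
Context {R : realType}.

Lemma powR_expR (u y : R) : expR u `^ y = expR (y * u).
Proof. by rewrite /powR gt_eqF ?expR_gt0// expRK. Qed.

(** Writing positive numbers as exponentials turns identities between real powers into linear
    identities between exponents, which [ring] settles. *)
Lemma pos_expR (x : R) : 0 < x -> exists u, x = expR u.
Proof. by move=> x0; exists (ln x); rewrite lnK. Qed.

End powR_exponents.

Section exterior_equation.
Context {R : realType} {n : nat}.
Local Notation V := 'rV[R]_n.
Local Notation L := (Leb R n).
Implicit Types (phi psi : V -> R).

Lemma Rintegral_sum_eq0 (I : Type) (l : seq I) (f : I -> L -> R) :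
  (forall i, leb.-integrable [set: L] (EFin \o f i)) ->
  (forall i, \int[leb]_(x in [set: L]) f i x = 0) ->
  leb.-integrable [set: L] (EFin \o (fun x => \sum_(i <- l) f i x)) /\
  \int[leb]_(x in [set: L]) (\sum_(i <- l) f i x) = 0.
Proof.
move=> fi f0; elim: l => [|i l [IH1 IH2]].
  rewrite (_ : (fun x => _) = (fun=> 0)); last by apply/funext => x; rewrite big_nil.
  split; first exact: integrable0.
  by rewrite /Rintegral integral0.
rewrite (_ : (fun x => _) = (fun x => f i x + \sum_(j <- l) f j x)); last first.
  by apply/funext => x; rewrite big_cons.
split; last by rewrite RintegralD// f0 IH2 addr0.
by have := integrableD measurableT (fi i) IH1; apply: eq_integrable.
Qed.

Lemma C1c_partial_integrable b phi i : C1c b phi ->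
  leb.-integrable [set: L] (EFin \o (partial i phi : L -> R)).
Proof. by move=> h; apply: Cc_integrable (C1c_partial_Cc i h). Qed.

(** The field |x|^(-n) x has divergence zero off the origin, so the integrand is the divergence of
    the compactly supported C1 field chi |x|^(-n) x. *)
Lemma divergence_free chi s t : C1_on setT chi -> supp_in s t chi -> 0 < s ->
  let f (x : L) := enorm (x : V) `^ (- n%:R) * dotr x (grad chi x) in
  leb.-integrable [set: L] (EFin \o f) /\ \int[leb]_(x in [set: L]) f x = 0.
Proof.
move=> chiC cs s0 f.
have oP : open (@punctured R n) by exact: open_punctured.
have sP : annulus s t `<=` (@punctured R n).
  by move=> x /andP[sx _]; rewrite /punctured /= -enorm_gt0 (lt_le_trans s0).
have [pC pg] := @C1_on_enorm_powR R n (- n%:R).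
pose h i (x : V) : R := enorm x `^ (- n%:R) * x 0 i.
have hC i : C1_on punctured (h i) /\ (forall x, punctured x -> grad (h i) x =
    x 0 i *: grad (fun x : V => enorm x `^ (- n%:R)) x + enorm x `^ (- n%:R) *: delta_mx 0 i).
  have [c1 c2] := C1_on_coord i oP.
  have [m1 m2] := C1_onM oP pC c1; split=> // x px; by rewrite m2// c2.
have key i : [/\ C1_on setT (fun x => h i x * chi x), supp_in s t (fun x => h i x * chi x) &
  (forall x, punctured x ->
     grad (fun x => h i x * chi x) x = chi x *: grad (h i) x + h i x *: grad chi x)].
  by have [h1 _] := hC i; exact: C1_on_extend_supp.
have cc i : C1c t (fun x => h i x * chi x) by have [k1 k2 _] := key i; exact: supp_in_C1c k2.
have fE : f = (fun x => \sum_(i <- index_enum 'I_n) partial i (fun x => h i x * chi x) x).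
  apply/funext => x; rewrite /f; have [xs|nxs] := pselect (annulus s t x); last first.
    rewrite (supp_in_grad cs nxs) dotr0r mulr0 big1// => i _.
    have [_ k2 _] := key i; have := supp_in_grad k2 nxs => /rowP/(_ i).
    by rewrite !mxE.
  have px := sP x xs.
  have E i : partial i (fun x => h i x * chi x) x =
      chi x * (enorm x `^ (- n%:R) + (- n%:R) * enorm x `^ (- n%:R - 2) * (x 0 i * x 0 i)) +
      enorm x `^ (- n%:R) * (x 0 i * grad chi x 0 i).
    have [_ _ k3] := key i; have := k3 x px => /rowP/(_ i).
    have [_ ->] := hC i => //; rewrite pg// !mxE !eqxx mulr1 => ->.
    by rewrite /h; ring.
  under eq_bigr do rewrite E.
  rewrite big_split/= -!mulr_sumr big_split/= -mulr_sumr sumr_const card_ord -/(dotr x x).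
  rewrite -sqr_enorm.
  (* The divergence n |x|^(-n) - n |x|^(-n-2) |x|^2 cancels once both terms carry the same power. *)
  have -> : enorm x `^ (- n%:R) = enorm x `^ (- n%:R - 2) * enorm x ^+ 2.
    rewrite -powR_mulrn ?enorm_ge0// -powRD ?subrK//.
    by apply/implyP => _; rewrite enorm_eq0.
  by rewrite -mulr_natl /dotr; ring.
rewrite fE; apply: Rintegral_sum_eq0 => i; first exact: C1c_partial_integrable (cc i).
exact: integral_partial_eq0 (cc i).
Qed.

(** Mollified test functions converge uniformly with their first derivatives, and the coefficients
    are integrable on the annulus that carries them. C1 is the regularity of the test functions
    produced by v and by the cutoffs. *)
Lemma weak_eq_C1 (rho : R) (G : 'I_n -> L -> R) (F : L -> R) :
  (forall i s t, rho < s -> leb.-integrable (annulus s t : set L) (EFin \o G i)) ->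
  (forall s t, rho < s -> leb.-integrable (annulus s t : set L) (EFin \o F)) ->
  (forall phi, test_function (exterior rho) phi ->
     \int[leb]_(x in (exterior rho : set L)) (\sum_i G i x * partial i phi x - F x * phi x) = 0) ->
  forall psi s t, C1_on setT psi -> supp_in s t psi -> rho < s ->
  let f (x : L) := \sum_i G i x * partial i psi x - F x * psi x in
  leb.-integrable [set: L] (EFin \o f) /\ \int[leb]_(x in [set: L]) f x = 0.
Proof.
move=> iG iF eq psi s t psiC ps rs f.
pose del := (s - rho) / 2; have del0 : 0 < del by rewrite divr_gt0// subr_gt0.
have rs' : rho < s - del by rewrite /del; lra.
pose K := annulus (s - del) (t + del) : set L.
have mK : measurable K by exact: annulus_measurable.
have e0 k : (0 : R) < k.+1%:R^-1 by rewrite invr_gt0.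
have [phi_ hphi] : exists phi_ : nat -> V -> R, forall k,
   [/\ smooth_on setT (phi_ k), supp_in (s - del) (t + del) (phi_ k),
    (forall x, `|phi_ k x - psi x| <= k.+1%:R^-1) &
    (forall i x, `|partial i (phi_ k) x - partial i psi x| <= k.+1%:R^-1)].
  suff h k : exists phi : V -> R, [/\ smooth_on setT phi, supp_in (s - del) (t + del) phi,
    (forall x, `|phi x - psi x| <= k.+1%:R^-1) &
    (forall i x, `|partial i phi x - partial i psi x| <= k.+1%:R^-1)].
    by have [H hH] := choice h; exists H.
  have [phi [q1 q2 q3 q4]] := mollify (C1_setT_continuous psiC) ps (e0 k) del0.
  by exists phi; split => //; exact: q4.
have ps' : supp_in (s - del) (t + del) psi.
  by move=> x /ps /andP[h1 h2]; apply/andP; split; [apply: le_trans h1|apply: le_trans h2 _]; lra.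
pose f_ k (x : L) := \sum_i G i x * partial i (phi_ k) x - F x * phi_ k x.
pose S (x : L) := \sum_i `|G i x| + `|F x|.
have phiC k : C1_on setT (phi_ k) by have [h _ _ _] := hphi k; exact: smooth_on_C1.
have mG i : measurable_fun K (G i) by apply/measurable_EFinP; exact: measurable_int (iG i _ _ rs').
have mF : measurable_fun K F by apply/measurable_EFinP; exact: measurable_int (iF _ _ rs').
have mH phi : C1_on setT phi -> measurable_fun K (fun x => \sum_i G i x * partial i phi x - F x * phi x).
  move=> h; apply: measurable_funB.
    apply: measurable_sum => i; apply: (measurable_funM (mG i)).
    by apply: continuous_measurable; exact: C1_setT_continuous_partial.
  by apply: (measurable_funM mF); apply: continuous_measurable; exact: C1_setT_continuous.
have supp_off phi x : C1_on setT phi -> supp_in (s - del) (t + del) phi -> ~ K x ->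
    \sum_i G i x * partial i phi x - F x * phi x = 0.
  move=> h1 h2 nK; rewrite (supp_in_notin h2 nK) mulr0 subr0 big1// => i _.
  by have := supp_in_grad h2 nK => /rowP/(_ i); rewrite !mxE => ->; rewrite mulr0.
have Z k : \int[leb]_(x in K) f_ k x = 0.
  have [h1 h2 _ _] := hphi k.
  have tphi : test_function (exterior rho) (phi_ k).
    by apply: (smooth_test_function h1 h2); exact: annulus_exterior.
  rewrite -(eq _ tphi); apply: Rintegral_eq_support => x fx.
  have Kx : K x by apply: contrapT => nK; move: fx; rewrite /f_ (supp_off _ _ (phiC k) h2 nK) eqxx.
  by split=> // _; exact: (annulus_exterior rs' Kx).
have iS : leb.-integrable K (EFin \o S).
  have i1 (l : seq 'I_n) : leb.-integrable K (EFin \o (fun x => \sum_(i <- l) `|G i x|)).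
    elim: l => [|i l IH].
      rewrite (_ : (fun x => _) = (fun=> 0)); last by apply/funext => x; rewrite big_nil.
      exact: integrable0.
    rewrite (_ : (fun x => _) = (fun x => `|G i x| + \sum_(j <- l) `|G j x|)); last first.
      by apply/funext => x; rewrite big_cons.
    have := integrableD mK (integrable_norm (iG i _ _ rs')) IH; exact: eq_integrable.
  by have := integrableD mK (i1 (index_enum 'I_n)) (integrable_norm (iF _ _ rs')); apply: eq_integrable.
have close k x : `|f_ k x - f x| <= k.+1%:R^-1 * S x.
  have [_ _ h3 h4] := hphi k.
  rewrite /f_ /f (_ : _ - _ = \sum_i G i x * (partial i (phi_ k) x - partial i psi x) -
     F x * (phi_ k x - psi x)); last first.
    under [X in _ = X - _]eq_bigr do rewrite mulrBr.
    by rewrite sumrB; ring.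
  apply: le_trans (ler_normB _ _) _; rewrite /S [leRHS]mulrDr [X in _ <= X + _]mulr_sumr; apply: lerD.
    apply: le_trans (ler_norm_sum _ _ _) _; apply: ler_sum => i _.
    by rewrite normrM mulrC ler_wpM2r.
  by rewrite normrM mulrC ler_wpM2r.
have [N N0 hN] := Cc_bound (supp_in_Cc (C1_setT_continuous psiC) ps').
have h i : exists M : R, 0 <= M /\ forall y, `|partial i psi y| <= M.
  have [M1 M10 h] := Cc_bound (supp_in_Cc (C1_setT_continuous_partial (i:=i) psiC) (supp_in_partial (i:=i) ps')).
  by exists M1.
have [B hB] := choice h.
pose T := N + \sum_i B i; have B0 i : 0 <= B i by have [] := hB i.
have T0 : 0 <= T by rewrite addr_ge0// sumr_ge0.
have fT x : `|f x| <= T * S x.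
  rewrite /f /S; apply: le_trans (ler_normB _ _) _; rewrite mulrDr mulr_sumr; apply: lerD.
    apply: le_trans (ler_norm_sum _ _ _) _; apply: ler_sum => i _.
    rewrite normrM mulrC ler_wpM2r//; have [_ hi] := hB i; apply: le_trans (hi x) _.
    rewrite /T (bigD1 i)//= addrCA lerDl addr_ge0// sumr_ge0//.
  by rewrite normrM mulrC ler_wpM2r// (le_trans (hN x))// /T lerDl sumr_ge0.
have S0 x : 0 <= S x by rewrite addr_ge0// sumr_ge0.
have iG' : leb.-integrable K (EFin \o (fun x => (T + 1) * S x)).
  by have := integrableZl mK (T + 1) iS; apply: eq_integrable.
have A1 : leb ([set x | K x /\ ~ (f_ k x @[k --> \oo] --> f x)] : set L) = 0%E.
  rewrite (_ : [set x | _] = set0) ?measure0//; apply/seteqP; split=> // x [_ []].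
  apply/cvgrPdist_le => e ee; near=> k; rewrite distrC; apply: le_trans (close k x) _.
  rewrite mulrC -ler_pdivlMr ?e0// invrK mulrC -ler_pdivrMr//.
  apply: (@le_trans _ _ k%:R); last by rewrite ler_nat.
  by near: k; exact: nbhs_infty_ger.
have A2 : leb ([set x | K x /\ ~ (forall k, `|f_ k x| <= (T + 1) * S x)] : set L) = 0%E.
  rewrite (_ : [set x | _] = set0) ?measure0//; apply/seteqP; split=> // x [_ []] k.
  rewrite -(subrK (f x) (f_ k x)) addrC mulrDl mul1r; apply: le_trans (ler_normD _ _) _; apply: lerD => //.
  by apply: le_trans (close k x) _; rewrite ler_piMl// invf_le1// ler1n.
have mf_ k : measurable_fun K (f_ k) by exact: mH.
have [i1 c1] := dominated_Rintegral mK mf_ (mH _ psiC) A1 iG' A2.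
have fsupp x : f x != 0 -> K x <-> [set: L] x.
  move=> fx; split=> // _; apply: contrapT => nK; move: fx.
  by rewrite /f (supp_off _ _ psiC ps' nK) eqxx.
split; first exact: (integrable_eq_support mK measurableT fsupp i1).
rewrite -(Rintegral_eq_support _ fsupp); move: c1; under eq_fun do rewrite Z.
by move=> /(cvg_unique (@Rhausdorff R) (cvg_cst 0)) <-.
Unshelve. all: by end_near. Qed.

Section identity.
Variables (p a mu M m1 : R) (v : V -> R) (F : L -> R).
Hypotheses (p1 : 1 < p) (mu0 : 0 < mu) (M0 : 0 < M) (m10 : 0 < m1).
Hypothesis hmu : n%:R = mu * (p - 1) + p * (1 + a).
Hypothesis vC : C1_on (exterior M) v.
Hypothesis v_ge : forall x, exterior M x -> m1 <= enorm x `^ mu * v x.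

(** The gradient of |x|^(-mu) w with w = [wt] held constant; the remainder [rest_grad] is |x|^(-mu)
    grad w, as [wt_C1] shows. *)
Definition radial_grad (x : V) : V := - (mu * v x * enorm x ^- 2) *: x.
Definition rest_grad (x : V) : V := grad v x - radial_grad x.
Local Notation X := radial_grad.
Local Notation Y := rest_grad.
Definition wt (x : V) : R := enorm x `^ mu * v x.
Definition excess_flux (x : V) : V :=
  enorm x `^ (- (a * p)) *: (pflux p (grad v x) - pflux p (X x)).

Hypothesis eq : forall psi s t, C1_on setT psi -> supp_in s t psi -> M < s ->
  let f (x : L) := enorm (x : V) `^ (- (a * p)) * dotr (pflux p (grad v x)) (grad psi x) - F x * psi x in
  leb.-integrable [set: L] (EFin \o f) /\ \int[leb]_(x in [set: L]) f x = 0.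

Let oM : open (exterior M : set V). Proof. exact: open_exterior. Qed.

Lemma ext_gt0 (x : V) : exterior M x -> 0 < enorm x.
Proof. by move=> Mx; apply: lt_trans M0 _. Qed.

Lemma ext_sub : (exterior M : set V) `<=` punctured.
Proof. by move=> x /ext_gt0; rewrite enorm_gt0. Qed.

Lemma ext_v_gt0 (x : V) : exterior M x -> 0 < v x.
Proof.
move=> Mx; have := lt_le_trans m10 (v_ge Mx).
by rewrite pmulr_rgt0// powR_gt0// ext_gt0.
Qed.

Lemma ext_wt_gt0 (x : V) : exterior M x -> 0 < wt x.
Proof. by move=> Mx; exact: lt_le_trans m10 (v_ge Mx). Qed.

Lemma wt_C1 : C1_on (exterior M) wt /\
  (forall x, exterior M x -> grad wt x = enorm x `^ mu *: Y x).
Proof.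
have [c1 c2] := @C1_on_enorm_powR R n mu.
have [h1 h2] := C1_onM oM (C1_onS ext_sub c1) vC.
split=> // x Mx; rewrite h2// c2; last exact: ext_sub.
rewrite /rest_grad /radial_grad scaleNr opprK scalerDr addrC; congr (_ + _).
rewrite !scalerA; congr (_ *: _).
have [le leE] := pos_expR (ext_gt0 Mx).
rewrite leE !powR_expR -expRM_natl -expRN; have -> : expR ((mu - 2) * le) = expR (mu * le) * expR (- (2 * le)).
  by rewrite -expRD; congr expR; ring.
by ring.
Qed.

Lemma radial_enorm (x : V) : exterior M x -> enorm (X x) = mu * v x / enorm x.
Proof.
move=> Mx; have e0 := ext_gt0 Mx; have v0 := ext_v_gt0 Mx.
rewrite /X enormZ normrN ger0_norm; last by rewrite !mulr_ge0 ?invr_ge0 ?exprn_ge0// ltW.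
by field; rewrite gt_eqF.
Qed.

(** The definition of mu makes the total exponent of |x| equal to -n; if w were constant this flux
    would be divergence free. *)
Lemma radial_flux (x : V) : exterior M x -> enorm x `^ (- (a * p)) *: pflux p (X x) =
  - (mu `^ (p - 1) * wt x `^ (p - 1) * enorm x `^ (- n%:R)) *: x.
Proof.
move=> Mx; rewrite /pflux radial_enorm// /X !scalerA /wt; congr (_ *: _).
have [le leE] := pos_expR (ext_gt0 Mx); have [lv lvE] := pos_expR (ext_v_gt0 Mx).
have [lm lmE] := pos_expR mu0.
rewrite leE lvE; have -> : expR le `^ mu * expR lv = expR (mu * le + lv) by rewrite powR_expR -expRD.
have -> : mu * expR lv / expR le = expR (lm + lv - le) by rewrite {1}lmE -expRN -!expRD.
have -> : mu * expR lv * expR le ^- 2 = expR (lm + lv - 2 * le).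
  by rewrite {1}lmE -expRM_natl -expRN -!expRD.
have -> : mu `^ (p - 1) = expR ((p - 1) * lm) by rewrite {1}lmE powR_expR.
rewrite !powR_expR !mulrN -!expRD; congr (- expR _).
by rewrite hmu; ring.
Qed.

(** The bracket looks linear in Y, but it is a multiple of the second-order remainder of the flux
    along X, as the proof of [pullb1_norm] shows. *)
Definition excess_source (x : V) : R :=
  F x * enorm x `^ (- mu) - (dotr (excess_flux x) ((- mu * enorm x `^ (- mu - 2)) *: x) +
   (p - 1) * mu `^ (p - 1) * wt x `^ (p - 2) * enorm x `^ (- n%:R) * dotr (Y x) x).

(** The equation tested with |x|^(-mu) phi, plus mu^(p-1) times [divergence_free] for chi = w^(p-1)
    |x|^(-mu) phi. The flux of X cancels in full; differentiating w^(p-1) leaves the term with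
    factor p - 1. *)
Lemma exterior_identity phi s t : C1_on setT phi -> supp_in s t phi -> M < s ->
  let f (x : L) := enorm (x : V) `^ (- mu) * dotr (excess_flux x) (grad phi x) - excess_source x * phi x in
  leb.-integrable [set: L] (EFin \o f) /\ \int[leb]_(x in [set: L]) f x = 0.
Proof.
move=> phiC ps Ms f; have sM : (annulus s t : set V) `<=` exterior M by exact: annulus_exterior.
have [G1 G2] := @C1_on_enorm_powR R n (- mu).
have {}G1 := C1_onS ext_sub G1.
have [q1 q2 q3] := @C1_on_extend_supp R n (exterior M) (fun x => enorm x `^ (- mu)) phi s t oM G1 phiC ps sM.
have [w1 w2] := wt_C1.
have dI (z : R) : [set z : R | 0 < z] z ->
    is_derive z 1 (@powR R ^~ (p - 1)) ((p - 1) * z `^ (p - 1 - 1)).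
  by move=> t0; exact: is_derive1_powR.
have cI (z : R) : [set z : R | 0 < z] z ->
    {for z, continuous (fun z => (p - 1) * z `^ (p - 1 - 1))}.
  by move=> t0; apply: continuousM; [exact: cst_continuous|exact: powR_continuous_pos].
have [k1 k2] := C1_on_comp1 oM w1 (fun x => @ext_wt_gt0 x) dI cI.
have [l1 l2] := C1_onM oM k1 G1.
have [c1 c2 c3] := C1_on_extend_supp oM l1 phiC ps sM.
have [i1 z1] := eq q1 q2 Ms.
have [i2 z2] := divergence_free c1 c2 (lt_trans M0 Ms).
have i3 := integrableZl measurableT (mu `^ (p - 1)) i2.
set f1 := (fun x : L => _ - _) in i1 z1.
set f2 := (fun x : L => enorm _ `^ (- n%:R) * _) in i2 z2 i3.
have {}i3 : leb.-integrable [set: L] (EFin \o (fun x => mu `^ (p - 1) * f2 x)).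
  by move: i3; apply: eq_integrable.
have fE : f = (fun x => f1 x + mu `^ (p - 1) * f2 x).
  apply/funext => x; rewrite /f /f1 /f2; have [xs|nxs] := pselect (annulus s t x); last first.
    rewrite (supp_in_grad ps nxs) (supp_in_grad q2 nxs) (supp_in_grad c2 nxs) !dotr0r.
    by rewrite (supp_in_notin q2 nxs) (supp_in_notin ps nxs) !mulr0 subr0 addr0.
  have Mx := sM x xs.
  rewrite q3// c3// l2// k2// w2// (G2 _ (ext_sub Mx)).
  have FE : enorm x `^ (- (a * p)) *: pflux p (grad v x) = excess_flux x +
      - (mu `^ (p - 1) * wt x `^ (p - 1) * enorm x `^ (- n%:R)) *: x.
    by rewrite -(radial_flux Mx) /excess_flux -scalerDr subrK.
  rewrite -[X in _ = X - _ + _]dotrZl FE /excess_source.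
  have E1 : enorm x `^ (- mu) * enorm x `^ mu = 1.
    by rewrite -powRD ?addNr ?powRr0//; apply/implyP => _; rewrite gt_eqF// ext_gt0.
  have -> : p - 1 - 1 = p - 2 by ring.
  move: (Y x) (excess_flux x) => Yx Ex.
  rewrite (dotrC Yx x) !(dotrDl, dotrDr, dotrZl, dotrZr, dotrNl).
  set en := enorm x `^ (- n%:R).
  set e1 := enorm x `^ (- mu) in E1 *; set e2 := enorm x `^ mu in E1 *.
  apply/eqP; rewrite -subr_eq0; apply/eqP.
  (* The two sides differ only through the product of |x|^(-mu) and |x|^mu, which is 1. *)
  transitivity ((1 - e1 * e2) *
    ((p - 1) * mu `^ (p - 1) * wt x `^ (p - 2) * en * dotr x Yx * phi x)).
    by ring.
  by rewrite E1 subrr mul0r.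
split.
  have := integrableD measurableT i1 i3; rewrite fE; exact: eq_integrable.
by rewrite fE RintegralD// RintegralZl// z1 z2 mulr0 addr0.
Qed.

End identity.

End exterior_equation.

(** * Consequences of the asymptotics at infinity *)

Section asymptotics.
Context {R : realType} {n : nat}.
Local Notation V := 'rV[R]_n.
Local Notation L := (Leb R n).

(** The vector |x|^(mu+1) Y is the quantity assumed to tend to 0 plus mu (w - alpha) x/|x|, hence
    small, while |x|^(mu+1) |X| = mu w stays above mu alpha/2. *)
Lemma exterior_asymptotics (mu alpha d M0 : R) (v : V -> R) : 0 < mu -> 0 < alpha -> 0 < d ->
  (`|enorm x `^ mu * v x - alpha| +
     enorm (enorm x `^ (mu + 1) *: grad v x + (alpha * mu * (enorm x)^-1) *: x))
    @[x --> enorm_infty] --> (0 : R) ->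
  exists2 M, M0 <= M /\ 1 <= M & forall x, exterior M x ->
    alpha / 2 <= enorm x `^ mu * v x <= 2 * alpha /\
    enorm (rest_grad mu v x) <= d * enorm (radial_grad mu v x).
Proof.
move=> mu0 al0 d0 h.
(* The first entry keeps w within alpha/2 of alpha; the second gives (1 + mu) e <= d mu alpha/2. *)
pose e := Num.min (alpha / 2) (d * (mu * (alpha / 2)) / (1 + mu)).
have mu1 : 0 < 1 + mu by rewrite ltr_wpDl.
have e0 : 0 < e by rewrite lt_min !(divr_gt0, mulr_gt0).
have [M hM] : enorm_infty ((fun x : V => `|enorm x `^ mu * v x - alpha| +
     enorm (enorm x `^ (mu + 1) *: grad v x + (alpha * mu * (enorm x)^-1) *: x)) @^-1` [set z : R | `|z| <= e]).
  apply: h; apply/nbhs_ballP; exists e => //= z; rewrite /ball /= sub0r normrN; exact: ltW.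
exists (Num.max M (Num.max M0 1)); first by rewrite !le_max !lexx !orbT.
move=> x; rewrite /exterior /= !gt_max => /andP[Mx /andP[_ x1]].
have x0 : 0 < enorm x by apply: lt_trans x1.
have := hM x Mx; rewrite /= ger0_norm ?addr_ge0 ?enorm_ge0//.
set t1 := `|_|; set t2 := enorm (_ + _) => te.
have t10 : 0 <= t1 by exact: normr_ge0.
have t20 : 0 <= t2 by exact: enorm_ge0.
have e1 : e <= alpha / 2 by rewrite ge_min lexx.
have e2 : (1 + mu) * e <= d * (mu * (alpha / 2)).
  by rewrite mulrC -ler_pdivlMr// ge_min lexx orbT.
have t1e : t1 <= alpha / 2 by lra.
have b : alpha / 2 <= enorm x `^ mu * v x <= 2 * alpha.
  by move: t1e; rewrite /t1 => /ler_normlP[b1 b2]; apply/andP; split; lra.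
split=> //; have /andP[b1 b2] := b.
have w0 : 0 < enorm x `^ mu * v x by apply: lt_le_trans b1; rewrite divr_gt0.
have v0 : 0 < v x by move: w0; rewrite pmulr_rgt0// powR_gt0.
have p0 : 0 < enorm x `^ (mu + 1) by rewrite powR_gt0.
rewrite -(ler_pM2l p0).
have pE : enorm x `^ (mu + 1) = enorm x `^ mu * enorm x.
  rewrite powRD ?powRr1 ?enorm_ge0//; by apply/implyP => _; rewrite gt_eqF.
have RE : enorm x `^ (mu + 1) * (d * enorm (radial_grad mu v x)) = d * (mu * (enorm x `^ mu * v x)).
  rewrite /radial_grad enormZ normrN ger0_norm; last by rewrite !mulr_ge0 ?invr_ge0 ?exprn_ge0// ltW.
  by rewrite pE; field; rewrite gt_eqF.
rewrite RE -[X in X * _](ger0_norm (ltW p0)) -enormZ.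
have -> : enorm x `^ (mu + 1) *: rest_grad mu v x =
   (enorm x `^ (mu + 1) *: grad v x + (alpha * mu * (enorm x)^-1) *: x) +
   ((enorm x `^ mu * v x - alpha) * mu * (enorm x)^-1) *: x.
  rewrite /rest_grad /radial_grad scaleNr opprK scalerDr -addrA; congr (_ + _).
  rewrite scalerA -scalerDl; congr (_ *: _); rewrite pE; field; by rewrite gt_eqF.
apply: le_trans (ler_enormD _ _) _; rewrite -/t2 [enorm (_ *: x)]enormZ.
rewrite !normrM -/t1 (ger0_norm (ltW mu0)) normfV (ger0_norm (enorm_ge0 x)) mulfVK ?gt_eqF//.
apply: (@le_trans _ _ ((1 + mu) * e)).
  rewrite mulrDl mul1r lerD//; first by lra.
  by rewrite mulrC ler_wpM2l ?(ltW mu0)//; lra.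
by apply: le_trans e2 _; rewrite ler_pM2l// ler_pM2l.
Qed.

End asymptotics.

(** * Passing to the C1 representative in the weak equation *)

Section weak_solution.
Context {R : realType} {n : nat}.
Local Notation V := 'rV[R]_n.
Local Notation L := (Leb R n).

(** The definition of a weak solution only makes F phi integrable for test functions; dividing by a
    plateau function, at least 1/2 on the annulus, gives F. *)
Lemma loc_integrable_source (R0 M : R) (F : L -> R) : R0 <= M ->
  (forall phi, test_function (exterior R0) phi ->
     leb.-integrable (exterior R0 : set L) (EFin \o (fun x => F x * phi x))) ->
  forall s t, M < s -> leb.-integrable (annulus s t : set L) (EFin \o F).
Proof.
move=> RM iF s t Ms; have R0s := le_lt_trans RM Ms.
have [phi tphi hphi] := @plateau_test_function R n _ s t R0s.
have phiC : C1_on setT phi by case: tphi => h _ _; exact: smooth_on_C1.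
pose K := annulus s t : set L.
have mK : measurable K by exact: annulus_measurable.
have mE : measurable (exterior R0 : set L) by exact: exterior_measurable.
have KE : K `<=` (exterior R0 : set L) by exact: annulus_exterior.
have i1 := integrableS mE mK KE (iF _ tphi).
have p0 x : K x -> 0 < phi x by move=> /hphi; apply: lt_le_trans; rewrite divr_gt0.
(* The maximum with 0 changes nothing on K and makes the denominator nonnegative everywhere, as the
   measurability of inverses asks. *)
have mV : measurable_fun K (fun x : L => (Num.max 0 (phi x))^-1).
  apply: measurable_funV_ge0 => [x|]; first by rewrite le_max lexx.
  apply: measurable_maxr; first exact: measurable_cst.
  by apply: continuous_measurable; exact: C1_setT_continuous.
have i2 : leb.-integrable K (EFin \o (fun x => F x * phi x * (Num.max 0 (phi x))^-1)).
  apply: (@integrable_bounded_mul _ _ _ _ _ mK _ _ 2 i1 mV) => x Kx.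
  rewrite max_r ?(ltW (p0 x Kx))// ger0_norm ?invr_ge0 ?(ltW (p0 x Kx))//.
  rewrite -[leRHS]invrK lef_pV2 ?posrE ?p0 ?invr_gt0//.
  by have := hphi x Kx; rewrite div1r.
apply: eq_integrable i2 => // x /set_mem Kx /=.
by rewrite max_r ?(ltW (p0 x Kx))// mulfK// gt_eqF// p0.
Qed.

Lemma weak_solution_C1 (p a R0 M : R) (f : V -> R -> R) (u v : V -> R) :
  R0 <= M -> weak_solution_exterior p a f R0 u -> C1_on (exterior M) v ->
  leb ([set x | M < enorm x /\ u x <> v x] : set L) = 0%E ->
  (0 < M) -> (forall x, exterior M x -> grad v x != 0) ->
  forall psi s t, C1_on setT psi -> supp_in s t psi -> M < s ->
  let g (x : L) := enorm (x : V) `^ (- (a * p)) * dotr (pflux p (grad v x)) (grad psi x) -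
    f x (u x) * psi x in
  leb.-integrable [set: L] (EFin \o g) /\ \int[leb]_(x in [set: L]) g x = 0.
Proof.
move=> RM [Du [wg _ heq]] vC uv M0 gv0 psi s t psiC ps Ms g.
have Dv := weak_gradient_C1 RM wg vC uv.
have oM : open (exterior M : set V) by exact: open_exterior.
have mM : measurable (exterior M : set L) by exact: exterior_measurable.
have mR : measurable (exterior R0 : set L) by exact: exterior_measurable.
have MR : exterior M `<=` (exterior R0 : set V) by move=> x; exact: le_lt_trans.
pose G i (x : L) : R := enorm (x : V) `^ (- (a * p)) * (enorm (grad v x) `^ (p - 2) * grad v x 0 i).
pose F (x : L) : R := f x (u x).
have cG i (x : V) : exterior M x -> {for x, continuous (G i : V -> R)}.
  move=> Mx; have x0 : x != 0 by rewrite -enorm_gt0 (lt_trans M0).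
  have cg j : {for x, continuous (fun x : V => grad v x 0 j)} by exact: C1_continuous_grad vC Mx.
  have cd : {for x, continuous (fun x : V => dotr (grad v x) (grad v x))}.
    apply: continuous_sumr => j; exact: (continuousM (cg j) (cg j)).
  have ce : {for x, continuous (fun x : V => enorm (grad v x) `^ (p - 2))}.
    rewrite (_ : (fun x => _) = (fun x : V => dotr (grad v x) (grad v x) `^ ((p - 2) / 2))); last first.
      by apply/funext => z; rewrite enorm_powRE.
    apply: (@continuous_comp _ _ _ (fun x : V => dotr (grad v x) (grad v x)) (@powR R ^~ ((p - 2) / 2))) => //.
    by apply: powR_continuous_pos; rewrite -sqr_enorm exprn_gt0// enorm_gt0 gv0.
  have [c1 _] := @C1_on_enorm_powR R n (- (a * p)).
  have cx : {for x, continuous (fun x : V => enorm x `^ (- (a * p)))}.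
    by apply: (C1_continuous (@open_punctured R n) c1).
  by apply: (continuousM cx); exact: (continuousM ce (cg i)).
have locG i : loc_integrable (exterior M) (G i) by apply: continuous_loc_integrable => // x; exact: cG.
have iG i s' t' : M < s' -> leb.-integrable (annulus s' t' : set L) (EFin \o G i).
  by move=> h; exact: (loc_integrable_annulus (locG i) _ h).
have iF s' t' : M < s' -> leb.-integrable (annulus s' t' : set L) (EFin \o F).
  apply: (loc_integrable_source RM) => phi tphi.
  by have [_ h _] := heq phi tphi.
have main phi : test_function (exterior M) phi ->
    \int[leb]_(x in (exterior M : set L)) (\sum_i G i x * partial i phi x - F x * phi x) = 0.
  move=> tphi; have [h1 h2 h3] := heq phi (test_functionS MR tphi).
  have [s' [t' [Ms' ps']]] := test_function_supp_in tphi.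
  have phiC : C1_on setT phi by case: tphi => h _ _; exact: smooth_on_C1.
  set lhs := (fun x : V => _ * dotr _ _) in h1 h3; set rhs := (fun x : V => f x (u x) * phi x) in h2 h3.
  have sup0 x : exterior R0 x -> ~ exterior M x -> grad phi x = 0 /\ phi x = 0.
    move=> _ nM; have nA : ~ annulus s' t' x by move=> /(annulus_exterior Ms').
    by rewrite (supp_in_grad ps' nA) (supp_in_notin ps' nA).
  have r1 : \int[leb]_(x in (exterior R0 : set L)) lhs x = \int[leb]_(x in (exterior M : set L)) lhs x.
    apply: Rintegral_eq_support => x lx; split; last exact: MR.
    move=> Rx; apply: contrapT => nM; have [g0 _] := sup0 x Rx nM.
    by move: lx; rewrite /lhs g0 dotr0r mulr0 eqxx.
  have r2 : \int[leb]_(x in (exterior R0 : set L)) rhs x = \int[leb]_(x in (exterior M : set L)) rhs x.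
    apply: Rintegral_eq_support => x lx; split; last exact: MR.
    move=> Rx; apply: contrapT => nM; have [_ g0] := sup0 x Rx nM.
    by move: lx; rewrite /rhs g0 mulr0 eqxx.
  have i1 := integrableS mR mM MR h1; have i2 := integrableS mR mM MR h2.
  have i3 : leb.-integrable (exterior M : set L) (EFin \o (fun x => lhs x - rhs x)).
    by have := integrableB mM i1 i2; apply: eq_integrable.
  transitivity (\int[leb]_(x in (exterior M : set L)) (lhs x - rhs x)); last first.
    by rewrite RintegralB// -r1 -r2 h3 subrr.
  symmetry; apply: (Rintegral_null_eq mM).
    by apply/measurable_EFinP; exact: measurable_int i3.
  (* The finitely many coordinates are indexed by natural numbers so that countable subadditivity
     applies; indices beyond n give empty sets. *)
  have un : leb (\bigcup_k [set x : V | exists2 i : 'I_n, k = i :> nat &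
      M < enorm x /\ Du x 0 i <> grad v x 0 i] : set L) = 0%E.
    apply/eqP; rewrite eq_le leb_ge0 andbT.
    apply: (le_trans (outer_measure_sigma_subadditive (@lebesgue_outer R n) _)).
    rewrite eseries0// => k _ _.
    have [kn|nk] := ltnP k n.
      apply: (subset_null _ (Dv (Ordinal kn))) => x [i ki] h.
      by rewrite (_ : Ordinal kn = i)//; apply: val_inj.
    rewrite (_ : [set x | _] = set0) ?outer_measure0//.
    by apply/seteqP; split=> // x [i ki]; move: nk; rewrite ki leqNgt ltn_ord.
  apply: subset_null un => x [Mx h]; apply: contrapT => nx; apply: h.
  have DE : Du x = grad v x.
    apply/rowP => i; apply: contrapT => hi; apply: nx.
    by exists (i : nat) => //; exists i.
  rewrite /lhs /rhs DE -/(F x) /G; congr (_ - _).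
  rewrite /dotr mulr_sumr; apply: eq_bigr => i _.
  by rewrite [grad phi x 0 i]mxE !mulrA.
have [j1 j2] := weak_eq_C1 iG iF main psiC ps Ms.
have gE : g = (fun x : L => \sum_i G i x * partial i psi x - F x * psi x).
  apply/funext => x; rewrite /g /F; congr (_ - _).
  rewrite /dotr mulr_sumr; apply: eq_bigr => i _.
  by rewrite /pflux /G !mxE !mulrA.
by rewrite gE.
Qed.

End weak_solution.

(** * Pulling the equation back by the inversion *)

Section pullback.
Context {R : realType} {n : nat}.
Local Notation V := 'rV[R]_n.
Local Notation L := (Leb R n).
Local Notation jac := (@inversion_jac R n).
Variables (p a b q mu Lam M m1 m2 d c0 C1 : R) (v : V -> R) (F : L -> R).
Hypothesis n0 : (0 < n)%N.
Hypotheses (p1 : 1 < p) (mu0 : 0 < mu) (M0 : 0 < M) (m10 : 0 < m1).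
Hypotheses (d01 : 0 < d <= 1) (c00 : 0 < c0) (C10 : 0 <= C1) (Lam0 : 0 <= Lam).
Hypothesis hmu : n%:R = mu * (p - 1) + p * (1 + a).
Hypothesis hq : n%:R = mu * q + b * q - mu * q / p.
Hypothesis vC : C1_on (exterior M) v.
Hypothesis v_bd : forall x : V, exterior M x -> m1 <= wt mu v x <= m2.
Hypothesis hexp : forall X Y : V, X != 0 -> enorm Y <= d * enorm X ->
   [/\ enorm (pflux p (X + Y) - pflux p X) <= C1 * (enorm X `^ (p - 2) * enorm Y),
       c0 * (enorm X `^ (p - 2) * enorm Y ^+ 2) <= dotr (pflux p (X + Y) - pflux p X) Y &
       `|dotr (pflux p (X + Y) - pflux p X) X - (p - 1) * enorm X `^ (p - 2) * dotr X Y| <=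
         C1 * (enorm X `^ (p - 2) * enorm Y ^+ 2)].
Hypothesis hY : forall x : V, exterior M x ->
  enorm (rest_grad mu v x) <= d * enorm (radial_grad mu v x).
Hypothesis iF : forall s t, M < s -> leb.-integrable (annulus s t : set L) (EFin \o F).
Hypothesis hF : leb ([set x : V | M < enorm x /\
  ~ (`|F x| <= Lam * enorm x `^ (- (b * q)) * v x `^ (q - 1))] : set L) = 0%E.
Hypothesis eqv : forall (psi : V -> R) s t, C1_on setT psi -> supp_in s t psi -> M < s ->
  let f (x : L) := enorm (x : V) `^ (- (a * p)) * dotr (pflux p (grad v x)) (grad psi x) - F x * psi x in
  leb.-integrable [set: L] (EFin \o f) /\ \int[leb]_(x in [set: L]) f x = 0.

Local Notation X := (radial_grad mu v).
Local Notation Y := (rest_grad mu v).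
Local Notation W := (wt mu v).
Local Notation DPhi x := (pflux p (grad v x) - pflux p (X x)).

Let v_ge x : exterior M x -> m1 <= enorm x `^ mu * v x.
Proof. by move=> /v_bd /andP[]. Qed.

Let e_gt0 (x : V) : exterior M x -> 0 < enorm x. Proof. exact: ext_gt0. Qed.
Let v_gt0 (x : V) : exterior M x -> 0 < v x. Proof. exact: (ext_v_gt0 M0 m10 v_ge). Qed.
Let w_gt0 (x : V) : exterior M x -> 0 < W x. Proof. exact: (ext_wt_gt0 m10 v_ge). Qed.

Let X_neq0 (x : V) : exterior M x -> X x != 0.
Proof.
move=> Mx; rewrite -enorm_gt0 (radial_enorm mu0 M0 m10 v_ge Mx).
by rewrite divr_gt0 ?mulr_gt0 ?v_gt0 ?e_gt0.
Qed.

Let XY (x : V) : grad v x = X x + Y x. Proof. by rewrite /rest_grad addrC subrK. Qed.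

(** Half of 1/M: the estimates hold in the punctured ball of twice this radius, which leaves room
    for the cutoff around the ball where the equation is stated. *)
Definition pullr : R := (2 * M)^-1.

Definition pullw (y : V) : R := W (inversion y).
(** The gradient of phi composed with the inversion is [reflection] applied to grad phi; the
    reflection is symmetric, so it moves onto the flux, and the Jacobian of the substitution
    multiplies it. *)
Definition pulla (y : V) : V := jac y *:
  reflection (inversion y) (enorm (inversion y) `^ (- mu) *: excess_flux p a mu v (inversion y)).
Definition pullb1 (y : V) : R := - (jac y *
  (dotr (excess_flux p a mu v (inversion y)) ((- mu * enorm (inversion y) `^ (- mu - 2)) *: inversion y) +
   (p - 1) * mu `^ (p - 1) * W (inversion y) `^ (p - 2) * enorm (inversion y) `^ (- n%:R) *
     dotr (Y (inversion y)) (inversion y))).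
Definition pullb2 (y : V) : R := jac y * (F (inversion y) * enorm (inversion y) `^ (- mu)).

Lemma pullr_gt0 : 0 < pullr. Proof. by rewrite invr_gt0 mulr_gt0. Qed.

Lemma inversion_ext (y : V) : y != 0 -> enorm y < 2 * pullr -> exterior M (inversion y).
Proof.
move=> y0; have e0 : 0 < enorm y by rewrite enorm_gt0.
rewrite /exterior /= enorm_inversion /pullr invfM mulrA mulfV// mul1r => h.
by rewrite -[ltLHS]invrK ltf_pV2 ?posrE ?invr_gt0.
Qed.

Let pullD := (punctured `&` eball (2 * pullr) : set V).

Lemma pullw_C1 : C1_on pullD pullw /\ (forall y, pullD y ->
  grad pullw y = reflection y (enorm (inversion y) `^ mu *: Y (inversion y))).
Proof.
have oM : open (exterior M : set V) by exact: open_exterior.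
have [w1 w2] := wt_C1 mu M0 vC.
have [h1 h2] := C1_on_comp_inversion oM (ext_sub M0) w1.
have sub : pullD `<=` inversion @^-1` exterior M by move=> y [y0 yr]; exact: inversion_ext.
split; first exact: (C1_onS sub h1).
by move=> y Dy; rewrite [grad _ _]h2 ?w2//; exact: sub.
Qed.

Lemma pull_jac (y : V) : jac y = enorm (inversion y) ^+ (2 * n).
Proof. by rewrite /inversion_jac enorm_inversion exprVn. Qed.

(** The relation defining mu gathers all powers of |x| into |y|^gamma, with a factor (mu w)^(p-2)
    that lies between positive constants; |x|^mu |x|^4 is later absorbed by the gradient of
    [pullw]. *)
Lemma pull_exponent (y : V) : y != 0 -> enorm y < 2 * pullr ->
  let x := inversion y in
  jac y * enorm x `^ (- mu) * enorm x `^ (- (a * p)) * enorm (X x) `^ (p - 2) =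
  (mu * W x) `^ (p - 2) * enorm y `^ (mu + 2 - n%:R) * (enorm x `^ mu * enorm x ^+ 4).
Proof.
move=> y0 yr x; have Mx := inversion_ext y0 yr; rewrite -/x in Mx.
rewrite pull_jac -/x (radial_enorm mu0 M0 m10 v_ge Mx).
have -> : enorm y = (enorm x)^-1 by rewrite /x enorm_inversion invrK.
have [le leE] := pos_expR (e_gt0 Mx); have [lv lvE] := pos_expR (v_gt0 Mx).
have [lm lmE] := pos_expR mu0.
rewrite /wt leE lvE; have -> : expR le `^ mu * expR lv = expR (mu * le + lv) by rewrite powR_expR -expRD.
have -> : mu * expR lv / expR le = expR (lm + lv - le) by rewrite {1}lmE -expRN -!expRD.
have -> : mu * expR (mu * le + lv) = expR (lm + (mu * le + lv)) by rewrite {1}lmE -expRD.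
rewrite -expRN !powR_expR -!expRM_natl -!expRD; congr expR.
by rewrite natrM hmu; ring.
Qed.

Lemma pull_grad_norm (y : V) : y != 0 -> enorm y < 2 * pullr ->
  enorm (grad pullw y) = enorm (inversion y) ^+ 2 * (enorm (inversion y) `^ mu * enorm (Y (inversion y))).
Proof.
move=> y0 yr; have [_ ->] := pullw_C1; last by split.
rewrite enorm_reflection// enormZ (ger0_norm (powR_ge0 _ _)).
by rewrite enorm_inversion exprVn.
Qed.

Lemma pulla_norm (y : V) : y != 0 -> enorm y < 2 * pullr ->
  enorm (pulla y) <= C1 * (mu * W (inversion y)) `^ (p - 2) * enorm y `^ (mu + 2 - n%:R) * enorm (grad pullw y).
Proof.
move=> y0 yr; have Mx := inversion_ext y0 yr; have E := pull_exponent y0 yr.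
cbv zeta in E.
rewrite pull_grad_norm// /pulla; move: (inversion y) Mx E => x Mx E.
have x0 : x != 0 by rewrite -enorm_gt0 e_gt0.
have [h1 _ _] := hexp (X_neq0 Mx) (hY Mx); rewrite -XY in h1.
have ex0 := e_gt0 Mx.
rewrite enormZ (ger0_norm (inversion_jac_ge0 y)) enorm_reflection// /excess_flux !enormZ.
rewrite !(ger0_norm (powR_ge0 _ _)).
have k0 : 0 <= jac y * enorm x `^ (- mu) * enorm x `^ (- (a * p)) * enorm x ^- 2.
  by rewrite !mulr_ge0 ?powR_ge0 ?inversion_jac_ge0 ?invr_ge0 ?exprn_ge0 ?enorm_ge0.
rewrite [leLHS](_ : _ = (jac y * enorm x `^ (- mu) * enorm x `^ (- (a * p)) * enorm x ^- 2) * enorm (DPhi x)); last by ring.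
apply: le_trans (ler_wpM2l k0 h1) _.
rewrite [leLHS](_ : _ = C1 * (jac y * enorm x `^ (- mu) * enorm x `^ (- (a * p)) * enorm (X x) `^ (p - 2)) *
   (enorm x ^- 2 * enorm (Y x))); last by ring.
rewrite E le_eqVlt; apply/orP; left; apply/eqP; field.
by rewrite gt_eqF.
Qed.

(** The reflections in the flux and in the gradient of [pullw] compose to a scalar, so the product
    is a multiple of the flux increment times Y, to which coercivity applies. *)
Lemma pulla_dot (y : V) : y != 0 -> enorm y < 2 * pullr ->
  c0 * (mu * W (inversion y)) `^ (p - 2) * enorm y `^ (mu + 2 - n%:R) * enorm (grad pullw y) ^+ 2 <=
  dotr (pulla y) (grad pullw y).
Proof.
move=> y0 yr; have Mx := inversion_ext y0 yr; have E := pull_exponent y0 yr.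
rewrite pull_grad_norm//; have [_ ->] := pullw_C1; last by split.
have ey0 : 0 < enorm y by rewrite enorm_gt0.
rewrite /pulla dotrZl reflectionK_dotr reflection_inversion// reflection_reflection// (scalerA (enorm y ^+ 4)).
rewrite mulfV ?scale1r; last by rewrite expf_eq0/= gt_eqF.
cbv zeta in E; move: (inversion y) Mx E => x Mx E.
have [_ h2 _] := hexp (X_neq0 Mx) (hY Mx); rewrite -XY in h2.
rewrite /excess_flux !(dotrZl, dotrZr).
have k0 : 0 <= jac y * enorm x `^ (- mu) * enorm x `^ (- (a * p)) * enorm x `^ mu.
  by rewrite !mulr_ge0 ?powR_ge0 ?inversion_jac_ge0.
rewrite [leRHS](_ : _ = (jac y * enorm x `^ (- mu) * enorm x `^ (- (a * p)) * enorm x `^ mu) * dotr (DPhi x) (Y x)); last by ring.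
apply: le_trans (ler_wpM2l k0 h2).
rewrite [leRHS](_ : _ = c0 * (jac y * enorm x `^ (- mu) * enorm x `^ (- (a * p)) * enorm (X x) `^ (p - 2)) *
   (enorm x `^ mu * enorm (Y x) ^+ 2)); last by ring.
by rewrite E le_eqVlt; apply/orP; left; apply/eqP; ring.
Qed.

(** The linear contributions in Y cancel: b1 is a multiple of the remainder in the third estimate of
    [hexp], which is quadratic in Y. *)
Lemma pullb1_norm (y : V) : y != 0 -> enorm y < 2 * pullr ->
  `|pullb1 y| <= C1 * (mu * W (inversion y)) `^ (p - 2) * (W (inversion y))^-1 *
     enorm y `^ (mu + 2 - n%:R) * enorm (grad pullw y) ^+ 2.
Proof.
move=> y0 yr; have Mx := inversion_ext y0 yr; have E := pull_exponent y0 yr.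
cbv zeta in E.
rewrite pull_grad_norm// /pullb1; move: (inversion y) Mx E => x Mx E.
have [_ _ h3] := hexp (X_neq0 Mx) (hY Mx); rewrite -XY in h3.
have ex0 := e_gt0 Mx; have v0 := v_gt0 Mx.
have F1 : enorm x `^ (- mu - 2) = enorm x `^ (- mu) * enorm x ^- 2.
  have [le leE] := pos_expR ex0; rewrite leE !powR_expR -expRM_natl -expRN -expRD.
  by congr expR; ring.
have F2 : mu `^ (p - 1) * W x `^ (p - 2) * enorm x `^ (- n%:R) =
    enorm x `^ (- (a * p)) * enorm x `^ (- mu) * enorm (X x) `^ (p - 2) * mu * enorm x ^- 2.
  rewrite (radial_enorm mu0 M0 m10 v_ge Mx).
  have [le leE] := pos_expR ex0; have [lv lvE] := pos_expR v0.
  have [lm lmE] := pos_expR mu0.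
  rewrite /wt leE lvE; have -> : expR le `^ mu * expR lv = expR (mu * le + lv) by rewrite powR_expR -expRD.
  have -> : mu * expR lv / expR le = expR (lm + lv - le) by rewrite {1}lmE -expRN -!expRD.
  have -> : mu `^ (p - 1) = expR ((p - 1) * lm) by rewrite {1}lmE powR_expR.
  have -> : forall z, z * mu * expR le ^- 2 = z * expR (lm - 2 * le).
    by move=> z; rewrite {1}lmE -mulrA -expRM_natl -expRN -expRD.
  by rewrite !powR_expR -!expRD; congr expR; rewrite hmu; ring.
set D := dotr (DPhi x) x; set S := dotr (Y x) x.
(* As X is the multiple -mu v/|x|^2 of x, the products with x become products with X divided by v,
   and the two terms combine into the second-order remainder. *)
have key : dotr (excess_flux p a mu v x) ((- mu * enorm x `^ (- mu - 2)) *: x) +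
   (p - 1) * mu `^ (p - 1) * W x `^ (p - 2) * enorm x `^ (- n%:R) * S =
   enorm x `^ (- (a * p)) * enorm x `^ (- mu) / v x *
   (dotr (DPhi x) (X x) - (p - 1) * enorm (X x) `^ (p - 2) * dotr (X x) (Y x)).
  rewrite -(mulrA (p - 1)) -(mulrA (p - 1)) F2 F1 /excess_flux.
  have -> : dotr (X x) (Y x) = - (mu * v x * enorm x ^- 2) * S by rewrite dotrC /radial_grad dotrZr.
  have -> : dotr (DPhi x) (X x) = - (mu * v x * enorm x ^- 2) * D by rewrite {2}/radial_grad dotrZr.
  rewrite dotrZl dotrZr -/D; move: (enorm (X x) `^ (p - 2)) => N.
  by field; rewrite !gt_eqF.
rewrite key normrN !normrM (ger0_norm (inversion_jac_ge0 y)) !(ger0_norm (powR_ge0 _ _)).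
rewrite normfV (ger0_norm (ltW v0)).
have k0 : 0 <= jac y * (enorm x `^ (- (a * p)) * enorm x `^ (- mu) / v x).
  by rewrite !mulr_ge0 ?powR_ge0 ?inversion_jac_ge0 ?invr_ge0 ?(ltW v0).
rewrite mulrA; apply: le_trans (ler_wpM2l k0 h3) _.
rewrite [leLHS](_ : _ = C1 * (jac y * enorm x `^ (- mu) * enorm x `^ (- (a * p)) * enorm (X x) `^ (p - 2)) *
   (enorm (Y x) ^+ 2 / v x)); last by ring.
have p0 : 0 < enorm x `^ mu by rewrite powR_gt0.
rewrite E /wt le_eqVlt; apply/orP; left; apply/eqP.
move: (_ `^ (p - 2)) => T; move: p0; set em := enorm x `^ mu => p0.
by field; rewrite !gt_eqF.
Qed.

(** The powers are |x|^(2n - mu - bq) v^(q-1) = w^(q-1) |x|^(2n - bq - mu q), and the relation for q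
    turns the last exponent into n - mu q/p. *)
Lemma pullb2_norm (y : V) : y != 0 -> enorm y < 2 * pullr ->
  `|F (inversion y)| <= Lam * enorm (inversion y) `^ (- (b * q)) * v (inversion y) `^ (q - 1) ->
  `|pullb2 y| <= Lam * W (inversion y) `^ (q - 1) * enorm y `^ (mu * q / p - n%:R).
Proof.
move=> y0 yr; have Mx := inversion_ext y0 yr; have ey : enorm y = (enorm (inversion y))^-1 by rewrite enorm_inversion invrK.
rewrite /pullb2 pull_jac ey; move: (inversion y) Mx => x Mx.
move=> hb; have ex0 := e_gt0 Mx; have v0 := v_gt0 Mx.
rewrite (_ : enorm x ^+ (2 * n) * _ = F x * (enorm x `^ (- mu) * enorm x ^+ (2 * n))); last by ring.
have k0 : 0 <= enorm x `^ (- mu) * enorm x ^+ (2 * n) by rewrite mulr_ge0 ?powR_ge0 ?exprn_ge0 ?enorm_ge0.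
rewrite normrM (ger0_norm k0); apply: le_trans (ler_wpM2r k0 hb) _.
rewrite -!mulrA le_eqVlt; apply/orP; left; apply/eqP; congr (Lam * _).
have [le leE] := pos_expR ex0; have [lv lvE] := pos_expR v0.
rewrite /wt leE lvE; have -> : expR le `^ mu * expR lv = expR (mu * le + lv) by rewrite powR_expR -expRD.
rewrite -expRN !powR_expR -!expRM_natl -!expRD; congr expR.
by rewrite natrM; have -> : mu * (q / p) = mu * q + b * q - n%:R; [rewrite hq; ring|ring].
Qed.

Lemma pull_bounds (y : V) : y != 0 -> enorm y < 2 * pullr ->
  `|pullw y| <= m2 /\ enorm (grad pullw y) * enorm y <= mu * m2.
Proof.
move=> y0 yr; have Mx := inversion_ext y0 yr; have /andP[w1 w2] := v_bd Mx.
have ex0 := e_gt0 Mx; split; first by rewrite ger0_norm// ltW// w_gt0.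
rewrite pull_grad_norm//; set x := inversion y in Mx w1 w2 ex0 *.
have -> : enorm y = (enorm x)^-1 by rewrite /x enorm_inversion invrK.
have h : enorm (Y x) <= mu * v x / enorm x.
  rewrite -(radial_enorm mu0 M0 m10 v_ge Mx); apply: le_trans (hY Mx) _.
  by rewrite ler_piMl ?enorm_ge0//; case/andP: d01.
apply: (@le_trans _ _ (enorm x ^+ 2 * (enorm x `^ mu * (mu * v x / enorm x)) * (enorm x)^-1)).
  by rewrite ler_wpM2r ?invr_ge0 ?enorm_ge0// ler_wpM2l ?exprn_ge0 ?enorm_ge0// ler_wpM2l ?powR_ge0.
rewrite [leLHS](_ : _ = mu * W x); first by rewrite ler_wpM2l// ltW.
by rewrite /wt; field; rewrite gt_eqF.
Qed.

Lemma measurable_pull (h : V -> R) : measurable_fun (exterior M : set L) (h : L -> R) ->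
  measurable_fun (eball pullr : set L) (fun y : L => h (inversion (y : V))).
Proof.
move=> mh; pose U := punctured `&` eball pullr : set V.
have mU : measurable (U : set L).
  by apply: open_measurable; apply: openI; [exact: open_punctured|exact: open_eball].
have m0 : measurable ([set 0] : set L) by apply: null_measurable; exact: leb0.
apply: (@measurable_funS _ _ _ _ ((U : set L) `|` [set 0])).
- exact: measurableU.
- move=> y yr; have [->|y0] := eqVneq (y : V) 0; [by right|by left].
- apply/measurable_funU; [exact: mU|exact: m0|split; last exact: measurable_fun_set1].
  apply: (measurable_comp (exterior_measurable M) _ mh).
    move=> _ [y [y0 yr] <-]; apply: inversion_ext => //.
    by apply: lt_trans yr _; rewrite ltr_pMl ?ltr1n// pullr_gt0.
  by apply: measurable_funTS; exact: measurable_inversion.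
Qed.

Let mE : measurable (exterior M : set L). Proof. exact: exterior_measurable. Qed.

Let m_v : measurable_fun (exterior M : set L) (v : L -> R).
Proof.
apply: open_continuous_measurable; first exact: open_exterior.
by move=> x Mx; apply: (C1_continuous (@open_exterior R n M) vC).
Qed.

Let m_gv i : measurable_fun (exterior M : set L) (fun x : L => grad v x 0 i).
Proof.
apply: (@open_continuous_measurable _ _ _ (fun x => grad v x 0 i)); first exact: open_exterior.
by move=> x Mx; exact: C1_continuous_grad vC Mx.
Qed.

Let m_x i : measurable_fun (exterior M : set L) (fun x : L => (x : V) 0 i).
Proof. by apply: (@continuous_measurable _ _ _ (fun x : V => x 0 i)); exact: coord_continuous. Qed.

Let m_en : measurable_fun (exterior M : set L) (fun x : L => (enorm (x : V) ^- 2)).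
Proof.
rewrite (_ : (fun x => _) = (fun x : L => (dotr (x : V) x)^-1)); last first.
  by apply/funext => x; rewrite -sqr_enorm.
by apply: measurable_funV_ge0 => [x|]; [exact: dotr_ge0|exact: measurable_dotr].
Qed.

Let m_X i : measurable_fun (exterior M : set L) (fun x : L => X x 0 i).
Proof.
rewrite (_ : (fun x => _) = (fun x : L => -1 * (mu * v x * enorm (x : V) ^- 2 * (x : V) 0 i))); last first.
  by apply/funext => x; rewrite /radial_grad mxE mulN1r mulNr.
apply: measurable_funM; first exact: measurable_cst.
apply: measurable_funM (m_x i); apply: measurable_funM m_en.
by apply: measurable_funM m_v; exact: measurable_cst.
Qed.

Let m_powd (G : L -> V) (s : R) : (forall i, measurable_fun (exterior M : set L) (fun x => G x 0 i)) ->
  measurable_fun (exterior M : set L) (fun x => enorm (G x) `^ s).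
Proof.
move=> mG; rewrite (_ : (fun x => _) = (@powR R ^~ (s / 2)) \o (fun x => dotr (G x) (G x))); last first.
  by apply/funext => x; rewrite /= -enorm_powRE.
by apply: measurableT_comp; [exact: measurable_powR|exact: (measurable_dotr mG mG)].
Qed.

Let m_E i : measurable_fun (exterior M : set L) (fun x : L => excess_flux p a mu v x 0 i).
Proof.
rewrite (_ : (fun x => _) = (fun x : L => enorm (x : V) `^ (- (a * p)) *
   (enorm (grad v x) `^ (p - 2) * grad v x 0 i - enorm (X x) `^ (p - 2) * X x 0 i))); last first.
  by apply/funext => x; rewrite /excess_flux /pflux !mxE.
apply: measurable_funM; first exact: measurable_enorm_powR.
apply: measurable_funB.
  by apply: measurable_funM (m_gv i); exact: (m_powd (p - 2) m_gv).
by apply: measurable_funM (m_X i); exact: (m_powd (p - 2) m_X).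
Qed.

Let m_Y i : measurable_fun (exterior M : set L) (fun x : L => Y x 0 i).
Proof.
rewrite (_ : (fun x => _) = (fun x : L => grad v x 0 i - X x 0 i)); last first.
  by apply/funext => x; rewrite /rest_grad mxE [in X in _ + X = _]mxE.
exact: measurable_funB (m_gv i) (m_X i).
Qed.

Let m_jac : measurable_fun (eball pullr : set L) (jac : L -> R).
Proof. by apply: measurable_funTS; exact: measurable_inversion_jac. Qed.

Lemma measurable_pulla i : measurable_fun (eball pullr : set L) (fun y : L => pulla y 0 i).
Proof.
pose G (x : V) : R := enorm x ^- 2 * (enorm x `^ (- mu) * excess_flux p a mu v x 0 i -
   2 * (enorm x `^ (- mu) * dotr x (excess_flux p a mu v x)) * enorm x ^- 2 * x 0 i).
have mG : measurable_fun (exterior M : set L) (G : L -> R).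
  apply: (measurable_funM m_en); apply: measurable_funB.
    by apply: measurable_funM (m_E i); exact: measurable_enorm_powR.
  apply: measurable_funM (m_x i); apply: measurable_funM m_en.
  apply: measurable_funM; first exact: measurable_cst.
  by apply: measurable_funM; [exact: measurable_enorm_powR|exact: (measurable_dotr m_x m_E)].
rewrite (_ : (fun y => _) = (fun y : L => jac y * G (inversion (y : V)))); last first.
  by apply/funext => y; rewrite /pulla /reflection /G dotrZr !mxE.
exact: (measurable_funM m_jac (measurable_pull mG)).
Qed.

Lemma measurable_pullb1 : measurable_fun (eball pullr : set L) (pullb1 : L -> R).
Proof.
pose G (x : V) : R := -1 * ((- mu * enorm x `^ (- mu - 2)) * dotr (excess_flux p a mu v x) x +
   (p - 1) * mu `^ (p - 1) * W x `^ (p - 2) * enorm x `^ (- n%:R) * dotr (Y x) x).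
have mG : measurable_fun (exterior M : set L) (G : L -> R).
  apply: measurable_funM; first exact: measurable_cst.
  apply: measurable_funD.
    apply: measurable_funM; last exact: (measurable_dotr m_E m_x).
    by apply: measurable_funM; [exact: measurable_cst|exact: measurable_enorm_powR].
  apply: measurable_funM; last exact: (measurable_dotr m_Y m_x).
  apply: measurable_funM; last exact: measurable_enorm_powR.
  apply: measurable_funM; first exact: measurable_cst.
  apply: (@measurableT_comp _ _ _ _ _ _ (@powR R ^~ (p - 2)) _ (fun x : L => W x)).
    exact: measurable_powR.
  by apply: measurable_funM m_v; exact: measurable_enorm_powR.
rewrite (_ : pullb1 = (fun y : L => jac y * G (inversion (y : V)))); last first.
  by apply/funext => y; rewrite /pullb1 /G dotrZr mulN1r mulrN.
exact: (measurable_funM m_jac (measurable_pull mG)).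
Qed.

(** F is known only through integrability on annuli, and countably many of them fill the
    exterior. *)
Lemma measurable_source : measurable_fun (exterior M : set L) F.
Proof.
pose s k : R := M + k.+1%:R^-1.
pose A k : set L := annulus (s k) (s k + k%:R).
have sM k : M < s k by rewrite /s ltrDl invr_gt0.
rewrite (_ : (exterior M : set L) = \bigcup_k A k).
  apply/measurable_fun_bigcup => k; first exact: annulus_measurable.
  by apply/measurable_EFinP; exact: measurable_int (iF _ (sM k)).
apply/seteqP; split=> x; last first.
  by move=> [k _ /andP[h _]]; exact: lt_le_trans (sM k) h.
move=> Mx; have [N hN] : exists k : nat, k.+1%:R^-1 < enorm (x : V) - M.
  by apply: exists_natSinv_lt; rewrite subr_gt0.
exists (maxn N (Num.trunc (enorm (x : V))).+1) => //=; apply/andP; split.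
  rewrite /s -lerBrDl; apply: le_trans (ltW hN).
  by rewrite lef_pV2 ?posrE// ler_nat ltnS leq_maxl.
apply: (@le_trans _ _ (Num.trunc (enorm (x : V))).+1%:R); first exact: ltW (truncnS_gt _).
apply: (@le_trans _ _ (maxn N (Num.trunc (enorm (x : V))).+1)%:R); first by rewrite ler_nat leq_maxr.
by rewrite lerDr ltW// (lt_trans M0).
Qed.

Lemma measurable_pullb2 : measurable_fun (eball pullr : set L) (pullb2 : L -> R).
Proof.
pose G (x : V) : R := F x * enorm x `^ (- mu).
have mG : measurable_fun (exterior M : set L) (G : L -> R).
  by apply: (measurable_funM measurable_source); exact: measurable_enorm_powR.
exact: (measurable_funM m_jac (measurable_pull mG)).
Qed.

(** [exterior_identity] for phi composed with the inversion, supported in an annulus outside the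
    ball of radius M, followed by the change of variables. *)
Lemma pull_identity (phi : V -> R) s t : 0 < s -> t < pullr -> C1_on setT phi -> supp_in s t phi ->
  \int[leb]_(y in [set: L]) (dotr (pulla y) (grad phi y) - (pullb1 y + pullb2 y) * phi y) = 0.
Proof.
move=> s0 tr phiC ps0.
(* The outer radius t may be nonpositive when phi = 0; a positive one is needed in order to invert
   it. *)
pose t1 := Num.max t (pullr / 2).
have t1r : t1 < pullr by rewrite gt_max tr/= ltr_pdivrMr// ltr_pMr ?pullr_gt0// ltr1n.
have t10 : 0 < t1 by rewrite lt_max [_ < _ / _]divr_gt0 ?pullr_gt0// orbT.
have ps : supp_in s t1 phi by move=> y /ps0 /andP[-> h]; rewrite le_max h.
pose f := phi \o (@inversion R n).
have [g1 g2] := C1_on_comp_inversion (@open_punctured R n) (@subset_refl _ _) (C1_onS (@subsetT _ _) phiC).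
have fz x : x = 0 \/ enorm x < t1^-1 -> f x = 0.
  move=> h; apply: (supp_in_notin ps) => /andP[h1 h2].
  have e0 : 0 < enorm (inversion x) by exact: lt_le_trans h1.
  case: h => [xz|h]; first by move: e0; rewrite xz inversion0 enorm0 ltxx.
  have x0 : 0 < enorm x by move: e0; rewrite enorm_inversion invr_gt0.
  by move: h2; rewrite enorm_inversion leNgt -[ltLHS]invrK ltf_pV2 ?posrE ?invr_gt0// h.
(* The support of phi is bounded, so f vanishes near 0 and the inversion causes no singularity
   there. *)
have fC : C1_on setT f.
  move=> x _; have [x0|x0] := eqVneq x 0; last first.
    by apply: g1; rewrite /punctured /= inversion_eq0.
  have [c1 _] := C1_on_cst (0 : R) (@open_eball R n (t1^-1)).
  have e z : eball (t1^-1) z -> 0 = f z by move=> hz; rewrite fz//; right.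
  have [h _] := eq_C1_on (@open_eball R n (t1^-1)) e c1; apply: h.
  by rewrite /eball /= x0 enorm0 invr_gt0.
have fs : supp_in (t1^-1) (s^-1) f.
  move=> x /ps; rewrite enorm_inversion => /andP[h1 h2].
  have x0 : 0 < enorm x by rewrite -invr_gt0 (lt_le_trans s0).
  rewrite -[X in X <= s^-1]invrK !(lef_pV2, posrE) ?invr_gt0//.
  by rewrite h1 -[enorm x]invrK lef_pV2 ?posrE ?invr_gt0// h2.
have Mt : M < t1^-1.
  rewrite -[ltLHS]invrK ltf_pV2 ?posrE ?invr_gt0//; apply: lt_trans t1r _.
  by rewrite /pullr invfM gtr_pMl ?invr_gt0// invf_lt1// ltr1n.
have [i1 z1] := exterior_identity mu0 M0 m10 hmu vC v_ge eqv fC fs Mt.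
rewrite -[RHS]z1 (Rintegral_inversion n0 i1); apply: eq_Rintegral => y _ /=.
have [y0|y0] := eqVneq (y : V) 0.
  have ny : ~ annulus s t1 (y : V) by move=> /andP[]; rewrite y0 enorm0 leNgt s0.
  have ny' : ~ annulus (t1^-1) (s^-1) (inversion (y : V)).
    by move=> /andP[]; rewrite y0 inversion0 enorm0 leNgt invr_gt0 t10.
  rewrite (supp_in_grad ps ny) (supp_in_notin ps ny) (supp_in_grad fs ny') (supp_in_notin fs ny').
  by rewrite !dotr0r !mulr0 subr0 mul0r.
rewrite (_ : f (inversion (y : V)) = phi y); last by rewrite /f /= inversionK.
rewrite [grad f _]g2; last by rewrite /punctured /= inversionK.
rewrite inversionK /pulla dotrZl reflectionK_dotr dotrZl /pullb1 /pullb2 /excess_source.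
by ring.
Qed.

End pullback.

(** * Relations between the exponents, transfer of null sets, and the theorem *)

Section exponents.
Context {R : realType}.

Lemma exponent_gradient (n : nat) (p a mu : R) : 1 < p ->
  mu = (n%:R - p * (1 + a)) / (p - 1) -> n%:R = mu * (p - 1) + p * (1 + a).
Proof.
by move=> p1 ->; rewrite divfK ?subrK// gt_eqF// subr_gt0.
Qed.

(** Equivalent to q (n - p (1 + a - b)) = n p once n is expressed through mu; it is the form in
    which [pullb2_norm] uses q. *)
Lemma exponent_source (n : nat) (p a b q mu : R) : 1 < p -> n%:R - p * (1 + a - b) != 0 ->
  q = n%:R * p / (n%:R - p * (1 + a - b)) -> n%:R = mu * (p - 1) + p * (1 + a) ->
  n%:R = mu * q + b * q - mu * q / p.
Proof.
move=> p1 den qE hmu; have p0 : p != 0 by rewrite gt_eqF// (lt_trans ltr01).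
have qd : q * (n%:R - p * (1 + a - b)) = n%:R * p by rewrite qE divfK.
have -> : mu * q + b * q - mu * q / p = q * (n%:R - p * (1 + a - b)) / p.
  by rewrite hmu; field.
by rewrite qd mulfK.
Qed.

Lemma le_sum5 (x1 x2 x3 x4 x5 : R) :
  0 <= x1 -> 0 <= x2 -> 0 <= x3 -> 0 <= x4 -> 0 <= x5 ->
  let S := x1 + x2 + x3 + x4 + x5 in
  [/\ x1 <= S, x2 <= S, x3 <= S, x4 <= S & x5 <= S].
Proof. by move=> h1 h2 h3 h4 h5 S; rewrite /S; split; lra. Qed.

Lemma lt_mulr2l (x y : R) : 0 < y -> x < y -> x < 2 * y.
Proof. by move=> *; lra. Qed.

End exponents.

Section null_transfer.
Context {R : realType} {n : nat}.
Local Notation V := 'rV[R]_n.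
Local Notation L := (Leb R n).

Lemma integrable_null_eq (D : set L) (f g : L -> R) : measurable D ->
  leb.-integrable D (EFin \o f) -> leb ([set x | D x /\ f x <> g x] : set L) = 0%E ->
  leb.-integrable D (EFin \o g).
Proof.
move=> mD fi fg; have mf : measurable_fun D (EFin \o f) by exact: measurable_int fi.
have mg : measurable_fun D (EFin \o g).
  by apply/measurable_EFinP; apply: ae_eq_measurable_fun fg _ => //; exact/measurable_EFinP.
apply/integrableP; split; first exact: mg.
have /integrableP[_] := fi; congr (_ < _)%E.
apply: ae_eq_integral; [exact: mD|exact: measurableT_comp|exact: measurableT_comp|].
apply/aeP; apply: subset_null fg => y /= h; apply: contrapT => h2; apply: h => Dy.
by congr (`| _%:E |)%E; apply: contrapT => h3; apply: h2.
Qed.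

Lemma ae_exterior (M M1 : R) (u v : V -> R) : M1 <= M ->
  {ae (@leb R n), forall x, exterior M1 x -> u x = v x} ->
  leb ([set x | M < enorm x /\ u x <> v x] : set L) = 0%E.
Proof.
move=> MM /aeP; apply: subset_null => x [Mx uv] h; apply: uv; apply: h.
exact: le_lt_trans Mx.
Qed.

(** The inversion maps null sets to null sets, so almost everywhere statements near infinity become
    such statements near the origin, the origin itself being negligible. *)
Lemma ae_inversion (M r : R) (P : V -> Prop) (Q : V -> Prop) : (0 < n)%N ->
  leb ([set x : V | M < enorm x /\ ~ P x] : set L) = 0%E ->
  (forall y : V, y != 0 -> enorm y < r -> M < enorm (inversion y)) ->
  (forall y : V, y != 0 -> enorm y < r -> P (inversion y) -> Q y) ->
  leb ([set y : V | eball r y /\ ~ Q y] : set L) = 0%E.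
Proof.
move=> n0 P0 hM PQ.
have z0 : leb ([set 0] : set L) = 0%E by exact: leb0.
apply: (@subset_null _ _ _ _ _ (lebU0 z0 (inversion_null n0 P0))) => y [yr nQ].
have [->|y0] := eqVneq (y : V) 0; first by left.
by right; split; [exact: hM|move=> Py; apply: nQ; exact: PQ].
Qed.

End null_transfer.

Section final.
Context {R : realType} {n : nat}.
Local Notation V := 'rV[R]_n.
Local Notation L := (Leb R n).

Lemma source_bound (M b q Lam : R) (f : V -> R -> R) (u v : V -> R) :
  (forall x, exterior M x -> 0 < v x) ->
  {ae (@leb R n), forall x, forall s : R,
       `|f x s| <= Lam * enorm x `^ (- (b * q)) * `|s| `^ (q - 1)} ->
  leb ([set x | M < enorm x /\ u x <> v x] : set L) = 0%E ->
  leb ([set x : V | M < enorm x /\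
    ~ (`|f x (u x)| <= Lam * enorm x `^ (- (b * q)) * v x `^ (q - 1))] : set L) = 0%E.
Proof.
move=> v0 /aeP hf uv; apply: (@subset_null _ _ _ _ _ (lebU0 hf uv)) => x [Mx h].
have [uvx|uvx] := pselect (u x = v x); last by right.
by left => hs; apply: h; have := hs (u x); rewrite uvx (gtr0_norm (v0 x Mx)).
Qed.

(** A zero gradient would give |Y| = |X|, which d < 1 and X nonzero exclude. *)
Lemma gradient_neq0 (mu M m1 d : R) (v : V -> R) : 0 < mu -> 0 < M -> 0 < m1 -> d < 1 ->
  (forall x, exterior M x -> m1 <= enorm x `^ mu * v x) ->
  (forall x : V, exterior M x -> enorm (rest_grad mu v x) <= d * enorm (radial_grad mu v x)) ->
  forall x, exterior M x -> grad v x != 0.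
Proof.
move=> mu0 M0 m10 d1 hv hY x Mx; apply/negP => /eqP g0.
have e0 : 0 < enorm (radial_grad mu v x).
  rewrite (radial_enorm mu0 M0 m10 hv Mx) divr_gt0 ?mulr_gt0//; last exact: (ext_gt0 M0 Mx).
  exact: (ext_v_gt0 M0 m10 hv Mx).
have := hY x Mx; rewrite {1}/rest_grad g0 sub0r enormN leNgt.
by rewrite gtr_pMl// d1.
Qed.

End final.

Theorem proposition1p1 (R : realType) (n : nat) (p a b q mu : R)
    (f : 'rV[R]_n -> R -> R) (Lambda R0 : R) (u : 'rV[R]_n -> R) (alpha : R)
    (hn : (1 <= n)%N) (hp : 1 < p) (ha : a < (n%:R - p) / p)
    (hab : a <= b) (hba : b < a + 1)
    (hden : 0 < n%:R - p * (1 + a - b))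
    (hq : q = n%:R * p / (n%:R - p * (1 + a - b)))
    (hmu : mu = (n%:R - p * (1 + a)) / (p - 1))
    (hf : caratheodory setT f) (hLambda : 0 < Lambda)
    (hfbound : {ae (@leb R n), forall x, forall s : R,
       `|f x s| <= Lambda * enorm x `^ (- (b * q)) * `|s| `^ (q - 1)})
    (hR0 : 0 < R0) (hu : weak_solution_exterior p a f R0 u)
    (halpha : 0 < alpha)
    (hasymp : exists2 v : 'rV[R]_n -> R, C1_representative_near_infinity u v &
       (`|enorm x `^ mu * v x - alpha| +
        enorm (enorm x `^ (mu + 1) *: grad v x +
               (alpha * mu * (enorm x)^-1) *: x))
         @[x --> enorm_infty] --> (0 : R)) :
  let r0 := R0^-1 in
  let ustar := fun y : 'rV[R]_n =>
    enorm y `^ (- mu) * u ((enorm y ^- 2) *: y) in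
  let gamma := mu + 2 - n%:R in
  let gamma' := mu * q / p - n%:R in
  exists (r : R) (A : 'rV[R]_n -> R * 'rV[R]_n -> 'rV[R]_n)
         (B : 'rV[R]_n -> R * 'rV[R]_n -> R) (C : R),
  [/\ 0 < r < r0,
      (forall i, caratheodory (eball r) (fun y w => A y w 0 i)) /\
      caratheodory (eball r) B,
      0 < C,
      {ae (@leb R n), forall y, eball r y -> forall (z : R) (xi : 'rV[R]_n),
        [/\ enorm (A y (z, xi)) <= C * enorm y `^ gamma * enorm xi,
            dotr (A y (z, xi)) xi >= C^-1 * enorm y `^ gamma * enorm xi ^+ 2 &
            `|B y (z, xi)| <= C * (enorm y `^ gamma * enorm xi ^+ 2 +
                                   enorm y `^ gamma')]} &
      weak_solution_ball r gamma A B ustar].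
Proof.
move=> r0 ustar gamma gamma'.
have p0 : 0 < p by apply: lt_trans hp.
have p10 : 0 < p - 1 by rewrite subr_gt0.
have mu0 : 0 < mu.
  rewrite hmu divr_gt0// subr_gt0; move: ha; rewrite ltr_pdivlMr//; lra.
have hmu' := exponent_gradient hp hmu.
have hq' := exponent_source hp (lt0r_neq0 hden) hq hmu'.
have n0 : 0 < n%:R :> R by rewrite ltr0n.
have q0 : 0 < q by rewrite hq divr_gt0// mulr_gt0.
have gam_gt : 2 - n%:R < gamma by rewrite /gamma; move: mu0; lra.
have gam'_gt : - n%:R < gamma'.
  by rewrite /gamma' -[ltLHS]add0r ltrD2r divr_gt0// mulr_gt0.
have [d [c0 [C1 [d01 c00 C10 hexp]]]] := @pflux_expansion R n p hp.
have /andP[d0 d1] := d01.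
have [v [M1 [vC uv]] hlim] := hasymp.
(* The smallness is requested with d/2, which is strictly below 1 even if d = 1; this is what the
   nonvanishing of the gradient needs. *)
have d20 : 0 < d / 2 by rewrite divr_gt0.
have [M [MM M1'] hM] := exterior_asymptotics (Num.max R0 M1) mu0 halpha d20 hlim.
have RM : R0 <= M by apply: le_trans MM; rewrite le_max lexx.
have M1M : M1 <= M by apply: le_trans MM; rewrite le_max lexx orbT.
have M0 : 0 < M by apply: lt_le_trans M1'.
have {}vC : C1_on (exterior M) v by apply: C1_onS vC => x; exact: le_lt_trans.
have {}uv := ae_exterior M1M uv.
pose m1 := alpha / 2; pose m2 := 2 * alpha.
have m10 : 0 < m1 by rewrite divr_gt0.
have m20 : 0 < m2 by rewrite mulr_gt0.
have v_bd (x : 'rV[R]_n) : exterior M x -> m1 <= wt mu v x <= m2 by move=> /hM[].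
have v_ge (x : 'rV[R]_n) : exterior M x -> m1 <= enorm x `^ mu * v x by move=> /v_bd /andP[].
have hY' (x : 'rV[R]_n) : exterior M x -> enorm (rest_grad mu v x) <= d / 2 * enorm (radial_grad mu v x).
  by move=> /hM[].
have hY (x : 'rV[R]_n) : exterior M x -> enorm (rest_grad mu v x) <= d * enorm (radial_grad mu v x).
  by move=> /hY' h; apply: le_trans h _; rewrite ler_wpM2r ?enorm_ge0//; move: d0; lra.
have d21 : d / 2 < 1 by move: d1; lra.
have gv0 := gradient_neq0 mu0 M0 m10 d21 v_ge hY'.
pose F (x : Leb R n) := f x (u x).
have eqv := weak_solution_C1 RM hu vC uv M0 gv0.
have iF s t : M < s -> leb.-integrable (annulus s t : set (Leb R n)) (EFin \o F).
  apply: (loc_integrable_source RM) => phi tphi.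
  by have [Du [_ _ h]] := hu; have [] := h phi tphi.
have v0 (x : 'rV[R]_n) : exterior M x -> 0 < v x by exact: (ext_v_gt0 M0 m10 v_ge).
have hF := source_bound v0 hfbound uv.
have mm1 : 0 < mu * m1 by rewrite mulr_gt0.
(* As w stays in [m1, m2], the powers (mu w)^(p-2) and w^(q-1) are bounded above, and the first one
   also away from 0. *)
have [K K0 hK] := powR_bounds (p - 2) (mu * m2) mm1.
have [Kq Kq0 hKq] := powR_bounds (q - 1) m2 m10.
(* One constant above the bounds for a, b1, b2, w and |y| |grad w|, in this order. *)
pose Cc := C1 * K + C1 * K / m1 + Lambda * Kq + m2 + mu * m2.
have s1 : 0 <= C1 * K by rewrite mulr_ge0// ltW.
have s2 : 0 <= C1 * K / m1 by rewrite divr_ge0// ltW.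
have s3 : 0 <= Lambda * Kq by rewrite mulr_ge0 ?ltW.
have s5 : 0 <= mu * m2 by rewrite mulr_ge0 ?ltW.
have s4 : 0 <= m2 by exact: ltW.
have [S1 S2 S3 S4 S5] : [/\ C1 * K <= Cc, C1 * K / m1 <= Cc, Lambda * Kq <= Cc, m2 <= Cc & mu * m2 <= Cc].
  exact: le_sum5.
have Cc0 : 0 <= Cc by exact: le_trans S1.
pose c := c0 * K^-1; have cp : 0 < c by rewrite mulr_gt0// invr_gt0.
pose r := pullr M; have rp : 0 < r by exact: pullr_gt0.
pose w := pullw mu v; pose av := pulla p a mu v; pose b1 := pullb1 p a mu v; pose b2 := pullb2 mu F.
have r2 (y : 'rV[R]_n) : enorm y < r -> enorm y < 2 * r.
  exact: lt_mulr2l.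
have ext (y : 'rV[R]_n) : y != 0 -> enorm y < r -> exterior M (inversion y).
  by move=> y0 yr; exact: (inversion_ext M0 y0 (r2 y yr)).
have hT (y : 'rV[R]_n) : y != 0 -> enorm y < r -> K^-1 <= (mu * wt mu v (inversion y)) `^ (p - 2) <= K.
  by move=> y0 yr; have /andP[h1 h2] := v_bd _ (ext y y0 yr); apply: hK; rewrite ler_pM2l.
have P0 (y : 'rV[R]_n) : 0 <= enorm y `^ gamma by exact: powR_ge0.
have a_le (y : 'rV[R]_n) : y != 0 -> enorm y < r -> enorm (av y) <= Cc * enorm y `^ gamma * enorm (grad w y).
  move=> y0 yr; apply: le_trans (pulla_norm mu0 M0 m10 hmu' vC v_bd hexp hY y0 (r2 _ yr)) _.
  rewrite ler_wpM2r ?enorm_ge0// ler_wpM2r//; apply: le_trans S1; rewrite ler_wpM2l//.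
  by have /andP[] := hT y y0 yr.
have a_ge (y : 'rV[R]_n) : y != 0 -> enorm y < r -> c * enorm y `^ gamma * enorm (grad w y) ^+ 2 <= dotr (av y) (grad w y).
  move=> y0 yr; apply: le_trans (pulla_dot mu0 M0 m10 hmu' vC v_bd hexp hY y0 (r2 _ yr)).
  rewrite ler_wpM2r ?exprn_ge0 ?enorm_ge0// ler_wpM2r// ler_wpM2l ?(ltW c00)//.
  by have /andP[] := hT y y0 yr.
have b1_le (y : 'rV[R]_n) : y != 0 -> enorm y < r -> `|b1 y| <= Cc * enorm y `^ gamma * enorm (grad w y) ^+ 2.
  move=> y0 yr; apply: le_trans (pullb1_norm mu0 M0 m10 hmu' vC v_bd hexp hY y0 (r2 _ yr)) _.
  rewrite ler_wpM2r ?exprn_ge0 ?enorm_ge0// ler_wpM2r//; apply: le_trans S2.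
  have /andP[h1 h2] := v_bd _ (ext y y0 yr); have w0 := lt_le_trans m10 h1.
  have /andP[_ hT2] := hT y y0 yr.
  by rewrite ler_pM ?mulr_ge0 ?powR_ge0 ?invr_ge0 ?(ltW w0) ?ler_wpM2l// lef_pV2 ?posrE.
have b2_le : leb ([set y | eball r y /\ ~ (`|b2 y| <= Cc * enorm y `^ gamma')] : set (Leb R n)) = 0%E.
  apply: (ae_inversion hn hF ext) => y y0 yr hb.
  apply: le_trans (pullb2_norm M0 m10 hq' v_bd y0 (r2 _ yr) hb) _.
  rewrite ler_wpM2r ?powR_ge0//; apply: le_trans S3; rewrite ler_wpM2l ?(ltW hLambda)//.
  by have /andP[h1 h2] := v_bd _ (ext y y0 yr); have /andP[] := hKq _ h1 h2.
have wbd (y : 'rV[R]_n) : (punctured `&` eball (2 * r)) y -> `|w y| <= Cc /\ enorm (grad w y) * enorm y <= Cc.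
  move=> [y0 yr]; have [h1 h2] := pull_bounds mu0 M0 m10 d01 vC v_bd hY y0 yr.
  by split; [exact: le_trans h1 S4|exact: le_trans h2 S5].
have [wC _] := pullw_C1 mu M0 vC.
have ma := measurable_pulla p a mu hn M0 vC.
have mxi := measurable_grad_w hn rp wC.
have mb1 := measurable_pullb1 p a mu hn M0 vC.
have mb2 := measurable_pullb2 mu hn M0 iF.
have gw (y : 'rV[R]_n) (h : (punctured `&` eball (2 * r)) y) := (wbd y h).2.
have hw (y : 'rV[R]_n) (h : (punctured `&` eball (2 * r)) y) := (wbd y h).1.
(* By the inversion of norms |y|^(-mu) = |x|^mu, so u_* equals w wherever u agrees with its C1
   representative. *)
have uw : leb ([set y | eball r y /\ ustar y <> w y] : set (Leb R n)) = 0%E.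
  apply: (ae_inversion (P := fun x => u x = v x) (Q := fun y => ustar y = w y) hn uv ext) => y y0 yr E.
  rewrite /ustar /w /pullw /wt -/(inversion y) E enorm_inversion; congr (_ * _).
  rewrite -powR_inv1 ?enorm_ge0// -powRrM; congr (_ `^ _); ring.
pose A := coefA gamma av (grad w); pose B := coefB (grad w) b1 b2.
pose C' := 3 * Cc + 1 + c^-1.
exists r, A, B, C'; split.
- rewrite rp /r0 /r /pullr ltf_pV2 ?posrE ?mulr_gt0//=; move: RM M0; lra.
- split; first by move=> i; exact: (caratheodory_coefA gamma ma mxi i).
  exact: (caratheodory_coefB mxi mb1 mb2).
- have ci : 0 < c^-1 by rewrite invr_gt0.
  by rewrite /C' ltr_wpDl// addr_ge0// mulr_ge0.
- have z0 : leb ([set 0] : set (Leb R n)) = 0%E by exact: leb0.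
  apply/aeP; apply: (subset_null _ (lebU0 z0 b2_le)) => y h; apply: contrapT => h2.
  apply: h => yr z xi.
  have y0 : (y : 'rV[R]_n) != 0 by apply/negP => /eqP yz; apply: h2; left.
  have hb2 : `|b2 y| <= Cc * enorm (y : 'rV[R]_n) `^ gamma'.
    by apply: contrapT => hb; apply: h2; right.
  exact: (coef_bounds cp Cc0 a_le a_ge b1_le z xi y0 yr hb2).
- exists (grad w); split; first exact: (ball_H12 hn rp gam_gt Cc0 wC hw gw uw).
  move=> phi tphi g.
  have eq0 := pull_identity hn mu0 M0 m10 hmu' vC v_bd eqv.
  have [i1 z1] := ball_test_identity hn rp gam_gt gam'_gt Cc0 gw ma mb1 mb2 a_le b1_le b2_le eq0 tphi.
  have mD : measurable (eball r : set (Leb R n)) by exact: eball_measurable.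
  set h := (fun y : Leb R n => _) in i1 z1.
  (* Off the origin A and B take the values a and b1 + b2 along the gradient of w, so the required
     integrand is the one already treated. *)
  have gh : leb ([set y | eball r y /\ h y <> g y] : set (Leb R n)) = 0%E.
    apply: (subset_null _ (@leb0 R n hn)) => y [yr hy]; apply: contrapT => /eqP y0; apply: hy.
    have [e1 e2] := coef_xi0 b2 a_le b1_le (ustar y) y0 yr.
    by rewrite /h /g /A /B e1 e2.
  split; first exact: (integrable_null_eq mD i1 gh).
  rewrite -[RHS]z1; symmetry; apply: (Rintegral_null_eq mD) gh.
  by apply/measurable_EFinP; exact: measurable_int i1.
Qed.
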